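(* Let $T>0$ and $\kappa\in[1,\alpha)$. Assume (H1). Let $b:\mathbb{R}^d\times\mathscr{P}\to\mathbb{R}^d$ be bounded and measurable, with $\|b\|_\infty:=\sup_{x\in\mathbb{R}^d,\mu\in\mathscr P}|b(x,\mu)|<\infty$, and suppose there is $K>0$ such that $|b(x,\mu)-b(x,\bar\mu)|\le K\,\mathbb{W}_\kappa(\mu,\bar\mu)$ for all $x\in\mathbb{R}^d$ and $\mu,\bar\mu\in\mathscr P_\kappa$ (this is the measure part of (H2)). Then for every $\mu_0\in\mathscr P_\kappa$, the McKean–Vlasov SDE $$\mathrm{d}X_t=b(X_t,\mathscr L_{X_t})\,\mathrm{d}t+\mathrm{d}L_t,\qquad t\in[0,T],$$ has a weak solution $(\tilde X_t,\tilde L_t)_{t\in[0,T]}$ with $\mathscr L_{\tilde X_0}=\mu_0$.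
   Context: Here $L$ is a $d$-dimensional symmetric $\alpha$-stable Lévy process, i.e. a Lévy process with Lévy symbol $\Psi(u)=\int_{\mathbb{R}^d}[1-\cos\langle u,x\rangle]\,\nu(\mathrm{d}x)$, where $\nu(D)=\int_S\mu(\mathrm{d}\xi)\int_0^\infty \mathbf 1_D(r\xi)\,r^{-1-\alpha}\mathrm{d}r$ for Borel $D\subset\mathbb{R}^d$, $S$ is the unit sphere, and $\mu$ is a finite symmetric measure on $S$. Condition (H1): $\alpha\in(1,2)$ is fixed and there is $C_\alpha>0$ with $\Psi(u)\ge C_\alpha|u|^\alpha$ for all $u\in\mathbb{R}^d$. $\mathscr P$ is the set of probability measures on $\mathbb{R}^d$, $\mathscr P_p=\{\mu\in\mathscr P:\int|x|^p\mu(\mathrm dx)<\infty\}$, and $\mathbb W_p(\mu,\bar\mu)=\inf_{\pi}\big(\int|x-y|^p\pi(\mathrm dx,\mathrm dy)\big)^{1/p}$, the infimum over couplings $\pi$ of $\mu,\bar\mu$. $\mathscr L_\xi$ denotes the law of a random variable $\xi$. A weak solution is a pair $(\tilde X,\tilde L)$ on some complete filtered probability space $(\tilde\Omega,\{\tilde{\mathscr F}_t\},\tilde{\mathbb P})$ such that $\tilde L$ is a $d$-dimensional symmetric $\alpha$-stable process (with the same symbol) w.r.t. $\{\tilde{\mathscr F}_t\}$, $\tilde X$ is càdlàg adapted, and $\tilde{\mathbb P}$-a.s. $\tilde X_t=\tilde X_0+\int_0^t b(\tilde X_s,\mathscr L_{\tilde X_s}|_{\tilde{\mathbb P}})\,\mathrm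 ds+\tilde L_t$ for all $t$. *)

(* Defs.v *)
From HB Require Import structures.
From mathcomp Require Import all_boot all_order all_algebra.
From mathcomp Require Import all_classical all_reals all_analysis.

Set Implicit Arguments.
Unset Strict Implicit.
Unset Printing Implicit Defensive.

Import Order.TTheory GRing.Theory Num.Theory.
Import numFieldNormedType.Exports.

Local Open Scope classical_set_scope.
Local Open Scope ring_scope.

Section Defs.
Context {R : realType} {d : nat}.

Definition Rd := g_sigma_algebraType (@open 'rV[R]_d).

Definition dotv (u x : 'rV[R]_d) : R := \sum_(i < d) u 0 i * x 0 i.
Definition enorm (x : 'rV[R]_d) : R := Num.sqrt (\sum_(i < d) x 0 i ^+ 2).

Definition sphere : set Rd := [set x | enorm x = 1].

Definition spherical_symmetric (mu : {finite_measure set Rd -> \bar R}) : Prop :=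
  mu (~` sphere) = 0%E /\
  forall A : set Rd, measurable A -> mu [set - (x : 'rV[R]_d) | x in A] = mu A.

(* Levy symbol Psi(u) = \int (1 - cos<u,x>) nu(dx) with
   nu(D) = \int_S mu(dxi) \int_0^oo 1_D(r xi) r^{-1-alpha} dr,
   i.e. Psi(u) = \int_S mu(dxi) \int_0^oo (1 - cos(r <u,xi>)) r^{-1-alpha} dr *)
Definition stable_symbol (alpha : R) (mu : {finite_measure set Rd -> \bar R})
    (u : 'rV[R]_d) : \bar R :=
  (\int[mu]_xi
     (\int[lebesgue_measure]_(r in `]0%R, +oo[)
        ((1 - cos (r * dotv u xi)) * r `^ (- 1 - alpha))%:E))%E.

Definition H1 (alpha : R) (mu : {finite_measure set Rd -> \bar R}) : Prop :=
  1 < alpha < 2 /\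
  exists Calpha : R, 0 < Calpha /\
    forall u : 'rV[R]_d, ((Calpha * enorm u `^ alpha)%:E <= stable_symbol alpha mu u)%E.

Definition finite_moment (p : R) (m : probability Rd R) : Prop :=
  (\int[m]_x ((enorm x) `^ p)%:E < +oo)%E.

Definition coupling (m m' : probability Rd R) (pi : probability (Rd * Rd)%type R) : Prop :=
  (forall A : set Rd, measurable A -> pi (A `*` setT) = m A) /\
  (forall B : set Rd, measurable B -> pi (setT `*` B) = m' B).

Definition wasserstein (p : R) (m m' : probability Rd R) : \bar R :=
  poweR (ereal_inf [set (\int[pi]_z ((enorm ((z.1 : 'rV[R]_d) - z.2)%R) `^ p)%:E)%E
                   | pi in [set pi | coupling m m' pi]]) p^-1.

Section Process.
Context {dO : measure_display} {Om : measurableType dO}.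

Definition filtration (F : R -> set (set Om)) : Prop :=
  (forall t, sigma_algebra setT (F t)) /\
  (forall t, F t `<=` measurable) /\
  (forall s t, s <= t -> F s `<=` F t).

Definition complete_fps (P : probability Om R) (F : R -> set (set Om)) : Prop :=
  forall N : set Om, measurable N -> P N = 0%E ->
    forall A, A `<=` N -> measurable A /\ F 0 A.

Definition adapted (T : R) (F : R -> set (set Om)) (X : R -> Om -> 'rV[R]_d) : Prop :=
  forall t, 0 <= t <= T -> forall B : set Rd, measurable B -> F t (X t @^-1` B).

Definition cadlag (T : R) (X : R -> Om -> 'rV[R]_d) : Prop :=
  forall w : Om,
    (forall t, 0 <= t < T -> X^~ w @ t^'+ --> X t w) /\
    (forall t, 0 < t <= T -> cvg (X^~ w @ t^'-)).

(* L is a Levy process w.r.t. the filtration F on [0,T] with Levy symbol Psi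
   (Psi real and symmetric): L_0 = 0, cadlag, adapted, increments L_t - L_s
   independent of F_s, with characteristic function
   E exp(i<u, L_t - L_s>) = exp(-(t-s) Psi(u)). *)
Definition levy_process (T : R) (P : probability Om R) (F : R -> set (set Om))
    (L : R -> Om -> 'rV[R]_d) (Psi : 'rV[R]_d -> \bar R) : Prop :=
  (forall w, L 0 w = 0) /\ cadlag T L /\ adapted T F L /\
  forall s t, 0 <= s -> s <= t -> t <= T ->
    (forall (A : set Om) (B : set Rd), F s A -> measurable B ->
        P (A `&` ((fun w => (L t w - L s w)%R) @^-1` B)) =
        (P A * P ((fun w => (L t w - L s w)%R) @^-1` B))%E) /\
    (forall u : 'rV[R]_d,
        (\int[P]_w (cos (dotv u (L t w - L s w)%R))%:E)%E
          = expeR (- ((t - s)%:E * Psi u))%E /\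
        (\int[P]_w (sin (dotv u (L t w - L s w)%R))%:E)%E = 0%E).

Definition vintegral (t : R) (f : R -> 'rV[R]_d) : 'rV[R]_d :=
  \row_i Rintegral lebesgue_measure `[0%R, t] (fun s => f s 0 i).

End Process.
End Defs.

(* Main.v *)
Require Import Defs.
From HB Require Import structures.
From mathcomp Require Import all_boot all_order all_algebra.
From mathcomp Require Import all_classical all_reals all_analysis.
From mathcomp Require Import measurable_realfun ring lra.
Set Implicit Arguments.
Unset Strict Implicit.
Unset Printing Implicit Defensive.
Import Order.TTheory GRing.Theory Num.Theory.
Import numFieldNormedType.Exports.
Local Open Scope classical_set_scope.
Local Open Scope ring_scope.

(* The solution is the standard part of an Euler scheme. For each m the equation is discretised with
   step T/(m+1), the noise being a random walk whose steps are Pareto jumps in the directions of mu,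
   slightly smeared; by H1 the walk smooths: after time t it maps bounded functions to functions with
   Lipschitz constant of order t^(-1/alpha). The schemes live on one Loeb space, the ultraproduct of
   the discrete path spaces, which is complete, so limits along the ultrafilter give processes there
   without any tightness or Skorokhod argument: the walk becomes the stable process L (regularised
   along a countable set of times, thanks to a bound on the number of its oscillations), and the drift
   term becomes a Lipschitz process Y with X = X_0 + Y + L.
   It remains to identify Y. As alpha > 1, the singularity t^(-1/alpha) is integrable, so replacing
   the drift by zero on a short window changes the law of the scheme little; hence, uniformly in m,
   that law hardly changes when a bounded function is mollified. Riemann sums of Lipschitz functions
   of the scheme converge, and approximating a bounded measurable function in L^1 of the occupation
   measure of X and of its mollification extends this to b(., law_s). Continuity of s -> law_s in
   W_kappa and the Lipschitz condition then allow the measure argument to be frozen on short windows. *)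

(** * Expectations of bounded functions *)

(** The obstacle is that [b] is only measurable in space: convergence of the schemes to [X] says
    nothing about sums of [b] along the schemes, which evaluate [b] at other points than [X] does.
    What saves the limit is an estimate uniform in the step size: over a short lag the law of the
    scheme is that of pure noise up to a small error, and pure noise commutes with mollification.
    Hence [b] may be exchanged for a Lipschitz function at a cost measured under laws of the limit
    alone. The noise is tuned so that its smoothing is elementary and needs no transition densities.
    Jump lengths start at [a], with a^alpha proportional to the time step, so that one jump per step
    reproduces the truncated symbol exactly. A smear of width proportional to [a] supplies the
    Lipschitz constant 1/a, from which a coupling argument goes on improving; its effect on
    characteristic functions is of lower order because alpha < 2. The gap kappa < alpha leaves room
    for a moment of intermediate order, hence for uniform integrability and convergence of the laws
    in W_kappa. *)

Section bounded_expectation.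
Context {R : realType} {d : measure_display} {T : measurableType d}.
Implicit Types (f g : T -> R) (P : probability T R).

(** Test functions are kept bounded, so that expectations are real numbers and their linearity has
    no integrability conditions. Unbounded moments enter only through truncations such as
    [Num.min _ n%:R]. *)
Definition bmf f := measurable_fun setT f /\ exists M : R, forall x, `|f x| <= M.

Definition Ex P f : R := fine (\int[P]_x (f x)%:E)%E.

Lemma bmf_meas f : bmf f -> measurable_fun setT f. Proof. by case. Qed.

Lemma bmf_bound f : bmf f -> exists M : R, 0 < M /\ forall x, `|f x| <= M.
Proof.
case=> _ [M hM]; exists (Num.max 1 M); split; first by rewrite lt_max ltr01.
by move=> x; rewrite le_max hM orbT.
Qed.

Lemma bmf_cst (c : R) : bmf (fun _ : T => c).
Proof. by split; [exact: measurable_cst|exists `|c|]. Qed.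

Lemma bmfD f g : bmf f -> bmf g -> bmf (fun x => f x + g x).
Proof.
move=> [mf [M hM]] [mg [N hN]]; split; first exact: measurable_funD.
by exists (M + N) => x; apply: (le_trans (ler_normD _ _)); exact: lerD.
Qed.

Lemma bmfN f : bmf f -> bmf (fun x => - f x).
Proof.
move=> [mf [M hM]]; split; first exact: measurableT_comp.
by exists M => x; rewrite normrN.
Qed.

Lemma bmfB f g : bmf f -> bmf g -> bmf (fun x => f x - g x).
Proof. by move=> bf bg; apply: bmfD => //; exact: bmfN. Qed.

Lemma bmfM f g : bmf f -> bmf g -> bmf (fun x => f x * g x).
Proof.
move=> [mf [M hM]] [mg [N hN]]; split; first exact: measurable_funM.
by exists (M * N) => x; rewrite normrM; apply: ler_pM.
Qed.

Lemma bmfZ (c : R) f : bmf f -> bmf (fun x => c * f x).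
Proof. by move=> bf; apply: bmfM => //; exact: bmf_cst. Qed.

Lemma bmf_abs f : bmf f -> bmf (fun x => `|f x|).
Proof.
move=> [mf [M hM]]; split; first exact: measurableT_comp.
by exists M => x; rewrite normr_id.
Qed.

Lemma bmf_indic (A : set T) : measurable A -> bmf (\1_A : T -> R).
Proof.
move=> mA; split; first exact: measurable_indic.
by exists 1 => x; rewrite indicE; case: (_ \in _); rewrite ?normr1 ?normr0.
Qed.

Lemma bmf_sum (I : Type) (s : seq I) (h : I -> T -> R) :
  (forall i, bmf (h i)) -> bmf (fun x => \sum_(i <- s) h i x).
Proof.
move=> bh; elim: s => [|i s IH].
  by under eq_fun do rewrite big_nil; exact: bmf_cst.
by under eq_fun do rewrite big_cons; exact: bmfD.
Qed.

Lemma bmf_max f g : bmf f -> bmf g -> bmf (fun x => Num.max (f x) (g x)).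
Proof.
move=> [mf [M hM]] [mg [N hN]]; split; first exact: measurable_maxr.
exists (Num.max M N) => x; rewrite maxEle; case: ifP => _.
  by rewrite le_max hN orbT.
by rewrite le_max hM.
Qed.

Lemma bmf_integrable P f : bmf f -> P.-integrable setT (EFin \o f).
Proof.
move=> [mf [M hM]]; apply: measurable_bounded_integrable => //.
  by rewrite -ge0_fin_numE// fin_num_measure.
exists M; split; first exact: num_real.
by move=> x Mx y _ /=; apply: (le_trans (hM y)); exact: ltW.
Qed.

Lemma Ex_fin P f : bmf f -> (\int[P]_x (f x)%:E = (Ex P f)%:E)%E.
Proof.
move=> bf; rewrite /Ex fineK//; apply: integrable_fin_num => //.
exact: bmf_integrable.
Qed.

Lemma eq_Ex P f g : f =1 g -> Ex P f = Ex P g.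
Proof. by move=> fg; rewrite /Ex; under eq_integral do rewrite fg. Qed.

Lemma ExD P f g : bmf f -> bmf g -> Ex P (fun x => f x + g x) = Ex P f + Ex P g.
Proof. by move=> bf bg; apply: RintegralD => //; exact: bmf_integrable. Qed.

Lemma ExB P f g : bmf f -> bmf g -> Ex P (fun x => f x - g x) = Ex P f - Ex P g.
Proof. by move=> bf bg; apply: RintegralB => //; exact: bmf_integrable. Qed.

Lemma ExZ P (c : R) f : bmf f -> Ex P (fun x => c * f x) = c * Ex P f.
Proof. by move=> bf; apply: RintegralZl => //; exact: bmf_integrable. Qed.

Lemma Ex_cst P (c : R) : Ex P (fun _ => c) = c.
Proof.
have e : P setT = 1%E := probability_setT P.
by rewrite /Ex integral_cst// [X in (_ * X)%E]e mule1.
Qed.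

Lemma ExN P f : bmf f -> Ex P (fun x => - f x) = - Ex P f.
Proof.
move=> bf; rewrite -mulN1r -ExZ//; apply: eq_Ex => x.
by rewrite mulN1r.
Qed.

Lemma Ex_le P f g : bmf f -> bmf g -> (forall x, f x <= g x) -> Ex P f <= Ex P g.
Proof. by move=> bf bg fg; apply: le_Rintegral => //; exact: bmf_integrable. Qed.

Lemma Ex_ge0 P f : (forall x, 0 <= f x) -> 0 <= Ex P f.
Proof. by move=> f0; apply: Rintegral_ge0. Qed.

Lemma Ex_abs P f : bmf f -> `|Ex P f| <= Ex P (fun x => `|f x|).
Proof. by move=> bf; apply: le_normr_Rintegral => //; exact: bmf_integrable. Qed.

Lemma Ex_le_cst P f (M : R) : bmf f -> (forall x, f x <= M) -> Ex P f <= M.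
Proof.
by move=> bf fM; rewrite -(Ex_cst P M); apply: Ex_le => //; exact: bmf_cst.
Qed.

Lemma Ex_abs_le P f (M : R) : bmf f -> (forall x, `|f x| <= M) -> `|Ex P f| <= M.
Proof.
move=> bf fM; apply: (le_trans (Ex_abs P bf)).
by apply: Ex_le_cst => //; exact: bmf_abs.
Qed.

Lemma Ex_sum (I : Type) (s : seq I) P (h : I -> T -> R) :
  (forall i, bmf (h i)) ->
  Ex P (fun x => \sum_(i <- s) h i x) = \sum_(i <- s) Ex P (h i).
Proof.
move=> bh; elim: s => [|i s IH].
  by under eq_Ex do rewrite big_nil; rewrite Ex_cst big_nil.
under eq_Ex do rewrite big_cons.
by rewrite ExD// ?IH ?big_cons//; exact: bmf_sum.
Qed.

Lemma Ex_indic P (A : set T) : measurable A -> Ex P (\1_A) = fine (P A).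
Proof. by move=> mA; rewrite /Ex integral_indic// setIT. Qed.

Lemma Ex_indicE P (A : set T) : measurable A -> P A = (Ex P (\1_A))%:E.
Proof. by move=> mA; rewrite Ex_indic// fineK// fin_num_measure. Qed.

Lemma Ex_dominated P (f : (T -> R)^nat) g (M : R) :
  (forall n, measurable_fun setT (f n)) -> (forall n x, `|f n x| <= M) ->
  (forall x, f^~ x @ \oo --> g x) ->
  bmf g /\ Ex P (f n) @[n --> \oo] --> Ex P g.
Proof.
move=> mf fM fg.
have bf n : bmf (f n) by split => //; exists M.
have mg : measurable_fun setT g.
  by apply: (measurable_fun_cvg (h := f)) => // x _; exact: fg.
have gM x : `|g x| <= M.
  have h : `|f n x| @[n --> \oo] --> `|g x| by apply: cvg_norm; exact: fg.
  rewrite -(cvg_lim _ h)//; apply: limr_le; first by apply/cvg_ex; exists `|g x|.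
  by near=> n.
have bg : bmf g by split => //; exists M.
split => //.
have mE (h : T -> R) : bmf h -> measurable_fun setT (EFin \o h).
  by move=> bh; apply/measurable_EFinP; exact: bmf_meas.
have fgE x : setT x -> (EFin \o f n) x @[n --> \oo] --> (EFin \o g) x.
  by move=> _; apply: cvg_EFin; [near=> n|exact: fg].
have [_ _ H] := @dominated_convergence _ _ _ P setT measurableT
  (fun n => EFin \o f n) (EFin \o g) (cst M%:E) (fun n => mE _ (bf n)) (mE _ bg)
  (aeW _ fgE)
  (bmf_integrable P (bmf_cst M)) (aeW _ (fun x n _ => fM n x)).
apply: fine_cvg; rewrite (_ : (Ex P g)%:E = \int[P]_x (EFin \o g) x)%E; last first.
  by rewrite -Ex_fin.
exact: H.
Unshelve. all: by end_near. Qed.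

Lemma Ex_markov P f (c : R) : bmf f -> (forall x, 0 <= f x) -> 0 < c ->
  fine (P [set x | c <= f x]) <= Ex P f / c.
Proof.
move=> bf f0 c0.
have mA : measurable [set x | c <= f x].
  rewrite (_ : [set x | _] = f @^-1` `[c, +oo[); last first.
    by apply/seteqP; split => x /=; rewrite in_itv/= andbT.
  by rewrite -[X in measurable X]setTI; apply: bmf_meas.
rewrite -Ex_indic// ler_pdivlMr// mulrC -ExZ; last exact: bmf_indic.
apply: Ex_le => //; first by apply: bmfZ; exact: bmf_indic.
move=> x; rewrite indicE; case: (boolP (_ \in _)); rewrite ?(mulr1, mulr0)//.
by rewrite inE.
Qed.

End bounded_expectation.

#[export] Hint Resolve bmf_cst : core.

(** * Image laws and product laws *)

Section transfer.
Context {R : realType} {d d' : measure_display} {T : measurableType d}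
  {T' : measurableType d'}.

Lemma bmf_comp (f : T' -> R) (X : T -> T') : bmf f -> measurable_fun setT X ->
  bmf (fun w => f (X w)).
Proof.
move=> [mf [M hM]] mX; split; first exact: measurableT_comp.
by exists M => x.
Qed.

Definition law_of (P : probability T R) (X : {mfun T >-> T'}) : probability T' R :=
  distribution P X.

Lemma law_ofE (P : probability T R) (X : {mfun T >-> T'}) A :
  law_of P X A = P (X @^-1` A).
Proof. by []. Qed.

Lemma Ex_law (P : probability T R) (X : {mfun T >-> T'}) f : bmf f ->
  Ex (law_of P X) f = Ex P (f \o X).
Proof.
move=> bf; rewrite /Ex /law_of /distribution integral_pushforward//=.
- exact/measurable_EFinP/bmf_meas.
- by apply: (bmf_integrable P); apply: bmf_comp.
Qed.

End transfer.

Definition pack_mfun {d d'} {T : measurableType d} {T' : measurableType d'}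
  (X : T -> T') (mX : measurable_fun setT X) : {mfun T >-> T'} :=
  HB.pack X (isMeasurableFun.Build _ _ _ _ X mX).

Section product_expectation.
Context {R : realType} {d d' : measure_display} {T : measurableType d}
  {T' : measurableType d'} (P : probability T R) (Q : probability T' R).

Definition pprod : probability (T * T')%type R := (P \x Q)%E.

Lemma bmf_sec1 (f : T * T' -> R) x : bmf f -> bmf (fun y => f (x, y)).
Proof. by move=> bf; apply: (bmf_comp bf); exact: measurable_pair1. Qed.

Lemma bmf_sec2 (f : T * T' -> R) y : bmf f -> bmf (fun x => f (x, y)).
Proof. by move=> bf; apply: (bmf_comp bf); exact: measurable_pair2. Qed.

Lemma bmf_Ex1 (f : T * T' -> R) : bmf f -> bmf (fun x => Ex Q (fun y => f (x, y))).
Proof.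
move=> bf; have [M [_ hM]] := bmf_bound bf; split; last first.
  by exists M => x; apply: Ex_abs_le => //; exact: bmf_sec1.
(* Adding the bound [M] makes the integrand nonnegative, as Tonelli's measurability statement
   requires. *)
have bg : bmf (fun z => f z + M) by apply: bmfD.
have -> : (fun x => Ex Q (fun y => f (x, y))) =
   (fun x => fine (\int[Q]_y (f (x, y) + M)%:E)%E - M).
  apply/funext => x; rewrite -/(Ex Q (fun y => f (x, y) + M)).
  by rewrite ExD// ?Ex_cst ?addrK//; exact: bmf_sec1.
apply: measurable_funB => //; apply: measurableT_comp => //=.
apply: (@measurable_fun_fubini_tonelli_F _ _ _ _ _ Q (fun z => (f z + M)%:E)) => /=.
  by apply/measurable_EFinP; exact: bmf_meas.
by move=> z; rewrite lee_fin -lerBlDr sub0r lerNl (le_trans _ (hM z))// -normrN ler_norm.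
Qed.

Lemma bmf_Ex2 (f : T * T' -> R) : bmf f -> bmf (fun y => Ex P (fun x => f (x, y))).
Proof.
move=> bf; have [M [_ hM]] := bmf_bound bf; split; last first.
  by exists M => x; apply: Ex_abs_le => //; exact: bmf_sec2.
have bg : bmf (fun z => f z + M) by apply: bmfD.
have -> : (fun y => Ex P (fun x => f (x, y))) =
   (fun y => fine (\int[P]_x (f (x, y) + M)%:E)%E - M).
  apply/funext => y; rewrite -/(Ex P (fun x => f (x, y) + M)).
  by rewrite ExD// ?Ex_cst ?addrK//; exact: bmf_sec2.
apply: measurable_funB => //; apply: measurableT_comp => //=.
apply: (@measurable_fun_fubini_tonelli_G _ _ _ _ _ P (fun z => (f z + M)%:E)) => /=.
  by apply/measurable_EFinP; exact: bmf_meas.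
by move=> z; rewrite lee_fin -lerBlDr sub0r lerNl (le_trans _ (hM z))// -normrN ler_norm.
Qed.

Lemma Ex_prod1 (f : T * T' -> R) : bmf f ->
  Ex pprod f = Ex P (fun x => Ex Q (fun y => f (x, y))).
Proof.
move=> bf; rewrite {1}/Ex /pprod -integral12_prod_meas1; last exact: bmf_integrable.
rewrite [in RHS]/Ex; congr fine; apply: eq_integral => x _.
by rewrite /= /fubini_F Ex_fin//; exact: bmf_sec1.
Qed.

Lemma Ex_prod2 (f : T * T' -> R) : bmf f ->
  Ex pprod f = Ex Q (fun y => Ex P (fun x => f (x, y))).
Proof.
move=> bf; rewrite {1}/Ex /pprod -integral21_prod_meas1; last exact: bmf_integrable.
rewrite [in RHS]/Ex; congr fine; apply: eq_integral => x _.
by rewrite /= /fubini_G Ex_fin//; exact: bmf_sec2.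
Qed.

Lemma Ex_swap (f : T -> T' -> R) : bmf (fun z : T * T' => f z.1 z.2) ->
  Ex P (fun x => Ex Q (f x)) = Ex Q (fun y => Ex P (f^~ y)).
Proof. by move=> bf; rewrite -(Ex_prod1 bf) (Ex_prod2 bf). Qed.

End product_expectation.

(** The sum is the integer part of [y], written with indicators so that measurability and
    expectations can be handled term by term. *)
Lemma count_le (R : realType) (y : R) (n : nat) : 0 <= y <= n%:R ->
  0 <= y - \sum_(k < n) (k.+1%:R <= y)%R%:R <= 1.
Proof.
elim: n => [|n IH] /andP[y0 yn]; first by rewrite big_ord0; lra.
rewrite big_ord_recr/=.
have [yn1|yn1] := leP y n%:R.
  have := IH; rewrite y0 yn1 => /(_ isT).
  have [h|h] := leP n.+1%:R y; last by rewrite addr0.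
  by exfalso; have := le_trans h yn1; rewrite ler_nat ltnn.
have -> : \sum_(i < n) (i.+1%:R <= y)%R%:R = n%:R :> R.
  rewrite -[RHS]mulr1n -[in RHS](card_ord n) -sumr_const; apply: eq_bigr => i _.
  by rewrite (le_trans _ (ltW yn1))// ler_nat.
move: yn yn1; rewrite -addn1 natrD => ? ?.
by have [h|h] := leP (n%:R + 1) y => /=; lra.
Qed.

(** * Averages of indicators of level sets *)

Section indicator_averages.
Context {R : realType} {d : measure_display} {T : measurableType d}.

Lemma indic_avg_meas (F : T -> R) (n k : nat) : measurable_fun setT F ->
  measurable [set x | k.+1%:R <= n.+1%:R * F x].
Proof.
move=> mF.
rewrite (_ : [set x | _] = (fun x => n.+1%:R * F x) @^-1` `[k.+1%:R, +oo[); last first.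
  by apply/seteqP; split => x /=; rewrite in_itv/= andbT.
rewrite -[X in measurable X]setTI.
by apply: (measurable_funM (measurable_cst _) mF).
Qed.

(** This replaces approximation by simple functions: a property stable under averages and uniform
    limits passes from indicators to all functions with values in [0, 1]. *)
Lemma indic_avg (F : T -> R) (n : nat) x : 0 <= F x <= 1 ->
  0 <= F x - n.+1%:R^-1 * \sum_(k < n.+1) \1_[set x | k.+1%:R <= n.+1%:R * F x] x
    <= n.+1%:R^-1.
Proof.
move=> /andP[F0 F1].
have n0 : (0 : R) < n.+1%:R by [].
have : 0 <= n.+1%:R * F x <= n.+1%:R by rewrite mulr_ge0//= ler_piMr.
move=> /count_le.
rewrite (eq_bigr (fun k : 'I_n.+1 => \1_[set x | k.+1%:R <= n.+1%:R * F x] x)); last first.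
  move=> k _; rewrite indicE; congr (_ %:R); congr nat_of_bool.
  by apply/idP/idP; rewrite inE.
move=> /andP[h1 h2].
set S := \sum_(k < _) _ in h1 h2 *.
have e : n.+1%:R * (F x - n.+1%:R^-1 * S) = n.+1%:R * F x - S.
  by rewrite mulrBr mulrA divff ?mul1r// gt_eqF.
rewrite -e in h1 h2; apply/andP; split.
  by move: h1; rewrite pmulr_rge0.
by rewrite -ler_pdivlMl// mulr1 in h2.
Qed.

End indicator_averages.

(** * Euclidean space and Lipschitz functions *)

Lemma bigsetI_ordP (T : Type) (n : nat) (F : 'I_n -> set T) w :
  (\big[setI/setT]_(i < n) F i) w <-> forall i, F i w.
Proof.
rewrite -bigcap_seq; split=> [h i|h i _]; last exact: h.
by apply: (h i); rewrite /= mem_index_enum.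
Qed.

Section euclid.
Context {R : realType} {d : nat}.
Local Notation V := 'rV[R]_d.
Local Notation Rd := (@Rd R d).
Implicit Types x y u v : V.

Lemma dotvC x y : dotv x y = dotv y x.
Proof. by apply: eq_bigr => i _; rewrite mulrC. Qed.

Lemma dotvDl x y u : dotv (x + y) u = dotv x u + dotv y u.
Proof. by rewrite /dotv -big_split; apply: eq_bigr => i _; rewrite !mxE mulrDl. Qed.

Lemma dotvZl (c : R) x u : dotv (c *: x) u = c * dotv x u.
Proof. by rewrite /dotv mulr_sumr; apply: eq_bigr => i _; rewrite !mxE mulrA. Qed.

Lemma dotvNl x u : dotv (- x) u = - dotv x u.
Proof. by rewrite -scaleN1r dotvZl mulN1r. Qed.

Lemma dotvBl x y u : dotv (x - y) u = dotv x u - dotv y u.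
Proof. by rewrite dotvDl dotvNl. Qed.

Lemma dotvDr u x y : dotv u (x + y) = dotv u x + dotv u y.
Proof. by rewrite dotvC dotvDl !(dotvC u). Qed.

Lemma dotvZr (c : R) u x : dotv u (c *: x) = c * dotv u x.
Proof. by rewrite dotvC dotvZl (dotvC u). Qed.

Lemma dotvNr u x : dotv u (- x) = - dotv u x.
Proof. by rewrite dotvC dotvNl (dotvC u). Qed.

Lemma dotvBr u x y : dotv u (x - y) = dotv u x - dotv u y.
Proof. by rewrite dotvC dotvBl !(dotvC u). Qed.

Lemma dotv0r u : dotv u 0 = 0.
Proof. by rewrite /dotv big1// => i _; rewrite mxE mulr0. Qed.

Lemma dotvv_ge0 x : 0 <= dotv x x.
Proof. by apply: sumr_ge0 => i _; rewrite -expr2 sqr_ge0. Qed.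

Lemma enormE x : enorm x = Num.sqrt (dotv x x).
Proof. by congr Num.sqrt; apply: eq_bigr => i _; rewrite expr2. Qed.

Lemma sqr_enorm x : enorm x ^+ 2 = dotv x x.
Proof. by rewrite enormE sqr_sqrtr// dotvv_ge0. Qed.

Lemma enorm_ge0 x : 0 <= enorm x.
Proof. exact: sqrtr_ge0. Qed.

Lemma enorm0 : enorm (0 : V) = 0.
Proof. by rewrite enormE dotv0r sqrtr0. Qed.

Lemma enormZ (c : R) x : enorm (c *: x) = `|c| * enorm x.
Proof.
by rewrite !enormE dotvZl dotvZr mulrA -expr2 sqrtrM ?sqr_ge0// sqrtr_sqr.
Qed.

Lemma enormN x : enorm (- x) = enorm x.
Proof. by rewrite -scaleN1r enormZ normrN1 mul1r. Qed.

Lemma enormB x y : enorm (x - y) = enorm (y - x).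
Proof. by rewrite -enormN opprB. Qed.

Lemma dotv_sqr_le x y : dotv x y ^+ 2 <= dotv x x * dotv y y.
Proof.
have [y0|y0] := eqVneq (dotv y y) 0.
  have -> : dotv x y = 0; last by rewrite y0 mulr0 expr0n.
  have yi i : y 0 i = 0.
    move/eqP: y0; rewrite psumr_eq0 => [/allP/(_ i (mem_index_enum _))|j _].
      by rewrite implyTb -expr2 sqrf_eq0 => /eqP.
    by rewrite -expr2 sqr_ge0.
  by rewrite /dotv big1// => i _; rewrite yi mulr0.
have y1 : 0 < dotv y y by rewrite lt_neqAle eq_sym y0 dotvv_ge0.
have := dotvv_ge0 (dotv y y *: x - dotv x y *: y).
rewrite !(dotvBl, dotvBr, dotvZl, dotvZr) (dotvC y x) => H.
rewrite -(ler_pM2l y1) -subr_ge0; apply: le_trans H _.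
by rewrite le_eqVlt; apply/orP; left; apply/eqP; ring.
Qed.

Lemma dotv_le x y : `|dotv x y| <= enorm x * enorm y.
Proof.
rewrite -(@ler_pXn2r _ 2)// ?nnegrE ?mulr_ge0 ?enorm_ge0//.
by rewrite exprMn !sqr_enorm -normrX ger0_norm ?sqr_ge0// dotv_sqr_le.
Qed.

Lemma enormD x y : enorm (x + y) <= enorm x + enorm y.
Proof.
rewrite -(@ler_pXn2r _ 2)// ?nnegrE ?addr_ge0 ?enorm_ge0//.
rewrite sqrrD !sqr_enorm dotvDl !dotvDr (dotvC y x).
have := le_trans (ler_norm _) (dotv_le x y); lra.
Qed.

Lemma enorm_tri x y z : enorm (x - z) <= enorm (x - y) + enorm (y - z).
Proof. by rewrite (_ : x - z = (x - y) + (y - z)) ?enormD// addrA subrK. Qed.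

Lemma enorm_distl x y : `|enorm x - enorm y| <= enorm (x - y).
Proof.
rewrite ler_distl; apply/andP; split.
  have := enormD (y - x) x; rewrite subrK enormB; lra.
by have := enormD (x - y) y; rewrite subrK; lra.
Qed.

Lemma coord_le x i : `|x 0 i| <= enorm x.
Proof.
rewrite enormE -sqrtr_sqr ler_sqrt ?dotvv_ge0// /dotv (bigD1 i)//= expr2 lerDl.
by apply: sumr_ge0 => j _; rewrite -expr2 sqr_ge0.
Qed.

Lemma enorm_delta i : enorm (delta_mx 0 i : V) = 1.
Proof.
rewrite enormE /dotv (bigD1 i)//= !mxE !eqxx mulr1 big1 ?addr0 ?sqrtr1// => j ji.
by rewrite !mxE (negbTE ji) andbF mulr0.
Qed.

Lemma dotv_delta i x : dotv (delta_mx 0 i) x = x 0 i.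
Proof.
rewrite /dotv (bigD1 i)//= !mxE !eqxx mul1r big1 ?addr0// => j ji.
by rewrite !mxE (negbTE ji) andbF mul0r.
Qed.

Lemma enorm_sum (I : Type) (s : seq I) (f : I -> V) :
  enorm (\sum_(i <- s) f i) <= \sum_(i <- s) enorm (f i).
Proof.
elim: s => [|a s IH]; first by rewrite !big_nil enorm0.
by rewrite !big_cons; apply: (le_trans (enormD _ _)); exact: lerD.
Qed.

Lemma enorm_le_sum x : enorm x <= \sum_(i < d) `|x 0 i|.
Proof.
rewrite {1}(row_sum_delta x); apply: (le_trans (enorm_sum _ _)).
by apply: ler_sum => i _; rewrite enormZ enorm_delta mulr1.
Qed.

Lemma enorm_le_max x (c : R) : (forall i, `|x 0 i| <= c) -> enorm x <= d%:R * c.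
Proof.
move=> h; apply: (le_trans (enorm_le_sum _)).
apply: (@le_trans _ _ (\sum_(i < d) c)); first exact: ler_sum.
by rewrite sumr_const card_ord mulr_natl.
Qed.

Lemma mx_norm_le_enorm x : `|x| <= enorm x.
Proof.
rewrite /Num.norm/= mx_normrE; apply: (@bigmax_le _ _ _ _ _ _ _ _) => [|[i j] _]/=.
  exact: enorm_ge0.
by rewrite ord1; exact: coord_le.
Qed.

Lemma enorm_le_mx_norm x : enorm x <= d%:R * `|x|.
Proof.
apply: enorm_le_max => i; rewrite /Num.norm/= mx_normrE.
exact: (le_bigmax _ (fun ij => `|x ij.1 ij.2|) (0, i)).
Qed.

Definition lip (l : R) (g : V -> R) := forall x y, `|g x - g y| <= l * enorm (x - y).

Lemma lip_continuous l g : lip l g -> continuous g.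
Proof.
move=> gl x; apply/(@cvgrPdist_lt _ _ _ (nbhs x) _ g (g x)) => e e0.
pose c := `|l| * d%:R + 1.
have c0 : 0 < c by rewrite /c ltr_wpDl// mulr_ge0.
have ec : 0 < e / c by rewrite divr_gt0.
near=> y; apply: (le_lt_trans (gl _ _)).
have xy : `|x - y| < e / c by near: y; exact: cvgr_dist_lt.
have h := enorm_le_mx_norm (x - y).
apply: (@le_lt_trans _ _ (c * `|x - y|)); last by rewrite mulrC -ltr_pdivlMr.
apply: (@le_trans _ _ (`|l| * (d%:R * `|x - y|))).
  apply: (@le_trans _ _ (`|l| * enorm (x - y))).
    by rewrite ler_wpM2r ?enorm_ge0// ler_norm.
  by rewrite ler_wpM2l.
by rewrite mulrA ler_wpM2r// /c lerDl.
Unshelve. all: by end_near. Qed.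

Lemma cont_meas (f : V -> R) : continuous f -> measurable_fun (setT : set Rd) f.
Proof.
move=> cf; apply: (measurability _ (RGenOInfty.measurableE R)).
move=> _ [_ [a ->] <-]; rewrite setTI; apply: sub_sigma_algebra.
by move: cf => /continuousP; apply; exact: interval_open.
Qed.

Lemma lip_meas l g : lip l g -> measurable_fun (setT : set Rd) g.
Proof. by move=> /lip_continuous/cont_meas. Qed.

Lemma lip_bmf l g M : lip l g -> (forall x, `|g x| <= M) -> @bmf R _ Rd g.
Proof. by move=> /lip_meas mg gM; split => //; exists M. Qed.

Lemma lip_coord i : lip 1 (fun x => x 0 i).
Proof. by move=> x y; have := coord_le (x - y) i; rewrite !mxE mul1r. Qed.

Lemma meas_coord i : measurable_fun (setT : set Rd) (fun x : V => x 0 i).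
Proof. exact: lip_meas (@lip_coord i). Qed.

Lemma lip_enorm : lip 1 (@enorm R d).
Proof. by move=> x y; rewrite mul1r enorm_distl. Qed.

Lemma meas_enorm : measurable_fun (setT : set Rd) (@enorm R d).
Proof. exact: lip_meas lip_enorm. Qed.

Lemma lip_dotv u : lip (enorm u) (dotv u).
Proof. by move=> x y; rewrite -dotvBr dotv_le. Qed.

Lemma meas_dotv u : measurable_fun (setT : set Rd) (dotv u).
Proof. exact: lip_meas (@lip_dotv u). Qed.

Lemma lipW l l' g : l <= l' -> lip l g -> lip l' g.
Proof.
by move=> ll gl x y; apply: (le_trans (gl x y)); rewrite ler_wpM2r ?enorm_ge0.
Qed.

Lemma lip_cst (c : R) : lip 0 (fun _ => c).
Proof. by move=> x y; rewrite subrr normr0 mul0r. Qed.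

Lemma lipD l l' g h : lip l g -> lip l' h -> lip (l + l') (fun x => g x + h x).
Proof.
move=> gl hl x y; rewrite (_ : _ - _ = (g x - g y) + (h x - h y)); last by ring.
by rewrite mulrDl (le_trans (ler_normD _ _))// lerD.
Qed.

Lemma lipZ c l g : lip l g -> lip (`|c| * l) (fun x => c * g x).
Proof. by move=> gl x y; rewrite -mulrBr normrM -mulrA ler_wpM2l. Qed.

Lemma lip_max l l' g h : 0 <= l -> 0 <= l' -> lip l g -> lip l' h ->
  lip (l + l') (fun x => Num.max (g x) (h x)).
Proof.
move=> l0 l0' gl hl x y.
have h1 := gl x y; have h2 := hl x y.
have e0 := enorm_ge0 (x - y).
have le1 : 0 <= l * enorm (x - y) by exact: mulr_ge0.
have le2 : 0 <= l' * enorm (x - y) by exact: mulr_ge0.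
rewrite mulrDl; move: h1 h2 le1 le2; set A := l * _; set B := l' * _.
rewrite !ler_distl !maxEle.
by case: ifP => ?; case: ifP => ?; lra.
Qed.

(** The boxes have rational centres and radii [n.+1%:R^-1] and are enumerated through [pickle].
    Countability of the union is what makes coordinatewise measurability imply Borel
    measurability. *)
Lemma open_boxes (O : set V) : open O -> exists (D : set nat) (c : nat -> V) (r : nat -> R),
  O = \bigcup_(k in D) [set x | forall i, `|x 0 i - c k 0 i| < r k].
Proof.
move=> oO.
pose c (q : 'rV[rat]_d) : V := \row_i ratr (q 0 i).
pose box (p : 'rV[rat]_d * nat) := [set x : V | forall i, `|x 0 i - c p.1 0 i| < p.2.+1%:R^-1].
pose dec k := odflt (0, 0%N) (unpickle k : option ('rV[rat]_d * nat)).
exists [set k | box (dec k) `<=` O], (fun k => c (dec k).1), (fun k => (dec k).2.+1%:R^-1).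
apply/seteqP; split => [x Ox|x [k Dk /= h]]; last by apply: Dk => i; exact: h.
have [e /= e0 eO] : exists2 e : R, 0 < e & ball x e `<=` O.
  by have /nbhs_ballP[e e0 eO] := open_nbhs_nbhs (conj oO Ox); exists e.
(* A box of radius below e/2 that contains [x] has all its points within [e] of [x]. *)
pose n := Num.truncn (2 / e).
have ne : 2 * n.+1%:R^-1 < e.
  rewrite ltr_pdivrMr// -ltr_pdivrMl// mulrC.
  by rewrite /n; apply: truncnS_gt.
have r0 : (0 : R) < n.+1%:R^-1 by rewrite invr_gt0.
have q_ex i : exists q : rat, `|x 0 i - ratr q| < n.+1%:R^-1.
  have H : x 0 i - n.+1%:R^-1 < x 0 i + n.+1%:R^-1.
    by rewrite ltrBlDr -addrA ltrDl addr_gt0.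
  have [q] := rat_in_itvoo H.
  rewrite in_itv/= => /andP[q1 q2]; exists q.
  move: q1 q2; move: (n.+1%:R^-1) => r q1 q2.
  by rewrite ltr_norml; apply/andP; split; lra.
pose q := \row_i projT1 (cid (q_ex i)).
have qx i : `|x 0 i - c q 0 i| < n.+1%:R^-1.
  by rewrite !mxE; case: cid.
exists (pickle (q, n)).
  rewrite /= /dec pickleK/= => y yq; apply: eO; split => // i j.
  rewrite ord1 /ball/=.
  apply: le_lt_trans ne.
  have := qx j; have := yq j => /=.
  rewrite !ltr_norml => /andP[a1 a2] /andP[b1 b2].
  move: a1 a2 b1 b2; move: (n.+1%:R^-1) => r a1 a2 b1 b2.
  by rewrite ler_norml; apply/andP; split; lra.
by rewrite /= /dec pickleK/=.
Qed.

Lemma measurable_rV d' (T : measurableType d') (f : T -> Rd) :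
  (forall i, measurable_fun setT (fun w => (f w : V) 0 i)) -> measurable_fun setT f.
Proof.
move=> mf.
apply: (@measurability _ _ _ Rd setT f (@open V)) => //.
move=> _ [U oU <-]; rewrite setTI.
have [D [c [r ->]]] := open_boxes oU.
rewrite preimage_bigcup; apply: bigcup_measurable => k _.
have -> : f @^-1` [set x | forall i, `|x 0 i - c k 0 i| < r k] =
   \big[setI/setT]_(i < d) [set w | `|(f w : V) 0 i - c k 0 i| < r k].
  apply/seteqP; split => [w /= h|w /=].
    by apply/bigsetI_ordP => i; exact: h.
  by move=> /bigsetI_ordP h i; exact: (h i).
apply: bigsetI_measurable => i _.
rewrite (_ : [set w | _] = (fun w => `|(f w : V) 0 i - c k 0 i|) @^-1` `]-oo, r k[); last first.
  by apply/seteqP; split => w /=; rewrite in_itv.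
rewrite -[X in measurable X]setTI.
apply: (measurableT_comp (@normr_measurable R setT) _) => //.
exact: measurable_funB.
Qed.

Lemma measurable_coord d' (T : measurableType d') (f : T -> Rd) i :
  measurable_fun setT f -> measurable_fun setT (fun w => (f w : V) 0 i).
Proof. by move=> mf; exact: (measurableT_comp (meas_coord i)). Qed.

Section vector_measurability.
Context d' (T : measurableType d').
Implicit Types f g : T -> Rd.

Lemma mvD f g : measurable_fun setT f -> measurable_fun setT g ->
  measurable_fun setT (fun w => ((f w : V) + g w) : Rd).
Proof.
move=> mf mg; apply: measurable_rV => i; under eq_fun do rewrite mxE.
by apply: measurable_funD; exact: measurable_coord.
Qed.

Lemma mvZ (c : R) f : measurable_fun setT f ->
  measurable_fun setT (fun w => (c *: (f w : V)) : Rd).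
Proof.
move=> mf; apply: measurable_rV => i; under eq_fun do rewrite mxE.
by apply: measurable_funM => //; exact: measurable_coord.
Qed.

Lemma mvN f : measurable_fun setT f -> measurable_fun setT (fun w => (- (f w : V)) : Rd).
Proof.
move=> mf; have := mvZ (-1) mf.
by under eq_fun do rewrite scaleN1r.
Qed.

Lemma mvB f g : measurable_fun setT f -> measurable_fun setT g ->
  measurable_fun setT (fun w => ((f w : V) - g w) : Rd).
Proof. by move=> mf mg; apply: mvD => //; exact: mvN. Qed.

Lemma mvZr (c : T -> R) f : measurable_fun setT c -> measurable_fun setT f ->
  measurable_fun setT (fun w => (c w *: (f w : V)) : Rd).
Proof.
move=> mc mf; apply: measurable_rV => i; under eq_fun do rewrite mxE.
by apply: measurable_funM => //; exact: measurable_coord.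
Qed.

Lemma mv_sum (I : Type) (s : seq I) (f : I -> T -> Rd) :
  (forall i, measurable_fun setT (f i)) ->
  measurable_fun setT (fun w => (\sum_(i <- s) (f i w : V)) : Rd).
Proof.
move=> mf; elim: s => [|i s IH].
  by under eq_fun do rewrite big_nil; exact: measurable_cst.
by under eq_fun do rewrite big_cons; exact: mvD.
Qed.

End vector_measurability.

Lemma bmf_shift (f : Rd -> R) (x : V) : bmf f -> @bmf R _ Rd (fun y => f (x + y)).
Proof. by move=> bf; apply: (bmf_comp bf); apply: mvD. Qed.

End euclid.

(** * Lipschitz functions are dense in L^1 of two laws at once *)

Section lipschitz_density.
Context {R : realType} {d : nat}.
Local Notation V := 'rV[R]_d.
Local Notation Rd := (@Rd R d).
Variables P Q : probability Rd R.

(** One Lipschitz function has to approximate in two L^1 norms simultaneously; in the application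
    [P] is the occupation measure of the limit process and [Q] its mollification. *)
Let dens (F : V -> R) := forall e : R, 0 < e -> exists (g : V -> R) (l : R),
  [/\ 0 <= l, lip l g, forall x, 0 <= g x <= 1,
      Ex P (fun x => `|F x - g x|) <= e & Ex Q (fun x => `|F x - g x|) <= e].

(** A functional monotone class: stability under limits, complements, maxima and averages leads from
    open slabs to Borel sets and from their indicators to all functions with values in [0, 1]. *)
Let cls (F : V -> R) := @bmf R _ Rd F /\ dens F.

Let g_bmf l (g : V -> R) : lip l g -> (forall x, 0 <= g x <= 1) -> @bmf R _ Rd g.
Proof.
move=> lg g01; apply: (lip_bmf (M := 1) lg) => x.
by have /andP[? ?] := g01 x; rewrite ger0_norm.
Qed.

Let cls_lim (F : (V -> R)^nat) G : (forall n, cls (F n)) ->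
  (forall n x, `|F n x| <= 1) -> (forall x, F^~ x @ \oo --> G x) -> cls G.
Proof.
move=> cF F1 FG.
have mF n : measurable_fun (setT : set Rd) (F n) by case: (cF n) => -[].
have [bG _] := Ex_dominated P mF F1 FG.
split => // e e0.
have conv (Z : probability Rd R) : Ex Z (fun x => `|G x - F n x|) @[n --> \oo] --> (0 : R).
  rewrite -(Ex_cst Z 0).
  have [M [_ GM]] := bmf_bound bG.
  apply: (Ex_dominated (f := fun n x => `|G x - F n x|) Z (M := M + 1) _ _ _).2.
  - move=> n; apply: (bmf_meas (bmf_abs (bmfB bG _))); exact: (cF n).1.
  - by move=> n x; rewrite normr_id (le_trans (ler_normB _ _))// lerD.
  move=> x; rewrite -(normr0 R) -(subrr (G x)).
  by apply: cvg_norm; apply: cvgB; [exact: cvg_cst|exact: FG].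
have e2 : 0 < e / 2 by rewrite divr_gt0.
near \oo => n.
have hP : `|0 - Ex P (fun x => `|G x - F n x|)| < e / 2.
  by near: n; move/cvgrPdist_lt : (conv P); apply.
have hQ : `|0 - Ex Q (fun x => `|G x - F n x|)| < e / 2.
  by near: n; move/cvgrPdist_lt : (conv Q); apply.
have [g [l [l0 lg g01 gP gQ]]] := (cF n).2 _ e2.
have bg := g_bmf lg g01; have bF := (cF n).1.
exists g, l; split => //.
  apply: (@le_trans _ _ (Ex P (fun x => `|G x - F n x| + `|F n x - g x|))).
    apply: Ex_le => [||x]; [exact/bmf_abs/bmfB|by apply: bmfD; exact/bmf_abs/bmfB|].
    exact: ler_distD.
  rewrite ExD; [|exact/bmf_abs/bmfB|exact/bmf_abs/bmfB].
  by move: hP; rewrite sub0r normrN => /(le_lt_trans (ler_norm _)); lra.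
apply: (@le_trans _ _ (Ex Q (fun x => `|G x - F n x| + `|F n x - g x|))).
  apply: Ex_le => [||x]; [exact/bmf_abs/bmfB|by apply: bmfD; exact/bmf_abs/bmfB|].
  exact: ler_distD.
rewrite ExD; [|exact/bmf_abs/bmfB|exact/bmf_abs/bmfB].
by move: hQ; rewrite sub0r normrN => /(le_lt_trans (ler_norm _)); lra.
Unshelve. all: by end_near. Qed.

Let cls_lip (l : R) (g : V -> R) : 0 <= l -> lip l g -> (forall x, 0 <= g x <= 1) -> cls g.
Proof.
move=> l0 lg g01; split; first exact: (g_bmf lg g01).
move=> e e0; exists g, l; split=> //.
  by under eq_Ex do rewrite subrr normr0; rewrite Ex_cst ltW.
by under eq_Ex do rewrite subrr normr0; rewrite Ex_cst ltW.
Qed.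

Let cls_ext F G : cls F -> F =1 G -> cls G.
Proof. by move=> cF /funext <-. Qed.

Let cls_compl F : cls F -> cls (fun x => 1 - F x).
Proof.
move=> [bF dF]; split; first by apply: bmfB.
move=> e /dF[g [l [l0 lg g01 gP gQ]]].
have h x : `|1 - F x - (1 - g x)| = `|F x - g x|.
  by rewrite -normrN; congr `|_|; ring.
exists (fun x => 1 - g x), l; split => //.
- move=> x y; rewrite (_ : _ - _ = - (g x - g y)); last by ring.
  by rewrite normrN.
- by move=> x; have := g01 x; lra.
- by under eq_Ex do rewrite h.
- by under eq_Ex do rewrite h.
Qed.

Let max_dist (a b c e : R) : `|Num.max a b - Num.max c e| <= `|a - c| + `|b - e|.
Proof.
have := normr_ge0 (a - c); have := normr_ge0 (b - e).
have := lexx `|a - c|; have := lexx `|b - e|.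
rewrite {1}ler_norml {1}ler_norml => /andP[? ?] /andP[? ?] ? ?.
by rewrite ler_norml !maxEle; case: ifP => ?; case: ifP => ?; lra.
Qed.

Let cls_max F G : cls F -> cls G -> cls (fun x => Num.max (F x) (G x)).
Proof.
move=> [bF dF] [bG dG]; split; first exact: bmf_max.
move=> e e0; have e2 : 0 < e / 2 by rewrite divr_gt0.
have [g [l [l0 lg g01 gP gQ]]] := dF _ e2.
have [h [k [k0 kh h01 hP hQ]]] := dG _ e2.
have bg := g_bmf lg g01; have bh := g_bmf kh h01.
have mm := bmf_max bg bh.
exists (fun x => Num.max (g x) (h x)), (l + k); split.
- exact: addr_ge0.
- exact: lip_max.
- move=> x; have /andP[? ?] := g01 x; have /andP[? ?] := h01 x.
  by rewrite maxEle; case: ifP => ?; apply/andP.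
- apply: (@le_trans _ _ (Ex P (fun x => `|F x - g x| + `|G x - h x|))).
    by apply: Ex_le => [||x]; [exact/bmf_abs/bmfB/mm/bmf_max|by apply: bmfD; exact/bmf_abs/bmfB|].
  by rewrite ExD; [lra|exact/bmf_abs/bmfB|exact/bmf_abs/bmfB].
- apply: (@le_trans _ _ (Ex Q (fun x => `|F x - g x| + `|G x - h x|))).
    by apply: Ex_le => [||x]; [exact/bmf_abs/bmfB/mm/bmf_max|by apply: bmfD; exact/bmf_abs/bmfB|].
  by rewrite ExD; [lra|exact/bmf_abs/bmfB|exact/bmf_abs/bmfB].
Qed.

Let cls_conv (t : R) F G : 0 <= t <= 1 -> cls F -> cls G -> cls (fun x => t * F x + (1 - t) * G x).
Proof.
move=> t01 [bF dF] [bG dG]; split; first by apply: bmfD; apply: bmfZ.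
move=> e e0.
have [g [l [l0 lg g01 gP gQ]]] := dF _ e0.
have [h [k [k0 kh h01 hP hQ]]] := dG _ e0.
have bg := g_bmf lg g01; have bh := g_bmf kh h01.
have /andP[t0 t1] := t01.
have bb : @bmf R _ Rd (fun x => `|(t * F x + (1 - t) * G x) - (t * g x + (1 - t) * h x)|).
  by apply: bmf_abs; apply: bmfB; apply: bmfD; apply: bmfZ.
have E (Z : probability Rd R) : Ex Z (fun x => `|F x - g x|) <= e -> Ex Z (fun x => `|G x - h x|) <= e ->
  Ex Z (fun x => `|(t * F x + (1 - t) * G x) - (t * g x + (1 - t) * h x)|) <= e.
  move=> z1 z2.
  apply: (@le_trans _ _ (Ex Z (fun x => t * `|F x - g x| + (1 - t) * `|G x - h x|))).
    apply: Ex_le => //.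
      by apply: bmfD; apply: bmfZ; apply: bmf_abs; apply: bmfB.
    move=> x; rewrite (_ : _ - _ = t * (F x - g x) + (1 - t) * (G x - h x)); last by ring.
    apply: (le_trans (ler_normD _ _)); have t1' : 0 <= 1 - t by rewrite subr_ge0.
    by rewrite !normrM (ger0_norm t0) (ger0_norm t1').
  rewrite ExD; [|by apply/bmfZ/bmf_abs/bmfB|by apply/bmfZ/bmf_abs/bmfB].
  by rewrite !ExZ; [nra|exact/bmf_abs/bmfB|exact/bmf_abs/bmfB].
exists (fun x => t * g x + (1 - t) * h x), (`|t| * l + `|1 - t| * k); split.
- by apply: addr_ge0; apply: mulr_ge0.
- by apply: lipD; exact: lipZ.
- move=> x; have := g01 x; have := h01 x; nra.
- exact: E.
- exact: E.
Qed.

Let cls_avg (F : nat -> V -> R) n : (forall k, cls (F k)) ->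
  cls (fun x => n.+1%:R^-1 * \sum_(k < n.+1) F k x).
Proof.
move=> cF; elim: n => [|n IH].
  by apply: (cls_ext (cF 0%N)) => x; rewrite big_ord1 invr1 mul1r.
pose t : R := n.+2%:R^-1.
have t01 : 0 <= t <= 1 by rewrite invr_ge0 ler0n/= invf_le1// ler1n.
apply: (cls_ext (cls_conv t01 (cF n.+1) IH)) => x /=.
rewrite [in RHS]big_ord_recr/= mulrDr addrC; congr (_ + _).
rewrite mulrA; congr (_ * _).
have n1 : n.+1%:R != 0 :> R by rewrite pnatr_eq0.
have n2 : n.+2%:R != 0 :> R by rewrite pnatr_eq0.
apply: (mulIf n1); rewrite -mulrA mulVf// mulr1 /t.
apply: (mulIf n2); rewrite mulrBl mul1r mulVf// mulrAC mulVf// mul1r.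
by rewrite -[n.+2]addn1 natrD addrK.
Qed.

Let indU (A B : set V) x : (\1_(A `|` B) x : R) = Num.max (\1_A x) (\1_B x).
Proof.
by rewrite !indicE in_setU; case: (x \in A); case: (x \in B); rewrite /= ?maxxx ?(max_l ler01) ?(max_r ler01).
Qed.

Let cls_indC (A : set V) : cls (\1_A) -> cls (\1_(~` A)).
Proof.
move=> /cls_compl cA; apply: (cls_ext cA) => x.
by rewrite !indicE in_setC; case: (x \in A); rewrite /= ?subr0 ?subrr.
Qed.

Let cls_ind_bigcup (F : (set V)^nat) : (forall n, cls (\1_(F n))) -> cls (\1_(\bigcup_n F n)).
Proof.
move=> cF.
apply: (cls_lim (F := fun n => \1_(\big[setU/set0]_(k < n) F k))).
- elim=> [|n IH].
    apply: (cls_ext (cls_lip (lexx 0) (lip_cst 0) _)).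
      by move=> x; rewrite lexx ler01.
    by move=> x; rewrite big_ord0 indic0.
  apply: (cls_ext (cls_max IH (cF n))) => x.
  by rewrite big_ord_recr/= indU.
- by move=> n x; rewrite indicE; case: (_ \in _); rewrite ?normr1 ?normr0.
move=> x; apply: cvg_near_cst.
have [[N _ FN]|nF] := pselect ((\bigcup_n F n) x).
  near=> n; rewrite !indicE !mem_set//; first by exists N.
  rewrite -bigcup_mkord; exists N => //=.
  by near: n; exact: nbhs_infty_gt.
near=> n; rewrite !indicE !memNset//.
by rewrite -bigcup_mkord => -[k _ Fk]; apply: nF; exists k.
Unshelve. all: by end_near. Qed.

Let cls_ind_open (O : set V) : open O -> cls (\1_O).
Proof.
move=> oO; have [D [c [r ->]]] := open_boxes oO.
rewrite bigcup_mkcond; apply: cls_ind_bigcup => k.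
have c0 : cls (\1_(set0 : set V)).
  apply: (cls_ext (cls_lip (lexx 0) (lip_cst 0) _)).
    by move=> x; rewrite lexx ler01.
  by move=> x; rewrite indic0.
case: ifP => // _.
have cT : cls (\1_(setT : set V)) by rewrite -setC0; exact: cls_indC.
have cI (A B : set V) : cls (\1_A) -> cls (\1_B) -> cls (\1_(A `&` B)).
  move=> /cls_indC cA /cls_indC cB; rewrite -[A `&` B]setCK setCI.
  apply: cls_indC; apply: (cls_ext (cls_max cA cB)) => x.
  by rewrite indU.
have bE : [set x : V | forall i, `|x 0 i - c k 0 i| < r k] =
   \big[setI/setT]_(i < d) [set x : V | `|x 0 i - c k 0 i| < r k].
  apply/seteqP; split => [w /= h|w /=].
    by apply/bigsetI_ordP => i; exact: h.
  by move=> /bigsetI_ordP h i; exact: (h i).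
apply: (@cls_ext (\1_(\big[setI/setT]_(i < d) [set x : V | `|x 0 i - c k 0 i| < r k]))); last first.
  by move=> x; rewrite -bE.
elim/big_ind : _ => // i _.
pose z (x : V) : R := Num.max 0 (r k - `|x 0 i - c k 0 i|).
have z0 x : 0 <= z x by rewrite /z le_max lexx.
(* [z] is the distance to the complement of the slab, so these Lipschitz functions increase to its
   indicator. *)
apply: (cls_lim (F := fun n x => Num.min 1 (n%:R * z x))).
- move=> n; apply: (@cls_lip n%:R).
  + by [].
  + move=> x y.
    have h : `|z x - z y| <= enorm (x - y).
      apply: le_trans (coord_le (x - y) i); rewrite !mxE.
      apply: (le_trans (max_dist _ _ _ _)); rewrite subrr normr0 add0r.
      rewrite (_ : _ - _ = - (`|x 0 i - c k 0 i| - `|y 0 i - c k 0 i|)); last by ring.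
      rewrite normrN (le_trans (ler_dist_dist _ _))//.
      by rewrite (_ : _ - _ - _ = x 0 i - y 0 i)//; ring.
    have : `|n%:R * z x - n%:R * z y| <= n%:R * enorm (x - y).
      by rewrite -mulrBr normrM ger0_norm// ler_wpM2l.
    apply: le_trans.
    have := lexx `|n%:R * z x - n%:R * z y|.
    rewrite {1}ler_norml => /andP[? ?]; rewrite ler_norml !minEle.
    have := normr_ge0 (n%:R * z x - n%:R * z y).
    by case: ifP => ?; case: ifP => ?; lra.
  + by move=> x; rewrite le_min ler01 mulr_ge0//= ge_min lexx.
- move=> n x; rewrite ger0_norm ?ge_min ?lexx//.
  by rewrite le_min ler01 mulr_ge0.
move=> x.
have [h|h] := ltP (`|x 0 i - c k 0 i|) (r k).
  rewrite indicE mem_set//=; apply: cvg_near_cst.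
  have zx : 0 < z x by rewrite /z lt_max subr_gt0 h orbT.
  near=> n; apply/min_idPl.
  rewrite -ler_pdivrMr// mul1r; near: n; exact: nbhs_infty_ger.
rewrite indicE memNset/=; last by apply/negP; rewrite -leNgt.
apply: cvg_near_cst; near=> n.
rewrite (_ : z x = 0); last by apply/max_idPl; lra.
by rewrite mulr0; apply/min_idPr.
Unshelve. all: by end_near. Qed.

Let cls_ind (A : set Rd) : measurable A -> cls (\1_A).
Proof.
(* The generated sigma-algebra is an intersection; [mA] is instantiated at the family of sets whose
   indicator lies in [cls]. *)
move=> mA; apply: (mA [set B : set V | cls (\1_B)]).
split; last by move=> O; exact: cls_ind_open.
split.
- by apply: cls_ind_open; exact: open0.
- by move=> B cB; rewrite setTD; exact: cls_indC.
- by move=> F; exact: cls_ind_bigcup.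
Qed.

Let cls_unit (F : V -> R) : @bmf R _ Rd F -> (forall x, 0 <= F x <= 1) -> cls F.
Proof.
move=> bF F01.
pose A n k : set V := [set x | k.+1%:R <= n.+1%:R * F x].
have mA n k : measurable (A n k : set Rd) by apply: indic_avg_meas; exact: bmf_meas.
pose h n x : R := n.+1%:R^-1 * \sum_(k < n.+1) \1_(A n k) x.
have hF n x : 0 <= F x - h n x <= n.+1%:R^-1 by exact: (@indic_avg R _ Rd F n x (F01 x)).
apply: (cls_lim (F := h)).
- by move=> n; apply: (@cls_avg (fun k => \1_(A n k)) n) => k; exact: cls_ind.
- move=> n x; have := hF n x; have := F01 x => /andP[? ?] /andP[? ?].
  rewrite ger0_norm; first lra.
  by rewrite mulr_ge0// sumr_ge0// => k _; rewrite indicE.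
move=> x; apply/cvgrPdist_le => e e0; near=> n.
have /andP[a1 a2] := hF n x; rewrite ger0_norm//; apply: (le_trans a2).
by apply: ltW; near: n; exact: (near_infty_natSinv_lt (PosNum e0)).
Unshelve. all: by end_near. Qed.

Lemma blip_dense2 (F : V -> R) (e : R) : @bmf R _ Rd F -> (forall x, `|F x| <= 1) -> 0 < e ->
  exists (g : V -> R) (l : R), [/\ 0 <= l, lip l g, forall x, `|g x| <= 1,
      Ex P (fun x => `|F x - g x|) <= e & Ex Q (fun x => `|F x - g x|) <= e].
Proof.
move=> bF F1 e0.
have [||_ /(_ _ (divr_gt0 e0 (@ltr0n R 2)))] := @cls_unit (fun x => 2^-1 * (F x + 1)).
- by apply: bmfZ; apply: bmfD.
- by move=> x; have := F1 x; rewrite ler_norml => /andP[? ?]; lra.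
move=> [g [l [l0 lg g01 gP gQ]]].
have bg := g_bmf lg g01.
have E (Z : probability Rd R) : Ex Z (fun x => `|2^-1 * (F x + 1) - g x|) <= e / 2 ->
  Ex Z (fun x => `|F x - (2 * g x - 1)|) <= e.
  move=> h; rewrite (@eq_Ex _ _ _ _ _ (fun x : Rd => 2 * `|2^-1 * (F x + 1) - g x|)); last first.
    move=> x; rewrite -[X in X * `|_|](@ger0_norm _ 2)// -normrM; congr `|_|.
    by field.
  rewrite ExZ; first lra.
  by apply: bmf_abs; apply: bmfB => //; apply: bmfZ; apply: bmfD.
exists (fun x => 2 * g x - 1), (2 * l); split.
- by rewrite mulr_ge0.
- move=> x y; rewrite (_ : _ - _ = 2 * (g x - g y)); last by ring.
  by rewrite normrM ger0_norm// -mulrA ler_wpM2l.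
- by move=> x; rewrite ler_norml; have := g01 x; lra.
- exact: E.
- exact: E.
Qed.

(** By simultaneous density, [F] is replaced by the same Lipschitz function under both laws. *)
Lemma prob_eq_of_blip : (forall (g : V -> R) l, lip l g -> (forall x, `|g x| <= 1) ->
  Ex P g = Ex Q g) -> forall F, @bmf R _ Rd F -> Ex P F = Ex Q F.
Proof.
move=> H F bF.
have [M [M0 FM]] := bmf_bound bF.
pose F' x := M^-1 * F x.
have bF' : @bmf R _ Rd F' by apply: bmfZ.
suff e : Ex P F' = Ex Q F'.
  have FF x : F x = M * F' x by rewrite /F' mulrA divff ?mul1r// gt_eqF.
  by rewrite (eq_Ex P FF) (eq_Ex Q FF) (ExZ P M bF') (ExZ Q M bF') e.
have F'1 x : `|F' x| <= 1.
  by rewrite /F' normrM gtr0_norm ?invr_gt0// ler_pdivrMl// mulr1.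
apply/eqP; rewrite -subr_eq0 -normr_le0; apply/ler_addgt0Pl => e e0; rewrite addr0.
have e2 : 0 < e / 2 by rewrite divr_gt0.
have [g [l [l0 lg g1 gP gQ]]] := blip_dense2 bF' F'1 e2.
have bg : @bmf R _ Rd g by exact: lip_bmf lg g1.
have D (Z : probability Rd R) : Ex Z (fun x => `|F' x - g x|) <= e / 2 -> `|Ex Z F' - Ex Z g| <= e / 2.
  by move=> h; rewrite -ExB//; apply: le_trans h; apply: Ex_abs; exact: bmfB.
have := D _ gP; have := D _ gQ; rewrite (H g l)// !ler_norml.
by move=> /andP[? ?] /andP[? ?]; apply/andP; split; lra.
Qed.

End lipschitz_density.

(** * Densities and elementary bounds *)

Section densities.
Context {R : realType} {d : measure_display} {T : measurableType d}.
Variable mu : {measure set T -> \bar R}.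

Section probability_of_density.
Variables (p : T -> R) (mp : measurable_fun setT p) (p0 : forall x, 0 <= p x)
  (p1 : (\int[mu]_x (p x)%:E = 1)%E).

(** The three proofs are arguments of the definition so that the structures of measure and of
    probability can be attached to the term itself. *)
Definition density_prob (_ : measurable_fun setT p) (_ : forall x, 0 <= p x)
    (_ : (\int[mu]_x (p x)%:E = 1)%E) : set T -> \bar R :=
  fun A => (\int[mu]_(x in A) (p x)%:E)%E.

Let dp0 : density_prob mp p0 p1 set0 = 0%E.
Proof. by rewrite /density_prob integral_set0. Qed.

Let dp_ge0 A : (0 <= density_prob mp p0 p1 A)%E.
Proof. by apply: integral_ge0 => x _; rewrite lee_fin. Qed.

Let dp_sigma : semi_sigma_additive (density_prob mp p0 p1).
Proof.
move=> /= F mF tF mUF; rewrite /density_prob; apply: cvg_toP.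
  apply: ereal_nondecreasing_is_cvgn => m n mn.
  apply: lee_sum_nneg_natr => // k _ _.
  by apply: integral_ge0 => /= x Fkx; rewrite lee_fin.
rewrite ge0_integral_bigcup//=.
- by apply: measurable_funTS; apply: measurableT_comp.
- by move=> x _; rewrite lee_fin.
Qed.

HB.instance Definition _ := isMeasure.Build _ _ _ (density_prob mp p0 p1)
  dp0 dp_ge0 dp_sigma.

Let dpT : density_prob mp p0 p1 [set: _] = 1%:E. Proof. exact: p1. Qed.

HB.instance Definition _ := @Measure_isProbability.Build _ _ R
  (density_prob mp p0 p1) dpT.

End probability_of_density.

Definition has_density (D : probability T R) (p : T -> R) :=
  [/\ measurable_fun setT p, forall x, 0 <= p x &
  forall A, measurable A -> D A = (\int[mu]_(x in A) (p x)%:E)%E].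

Lemma density_int1 D p : has_density D p -> (\int[mu]_x (p x)%:E = 1)%E.
Proof. by move=> [mp p0 <-]//; exact: probability_setT. Qed.

Lemma density_integrable D p f : has_density D p -> bmf f ->
  mu.-integrable setT (fun x => (f x * p x)%:E).
Proof.
move=> hD [mf [M hM]]; have [mp p0 hA] := hD.
have ip : mu.-integrable setT (fun x => (p x)%:E).
  apply/integrableP; split; first exact/measurable_EFinP.
  under eq_integral do rewrite gee0_abs ?lee_fin//.
  by rewrite (density_int1 hD) ltry.
have iM : mu.-integrable setT (fun x => M%:E * (p x)%:E)%E by exact: integrableZl.
apply: le_integrable iM => //.
  by apply/measurable_EFinP; exact: measurable_funM.
move=> x _; rewrite !abse_EFin lee_fin !normrM; apply: ler_wpM2r => //.
by apply: (le_trans (hM x)); exact: ler_norm.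
Qed.

Local Notation I f := (\int[mu]_x (f x))%R.

(** Both sides are linear and monotone in [f] and agree on indicators. Averages of indicators of
    level sets carry the identity to values in [0, 1], and an affine change of [f] to the general
    bounded case. *)
Lemma Ex_density D p f : has_density D p -> bmf f ->
  Ex D f = \int[mu]_x (f x * p x).
Proof.
move=> hD bf; have [mp p0 hA] := hD.
have int g := @density_integrable D p g hD.
have ind A : measurable A -> Ex D \1_A = \int[mu]_x (\1_A x * p x).
  move=> mA; rewrite Ex_indic// hA// /Rintegral; congr fine.
  rewrite integral_mkcond; apply: eq_integral => x _; rewrite patchE indicE.
  by case: (x \in A); rewrite ?mul1r ?mul0r.
have lin g h (a b : R) : bmf g -> bmf h ->
    \int[mu]_x ((a * g x + b * h x) * p x) = a * \int[mu]_x (g x * p x) + b * \int[mu]_x (h x * p x).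
  move=> bg bh; rewrite -!RintegralZl//; try exact: int.
  rewrite -RintegralD//.
  - by apply: eq_Rintegral => x _; ring.
  - under eq_fun do rewrite mulrA.
    by apply: int; exact: bmfZ.
  - under eq_fun do rewrite mulrA.
    by apply: int; exact: bmfZ.
have I1 : \int[mu]_x (1 * p x) = 1.
  rewrite /Rintegral; under eq_integral do rewrite mul1r.
  by rewrite (density_int1 hD).
have bnd g (M : R) : bmf g -> (forall x, 0 <= g x <= M) -> 0 <= \int[mu]_x (g x * p x) <= M.
  move=> bg gM; apply/andP; split.
    by apply: Rintegral_ge0 => x _; rewrite mulr_ge0//; have /andP[] := gM x.
  have := lin (fun=> 1) (fun=> 1) M 0 (bmf_cst _) (bmf_cst _).
  rewrite I1 mulr1 mul0r addr0 => <-.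
  apply: le_Rintegral => //.
  - exact: int.
  - by apply: (int (fun=> M)); apply: bmf_cst.
  - move=> x _; apply: ler_wpM2r => //.
    by have /andP[] := gM x.
have unit g : bmf g -> (forall x, 0 <= g x <= 1) -> Ex D g = \int[mu]_x (g x * p x).
  move=> bg g01; apply/eqP; rewrite -subr_eq0 -normr_le0; apply/ler_addgt0Pl => e e0.
  rewrite addr0.
  have [n ne] : exists n, n.+1%:R^-1 < e.
    by exists (Num.truncn e^-1); rewrite invf_plt ?posrE//; exact: truncnS_gt.
  pose A k : set T := [set x | k.+1%:R <= n.+1%:R * g x].
  have mA k : measurable (A k) by apply: indic_avg_meas; exact: bmf_meas.
  have bA k : bmf (\1_(A k) : T -> R) by exact: bmf_indic.
  pose S m x : R := \sum_(k < m) \1_(A k) x.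
  have bS m : bmf (S m) by apply: bmf_sum.
  have hS m : Ex D (S m) = \int[mu]_x (S m x * p x).
    rewrite /S Ex_sum//; elim: m => [|m IH].
      rewrite big_ord0; under eq_Rintegral do rewrite big_ord0 mul0r.
      by rewrite /Rintegral integral0.
    rewrite big_ord_recr/= IH ind//.
    have := lin (S m) (\1_(A m)) 1 1 (bS m) (bA m); rewrite !mul1r => <-.
    apply: eq_Rintegral => x _; rewrite /S big_ord_recr/= !mul1r//.
  pose h x := n.+1%:R^-1 * S n.+1 x.
  have bh : bmf h by exact: bmfZ.
  have gh x : 0 <= g x - h x <= n.+1%:R^-1 by exact: indic_avg.
  have hh : Ex D h = \int[mu]_x (h x * p x).
    rewrite /h ExZ// hS.
    have := lin (S n.+1) (fun=> 0) n.+1%:R^-1 0 (bS _) (bmf_cst _).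
    rewrite mul0r.
    rewrite (_ : \int[mu]_x ((_ + 0) * p x) = \int[mu]_x (n.+1%:R^-1 * S n.+1 x * p x)).
      by move=> ->; rewrite mul0r addr0.
    by apply: eq_Rintegral => x _; rewrite addr0.
  have bgh : bmf (fun x => g x - h x) by exact: bmfB.
  have e1 : Ex D (fun x => g x - h x) = Ex D g - Ex D h by exact: ExB.
  have e2 : \int[mu]_x ((g x - h x) * p x) = \int[mu]_x (g x * p x) - \int[mu]_x (h x * p x).
    have := lin g h 1 (-1) bg bh; rewrite mul1r mulN1r => <-.
    by apply: eq_Rintegral => x _; ring.
  have b1 : 0 <= Ex D (fun x => g x - h x) <= n.+1%:R^-1.
    apply/andP; split; first by apply: Ex_ge0 => x; have /andP[] := gh x.
    by apply: Ex_le_cst => // x; have /andP[] := gh x.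
  have /andP[b2 b3] := bnd _ _ bgh gh.
  move: b1 => /andP[b1 b4].
  rewrite e1 in b1 b4; rewrite e2 in b2 b3.
  move: ne b1 b2 b3 b4; move: (n.+1%:R^-1) => r ne; rewrite hh => *.
  by rewrite ler_norml; apply/andP; split; lra.
have [M [M0 hM]] := bmf_bound bf.
pose g x := 2^-1 * (M^-1 * f x + 1).
have bg : bmf g by apply: bmfZ; apply: bmfD => //; exact: bmfZ.
have g01 x : 0 <= g x <= 1.
  have : `|M^-1 * f x| <= 1 by rewrite normrM gtr0_norm ?invr_gt0// ler_pdivrMl// mulr1.
  by rewrite ler_norml /g => /andP[? ?]; apply/andP; split; lra.
have fE x : f x = (2 * M) * g x + (- M) * 1.
  by rewrite /g; field; rewrite gt_eqF.
transitivity (Ex D (fun x => (2 * M) * g x + (- M) * 1)); first exact: eq_Ex.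
rewrite ExD//; last exact: bmfZ.
rewrite ExZ// Ex_cst unit//.
have := lin g (fun=> 1) (2 * M) (- M) bg (bmf_cst _).
rewrite I1 => <-.
by apply: eq_Rintegral => x _; rewrite -fE.
Qed.

(** A minorisation in the manner of Doeblin: [D] is [k] times [U] plus a remainder of mass 1 - k, on
    which [f] is only bounded by [M]. *)
Lemma Ex_density_sub D U p q (k M : R) f : has_density D p -> has_density U q ->
  bmf f -> (forall x, `|f x| <= M) -> (forall x, k * q x <= p x) ->
  `|Ex D f - k * Ex U f| <= M * (1 - k).
Proof.
move=> hD hU bf fM kp.
have [mp p0 _] := hD; have [mq q0 _] := hU.
have iD g := @density_integrable D p g hD.
have iU g := @density_integrable U q g hU.
have one (Z : probability T R) r : has_density Z r -> \int[mu]_x (1 * r x) = 1.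
  move=> hZ; rewrite /Rintegral; under eq_integral do rewrite mul1r.
  by rewrite (density_int1 hZ).
have comb g : bmf g -> \int[mu]_x (g x * p x) - k * \int[mu]_x (g x * q x) =
    \int[mu]_x (g x * (p x - k * q x)) /\ mu.-integrable setT (EFin \o (fun x => g x * (p x - k * q x))).
  move=> bg.
  have ik : mu.-integrable setT (EFin \o (fun x => k * (g x * q x))).
    have -> : EFin \o (fun x => k * (g x * q x)) = (fun x => ((k * g x) * q x)%:E).
      by apply/funext => x /=; rewrite mulrA.
    by apply: iU; exact: bmfZ.
  split.
    rewrite -RintegralZl//; last exact: iU.
    rewrite -RintegralB//; last exact: iD.
    by apply: eq_Rintegral => x _; ring.
  have -> : EFin \o (fun x => g x * (p x - k * q x)) =
     ((EFin \o (fun x => (g x * p x)%R)) \- (EFin \o (fun x => (k * (g x * q x))%R)))%E.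
    by apply/funext => x /=; rewrite -EFinB; congr (_ %:E); ring.
  by apply: integrableB => //; exact: iD.
rewrite (Ex_density hD bf) (Ex_density hU bf).
have [-> i1] := comb _ bf.
apply: (le_trans (le_normr_Rintegral _ i1)) => //.
have [e2 i2] := comb _ (bmf_cst M).
have -> : M * (1 - k) = \int[mu]_x (M * (p x - k * q x)).
  rewrite -e2 !RintegralZl//.
  - by have := one _ _ hD; have := one _ _ hU; under eq_Rintegral do rewrite mul1r; move=> ->; under eq_Rintegral do rewrite mul1r; move=> ->; ring.
  - by have := iU _ (bmf_cst 1); under eq_fun do rewrite mul1r.
  - by have := iD _ (bmf_cst 1); under eq_fun do rewrite mul1r.
apply: le_Rintegral => //.
  have := integrable_abse i1; congr (_.-integrable _ _).
move=> x _; rewrite normrM; apply: ler_pM => //.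
by rewrite ger0_norm// subr_ge0.
Qed.

End densities.

(** * Translates of uniform laws *)

Section lebesgue_shift.
Context {R : realType}.
Local Notation leb := (@lebesgue_measure R).

Lemma lebesgue_shift (s : R) (A : set R) : measurable A ->
  leb ((fun x => x + s) @^-1` A) = leb A.
Proof.
move=> mA; apply/esym.
have ms : measurable_fun (setT : set (measurableTypeR R)) (fun x : measurableTypeR R => (x + s : measurableTypeR R)).
  by apply: measurable_funD.
apply: (@lebesgue_measure_unique R (pushforward leb (fun x : measurableTypeR R => (x + s : measurableTypeR R)))).
  move=> _ [[a b] _ <-] /=.
  rewrite /pushforward /= (_ : _ @^-1` _ = `](a - s), (b - s)]%classic); last first.
    by apply/seteqP; split => x /=; rewrite !in_itv/= ltrBlDr lerBrDr.
  rewrite !lebesgue_measure_itv/= !lte_fin ltrD2r.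
  by case: ifP => // _; rewrite -!EFinD; congr (_ %:E); ring.
exact: mA.
Qed.

Lemma ge0_lebesgue_shift (s : R) (g : R -> \bar R) : measurable_fun setT g ->
  (forall x, 0 <= g x)%E -> (\int[leb]_x g (x + s)%R = \int[leb]_x g x)%E.
Proof.
move=> mg g0.
have ms : measurable_fun (setT : set (measurableTypeR R)) (fun x : measurableTypeR R => (x + s : measurableTypeR R)).
  by apply: measurable_funD.
transitivity (\int[pushforward leb (fun x : measurableTypeR R => (x + s)%R : measurableTypeR R)]_y g y)%E.
  by rewrite ge0_integral_pushforward.
by apply: eq_measure_integral => A mA _; exact: lebesgue_shift.
Qed.

Lemma has_density_uniform (a b : R) (ab : a < b) :
  has_density leb (uniform_prob ab) (uniform_pdf a b).
Proof.
split => //; first exact: measurable_uniform_pdf.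
by move=> x; exact: uniform_pdf_ge0.
Qed.

(** The density and its translate differ by at most 1/(b - a), and only within distance |s| of the
    end points; two windows of length 2|s| give the constant 4. *)
Lemma uniform_shift (a b s : R) (ab : a < b) (f : R -> R) :
  @bmf R _ (measurableTypeR R) f -> (forall x, `|f x| <= 1) ->
  `|Ex (uniform_prob ab) (fun x => f (x + s)) - Ex (uniform_prob ab) f| <= 4 * `|s| / (b - a).
Proof.
move=> bf f1.
pose q := uniform_pdf a b.
have hq := has_density_uniform ab.
have mq : measurable_fun setT q by exact: measurable_uniform_pdf.
have q0 x : 0 <= q x by exact: uniform_pdf_ge0.
have ms (c : R) : measurable_fun (setT : set (measurableTypeR R)) (fun x : measurableTypeR R => (x + c : measurableTypeR R)).
  by apply: measurable_funD.
have bfs : @bmf R _ (measurableTypeR R) (fun x => f (x + s)) by apply: (bmf_comp bf).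
pose X := pack_mfun (ms s).
have hD : has_density leb (law_of (uniform_prob ab) X) (fun x => q (x - s)).
  split => //; first exact: (measurableT_comp mq (ms (- s))).
  move=> A mA; rewrite law_ofE.
  have mqs : measurable_fun setT (fun y : R => (q (y - s)%R)%:E * (\1_A y)%:E)%E.
    apply: emeasurable_funM; last by apply/measurable_EFinP; exact: measurable_indic.
    by apply/measurable_EFinP; exact: (measurableT_comp mq (ms (- s))).
  transitivity (\int[leb]_x ((q x)%:E * (\1_A (x + s)%R)%:E))%E.
    rewrite [LHS]integral_mkcond; apply: eq_integral => x _; rewrite patchE indicE.
    have -> : (x \in X @^-1` A) = (x + s \in A).
      by apply/idP/idP; rewrite !inE.
    by case: (_ \in A); rewrite ?mule1 ?mule0.
  transitivity (\int[leb]_y ((q (y - s)%R)%:E * (\1_A y)%:E))%E; last first.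
    rewrite [RHS]integral_mkcond; apply: eq_integral => x _; rewrite patchE indicE.
    by case: (_ \in A); rewrite ?mule1 ?mule0.
  rewrite -(ge0_lebesgue_shift s mqs); last by move=> y; rewrite mule_ge0// lee_fin.
  by apply: eq_integral => x _ /=; rewrite addrK.
have -> : Ex (uniform_prob ab) (fun x => f (x + s)) = Ex (law_of (uniform_prob ab) X) f.
  by rewrite Ex_law.
rewrite (Ex_density hD bf) (Ex_density hq bf).
have i1 := density_integrable hD bf; have i2 := density_integrable hq bf.
rewrite -RintegralB//.
have i12 : leb.-integrable setT (EFin \o (fun x => f x * q (x - s) - f x * q x)).
  have -> : EFin \o (fun x => f x * q (x - s) - f x * q x) =
     ((fun x => (f x * q (x - s))%R%:E) \- (fun x => (f x * q x)%R%:E))%E.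
    by apply/funext => x /=; rewrite -EFinB.
  exact: integrableB.
apply: (le_trans (le_normr_Rintegral _ i12)) => //.
have ba : 0 < b - a by rewrite subr_gt0.
pose I1 : set R := `[a - `|s|, a + `|s|]%classic.
pose I2 : set R := `[b - `|s|, b + `|s|]%classic.
have iI (c : R) : leb.-integrable setT (EFin \o \1_(`[c - `|s|, c + `|s|]%classic : set R)) /\
   \int[leb]_x (\1_(`[c - `|s|, c + `|s|]%classic : set R) x) = 2 * `|s|.
  have mI : measurable (`[c - `|s|, c + `|s|]%classic : set R) by [].
  have lI : leb `[c - `|s|, c + `|s|]%classic = (2 * `|s|)%:E.
    rewrite lebesgue_measure_itv/= lte_fin.
    case: ltP => h; first by rewrite -EFinD; congr (_ %:E); ring.
    have := normr_ge0 s => s0; congr (_ %:E); lra.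
  split.
    apply/integrableP; split; first exact/measurable_EFinP/measurable_indic.
    under eq_integral do rewrite /= indicE ger0_norm// -indicE.
    by rewrite integral_indic// setIT; apply: le_lt_trans (ltry (2 * `|s|)); rewrite -lI.
  by rewrite /Rintegral integral_indic// setIT; exact: (congr1 fine lI).
have [iI1 eI1] := iI a; have [iI2 eI2] := iI b.
have -> : 4 * `|s| / (b - a) = \int[leb]_x ((b - a)^-1 * (\1_I1 x + \1_I2 x)).
  rewrite RintegralZl//; last by have := integrableD measurableT iI1 iI2.
  by rewrite RintegralD// eI1 eI2; field; rewrite gt_eqF.
apply: le_Rintegral => //.
- exact: integrable_abse i12.
- have := integrableZl measurableT (b - a)^-1 (integrableD measurableT iI1 iI2).
  by congr (_.-integrable _ _).
move=> x _; rewrite -mulrBr normrM.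
apply: (@le_trans _ _ `|q (x - s) - q x|).
  by rewrite -[leRHS]mul1r ler_wpM2r.
have v0 : 0 <= (b - a)^-1 by rewrite invr_ge0 ltW.
rewrite /q /uniform_pdf.
have s1 : - `|s| <= s by rewrite lerNl -normrN ler_norm.
have s2 := ler_norm s.
have j0 (J : set R) : 0 <= \1_J x :> R by rewrite indicE.
have jj (J J' : set R) : J x -> 1 <= \1_J x + \1_J' x :> R.
  by move=> Jx; rewrite indicE mem_set//= lerDl.
have jj' (J J' : set R) : J' x -> 1 <= \1_J x + \1_J' x :> R.
  by move=> Jx; rewrite [X in _ + X]indicE mem_set//= lerDr.
case: ifP => [/andP[c1 c2]|c]; case: ifP => [/andP[c3 c4]|c'].
- by rewrite subrr normr0 mulr_ge0// addr_ge0.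
- rewrite subr0 ger0_norm// -[leLHS]mulr1 ler_wpM2l//.
  move/negbT : c'; rewrite negb_and -!ltNge => /orP[h|h].
    by apply: jj; rewrite /I1 /= in_itv/=; apply/andP; split; lra.
  by apply: jj'; rewrite /I2 /= in_itv/=; apply/andP; split; lra.
- rewrite sub0r normrN ger0_norm// -[leLHS]mulr1 ler_wpM2l//.
  move/negbT : c; rewrite negb_and -!ltNge => /orP[h|h].
    by apply: jj; rewrite /I1 /= in_itv/=; apply/andP; split; lra.
  by apply: jj'; rewrite /I2 /= in_itv/=; apply/andP; split; lra.
- by rewrite subrr normr0 mulr_ge0// addr_ge0.
Qed.

End lebesgue_shift.

Section trigonometric_bounds.
Context {R : realType}.
Implicit Types x z : R.

Lemma abs_sin_le x : `|sin x| <= `|x|.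
Proof.
wlog x0 : x / 0 <= x.
  move=> H; have [/H//|/ltW] := leP 0 x.
  by rewrite -oppr_ge0 => /H; rewrite sinN !normrN.
have [c _ e] := @MVT_segment R sin cos 0 x x0 (fun y _ => is_derive_sin y)
  (continuous_subspaceT (@continuous_sin R)).
by move: e; rewrite sin0 !subr0 => ->; rewrite normrM ler_piMl// cos_max.
Qed.

Lemma cos_le1_sqr x : 1 - cos x <= x ^+ 2 / 2.
Proof.
have -> : cos x = 1 - 2 * sin (x / 2) ^+ 2.
  rewrite {1}(_ : x = (x / 2) *+ 2); last by rewrite -mulr_natr; field.
  by rewrite cos_mulr2n cos2sin2 -mulr_natr; ring.
have : sin (x / 2) ^+ 2 <= (x / 2) ^+ 2.
  rewrite -[X in X <= _]real_normK ?num_real// -[leRHS]real_normK ?num_real//.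
  by rewrite ler_sqr ?nnegrE// abs_sin_le.
by rewrite expr_div_n; lra.
Qed.

Lemma onem_cos_ge0 x : 0 <= 1 - cos x.
Proof. by rewrite subr_ge0 cos_le1. Qed.

Lemma onem_cos_le2 x : 1 - cos x <= 2.
Proof. by have := cos_geN1 x; lra. Qed.

Lemma onem_cos1_gt0 : 0 < 1 - cos 1 :> R.
Proof.
have p2 := pi_ge2 R.
have h : (cos 1 < cos 0 :> R) = (0 < 1 :> R); last by rewrite subr_gt0 -[ltRHS](cos0 R) h.
by apply: ltr_cos; rewrite in_itv/=; apply/andP; split; lra.
Qed.

(** The interval [1, 2] contains one rescaled value of every dyadic scale and lies in [0, pi], where
    the cosine decreases. *)
Lemma onem_cos_ge x : 1 <= `|x| <= 2 -> 1 - cos 1 <= 1 - cos x.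
Proof.
move=> /andP[x1 x2]; rewrite lerD2l lerN2 -cos_norm.
have p2 := pi_ge2 R.
rewrite leNgt ltr_cos ?in_itv/=; [by rewrite -leNgt| |]; apply/andP; split; lra.
Qed.

End trigonometric_bounds.

(** * Power integrals and the Pareto law *)

Section power_integrals.
Context {R : realType}.
Local Notation leb := (@lebesgue_measure R).

Lemma is_derive_powR (p x : R) : 0 < x ->
  is_derive x 1 (fun r : R => r `^ p) (p * x `^ (p - 1)).
Proof.
move=> x0; have xI : x \in `]0, +oo[ by rewrite in_itv/= x0.
apply: DeriveDef; first exact: derivable_powR.
by rewrite -derive1E (powR_derive1 p xI).
Qed.

Lemma continuous_powR (p x : R) : 0 < x -> {for x, continuous (fun r : R => r `^ p)}.
Proof.
move=> x0; apply: differentiable_continuous; apply/derivable1_diffP.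
by apply: derivable_powR; rewrite in_itv/= x0.
Qed.

Lemma powR_cvg_pinfty (p : R) : 0 < p -> x `^ (- p) @[x --> +oo] --> (0 : R).
Proof.
move=> p0; apply/cvgrPdist_le => e e0; near=> x.
have x1 : e^-1 `^ p^-1 <= x by near: x; apply: nbhs_pinfty_ge; exact: num_real.
have b0 : 0 < e^-1 `^ p^-1 by rewrite powR_gt0// invr_gt0.
have x0 : 0 < x by apply: lt_le_trans x1.
rewrite sub0r normrN ger0_norm ?powR_ge0// powRN.
rewrite -[leRHS]invrK lef_pV2 ?posrE ?powR_gt0 ?invr_gt0//.
have -> : e^-1 = (e^-1 `^ p^-1) `^ p.
  by rewrite -powRrM mulVf ?gt_eqF// powRr1// invr_ge0 ltW.
by apply: ge0_ler_powR; rewrite ?nnegrE; exact: ltW.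
Unshelve. all: by end_near. Qed.

Lemma powR_integral_tail (al a : R) : 0 < al -> 0 < a ->
  (\int[leb]_(r in `[a, +oo[) (r `^ (- 1 - al))%:E = (a `^ (- al) / al)%:E)%E.
Proof.
move=> al0 a0.
pose F (r : R) := (- al^-1) * r `^ (- al).
have dF (x : R) : 0 < x -> is_derive x 1 F (x `^ (- 1 - al)).
  move=> x0; have h := @is_derive_powR (- al) x x0.
  have := @is_deriveZ _ _ _ (fun r : R => r `^ (- al)) (- al^-1) x 1 _ h.
  rewrite (_ : _ *: _ = x `^ (- 1 - al)) => [|//].
    by [].
  by rewrite /GRing.scale/= mulrA mulrNN mulVf ?gt_eqF// mul1r addrC.
rewrite (@ge0_continuous_FTC2y _ _ F a 0).
- by rewrite -EFinB; congr (_ %:E); rewrite /F sub0r mulNr opprK mulrC.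
- by move=> x _; exact: powR_ge0.
- apply: continuous_in_subspaceT => x; rewrite inE/= in_itv/= andbT => ax.
  by apply: continuous_powR; exact: lt_le_trans ax.
- rewrite -(mulr0 (- al^-1)); apply: cvgM; first exact: cvg_cst.
  exact: powR_cvg_pinfty.
- by move=> x ax; have := dF x (lt_trans a0 ax) => -[].
- apply: cvg_at_right_filter; apply: cvgM; first exact: cvg_cst.
  exact: continuous_powR.
- move=> x; rewrite in_itv/= andbT => ax.
  by have := dF x (lt_trans a0 ax) => -[_ <-]; rewrite derive1E.
Qed.

Lemma powR_integral_segment (al a b : R) : al < 2 -> 0 < a -> a < b ->
  (\int[leb]_(r in `[a, b]) (r `^ (1 - al))%:E <= (b `^ (2 - al) / (2 - al))%:E)%E.
Proof.
move=> al2 a0 ab.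
have al20 : 0 < 2 - al by rewrite subr_gt0.
pose F (r : R) := (2 - al)^-1 * r `^ (2 - al).
have dF (x : R) : 0 < x -> is_derive x 1 F (x `^ (1 - al)).
  move=> x0; have h := @is_derive_powR (2 - al) x x0.
  have := @is_deriveZ _ _ _ (fun r : R => r `^ (2 - al)) (2 - al)^-1 x 1 _ h.
  rewrite (_ : _ *: _ = x `^ (1 - al)) => [|//].
    by [].
  rewrite /GRing.scale/= mulrA mulVf ?gt_eqF// mul1r; congr (_ `^ _); lra.
have cF (x : R) : 0 < x -> {for x, continuous F}.
  by move=> x0; apply: cvgM; [exact: cvg_cst|exact: continuous_powR].
rewrite (@continuous_FTC2 _ _ F)//.
- rewrite -EFinB lee_fin /F mulrC gerBl.
  by rewrite mulr_ge0 ?powR_ge0// invr_ge0 ltW.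
- apply: continuous_in_subspaceT => x; rewrite inE/= in_itv/= => /andP[ax _].
  by apply: continuous_powR; exact: lt_le_trans ax.
- split.
  + move=> x; rewrite in_itv/= => /andP[ax _].
    by have := dF x (lt_trans a0 ax) => -[].
  + by apply: cvg_at_right_filter; exact: cF.
  + by apply: cvg_at_left_filter; apply: cF; exact: lt_trans ab.
- move=> x; rewrite in_itv/= => /andP[ax _].
  by have := dF x (lt_trans a0 ax) => -[_ <-]; rewrite derive1E.
Qed.

(** The radial integrand of the Lévy symbol, with [v] standing for the scalar product of [u] with a
    direction. [Kint] drops the jumps shorter than [a], [Kfull] keeps them all. *)
Definition kfun (al v r : R) : R := (1 - cos (r * v)) * r `^ (- 1 - al).

Definition Kint (al a v : R) : \bar R := (\int[leb]_(r in `[a, +oo[) (kfun al v r)%:E)%E.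

Definition Kfull (al v : R) : \bar R :=
  (\int[leb]_(r in `]0%R, +oo[) (kfun al v r)%:E)%E.

Lemma kfun_ge0 al v r : 0 <= kfun al v r.
Proof. by rewrite mulr_ge0 ?powR_ge0// onem_cos_ge0. Qed.

Lemma measurable_cos : measurable_fun (setT : set R) (@cos R).
Proof. by apply: continuous_measurable_fun; exact: continuous_cos. Qed.

Lemma measurable_sin : measurable_fun (setT : set R) (@sin R).
Proof. by apply: continuous_measurable_fun; exact: continuous_sin. Qed.

Lemma measurable_kfun d (T : measurableType d) (al : R) (v r : T -> R) :
  measurable_fun setT v -> measurable_fun setT r ->
  measurable_fun setT (fun w => kfun al (v w) (r w)).
Proof.
move=> mv mr; apply: measurable_funM.
  apply: measurable_funB => //; apply: (measurableT_comp measurable_cos).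
  exact: measurable_funM.
exact: (measurableT_comp (@measurable_powR R (- 1 - al))).
Qed.

Lemma measurable_kfun1 (al v : R) : measurable_fun (setT : set R) (kfun al v).
Proof. by apply: measurable_kfun => //; exact: measurable_id. Qed.

Lemma Kint_ge0 al a v : (0 <= Kint al a v)%E.
Proof. by apply: integral_ge0 => r _; rewrite lee_fin kfun_ge0. Qed.

Lemma Kfull_ge0 al v : (0 <= Kfull al v)%E.
Proof. by apply: integral_ge0 => r _; rewrite lee_fin kfun_ge0. Qed.

Lemma Kint_le_full al a v : 0 < a -> (Kint al a v <= Kfull al v)%E.
Proof.
move=> a0; apply: ge0_subset_integral => //.
- by apply/measurable_EFinP; apply: measurable_funTS; exact: measurable_kfun1.
- by move=> r _; rewrite lee_fin kfun_ge0.
- by move=> r /=; rewrite !in_itv/= !andbT; exact: lt_le_trans.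
Qed.

Lemma Kfull_cvg (al v : R) (a : R^nat) : (forall n, 0 < a n) ->
  nonincreasing_seq a -> a @ \oo --> 0 -> Kint al (a n) v @[n --> \oo] --> Kfull al v.
Proof.
move=> a0 na aoo; rewrite /Kfull.
have -> : (`]0%R, +oo[%classic : set R) = \bigcup_n `[a n, +oo[%classic.
  apply/seteqP; split => r /=; last first.
    by move=> [n _ /=]; rewrite !in_itv/= !andbT; exact: lt_le_trans.
  rewrite in_itv/= andbT => r0.
  have [N _ /(_ N (leqnn _)) h] := (cvgrPdist_lt _ _).1 aoo _ r0.
  exists N => //=; rewrite in_itv/= andbT.
  by move: h; rewrite /= sub0r normrN gtr0_norm// => /ltW.
apply: (@ge0_nondecreasing_set_cvg_integral _ _ _ (fun n => `[a n, +oo[%classic : set (measurableTypeR R)) (fun r => (kfun al v r)%:E) leb).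
- move=> m n mn; apply/subsetPset => r /=; rewrite !in_itv/= !andbT.
  by apply: le_trans; exact: na.
- by move=> n; exact: measurable_itv.
- by move=> n; apply/measurable_EFinP; apply: measurable_funTS; exact: measurable_kfun1.
- by move=> n r _; rewrite lee_fin kfun_ge0.
Qed.

(** Below [A] the quadratic bound on 1 - cos leaves r^(1-al), integrable at 0 since al < 2; above
    [A] the bound 2 leaves r^(-1-al), integrable at infinity. [A] stays free because it is used at
    two different scales. *)
Lemma Kfull_le (al v A : R) : 0 < al < 2 -> 0 < A ->
  (Kfull al v <= (v ^+ 2 * (A `^ (2 - al) / (2 - al)) + 2 * (A `^ (- al) / al))%:E)%E.
Proof.
move=> /andP[al0 al2] A0.
(* [n.+2] rather than [n.+1] keeps every [a n] strictly below [A]. *)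
pose a n : R := A / n.+2%:R.
have a0 n : 0 < a n by rewrite divr_gt0.
have na : nonincreasing_seq a.
  move=> m n mn; rewrite /a ler_pM2l// lef_pV2 ?posrE// ler_nat.
  by rewrite !ltnS.
have aoo : a @ \oo --> 0.
  rewrite /a -(mulr0 A); apply: cvgM; first exact: cvg_cst.
  apply/cvgrPdist_lt => e e0; near=> n.
  rewrite sub0r normrN gtr0_norm ?invr_gt0//; apply: (@le_lt_trans _ _ n.+1%:R^-1).
    by rewrite lef_pV2 ?posrE// ler_nat.
  by near: n; exact: (near_infty_natSinv_lt (PosNum e0)).
have aA n : a n < A by rewrite /a gtr_pMr// invf_lt1// ltr1n.
have h := @Kfull_cvg al v a a0 na aoo.
rewrite -(cvg_lim _ h)//; apply: lime_le; first by apply/cvg_ex; exists (Kfull al v).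
near=> n; rewrite /Kint.
have -> : (`[a n, +oo[%classic : set R) = `[a n, A] `|` `]A, +oo[.
  apply/seteqP; split => r /=; rewrite !in_itv/= !andbT.
    by move=> ar; have [rA|Ar] := leP r A; [left; rewrite ar|right].
  by move=> [/andP[]//|Ar]; rewrite ltW// (lt_trans (aA n)).
rewrite ge0_integral_setU//=; last 3 first.
- by apply/measurable_EFinP; apply: measurable_funTS; exact: measurable_kfun1.
- by move=> r _; rewrite lee_fin kfun_ge0.
- apply/disj_setPS => r /= []; rewrite !in_itv/= andbT => /andP[_ rA] Ar.
  by have := lt_le_trans Ar rA; rewrite ltxx.
rewrite EFinD; apply: leeD.
  apply: (@le_trans _ _ (\int[leb]_(r in `[a n, A]) ((v ^+ 2)%:E * (r `^ (1 - al))%:E))%E).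
    apply: ge0_le_integral => //.
    - by move=> r _; rewrite lee_fin kfun_ge0.
    - by apply/measurable_EFinP; apply: measurable_funTS; exact: measurable_kfun1.
    - apply/measurable_EFinP; apply: measurable_funTS; exact: measurable_funM.
    move=> r /=; rewrite in_itv/= => /andP[ar _].
    have r0 : 0 < r by apply: lt_le_trans ar.
    rewrite -EFinM lee_fin /kfun.
    have -> : 1 - al = 2 + (- 1 - al) by lra.
    rewrite (@powRD _ r 2 (- 1 - al)); last by rewrite (gt_eqF r0) implybT.
    rewrite (@powR_mulrn _ r 2) ?(ltW r0)// mulrA ler_wpM2r ?powR_ge0//.
    apply: (le_trans (cos_le1_sqr _)); rewrite exprMn.
    by have := mulr_ge0 (sqr_ge0 r) (sqr_ge0 v); lra.
  rewrite ge0_integralZl//; last 3 first.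
  - by apply/measurable_EFinP; apply: measurable_funTS; exact: measurable_powR.
  - by move=> r _; rewrite lee_fin powR_ge0.
  - by rewrite lee_fin sqr_ge0.
  rewrite [leRHS]EFinM; apply: lee_wpmul2l; first by rewrite lee_fin sqr_ge0.
  exact: powR_integral_segment.
apply: (@le_trans _ _ (\int[leb]_(r in `[A, +oo[) (2%:E * (r `^ (- 1 - al))%:E))%E); last first.
  rewrite ge0_integralZl//; last 2 first.
  - by apply/measurable_EFinP; apply: measurable_funTS; exact: measurable_powR.
  - by move=> r _; rewrite lee_fin powR_ge0.
  by rewrite powR_integral_tail// -EFinM.
apply: (@le_trans _ _ (\int[leb]_(r in `[A, +oo[) (kfun al v r)%:E)%E).
  apply: ge0_subset_integral => //.
  - by apply/measurable_EFinP; apply: measurable_funTS; exact: measurable_kfun1.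
  - by move=> r _; rewrite lee_fin kfun_ge0.
  - by move=> r /=; rewrite !in_itv/= !andbT; exact: ltW.
apply: ge0_le_integral => //.
- by move=> r _; rewrite lee_fin kfun_ge0.
- by apply/measurable_EFinP; apply: measurable_funTS; exact: measurable_kfun1.
- apply/measurable_EFinP; apply: measurable_funTS; exact: measurable_funM.
- move=> r _; rewrite -EFinM lee_fin /kfun ler_wpM2r ?powR_ge0//.
  exact: onem_cos_le2.
Unshelve. all: by end_near. Qed.

(** The radial part of the Lévy measure restricted to jumps of length at least [a], normalised to
    mass 1. *)
Definition pareto_pdf (al a r : R) : R :=
  \1_(`[a, +oo[%classic : set R) r * (al * a `^ al * r `^ (- 1 - al)).

Lemma pareto_pdf_ge0 (al a r : R) : 0 < al -> 0 <= pareto_pdf al a r.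
Proof. by move=> al0; rewrite !mulr_ge0 ?powR_ge0// ltW. Qed.

Lemma measurable_pareto_pdf (al a : R) : measurable_fun setT (pareto_pdf al a).
Proof.
apply: measurable_funM; first exact: measurable_indic.
by apply: measurable_funM => //; exact: measurable_powR.
Qed.

Lemma pareto_exists (al a : R) : 0 < al -> 0 < a ->
  exists D : probability (measurableTypeR R) R, has_density leb D (pareto_pdf al a).
Proof.
move=> al0 a0.
have p0 r := @pareto_pdf_ge0 al a r al0.
have p1 : (\int[leb]_r (pareto_pdf al a r)%:E = 1)%E.
  transitivity (\int[leb]_(r in `[a, +oo[) ((al * a `^ al)%:E * (r `^ (- 1 - al))%:E))%E.
    rewrite [RHS]integral_mkcond; apply: eq_integral => r _.
    rewrite patchE /pareto_pdf indicE; case: (r \in _) => /=; last by rewrite mul0r.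
    by rewrite mul1r EFinM.
  rewrite ge0_integralZl//; last 3 first.
  - by apply/measurable_EFinP; apply: measurable_funTS; exact: measurable_powR.
  - by move=> r _; rewrite lee_fin powR_ge0.
  - by rewrite lee_fin mulr_ge0 ?powR_ge0// ltW.
  rewrite powR_integral_tail// -EFinM powRN; congr (_ %:E); field.
  by rewrite gt_eqF//= gt_eqF// powR_gt0.
exists (@density_prob R _ (measurableTypeR R) leb (pareto_pdf al a) (measurable_pareto_pdf al a) p0 p1).
by split => //; exact: measurable_pareto_pdf.
Qed.

Lemma pareto_cos (al a v : R) (D : probability (measurableTypeR R) R) : 0 < al -> 0 < a ->
  has_density leb D (pareto_pdf al a) ->
  ((1 - Ex D (fun r : measurableTypeR R => cos (r * v)))%:E = (al * a `^ al)%:E * Kint al a v)%E.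
Proof.
move=> al0 a0 hD.
have mc : measurable_fun (setT : set (measurableTypeR R)) (fun r : measurableTypeR R => cos (r * v)).
  apply: (measurableT_comp measurable_cos).
  exact: (@measurable_funM _ (measurableTypeR R) _ _ id (cst v)).
have bc : @bmf R _ (measurableTypeR R) (fun r => cos (r * v)).
  by split => //; exists 1 => r; exact: cos_max.
rewrite -{1}(Ex_cst D 1) -ExB//.
have b1c : @bmf R _ (measurableTypeR R) (fun r => 1 - cos (r * v)) by exact: bmfB.
rewrite (Ex_density hD b1c).
have i1 := density_integrable hD b1c.
rewrite /Rintegral fineK; last exact: integrable_fin_num i1.
rewrite -ge0_integralZl//; last 3 first.
- by apply/measurable_EFinP; apply: measurable_funTS; exact: measurable_kfun1.
- by move=> r _; rewrite lee_fin kfun_ge0.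
- by rewrite lee_fin mulr_ge0 ?powR_ge0// ltW.
rewrite [RHS]integral_mkcond; apply: eq_integral => r _.
rewrite patchE /pareto_pdf indicE; case: (r \in _) => /=; last by rewrite mul0r mulr0.
by rewrite mul1r /kfun -EFinM; congr (_ %:E); ring.
Qed.

(* The Pareto law contains a uniform piece on [b, 2b] for every b >= a. *)
Lemma pareto_uniform (al a b : R) (b2 : b < 2 * b) (D : probability (measurableTypeR R) R) (f : R -> R) (M k : R) :
  0 < al -> 0 < a -> a <= b -> has_density leb D (pareto_pdf al a) ->
  @bmf R _ (measurableTypeR R) f -> (forall r, `|f r| <= M) ->
  k = al * a `^ al * (2 * b) `^ (- 1 - al) * b ->
  `|Ex D f - k * Ex (uniform_prob b2) f| <= M * (1 - k).
Proof.
move=> al0 a0 ab hD bf fM kE.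
apply: (Ex_density_sub hD (has_density_uniform b2)) => // r.
rewrite /uniform_pdf; case: ifP => [/andP[br rb]|_]; last by rewrite mulr0 pareto_pdf_ge0.
have b0 : 0 < b by exact: lt_le_trans ab.
have r0 : 0 < r by exact: lt_le_trans br.
rewrite /pareto_pdf indicE mem_set/= ?in_itv/= ?andbT ?(le_trans ab)// mul1r.
rewrite (_ : 2 * b - b = b); last by ring.
rewrite kE mulfK ?gt_eqF// ler_wpM2l ?mulr_ge0 ?powR_ge0 ?(ltW al0)//.
rewrite -opprD !powRN lef_pV2 ?posrE ?powR_gt0 ?mulr_gt0//.
have u0 : 0 <= 1 + al by lra.
by apply: ge0_ler_powR => //; rewrite nnegrE; lra.
Qed.

End power_integrals.

(** * The jumps of a stable process *)

Lemma mnormalizeE (R : realType) d (T : measurableType d)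
    (mu : {finite_measure set T -> \bar R}) (P : probability T R) A : 0 < fine (mu setT) ->
  mnormalize mu P A = ((fine (mu setT))^-1%:E * mu A)%E.
Proof.
move=> h; rewrite muleC /mnormalize; case: ifPn => [/orP[]/eqP h2|_]; last by [].
  by move: h; rewrite (h2 : mu setT = 0%E) ltxx.
by move: h; rewrite (h2 : mu setT = +oo%E) ltxx.
Qed.

Section jump_law.
Context {R : realType} {d : nat}.
Local Notation V := 'rV[R]_d.
Local Notation Rd := (@Rd R d).
Local Notation leb := (@lebesgue_measure R).
Local Notation RR := (measurableTypeR R).

(** The square of the left side is at most |h|^2 - s^2, which completing the square bounds by (|h| -
    s^2/(2|h|))^2. *)
Lemma enorm_project (h xs : V) : 0 < enorm h -> enorm xs <= 1 ->
  enorm (h - dotv h xs *: xs) <= enorm h - dotv h xs ^+ 2 / (2 * enorm h).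
Proof.
move=> hp xs1; set s := dotv h xs.
have s0 : 0 <= s ^+ 2 by exact: sqr_ge0.
have hs : s ^+ 2 <= enorm h ^+ 2.
  rewrite -[leLHS]ger0_norm// normrX ler_pXn2r ?nnegrE ?enorm_ge0//.
  by rewrite (le_trans (dotv_le _ _))// ler_piMr ?enorm_ge0.
have h2 : enorm (h - s *: xs) ^+ 2 <= (enorm h - s ^+ 2 / (2 * enorm h)) ^+ 2.
  rewrite sqr_enorm dotvBl !dotvBr !dotvZl !dotvZr -!sqr_enorm (dotvC xs h) -/s.
  have x1 : enorm xs ^+ 2 <= 1 by rewrite expr_le1// enorm_ge0.
  apply: (@le_trans _ _ (enorm h ^+ 2 - s ^+ 2)).
    have := ler_wpM2l s0 x1; rewrite mulr1 !expr2; set P := enorm xs * enorm xs.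
    rewrite (_ : s * (s * P) = s * s * P); first lra.
    by rewrite mulrA.
  rewrite sqrrB.
  rewrite (_ : enorm h * _ *+ 2 = s ^+ 2); last by rewrite -mulr_natr; field; rewrite gt_eqF.
  by rewrite lerDl sqr_ge0.
have r0 : 0 <= enorm h - s ^+ 2 / (2 * enorm h).
  rewrite subr_ge0 ler_pdivrMr ?mulr_gt0//; rewrite !expr2 in hs *.
  by have := mulr_ge0 (ltW hp) (ltW hp); lra.
by rewrite -(@ler_pXn2r _ 2)// nnegrE enorm_ge0.
Qed.

Variables (mu : {finite_measure set Rd -> \bar R}).
Hypothesis symm : spherical_symmetric mu.
Let c : R := fine (mu setT).
Hypothesis c0 : 0 < c.

(** As [mu] charges only the sphere, sending all other points to 0 changes no integral, and it makes
    the direction bounded everywhere. *)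
Definition ontosphere (x : V) : V := \1_(@sphere R d) (x : Rd) *: x.

Lemma enorm_ontosphere x : enorm (ontosphere x) <= 1.
Proof.
rewrite /ontosphere indicE; case: (boolP (_ \in _)) => h /=.
  by rewrite scale1r; move: h; rewrite inE => ->.
by rewrite scale0r enorm0.
Qed.

Lemma ontosphereN x : ontosphere (- x) = - ontosphere x.
Proof.
rewrite /ontosphere scalerN !indicE; congr (- (_ %:R *: _)); congr nat_of_bool.
by apply/idP/idP; rewrite !inE /sphere /= enormN.
Qed.

Lemma measurable_sphere : measurable (@sphere R d).
Proof.
rewrite (_ : sphere = (@enorm R d) @^-1` [set 1])//.
by rewrite -[X in measurable X]setTI; apply: meas_enorm.
Qed.

Lemma measurable_ontosphere : measurable_fun (setT : set Rd) (ontosphere : Rd -> Rd).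
Proof.
apply: mvZr; last exact: measurable_id.
exact: measurable_indic measurable_sphere.
Qed.

(** The Dirac mass is the default that [mnormalize] takes for a total mass 0 or infinite; [c0]
    excludes both cases. *)
Definition nmu : probability Rd R := mnormalize mu (@dirac _ Rd (0 : V) R).

Lemma nmuE (A : set Rd) : nmu A = (c^-1%:E * mu A)%E.
Proof.
exact: mnormalizeE.
Qed.

Lemma integral_nmu (f : Rd -> \bar R) : measurable_fun setT f -> (forall x, 0 <= f x)%E ->
  (\int[nmu]_x f x = c^-1%:E * \int[mu]_x f x)%E.
Proof.
move=> mf f0; have ci : 0 <= c^-1 by rewrite invr_ge0 ltW.
rewrite -(@ge0_integral_mscale _ _ _ mu setT measurableT (NngNum ci) f)//.
by apply: eq_measure_integral => A mA _; first [exact: nmuE | exact: esym (nmuE A)].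
Qed.

Let mN : measurable_fun (setT : set Rd) (fun x : Rd => (- (x : V)) : Rd).
Proof. by apply: mvN; exact: measurable_id. Qed.

Lemma Ex_nmuN (f : V -> R) : @bmf R _ Rd f -> Ex nmu (fun x : Rd => f (- (x : V))) = Ex nmu f.
Proof.
move=> bf.
have -> : Ex nmu f = Ex (law_of nmu (pack_mfun mN)) f.
  rewrite /Ex; congr fine; apply: eq_measure_integral => A mA _.
  transitivity (nmu ((fun x : Rd => (- (x : V)) : Rd) @^-1` A)); last by [].
  transitivity (c^-1%:E * mu A)%E; first exact: nmuE.
  transitivity (c^-1%:E * mu [set (- (x : V))%R | x in A])%E.
    by congr (_ * _)%E; exact: esym (symm.2 A mA).
  transitivity (c^-1%:E * mu ((fun x : Rd => (- (x : V))%R : Rd) @^-1` A))%E; last exact: esym (nmuE _).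
  congr (_ * mu _)%E.
  apply/seteqP; split => x /=; first by move=> [y Ay <-]; rewrite opprK.
  by move=> Ax; exists (- x) => //; rewrite opprK.
by rewrite Ex_law.
Qed.

Variable (al : R).
Hypothesis al12 : 0 < al < 2.
Let al0 : 0 < al. Proof. by case/andP: al12. Qed.

(** The symbol of the compound Poisson process formed by the jumps of length at least [a]. *)
Definition Psi_trunc (a : R) (u : V) : \bar R :=
  (\int[mu]_x Kint al a (dotv u (ontosphere x)))%E.

Let meas_dot (u : V) : measurable_fun (setT : set Rd) (fun x : Rd => dotv u (ontosphere x)).
Proof. exact: measurableT_comp (meas_dotv u) measurable_ontosphere. Qed.

Let meas_K (I : set R) (u : V) : measurable (I : set RR) ->
  measurable_fun (setT : set Rd)
    (fun x : Rd => \int[leb]_(r in I) (kfun al (dotv u (ontosphere x)) r)%:E)%E.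
Proof.
move=> mI; under eq_fun do rewrite integral_mkcond.
apply: (@measurable_fun_fubini_tonelli_F _ _ Rd RR R leb
  (fun z => ((fun r => (kfun al (dotv u (ontosphere z.1)) r)%:E) \_ I) z.2)) => /=; last first.
  by move=> z; rewrite patchE; case: ifP => // _; rewrite lee_fin kfun_ge0.
rewrite (_ : (fun _ => _) = (fun z : Rd * RR => (kfun al (dotv u (ontosphere z.1)) z.2 * \1_I z.2)%:E)); last first.
  apply/funext => z; rewrite patchE indicE.
  by case: (z.2 \in I); rewrite ?mulr1 ?mulr0.
apply/measurable_EFinP; apply: measurable_funM.
  apply: measurable_kfun; first exact: (measurableT_comp (meas_dot u)).
  exact: measurable_snd.
exact: (measurableT_comp (measurable_indic mI)).
Qed.

Lemma measurable_Kint (a : R) (u : V) :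
  measurable_fun (setT : set Rd) (fun x : Rd => Kint al a (dotv u (ontosphere x))).
Proof. exact: meas_K. Qed.

Lemma measurable_Kfull (u : V) :
  measurable_fun (setT : set Rd) (fun x : Rd => Kfull al (dotv u (ontosphere x))).
Proof. exact: meas_K. Qed.

Lemma stable_symbol_ontosphere (u : V) :
  stable_symbol al mu u = (\int[mu]_x Kfull al (dotv u (ontosphere x)))%E.
Proof.
have mS : measurable (~` @sphere R d) by apply: measurableC; exact: measurable_sphere.
have md : measurable_fun (setT : set Rd)
    (fun x : Rd => \int[leb]_(r in `]0%R, +oo[) (kfun al (dotv u x) r)%:E)%E.
  under eq_fun do rewrite integral_mkcond.
  apply: (@measurable_fun_fubini_tonelli_F _ _ Rd RR R leb
    (fun z => ((fun r => (kfun al (dotv u z.1) r)%:E) \_ `]0%R, +oo[) z.2)) => /=; last first.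
    by move=> z; rewrite patchE; case: ifP => // _; rewrite lee_fin kfun_ge0.
  rewrite (_ : (fun _ => _) = (fun z : Rd * RR => (kfun al (dotv u z.1) z.2 * \1_(`]0%R, +oo[%classic : set RR) z.2)%:E)); last first.
    apply/funext => z; rewrite patchE indicE.
    by case: (z.2 \in _); rewrite ?mulr1 ?mulr0.
  apply/measurable_EFinP; apply: measurable_funM.
    apply: measurable_kfun; last exact: measurable_snd.
    exact: (measurableT_comp (meas_dotv u) measurable_fst).
  exact: (measurableT_comp (@measurable_indic _ RR R setT _ (measurable_itv _))).
apply: ge0_ae_eq_integral => //.
- exact: measurable_Kfull.
- by move=> x _; apply: integral_ge0 => r _; rewrite lee_fin kfun_ge0.
- by move=> x _; exact: Kfull_ge0.
exists (~` sphere); split => //; first exact: symm.1.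
move=> x /= h Sx; apply: h => _.
by rewrite /Kfull /ontosphere indicE mem_set//= scale1r.
Qed.

Lemma Psi_trunc_le (a : R) (u : V) : 0 < a -> (Psi_trunc a u <= stable_symbol al mu u)%E.
Proof.
move=> a0; rewrite stable_symbol_ontosphere; apply: ge0_le_integral => //.
- by move=> x _; exact: Kint_ge0.
- exact: measurable_Kint.
- exact: measurable_Kfull.
- by move=> x _; exact: Kint_le_full.
Qed.

Lemma Psi_trunc_ge0 (a : R) (u : V) : (0 <= Psi_trunc a u)%E.
Proof. by apply: integral_ge0 => x _; exact: Kint_ge0. Qed.

Lemma Psi_trunc_cvg (u : V) (a : R^nat) : (forall n, 0 < a n) ->
  nonincreasing_seq a -> a @ \oo --> 0 ->
  Psi_trunc (a n) u @[n --> \oo] --> stable_symbol al mu u.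
Proof.
move=> a0 na aoo; rewrite stable_symbol_ontosphere.
rewrite (_ : (fun x => Kfull al _) = (fun x : Rd => limn (fun n => Kint al (a n) (dotv u (ontosphere x))))); last first.
  apply/funext => x; apply/esym/cvg_lim => //.
  exact: (@Kfull_cvg _ al (dotv u (ontosphere x)) a a0 na aoo).
apply: cvg_monotone_convergence => //.
- by move=> n; exact: measurable_Kint.
- by move=> n x _; exact: Kint_ge0.
- move=> x _ m n mn; apply: ge0_subset_integral => //.
  + by apply/measurable_EFinP; apply: measurable_funTS; exact: measurable_kfun1.
  + by move=> r _; rewrite lee_fin kfun_ge0.
  + by move=> r /=; rewrite !in_itv/= !andbT; apply: le_trans; exact: na.
Qed.

Lemma symbol_le_sqr (u : V) (A : R) : 0 < A ->
  (stable_symbol al mu u <=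
   ((A `^ (2 - al) / (2 - al)) * (c * Ex nmu (fun x : Rd => dotv u (ontosphere x) ^+ 2)) +
     2 * c * (A `^ (- al) / al))%:E)%E.
Proof.
move=> A0; rewrite stable_symbol_ontosphere.
have al20 : 0 < 2 - al by case/andP: al12; rewrite subr_gt0.
have bd : @bmf R _ Rd (fun x : Rd => dotv u (ontosphere x) ^+ 2).
  split; first by apply: measurable_funX; exact: meas_dot.
  exists (enorm u ^+ 2) => x; rewrite normrX ler_pXn2r ?nnegrE ?enorm_ge0//.
  by rewrite (le_trans (dotv_le _ _))// ler_piMr ?enorm_ge0// enorm_ontosphere.
set k1 := A `^ (2 - al) / (2 - al); set k2 := A `^ (- al) / al.
have k10 : 0 <= k1 by rewrite divr_ge0 ?powR_ge0// ltW.
have k20 : 0 <= k2 by rewrite divr_ge0 ?powR_ge0// ltW.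
have mf : measurable_fun (setT : set Rd) (fun x : Rd => (dotv u (ontosphere x) ^+ 2 * k1 + 2 * k2)%:E).
  apply/measurable_EFinP; apply: measurable_funD => //; apply: measurable_funM => //.
  exact: bmf_meas bd.
apply: (@le_trans _ _ (\int[mu]_x (dotv u (ontosphere x) ^+ 2 * k1 + 2 * k2)%:E)%E).
  apply: ge0_le_integral => //.
  - by move=> x _; exact: Kfull_ge0.
  - exact: measurable_Kfull.
  - by move=> x _; apply: Kfull_le.
have f0 (x : Rd) : (0 <= (dotv u (ontosphere x) ^+ 2 * k1 + 2 * k2)%:E)%E.
  by rewrite lee_fin; apply: addr_ge0; apply: mulr_ge0 => //; exact: sqr_ge0.
have e := integral_nmu mf f0.
have b2 : @bmf R _ Rd (fun x : Rd => dotv u (ontosphere x) ^+ 2 * k1 + 2 * k2).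
  by apply: bmfD => //; apply: bmfM.
rewrite Ex_fin// ExD//in e; last by apply: bmfM.
rewrite Ex_cst in e.
have e1 : Ex nmu (fun x : Rd => dotv u (ontosphere x) ^+ 2 * k1) = k1 * Ex nmu (fun x : Rd => dotv u (ontosphere x) ^+ 2).
  by rewrite -ExZ//; apply: eq_Ex => x; rewrite mulrC.
rewrite e1 in e.
have cc : (c%:E * c^-1%:E = 1)%E by rewrite -EFinM divff// gt_eqF.
rewrite -[X in (X <= _)%E]mul1e -cc -muleA -e -EFinM lee_fin.
by rewrite le_eqVlt; apply/orP; left; apply/eqP; ring.
Qed.

(** [symbol_le_sqr] at the scale A = 1/|u|, where both of its terms have the order |u|^al. *)
Lemma symbol_le_pow : exists C : R, 0 < C /\
  forall u : V, (stable_symbol al mu u <= (C * enorm u `^ al)%:E)%E.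
Proof.
have /andP[_ al2] := al12.
have al20 : 0 < 2 - al by rewrite subr_gt0.
exists (c * ((2 - al)^-1 + 2 / al)); split.
  by rewrite mulr_gt0// addr_gt0// ?invr_gt0// divr_gt0.
move=> u; have := enorm_ge0 u; rewrite le_eqVlt => /orP[/eqP u0|u0].
  rewrite stable_symbol_ontosphere -u0 powR0 ?gt_eqF// mulr0.
  rewrite (eq_integral (fun=> 0%E)); first by rewrite integral0.
  move=> x _; have -> : dotv u (ontosphere x) = 0.
    by apply/eqP; rewrite -normr_le0 (le_trans (dotv_le _ _))// -u0 mul0r.
  rewrite /Kfull (eq_integral (fun=> 0%E)); first by rewrite integral0.
  by move=> r _; rewrite /kfun mulr0 cos0 subrr mul0r.
have ui : 0 < (enorm u)^-1 by rewrite invr_gt0.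
apply: (le_trans (symbol_le_sqr u ui)); rewrite lee_fin.
have bd : @bmf R _ Rd (fun x : Rd => dotv u (ontosphere x) ^+ 2).
  split; first by apply: measurable_funX; exact: meas_dot.
  exists (enorm u ^+ 2) => x; rewrite normrX ler_pXn2r ?nnegrE ?enorm_ge0//.
  by rewrite (le_trans (dotv_le _ _))// ler_piMr ?enorm_ge0// enorm_ontosphere.
have h : Ex nmu (fun x : Rd => dotv u (ontosphere x) ^+ 2) <= enorm u ^+ 2.
  apply: Ex_le_cst => // x; rewrite -[leLHS]ger0_norm ?sqr_ge0// normrX.
  rewrite ler_pXn2r ?nnegrE ?enorm_ge0//.
  by rewrite (le_trans (dotv_le _ _))// ler_piMr ?enorm_ge0// enorm_ontosphere.
have inv p : (enorm u)^-1 `^ p = enorm u `^ (- p).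
  by rewrite -powR_inv1 ?enorm_ge0// -powRrM mulN1r.
rewrite !inv opprK opprB.
have -> : enorm u `^ (al - 2) = enorm u `^ al / enorm u ^+ 2.
  by rewrite powRB ?(gt_eqF u0) ?implybT// powR_mulrn// ltW.
set p := enorm u `^ al.
have p0 : 0 <= p by exact: powR_ge0.
apply: (@le_trans _ _ (p / enorm u ^+ 2 / (2 - al) * (c * enorm u ^+ 2) + 2 * c * (p / al))).
  rewrite lerD2r ler_wpM2l// ?ler_wpM2l// ?(ltW c0)//.
  by rewrite !mulr_ge0// ?invr_ge0 ?sqr_ge0// ltW.
rewrite le_eqVlt; apply/orP; left; apply/eqP; field.
by rewrite !gt_eqF.
Qed.

(** A quantitative form of the fact that the directions of [mu] span the space. For a unit vector,
    [A] is chosen so that the contribution of the long jumps to the upper bound is C/2; the other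
    half of the lower bound must come from the second moment. The minimum with 1 is a convenience
    for the choice of scale in [jump_smoothing]. *)
Lemma sphere_nondegenerate (C : R) : 0 < C ->
  (forall u : V, ((C * enorm u `^ al)%:E <= stable_symbol al mu u)%E) ->
  exists g : R, 0 < g <= 1 /\
   forall h : V, g * enorm h ^+ 2 <= Ex nmu (fun x : Rd => dotv h (ontosphere x) ^+ 2).
Proof.
move=> C0 HC; have /andP[_ al2] := al12.
have al20 : 0 < 2 - al by rewrite subr_gt0.
pose A := (C * al / (4 * c)) `^ (- al^-1).
have q0 : 0 < C * al / (4 * c) by rewrite divr_gt0 ?mulr_gt0.
have A0 : 0 < A by exact: powR_gt0.
have hA : 2 * c * (A `^ (- al) / al) = C / 2.
  rewrite /A -powRrM mulrNN mulVf ?gt_eqF// powRr1 ?ltW//.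
  by field; rewrite !gt_eqF.
set k1 := A `^ (2 - al) / (2 - al).
have k10 : 0 < k1 by rewrite divr_gt0 ?powR_gt0.
pose g0 := C / (2 * k1 * c).
have g00 : 0 < g0 by apply: divr_gt0 => //; apply: mulr_gt0 => //; apply: mulr_gt0.
pose g := Num.min g0 1.
have gg0 : g <= g0 by rewrite /g ge_min lexx.
exists g; split; first by rewrite lt_min g00 ltr01 ge_min lexx orbT.
move=> h; have := enorm_ge0 h; rewrite le_eqVlt => /orP[/eqP h0|h0].
  rewrite -h0 expr0n mulr0; apply: Ex_ge0 => x; exact: sqr_ge0.
have h1 : enorm ((enorm h)^-1 *: h) = 1.
  by rewrite enormZ gtr0_norm ?invr_gt0// mulVf// gt_eqF.
have := le_trans (HC ((enorm h)^-1 *: h)) (symbol_le_sqr _ A0).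
rewrite h1 powR1 mulr1 hA lee_fin -/k1.
rewrite (@eq_Ex _ _ _ _ _ (fun x : Rd => (enorm h ^-2) * (dotv h (ontosphere x) ^+ 2))); last first.
  by move=> x; rewrite dotvZl exprMn exprVn.
have bd : @bmf R _ Rd (fun x : Rd => dotv h (ontosphere x) ^+ 2).
  split; first by apply: measurable_funX; exact: meas_dot.
  exists (enorm h ^+ 2) => x; rewrite normrX ler_pXn2r ?nnegrE ?enorm_ge0//.
  by rewrite (le_trans (dotv_le _ _))// ler_piMr ?enorm_ge0// enorm_ontosphere.
rewrite ExZ//; set E := Ex _ _ => H.
have H2 : C / 2 <= k1 * (c * (enorm h ^- 2 * E)) by lra.
apply: (@le_trans _ _ (g0 * enorm h ^+ 2)).
  by rewrite ler_wpM2r// sqr_ge0.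
have hh : 0 < enorm h ^+ 2 by rewrite exprn_gt0.
have kc : 0 < 2 * k1 * c by apply: mulr_gt0 => //; apply: mulr_gt0.
rewrite -ler_pdivlMr// /g0 ler_pdivrMr//.
rewrite (_ : E / _ * _ = 2 * (k1 * (c * (enorm h ^- 2 * E)))); first lra.
by ring.
Qed.

Definition jump_law (D : probability RR R) : probability Rd R :=
  law_of (pprod nmu D) (pack_mfun (mvZr (T := (Rd * RR)%type) (c := snd)
    measurable_snd (measurableT_comp measurable_ontosphere measurable_fst))).

Lemma Ex_jump D (f : V -> R) : @bmf R _ Rd f ->
  Ex (jump_law D) f = Ex nmu (fun x : Rd => Ex D (fun r => f (r *: ontosphere x))) /\
  @bmf R _ Rd (fun x : Rd => Ex D (fun r => f (r *: ontosphere x))).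
Proof.
move=> bf; rewrite /jump_law Ex_law//=.
have bg : @bmf R _ (Rd * RR)%type (fun z => f (z.2 *: ontosphere z.1)).
  apply: (bmf_comp (T' := Rd) bf); apply: mvZr; first exact: measurable_snd.
  exact: (measurableT_comp measurable_ontosphere measurable_fst).
by split; [rewrite Ex_prod1|exact: (bmf_Ex1 D bg)].
Qed.

Variables (a : R) (D : probability RR R).
Hypotheses (a0 : 0 < a) (hD : has_density leb D (pareto_pdf al a)).

Let bsin (u : V) : @bmf R _ Rd (fun x => sin (dotv u x)).
Proof.
split; first exact: (measurableT_comp (@measurable_sin R) (meas_dotv u)).
by exists 1 => x; exact: sin_max.
Qed.

Let bcos (u : V) : @bmf R _ Rd (fun x => cos (dotv u x)).
Proof.
split; first exact: (measurableT_comp (@measurable_cos R) (meas_dotv u)).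
by exists 1 => x; exact: cos_max.
Qed.

Lemma jump_sin (u : V) : Ex (jump_law D) (fun x => sin (dotv u x)) = 0.
Proof.
have [-> bf] := Ex_jump D (bsin u).
set f := (fun x : Rd => _) in bf *.
have h : Ex nmu (fun x : Rd => f (- (x : V))) = - Ex nmu f.
  rewrite -ExN//; apply: eq_Ex => x; rewrite /f.
  rewrite -ExN; last first.
    apply: (bmf_comp (T' := Rd) (bsin u)); apply: mvZr => //; exact: measurable_id.
  by apply: eq_Ex => r; rewrite ontosphereN scalerN dotvNr sinN.
have h2 := Ex_nmuN bf; rewrite h in h2.
by apply/eqP; move/eqP : h2; rewrite eqNr.
Qed.

(** The factor is the inverse of the Lévy mass c a^(-al) / al of the jumps of length at least [a].
    If it equals the time step, one jump per step has exactly the right truncated symbol. *)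
Lemma jump_cos (u : V) :
  ((1 - Ex (jump_law D) (fun x => cos (dotv u x)))%:E = (al * a `^ al / c)%:E * Psi_trunc a u)%E.
Proof.
have [-> bf] := Ex_jump D (bcos u).
have e x : Ex D (fun r => cos (dotv u (r *: ontosphere x))) =
   Ex D (fun r : RR => cos (r * dotv u (ontosphere x))).
  by apply: eq_Ex => r; rewrite dotvZr.
rewrite -{1}(Ex_cst nmu 1) -ExB// -Ex_fin; last exact: bmfB.
rewrite (eq_integral (fun x : Rd => (al * a `^ al)%:E * Kint al a (dotv u (ontosphere x)))%E); last first.
  by move=> x _; rewrite e (pareto_cos _ al0 a0 hD).
have aa : 0 <= al * a `^ al by rewrite mulr_ge0 ?powR_ge0// ltW.
rewrite ge0_integralZl//; [|exact: measurable_Kint|by move=> x _; exact: Kint_ge0].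
rewrite integral_nmu; [|exact: measurable_Kint|by move=> x; exact: Kint_ge0].
by rewrite muleA -EFinM.
Qed.

(** A coupling of the jumps from [x] and from y = x + h. With weight [k] the jump length is uniform
    on [A, 2A], and there the jump from [x] can be lengthened by s = <h, xi>: the distance vector
    becomes h - s xi, shorter by s^2/(2|h|), while the change of length costs 4|s|/A since |G| <= 1.
    Averaging over xi turns s^2 into at least g|h|^2. The weight [k] is of order (a/A)^al, that is
    (a l)^al. *)
Lemma jump_smoothing (g : R) : 0 < g <= 1 ->
  (forall h : V, g * enorm h ^+ 2 <= Ex nmu (fun x : Rd => dotv h (ontosphere x) ^+ 2)) ->
  forall (l : R) (G : V -> R), 0 < l <= a^-1 -> lip l G -> (forall x, `|G x| <= 1) ->
  lip (l - (al * 2 `^ (- 1 - al) * (g / 16) `^ al * (g / 4)) * a `^ al * l `^ (1 + al))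
    (fun x => Ex (jump_law D) (fun y => G (x + y))).
Proof.
move=> /andP[g0 g1] Hg l G /andP[l0 la] lG G1 y x.
set h := y - x.
have [h0|hn] := eqVneq (enorm h) 0.
  have -> : y = x.
    apply/eqP; rewrite -subr_eq0; apply/eqP; apply/rowP => i; rewrite [RHS]mxE.
    by apply/eqP; rewrite -normr_le0 -h0; exact: (coord_le h i).
  by rewrite subrr normr0 h0 mulr0.
have hp : 0 < enorm h by rewrite lt_neqAle eq_sym hn enorm_ge0.
have bG := lip_bmf lG G1.
have bGs z : @bmf R _ Rd (fun y => G (z + y)) by exact: bmf_shift.
rewrite -ExB//.
have bdd : @bmf R _ Rd (fun z => G (y + z) - G (x + z)) by exact: bmfB.
have [-> bF] := Ex_jump D bdd.
apply: (le_trans (Ex_abs _ bF)).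
(* With this [A] the gain k l g |h| / 2 is twice the cost 4 k |h| / A, which leaves the net decrease
   k l g / 4. *)
pose A := 16 / (g * l).
have A0 : 0 < A by rewrite divr_gt0// mulr_gt0.
(* The uniform piece must lie in the support of the Pareto law; this is where l <= 1/a enters. *)
have aA : a <= A.
  have h1 : a * l <= 1 by rewrite -ler_pdivlMl// mulr1.
  rewrite /A ler_pdivlMr ?mulr_gt0//.
  have al0' : 0 <= a * l by rewrite mulr_ge0// ltW.
  have : a * (g * l) <= 1 * (a * l) by rewrite mulrCA ler_wpM2r.
  lra.
have A2 : A < 2 * A by lra.
set k := al * a `^ al * (2 * A) `^ (- 1 - al) * A.
have k0 : 0 < k.
  apply: mulr_gt0 => //; apply: mulr_gt0; last by rewrite powR_gt0// mulr_gt0.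
  by apply: mulr_gt0 => //; exact: powR_gt0.
pose s (xi : Rd) := dotv h (ontosphere xi).
have bs : @bmf R _ Rd s.
  split; first exact: meas_dot.
  by exists (enorm h) => xi; rewrite (le_trans (dotv_le _ _))// ler_piMr ?enorm_ge0// enorm_ontosphere.
have bs2 : @bmf R _ Rd (fun xi => s xi ^+ 2).
  by under eq_fun do rewrite expr2; exact: bmfM.
have s_le xi : `|s xi| <= enorm h.
  by rewrite (le_trans (dotv_le _ _))// ler_piMr ?enorm_ge0// enorm_ontosphere.
have key (xi : Rd) : `|Ex D (fun r => G (y + r *: ontosphere xi) - G (x + r *: ontosphere xi))| <=
   l * enorm h * (1 - k) + k * (l * (enorm h - s xi ^+ 2 / (2 * enorm h)) + 4 * enorm h / A).
  set xs := ontosphere xi; set f := (fun r : RR => _).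
  have mr (c' : R) : measurable_fun (setT : set RR) (fun r : RR => ((r + c') *: xs) : Rd).
    apply: mvZr => //; exact: (@measurable_funD _ RR _ _ id (cst c')).
  have br (z : V) (c' : R) : @bmf R _ RR (fun r : RR => G (z + (r + c') *: xs)).
    by apply: (bmf_comp (T' := Rd) (bGs z)); exact: mr.
  have br0 (z : V) : @bmf R _ RR (fun r : RR => G (z + r *: xs)).
    by have := br z 0; under eq_fun do rewrite addr0.
  have bf : @bmf R _ RR f by exact: bmfB.
  have fl (r : R) : `|f r| <= l * enorm h.
    by apply: (le_trans (lG _ _)); rewrite opprD addrACA subrr addr0.
  have := pareto_uniform A2 al0 a0 aA hD bf fl (erefl k).
  set U := Ex (uniform_prob A2) f => H.
  suff HU : `|U| <= l * (enorm h - s xi ^+ 2 / (2 * enorm h)) + 4 * enorm h / A.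
    rewrite -[Ex D f](subrK (k * U)); apply: (le_trans (ler_normD _ _)).
    by apply: lerD => //; rewrite normrM gtr0_norm// ler_wpM2l// ltW.
  pose H2 r := G (x + r *: xs).
  (* The intermediate term is the jump from [x] with the lengthened radius r + s. *)
  have -> : U = Ex (uniform_prob A2) (fun r => G (y + r *: xs) - G (x + (r + s xi) *: xs)) +
      (Ex (uniform_prob A2) (fun r => H2 (r + s xi)) - Ex (uniform_prob A2) H2).
    rewrite /H2 -ExB; [|exact: br|exact: br0].
    rewrite -ExD; [|by apply: bmfB => //; exact: br|by apply: bmfB => //; exact: br].
    by apply: eq_Ex => r; rewrite addrA subrK.
  apply: (le_trans (ler_normD _ _)); apply: lerD; last first.
    apply: (le_trans (@uniform_shift _ _ _ (s xi) A2 H2 (br0 x) (fun r => G1 _))).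
    rewrite (_ : 2 * A - A = A); last by ring.
    by rewrite ler_wpM2r ?invr_ge0 ?(ltW A0)// ler_wpM2l// s_le.
  apply: Ex_abs_le; first by apply: bmfB => //; exact: br.
  move=> r; apply: (le_trans (lG _ _)); rewrite ler_wpM2l ?(ltW l0)//.
  rewrite (_ : _ - _ = h - s xi *: xs); last first.
    by apply/rowP => i; rewrite /h !mxE; ring.
  by apply: enorm_project => //; exact: enorm_ontosphere.
pose B := fun xi : Rd => l * enorm h * (1 - k) + k * (l * (enorm h - s xi ^+ 2 / (2 * enorm h)) + 4 * enorm h / A).
have BE (xi : Rd) : B xi = (l * enorm h + k * (4 * enorm h / A)) + (- (k * l / (2 * enorm h))) * s xi ^+ 2.
  by rewrite /B; field; rewrite !gt_eqF.
have bB : @bmf R _ Rd B.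
  rewrite (_ : B = fun xi => (l * enorm h + k * (4 * enorm h / A)) + (- (k * l / (2 * enorm h))) * s xi ^+ 2).
    by apply: bmfD => //; apply: bmfZ.
  by apply/funext.
apply: (@le_trans _ _ (Ex nmu B)).
  by apply: Ex_le => //; exact: bmf_abs.
rewrite (eq_Ex _ BE) ExD//; last exact: bmfZ.
rewrite Ex_cst ExZ//.
set E := Ex nmu _.
have HE : g * enorm h ^+ 2 <= E by exact: Hg.
apply: (@le_trans _ _ (l * enorm h + k * (4 * enorm h / A) - (k * l / (2 * enorm h)) * (g * enorm h ^+ 2))).
  rewrite mulNr lerD2l lerN2 ler_wpM2l//; apply: divr_ge0; apply: mulr_ge0 => //; exact: ltW.
have -> : l * enorm h + k * (4 * enorm h / A) - (k * l / (2 * enorm h)) * (g * enorm h ^+ 2) =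
    (l - k * (l * g / 4)) * enorm h.
  by rewrite /A; field; rewrite !gt_eqF.
rewrite ler_wpM2r ?enorm_ge0// lerD2l lerN2.
have kE : k = al * a `^ al * 2 `^ (- 1 - al) * A `^ (- al).
  rewrite /k powRM ?(ltW A0)// mulrA -!mulrA; do 3 congr (_ * _).
  have -> : A `^ (- al) = A `^ (- 1 - al) * A; last by [].
  rewrite -[X in _ * X](powRr1 (ltW A0)) -powRD ?(gt_eqF A0) ?implybT//.
  by congr (_ `^ _); ring.
have AE : A `^ (- al) = (g / 16) `^ al * l `^ al.
  rewrite -powRM ?(ltW l0)//; last by rewrite divr_ge0// ltW.
  rewrite (_ : g / 16 * l = A^-1); last by rewrite /A; field; rewrite !gt_eqF.
  by rewrite -powR_inv1 ?ltW// -powRrM mulN1r.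
have lE : l `^ (1 + al) = l * l `^ al.
  by rewrite (@powRD _ l 1 al) ?(gt_eqF l0) ?implybT// powRr1// ltW.
rewrite kE AE lE.
by rewrite le_eqVlt; apply/orP; left; apply/eqP; ring.
Qed.

End jump_law.

(** * Convolution and the noise of one time step *)

Section convolution.
Context {R : realType} {d : nat}.
Local Notation V := 'rV[R]_d.
Local Notation Rd := (@Rd R d).
Local Notation leb := (@lebesgue_measure R).
Local Notation RR := (measurableTypeR R).
Implicit Types (P Q J : probability Rd R) (f g : V -> R).

Definition conv P Q : probability Rd R :=
  law_of (pprod P Q) (pack_mfun (mvD (T := (Rd * Rd)%type) measurable_fst measurable_snd)).

Lemma bmf_add f : @bmf R _ Rd f -> @bmf R _ (Rd * Rd)%type (fun z => f ((z.1 : V) + z.2)).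
Proof. by move=> bf; apply: (bmf_comp (T' := Rd) bf); apply: mvD. Qed.

Lemma Ex_conv P Q f : @bmf R _ Rd f ->
  Ex (conv P Q) f = Ex P (fun x : Rd => Ex Q (fun y : Rd => f ((x : V) + y))).
Proof. by move=> bf; rewrite /conv Ex_law//= (Ex_prod1 _ _ (bmf_add bf)). Qed.

(** The transition operator of a random walk step with law [P]; regularity of the noise is expressed
    through its powers. *)
Definition transl P f : V -> R := fun x => Ex P (fun y : Rd => f (x + y)).

Lemma bmf_transl P f : @bmf R _ Rd f -> @bmf R _ Rd (transl P f).
Proof. by move=> bf; exact: (bmf_Ex1 P (bmf_add bf)). Qed.

Lemma transl_le1 P f : @bmf R _ Rd f -> (forall x, `|f x| <= 1) -> forall x, `|transl P f x| <= 1.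
Proof. by move=> bf f1 x; apply: Ex_abs_le => //; exact: bmf_shift. Qed.

Lemma transl_conv P Q f x : @bmf R _ Rd f ->
  transl (conv P Q) f x = Ex P (fun y : Rd => transl Q f (x + y)).
Proof.
move=> bf; rewrite /transl Ex_conv; last exact: bmf_shift.
by apply: eq_Ex => y; apply: eq_Ex => z; rewrite addrA.
Qed.

Lemma lip_transl_Ex P g l : @bmf R _ Rd g -> lip l g -> lip l (fun x => Ex P (fun y : Rd => g (x + y))).
Proof.
move=> bg lg x y; rewrite -ExB; [|exact: bmf_shift|exact: bmf_shift].
apply: Ex_abs_le; first by apply: bmfB; exact: bmf_shift.
move=> z; apply: (le_trans (lg _ _)).
by rewrite (_ : x + z - (y + z) = x - y)// opprD addrACA subrr addr0.
Qed.

Lemma bmf_sin (u : V) : @bmf R _ Rd (fun x => sin (dotv u x)).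
Proof.
split; first exact: (measurableT_comp (@measurable_sin R) (meas_dotv u)).
by exists 1 => x; exact: sin_max.
Qed.

Lemma bmf_cos (u : V) : @bmf R _ Rd (fun x => cos (dotv u x)).
Proof.
split; first exact: (measurableT_comp (@measurable_cos R) (meas_dotv u)).
by exists 1 => x; exact: cos_max.
Qed.

(** The two parts of the characteristic function. For the laws used here the sine part vanishes, and
    then [cosE] is multiplicative under convolution. *)
Definition cosE P u := Ex P (fun x : Rd => cos (dotv u x)).
Definition sinE P u := Ex P (fun x : Rd => sin (dotv u x)).

Lemma cosE_le1 P u : `|cosE P u| <= 1.
Proof. by apply: Ex_abs_le => [|x]; [exact: bmf_cos|exact: cos_max]. Qed.

Lemma trig_conv P Q u : sinE P u = 0 -> sinE Q u = 0 ->
  sinE (conv P Q) u = 0 /\ cosE (conv P Q) u = cosE P u * cosE Q u.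
Proof.
move=> sP sQ; rewrite /sinE /cosE !Ex_conv; [|exact: bmf_cos|exact: bmf_sin].
split.
  rewrite (@eq_Ex _ _ _ _ _ (fun x : Rd => cosE Q u * sin (dotv u x))); last first.
    move=> x; rewrite -[RHS]addr0 -(mulr0 (cos (dotv u x))) -sQ [cosE _ _ * _]mulrC.
    rewrite /cosE /sinE -!ExZ; [|exact: bmf_cos|exact: bmf_sin].
    rewrite -ExD; [|by apply: bmfZ; exact: bmf_cos|by apply: bmfZ; exact: bmf_sin].
    by apply: eq_Ex => y; rewrite dotvDr sinD.
  by rewrite ExZ; [rewrite [Ex _ _]sP mulr0|exact: bmf_sin].
rewrite mulrC -ExZ; last exact: bmf_cos.
apply: eq_Ex => x.
rewrite [RHS]mulrC -[RHS]subr0 -(mulr0 (sin (dotv u x))) -sQ.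
rewrite /cosE /sinE -!ExZ; [|exact: bmf_cos|exact: bmf_sin].
rewrite -ExB; [|by apply: bmfZ; exact: bmf_cos|by apply: bmfZ; exact: bmf_sin].
by apply: eq_Ex => y; rewrite dotvDr cosD.
Qed.

Section smear.
Variable eta : R.
Hypothesis eta0 : 0 < eta.
Local Notation U := (uniform_prob eta0).

Let mdir (i : 'I_d) : measurable_fun setT
  (fun z : (RR * RR)%type => ((z.1 - z.2) *: (delta_mx 0 i : V)) : Rd).
Proof.
apply: mvZr; last exact: measurable_cst.
exact: (@measurable_funB _ (RR * RR)%type R setT fst snd measurable_fst measurable_snd).
Qed.

(** The difference of two independent uniform variables along one axis: its symmetry makes the sine
    transform vanish, and its first variable makes bounded functions Lipschitz along that axis. *)
Definition smear1 (i : 'I_d) : probability Rd R := law_of (pprod U U) (pack_mfun (mdir i)).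

Lemma Ex_smear1 i f : @bmf R _ Rd f ->
  Ex (smear1 i) f = Ex U (fun r => Ex U (fun s : RR => f ((r - s) *: delta_mx 0 i))).
Proof.
move=> bf; rewrite /smear1 Ex_law//= (Ex_prod1 U U (f := fun z => f ((z.1 - z.2) *: delta_mx 0 i)))//.
exact: (bmf_comp bf (mdir i)).
Qed.

Lemma Ex_smear1' i f : @bmf R _ Rd f ->
  Ex (smear1 i) f = Ex U (fun s => Ex U (fun r : RR => f ((r - s) *: delta_mx 0 i))).
Proof.
move=> bf; rewrite /smear1 Ex_law//= (Ex_prod2 U U (f := fun z => f ((z.1 - z.2) *: delta_mx 0 i)))//.
exact: (bmf_comp bf (mdir i)).
Qed.

Let bmf_dir2 i f r : @bmf R _ Rd f -> @bmf R _ RR (fun s => f ((r - s) *: delta_mx 0 i)).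
Proof.
move=> bf; have := bmf_sec1 r (bmf_comp bf (mdir i)).
exact.
Qed.

Let bmf_dir1 i f s : @bmf R _ Rd f -> @bmf R _ RR (fun r => f ((r - s) *: delta_mx 0 i)).
Proof.
move=> bf; have := bmf_sec2 s (bmf_comp bf (mdir i)).
exact.
Qed.

Let bmf_dirE i f : @bmf R _ Rd f ->
  @bmf R _ RR (fun r => Ex U (fun s : RR => f ((r - s) *: delta_mx 0 i))).
Proof. by move=> bf; exact: (bmf_Ex1 U (bmf_comp bf (mdir i))). Qed.

Lemma sinE_smear1 i u : sinE (smear1 i) u = 0.
Proof.
rewrite /sinE.
have h : Ex (smear1 i) (fun x => sin (dotv u x)) = - Ex (smear1 i) (fun x => sin (dotv u x)).
  rewrite {1}Ex_smear1; last exact: bmf_sin.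
  rewrite Ex_smear1'; last exact: bmf_sin.
  rewrite -ExN; last first.
    exact: (bmf_Ex2 U (bmf_comp (bmf_sin u) (mdir i))).
  apply: eq_Ex => r; rewrite -ExN; last by apply: (@bmf_dir1 i (fun x => sin (dotv u x))); exact: bmf_sin.
  by apply: eq_Ex => s; rewrite -sinN -dotvNr -scaleNr opprB.
by apply/eqP; rewrite -eqNr -h.
Qed.

Lemma Ex_smear1_le i f (M : R) : @bmf R _ Rd f ->
  (forall r t : R, 0 <= r <= eta -> 0 <= t <= eta -> f ((r - t) *: delta_mx 0 i) <= M) ->
  Ex (smear1 i) f <= M.
Proof.
move=> bf fM; rewrite Ex_smear1//.
have hU := has_density_uniform eta0.
have le_cst (h : R -> R) : @bmf R _ RR h -> (forall r, 0 <= r <= eta -> h r <= M) ->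
    Ex U h <= M.
  move=> bh hM; rewrite -(Ex_cst U M) (Ex_density hU bh) (Ex_density hU (bmf_cst M)).
  apply: le_Rintegral => //.
  - exact: (density_integrable hU bh).
  - exact: (density_integrable hU (bmf_cst M)).
  - move=> r _; rewrite /uniform_pdf; case: ifP => h2; last by rewrite !mulr0.
    by rewrite ler_wpM2r ?invr_ge0 ?subr0 ?(ltW eta0)// hM.
apply: (le_cst _ _); first exact: (@bmf_dirE i f).
move=> r r1; apply: (le_cst _ _); first exact: (@bmf_dir2 i f).
by move=> t t1; exact: fM.
Qed.

Lemma cosE_smear1 i u : 0 <= 1 - cosE (smear1 i) u <= (enorm u * eta) ^+ 2 / 2.
Proof.
have := cosE_le1 (smear1 i) u; rewrite ler_norml => /andP[_ c1].
apply/andP; split; first by rewrite subr_ge0.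
have b1 : @bmf R _ Rd (fun x => 1 - cos (dotv u x)) by apply: bmfB => //; exact: bmf_cos.
have -> : 1 - cosE (smear1 i) u = Ex (smear1 i) (fun x : Rd => 1 - cos (dotv u x)).
  by rewrite ExB ?Ex_cst//; exact: bmf_cos.
apply: Ex_smear1_le => // r t r1 t1; apply: (le_trans (cos_le1_sqr _)).
rewrite ler_pM2r ?invr_gt0// -[leLHS]ger0_norm ?sqr_ge0// normrX.
rewrite ler_pXn2r ?nnegrE ?mulr_ge0 ?enorm_ge0 ?(ltW eta0)//.
rewrite dotvZr normrM mulrC; apply: ler_pM => //.
  by apply: (le_trans (dotv_le _ _)); rewrite enorm_delta mulr1.
move: r1 t1 => /andP[r0 r1] /andP[t0 t1].
by rewrite ler_norml; apply/andP; split; lra.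
Qed.

Definition smear (s : seq 'I_d) J := foldr (fun i acc => conv (smear1 i) acc) J s.

Lemma sinE_smear s J u : sinE J u = 0 -> sinE (smear s J) u = 0.
Proof.
move=> sJ; elim: s => //= i s IH.
by have [] := trig_conv (sinE_smear1 i u) IH.
Qed.

Lemma cosE_smear s J u : sinE J u = 0 ->
  `|cosE (smear s J) u - cosE J u| <= (size s)%:R * ((enorm u * eta) ^+ 2 / 2).
Proof.
move=> sJ; elim: s => /= [|i s IH]; first by rewrite subrr normr0 mul0r.
have [_ ->] := trig_conv (sinE_smear1 i u) (sinE_smear s sJ).
set B := _ / 2 in IH *.
rewrite -addn1 natrD mulrDl mul1r.
rewrite (_ : _ - _ = (cosE (smear s J) u - cosE J u) - (1 - cosE (smear1 i) u) * cosE (smear s J) u); last by ring.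
apply: (le_trans (ler_normB _ _)); apply: lerD => //.
have /andP[h1 h2] := cosE_smear1 i u.
rewrite normrM (ger0_norm h1); apply: le_trans h2.
by rewrite ler_piMr// cosE_le1.
Qed.

(** Moving by [t] along axis [i] amounts to translating one uniform variable by [t], which
    [uniform_shift] controls; the remaining convolutions only average the difference. *)
Lemma smear_coord s J f i t x : @bmf R _ Rd f -> (forall x, `|f x| <= 1) -> i \in s ->
  `|transl (smear s J) f (x + t *: delta_mx 0 i) - transl (smear s J) f x| <= 4 * `|t| / eta.
Proof.
move=> bf f1; elim: s x => // j s IH x; rewrite inE => /orP[/eqP <-|si] /=.
  rewrite !transl_conv//.
  have bG := bmf_transl (smear s J) bf.
  have G1 := @transl_le1 (smear s J) f bf f1.
  set G := transl _ _ in bG G1 *.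
  have bGs z : @bmf R _ Rd (fun y => G (z + y)) by exact: bmf_shift.
  rewrite (Ex_smear1' _ (bGs (x + t *: delta_mx 0 i))) (Ex_smear1' _ (bGs x)).
  rewrite -ExB; last 2 first.
  - exact: (bmf_Ex2 U (bmf_comp (bGs (x + t *: delta_mx 0 i)) (mdir i))).
  - exact: (bmf_Ex2 U (bmf_comp (bGs x) (mdir i))).
  apply: Ex_abs_le.
    apply: bmfB.
    - exact: (bmf_Ex2 U (bmf_comp (bGs (x + t *: delta_mx 0 i)) (mdir i))).
    - exact: (bmf_Ex2 U (bmf_comp (bGs x) (mdir i))).
  move=> v.
  pose H (r : R) := G (x + (r - v) *: delta_mx 0 i).
  have bH : @bmf R _ RR H by exact: (@bmf_dir1 i (fun y => G (x + y)) v).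
  have := @uniform_shift R 0 eta t eta0 H bH (fun r => G1 _); rewrite subr0.
  have -> : Ex U (fun r : RR => G (x + t *: delta_mx 0 i + (r - v) *: delta_mx 0 i)) = Ex U (fun r : RR => H (r + t)).
    apply: eq_Ex => r.
    have e : t + ((r : R) - (v : R)) = ((r : R) + t) - (v : R) by rewrite addrA (addrC t).
    by rewrite /H -addrA -scalerDl e.
  exact.
rewrite !transl_conv// -ExB; [|by apply: bmf_shift; exact: bmf_transl|by apply: bmf_shift; exact: bmf_transl].
apply: Ex_abs_le.
  by apply: bmfB; apply: bmf_shift; exact: bmf_transl.
move=> y; rewrite addrAC; exact: IH.
Qed.

Lemma smear_lip J f : @bmf R _ Rd f -> (forall x, `|f x| <= 1) ->
  lip (4 * d%:R / eta) (transl (smear (enum 'I_d) J) f).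
Proof.
move=> bf f1 x y; set F := transl _ _.
have h (s : seq 'I_d) (z v : V) : `|F (z + \sum_(i <- s) v 0 i *: delta_mx 0 i) - F z| <=
    \sum_(i <- s) 4 * `|v 0 i| / eta.
  elim: s z => [|i s IH] z; first by rewrite !big_nil addr0 subrr normr0.
  rewrite !big_cons addrA.
  rewrite (_ : _ - F z = (F (z + v 0 i *: delta_mx 0 i) - F z) +
    (F (z + v 0 i *: delta_mx 0 i + \sum_(j <- s) v 0 j *: delta_mx 0 j) - F (z + v 0 i *: delta_mx 0 i))); last by ring.
  apply: (le_trans (ler_normD _ _)); apply: lerD => //.
  by apply: smear_coord => //; rewrite mem_enum.
have := h (index_enum 'I_d) y (x - y); rewrite -row_sum_delta (addrC y (x - y)) subrK => /le_trans; apply.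
apply: (@le_trans _ _ (\sum_(i < d) 4 * enorm (x - y) / eta)).
  apply: ler_sum => i _; rewrite ler_pM2r ?invr_gt0// ler_pM2l//.
  exact: coord_le.
rewrite sumr_const card_ord -mulr_natr.
by rewrite le_eqVlt; apply/orP; left; apply/eqP; ring.
Qed.

Lemma smear_lip_base s J g l : @bmf R _ Rd g -> lip l (transl J g) -> lip l (transl (smear s J) g).
Proof.
move=> bg lg; elim: s => //= i s IH x y.
rewrite !transl_conv//; apply: lip_transl_Ex => //; exact: bmf_transl.
Qed.

(** A law supported within distance [d%:R * eta] of 0. The operation that smears the noise is reused
    here on the Dirac mass, so its Lipschitz bound applies at once. *)
Definition mollifier : probability Rd R := smear (enum 'I_d) (\d_ (0 : Rd)).

Lemma Ex_mollifier_le f (M : R) : @bmf R _ Rd f ->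
  (forall y, enorm y <= d%:R * eta -> f y <= M) -> Ex mollifier f <= M.
Proof.
move=> bf fM; rewrite /mollifier.
have : forall y, enorm y <= (size (enum 'I_d))%:R * eta -> f y <= M.
  by rewrite size_enum_ord.
elim: (enum 'I_d) f bf {fM} => [|i s IH] f bf fM /=.
  have mf : measurable_fun (setT : set Rd) (fun x => (f x)%:E).
    by apply/measurable_EFinP; exact: bmf_meas bf.
  rewrite /Ex integral_dirac//.
  by rewrite diracT mul1e/= fM// enorm0 mul0r.
rewrite Ex_conv//; apply: Ex_smear1_le.
  by have := bmf_transl (smear s \d_ (0 : Rd)) bf.
move=> r t /andP[r0 r1] /andP[t0 t1]; apply: IH; first exact: bmf_shift.
move=> y hy; apply: fM; apply: (le_trans (enormD _ _)).
rewrite [size _]/= -natr1 mulrDl mul1r addrC; apply: lerD => //.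
rewrite enormZ enorm_delta mulr1 ler_norml; apply/andP; split; lra.
Qed.

Lemma transl_mollifier f l x : 0 <= l -> @bmf R _ Rd f -> lip l f ->
  `|transl mollifier f x - f x| <= l * (d%:R * eta).
Proof.
move=> l0 bf lf.
have bs := bmf_shift x bf.
have bc : @bmf R _ Rd (fun=> f x) by exact: bmf_cst.
rewrite -[X in _ - X](Ex_cst mollifier) -ExB//.
have bB : @bmf R _ Rd (fun y => f (x + y) - f x) by exact: bmfB.
apply: (le_trans (Ex_abs _ bB)).
apply: Ex_mollifier_le; first exact: bmf_abs.
move=> y hy; apply: (le_trans (lf _ _)).
by rewrite addrC addKr ler_wpM2l.
Qed.

Lemma mollifier_lip f : @bmf R _ Rd f -> (forall x, `|f x| <= 1) ->
  lip (4 * d%:R / eta) (transl mollifier f).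
Proof. exact: smear_lip. Qed.

End smear.

Lemma translC P Q f : @bmf R _ Rd f -> transl P (transl Q f) = transl Q (transl P f).
Proof.
move=> bf; apply/funext => x.
have bF : @bmf R _ (Rd * Rd)%type (fun z => f (x + ((z.1 : V) + z.2))).
  exact: (bmf_add (bmf_shift x bf)).
rewrite /transl; have := Ex_swap P Q (f := fun y z : Rd => f (x + ((y : V) + z))) bF.
under eq_Ex do under eq_Ex do rewrite addrA.
move=> ->; apply: eq_Ex => z; apply: eq_Ex => y.
by rewrite [(y : V) + z]addrC addrA.
Qed.

Definition titer P n f := iter n (transl P) f.

Lemma titerC P Q n f : @bmf R _ Rd f -> titer P n (transl Q f) = transl Q (titer P n f).
Proof.
move=> bf; elim: n => //= n ->; rewrite translC//.
by elim: n => //= n IH; exact: bmf_transl.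
Qed.

Lemma bmf_titer P n f : @bmf R _ Rd f -> @bmf R _ Rd (titer P n f).
Proof. by move=> bf; elim: n => //= n IH; exact: bmf_transl. Qed.

Lemma titer_le1 P n f : @bmf R _ Rd f -> (forall x, `|f x| <= 1) ->
  forall x, `|titer P n f x| <= 1.
Proof.
move=> bf f1; elim: n => //= n IH; apply: transl_le1 => //.
exact: bmf_titer.
Qed.

(* If each application of [transl P] turns a constant l <= 1/a into
   l - k l^(1+al), the constants after n steps decay like n^(-1/al). *)
Lemma titer_lip P (a k al : R) : 0 < a -> 0 < k -> 1 <= al ->
  (forall f, @bmf R _ Rd f -> (forall x, `|f x| <= 1) -> lip a^-1 (transl P f)) ->
  (forall f l, 0 < l <= a^-1 -> lip l f -> (forall x, `|f x| <= 1) ->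
     lip (l - k * a `^ al * l `^ (1 + al)) (transl P f)) ->
  forall f n, @bmf R _ Rd f -> (forall x, `|f x| <= 1) ->
    lip ((a `^ al * (1 + k * n%:R)) `^ (- al^-1)) (titer P n.+1 f).
Proof.
move=> a0 k0 al1 H1 H2 f n bf f1.
have al0 : 0 < al by lra.
have aal : 0 < a `^ al by exact: powR_gt0.
pose y j : R := a `^ al * (1 + k * j%:R).
have y0 j : 0 < y j by rewrite mulr_gt0// ltr_wpDr// mulr_ge0// ltW.
have inv_le p q : 0 < p -> p <= q -> q `^ (- al^-1) <= p `^ (- al^-1).
  move=> p0 pq; have q0 : 0 < q by exact: lt_le_trans pq.
  rewrite !powRN lef_pV2 ?posrE ?powR_gt0//.
  by apply: ge0_ler_powR; rewrite ?nnegrE; [rewrite invr_ge0 ltW|exact: ltW|exact: ltW|].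
have aE : (a `^ al) `^ (- al^-1) = a^-1.
  by rewrite -powRrM mulrN divff ?gt_eqF// powR_inv1// ltW.
elim: n => [|n IH].
  by rewrite /= mulr0 addr0 mulr1 aE; exact: H1.
set l := (_ `^ _) in IH; rewrite -/(y n) in l IH; rewrite -/(y n.+1).
have l0 : 0 < l by exact: powR_gt0.
have la : l <= a^-1.
  rewrite -aE; apply: inv_le => //; rewrite /y ler_pMr// lerDl.
  by rewrite mulr_ge0// ltW.
have := H2 _ l _ IH (@titer_le1 P n.+1 f bf f1); rewrite l0 la => /(_ isT).
apply: lipW.
have lal : l `^ al = (y n)^-1.
  by rewrite /l -powRrM mulNr mulVf ?gt_eqF// powR_inv1// ltW.
rewrite (@powRD _ l 1 al) ?(gt_eqF l0) ?implybT// powRr1 ?(ltW l0)// lal.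
pose t := k * a `^ al / y n.
have -> : l - k * a `^ al * (l / y n) = l * (1 - t) by rewrite /t; ring.
have t0 : 0 < t by rewrite divr_gt0// mulr_gt0.
have [t1|t1] := leP 1 t.
  apply: (@le_trans _ _ 0); last exact: powR_ge0.
  by apply: mulr_ge0_le0; [exact: ltW|rewrite subr_le0].
have yn : y n.+1 = y n * (1 + t).
  rewrite /t mulrDr mulr1 mulrCA divff ?gt_eqF// mulr1 /y -[n.+1]addn1 natrD; ring.
have t10 : 0 < 1 - t by rewrite subr_gt0.
clearbody t.
have t11 : 0 < 1 + t by rewrite ltr_pwDl// ltW.
rewrite yn powRM; [|exact: ltW|exact: ltW].
rewrite ler_wpM2l ?(ltW l0)// powRN -[leLHS]invrK lef_pV2 ?posrE ?powR_gt0 ?invr_gt0//.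
(* As al >= 1, one has (1 + t)^(1/al) <= 1 + t <= 1/(1 - t). *)
apply: (@le_trans _ _ (1 + t)).
  rewrite -[leRHS]powRr1 ?(ltW t11)//; apply: ler_powR; first by rewrite lerDl ltW.
  by rewrite invf_le1.
rewrite -[leRHS]mul1r ler_pdivlMr//.
rewrite (_ : (1 + t) * (1 - t) = 1 - t * t); last by ring.
by rewrite gerBl mulr_ge0// ltW.
Qed.

End convolution.

(** * Existence of the approximating noise *)

Section noise.
Context {R : realType} {d : nat}.
Local Notation V := 'rV[R]_d.
Local Notation Rd := (@Rd R d).

(* One step of length h of a random walk that converges to a stable process. *)
Definition noise (al C h : R) (P : probability Rd R) :=
  [/\ forall u, sinE P u = 0,
      forall u, 0 <= 1 - cosE P u <= C * h * (enorm u `^ al + enorm u ^+ 2) &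
      forall (f : V -> R) n, @bmf R _ Rd f -> (forall x, `|f x| <= 1) -> (0 < n)%N ->
        lip (C * (n%:R * h) `^ (- al^-1)) (titer P n f)].

(** For x <= 1/2 the number 1 - x lies between exp(-x(1 + 2x)) and exp(-x); both bounds are raised
    to the power [k n]. *)
Lemma onem_expn_cvg (x : R^nat) (k : nat -> nat) (y : R) : (forall n, 0 <= x n) ->
  x @ \oo --> 0 -> (fun n => (k n)%:R * x n) @ \oo --> y ->
  (fun n => (1 - x n) ^+ k n) @ \oo --> expR (- y).
Proof.
move=> x0 xoo kx.
have h2 : (0 : R) < 2^-1 by rewrite invr_gt0.
have B : \forall n \near \oo, expR (- ((k n)%:R * x n * (1 + 2 * x n))) <= (1 - x n) ^+ k n
    <= expR (- ((k n)%:R * x n)).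
  near=> n; have x1 : x n <= 2^-1.
    near: n; move/cvgrPdist_le : xoo => /(_ _ h2) [N _ H].
    by exists N => // m Nm; have := H m Nm; rewrite /= sub0r normrN ger0_norm.
  apply/andP; split; last first.
    rewrite -mulrN expRM_natl; apply: lerXn2r; rewrite ?nnegrE ?expR_ge0//.
      by have := x0 n; lra.
    by have := expR_ge1Dx (- x n); lra.
  rewrite -mulrA -mulrN expRM_natl; apply: lerXn2r; rewrite ?nnegrE ?expR_ge0//.
    by have := x0 n; lra.
  rewrite expRN -[leRHS]invrK lef_pV2 ?posrE ?expR_gt0 ?invr_gt0//; last by lra.
  apply: (@le_trans _ _ (1 + x n * (1 + 2 * x n))); last exact: expR_ge1Dx.
  have x2 : 0 < 1 - x n by lra.
  by rewrite -(@ler_pM2r _ (1 - x n))// mulVf ?gt_eqF//; have := x0 n; nra.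
apply: (squeeze_cvgr B).
- apply: (cvg_comp (fun n => - ((k n)%:R * x n * (1 + 2 * x n))) expR); last exact: continuous_expR.
  rewrite -[in - y](mulr1 y); apply: cvgN; apply: cvgM => //.
  rewrite -[in X in _ --> X](addr0 1) -(mulr0 2); apply: cvgD; first exact: cvg_cst.
  by apply: cvgM => //; exact: cvg_cst.
- apply: (cvg_comp (fun n => - ((k n)%:R * x n)) expR); last exact: continuous_expR.
  exact: cvgN.
Unshelve. all: by end_near. Qed.

Variables (T al : R) (mu : {finite_measure set Rd -> \bar R}).
Hypotheses (T0 : 0 < T) (symm : spherical_symmetric mu) (h1 : H1 al mu).

Lemma noise_exists0 : d = 0%N -> exists (psi : V -> R) (C : R) (rho : nat -> probability Rd R),
  [/\ 0 < C, forall u, stable_symbol al mu u = (psi u)%:E,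
      forall u, 0 <= psi u <= C * enorm u `^ al,
      forall m, noise al C (T / m.+1%:R) (rho m) &
      forall u (k : nat -> nat) (tau : R), (k m)%:R * (T / m.+1%:R) @[m --> \oo] --> tau ->
        cosE (rho m) u ^+ k m @[m --> \oo] --> expR (- (tau * psi u))].
Proof.
move=> d0.
have V0 (x y : V) : x = y by apply/rowP => -[i hi]; exfalso; move: hi; rewrite d0.
have dot0 (u x : V) : dotv u x = 0 by rewrite (V0 x 0) dotv0r.
have e0 (x : V) : enorm x = 0 by rewrite (V0 x 0) enorm0.
have c1 (P : probability Rd R) (u : V) : cosE P u = 1.
  rewrite /cosE; under eq_Ex do rewrite dot0 cos0.
  exact: Ex_cst.
have al0 : 0 < al by case: h1 => /andP[a1 _] _; exact: lt_trans a1.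
exists (fun=> 0), 1, (fun=> @dirac _ Rd (0 : V) R); split => //.
- move=> u; rewrite /stable_symbol.
  under eq_integral do under eq_integral do rewrite dot0 mulr0 cos0 subrr mul0r.
  under eq_integral do rewrite integral0.
  by rewrite integral0.
- by move=> u; rewrite lexx mul1r powR_ge0.
- move=> m; split.
  + move=> u; rewrite /sinE; under eq_Ex do rewrite dot0 sin0.
    exact: Ex_cst.
  + by move=> u; rewrite c1 subrr lexx/= e0 powR0 ?gt_eqF// expr0n/= addr0 mulr0.
  + by move=> f n bf f1 n0 x y; rewrite (V0 x y) subrr normr0 e0 mulr0.
- move=> u k tau _; rewrite mulr0 oppr0 expR0.
  under eq_fun do rewrite c1 expr1n.
  exact: cvg_cst.
Qed.

(** One step is a jump with Pareto length at least [a] in a direction drawn from [mu], followed by a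
    smear of width [eta]. The relation between [a] and the time step makes the unsmeared
    characteristic function exact for the truncated symbol. The smear changes it by O(a^2), which is
    the time step times O(a^(2-al)) and so disappears in the limit. *)
Lemma noise_exists : exists (psi : V -> R) (C : R) (rho : nat -> probability Rd R),
  [/\ 0 < C, forall u, stable_symbol al mu u = (psi u)%:E,
      forall u, 0 <= psi u <= C * enorm u `^ al,
      forall m, noise al C (T / m.+1%:R) (rho m) &
      forall u (k : nat -> nat) (tau : R), (k m)%:R * (T / m.+1%:R) @[m --> \oo] --> tau ->
        cosE (rho m) u ^+ k m @[m --> \oo] --> expR (- (tau * psi u))].
Proof.
have [d0|dn0] := eqVneq d 0%N; first exact: noise_exists0.
have dpos : (0 < d)%N by rewrite lt0n.
case: h1 => al12 [C1 [C10 hC1]].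
have /andP[al1 al2] := al12.
have al0 : 0 < al by exact: lt_trans al1.
have al02 : 0 < al < 2 by rewrite al0.
pose c := fine (mu setT).
(* If [mu] vanished, so would the symbol, against [H1] at a unit vector. *)
have c0 : 0 < c.
  rewrite lt_neqAle fine_ge0// andbT; apply/eqP => c0.
  have m0 : mu setT = 0%E by rewrite -[LHS]fineK ?fin_num_measure// -/c -c0.
  have := hC1 (delta_mx 0 (Ordinal dpos)); rewrite enorm_delta powR1 mulr1.
  have -> : stable_symbol al mu (delta_mx 0 (Ordinal dpos)) = 0%E.
    rewrite (stable_symbol_ontosphere symm al); apply: null_set_integral => //.
    exact: measurable_Kfull.
  by rewrite lee_fin leNgt C10.
have [g [g01 hg]] := sphere_nondegenerate symm c0 al02 C10 hC1.
have /andP[g0 g1] := g01.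
have [C2 [C20 hC2]] := symbol_le_pow symm c0 al02.
pose psi u := fine (stable_symbol al mu u).
have sE u : stable_symbol al mu u = (psi u)%:E.
  rewrite /psi fineK// ge0_fin_numE; last first.
    by apply: le_trans (hC1 u); rewrite lee_fin mulr_ge0 ?powR_ge0// ltW.
  by apply: le_lt_trans (hC2 u) _; rewrite ltry.
have psi0 u : 0 <= psi u <= C2 * enorm u `^ al.
  rewrite -!lee_fin -sE hC2 andbT.
  by apply: le_trans (hC1 u); rewrite lee_fin mulr_ge0 ?powR_ge0// ltW.
pose h m : R := T / m.+1%:R.
have h0 m : 0 < h m by rewrite divr_gt0.
have hT m : h m <= T by rewrite /h ler_pdivrMr// ler_peMr ?(ltW T0)// ler1n.
have hoo : h @ \oo --> 0.
  rewrite /h -(mulr0 T); apply: cvgM; [exact: cvg_cst|exact: cvg_harmonic].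
(* Chosen so that al a^al / c, the factor in [jump_cos], equals the time step [h m]. *)
pose a m : R := (h m * c / al) `^ al^-1.
have ac0 m : 0 < h m * c / al by rewrite divr_gt0// mulr_gt0.
have a0 m : 0 < a m by exact: powR_gt0.
have aal m : a m `^ al = h m * c / al.
  by rewrite /a -powRrM mulVf ?gt_eqF// powRr1// ltW.
have na : nonincreasing_seq a.
  move=> m n mn; rewrite /a; apply: ge0_ler_powR; [by rewrite invr_ge0 ltW|by rewrite nnegrE ltW|by rewrite nnegrE ltW|].
  rewrite ler_pM2r ?invr_gt0// ler_pM2r// /h ler_pM2l// lef_pV2 ?posrE// ler_nat.
  by rewrite ltnS.
have powoo (p : R) : 0 < p -> (fun m => (h m * c / al) `^ p) @ \oo --> 0.
  move=> p0; apply/cvgrPdist_le => e e0.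
  have e1 : 0 < e `^ p^-1 * al / c by rewrite divr_gt0// mulr_gt0// powR_gt0.
  move/cvgrPdist_le : hoo => /(_ _ e1); apply: filterS => m.
  rewrite !sub0r !normrN !ger0_norm ?powR_ge0 ?(ltW (h0 m))// => hm.
  have -> : e = (e `^ p^-1) `^ p by rewrite -powRrM mulVf ?gt_eqF// powRr1// ltW.
  apply: ge0_ler_powR; rewrite ?nnegrE ?powR_ge0 ?(ltW p0) ?(ltW (ac0 m))//.
  rewrite ler_pdivrMr//; apply: (@le_trans _ _ (e `^ p^-1 * al / c * c)).
    by rewrite ler_pM2r.
  by rewrite divfK ?gt_eqF.
have aoo : a @ \oo --> 0 by apply: powoo; rewrite invr_gt0.
have dR : (0 : R) < d%:R by rewrite ltr0n.
(* By [smear_lip] one step then turns bounded functions into functions with constant 4 d / eta =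
   1/a, the range in which [jump_smoothing] applies. *)
pose eta m := 4 * d%:R * a m.
have eta0 m : 0 < eta m by rewrite !mulr_gt0.
pose D m : probability (measurableTypeR R) R := projT1 (cid (pareto_exists al0 (a0 m))).
have hD m : has_density (@lebesgue_measure R) (D m) (pareto_pdf al (a m)).
  by rewrite /D; case: cid.
pose J m := jump_law mu (D m).
pose rho m := smear (eta0 m) (enum 'I_d) (J m).
have sJ m u : sinE (J m) u = 0 by exact: (jump_sin symm c0).
have cJ m u : ((1 - cosE (J m) u)%:E = (h m)%:E * Psi_trunc mu al (a m) u)%E.
  rewrite /cosE (jump_cos c0 al02 (a0 m) (hD m)) aal.
  by congr ((_ %:E) * _)%E; rewrite -/c; field; rewrite !gt_eqF.
have Pfin m u : (Psi_trunc mu al (a m) u = (fine (Psi_trunc mu al (a m) u))%:E)%E.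
  rewrite fineK// ge0_fin_numE ?Psi_trunc_ge0//.
  by apply: le_lt_trans (@Psi_trunc_le _ _ mu symm al (a m) u (a0 m)) _; rewrite sE ltry.
pose q m u := fine (Psi_trunc mu al (a m) u).
have cJ' m u : 1 - cosE (J m) u = h m * q m u.
  by have := cJ m u; rewrite Pfin -EFinM => -[].
have q_le m u : 0 <= q m u <= psi u.
  apply/andP; split; first by apply: fine_ge0; exact: Psi_trunc_ge0.
  have h2 := @Psi_trunc_le _ _ mu symm al (a m) u (a0 m).
  by rewrite Pfin sE lee_fin in h2.
have q_cvg u : q m u @[m --> \oo] --> psi u.
  apply: fine_cvg; rewrite -sE.
  exact: (@Psi_trunc_cvg _ _ mu symm al u a a0 na aoo).
pose B m (u : V) : R := d%:R * ((enorm u * eta m) ^+ 2 / 2).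
have rJ m u : `|cosE (rho m) u - cosE (J m) u| <= B m u.
  have := cosE_smear (eta0 m) (enum 'I_d) (sJ m u).
  by rewrite size_enum_ord.
pose K := 8 * d%:R ^+ 3 * (c / al).
have K0 : 0 < K by apply: mulr_gt0; [apply: mulr_gt0 => //; exact: exprn_gt0|exact: divr_gt0].
have a2 m : a m ^+ 2 = h m * (c / al) * a m `^ (2 - al).
  rewrite mulrA -aal -powRD; last by rewrite (gt_eqF (a0 m)) implybT.
  by rewrite addrC subrK powR_mulrn// ltW.
have BE m u : B m u = h m * (K * a m `^ (2 - al) * enorm u ^+ 2).
  by rewrite /B /eta !exprMn a2 /K; field; rewrite gt_eqF.
have p20 : 0 < 2 - al by rewrite subr_gt0.
pose A := a 0%N `^ (2 - al).
have aA m : a m `^ (2 - al) <= A.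
  apply: ge0_ler_powR; rewrite ?nnegrE ?(ltW (a0 _)) ?(ltW p20)//.
  exact: na.
have A0 : 0 <= A by exact: powR_ge0.
pose k0 := al * 2 `^ (- 1 - al) * (g / 16) `^ al * (g / 4).
have k00 : 0 < k0 by rewrite !mulr_gt0 ?powR_gt0 ?divr_gt0.
(* The minimum gives 1 + k0 n >= k1 (n + 1), which turns the bound of [titer_lip] into a power of
   the elapsed time. *)
pose k1 := Num.min 1 k0.
have k10 : 0 < k1 by rewrite lt_min ltr01 k00.
pose C3 := (k1 * (c / al)) `^ (- al^-1).
have C30 : 0 <= C3 by exact: powR_ge0.
pose C := C2 + K * A + C3.
have CC2 : C2 <= C by rewrite /C -addrA lerDl addr_ge0// mulr_ge0// ltW.
have C0 : 0 < C by exact: lt_le_trans CC2.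
exists psi, C, rho; split => //.
- move=> u; have /andP[-> h2]/= := psi0 u; apply: (le_trans h2).
  by rewrite ler_wpM2r ?powR_ge0.
- move=> m; split.
  + by move=> u; exact: sinE_smear.
  + move=> u; have := cosE_le1 (rho m) u; rewrite ler_norml => /andP[_ c1].
    rewrite subr_ge0 c1/=.
    rewrite (_ : 1 - _ = (1 - cosE (J m) u) - (cosE (rho m) u - cosE (J m) u)); last by ring.
    apply: (@le_trans _ _ (h m * q m u + B m u)).
      by rewrite cJ' lerD2l lerNl; have := rJ m u; rewrite ler_norml => /andP[].
    rewrite BE -mulrDr -/(h m) [C * h m]mulrC -[leRHS]mulrA (ler_pM2l (h0 m)).
    rewrite mulrDr; apply: lerD.
      have /andP[_ h2] := q_le m u; have /andP[_ h3] := psi0 u.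
      by apply: (le_trans h2); apply: (le_trans h3); rewrite ler_wpM2r ?powR_ge0.
    rewrite ler_wpM2r ?sqr_ge0//; apply: (@le_trans _ _ (K * A)).
      by rewrite ler_pM2l.
    by rewrite /C addrAC lerDr addr_ge0// ltW.
  + move=> f [//|n] bf f1 _.
    have S1 (f' : V -> R) : @bmf R _ Rd f' -> (forall x, `|f' x| <= 1) -> lip (a m)^-1 (transl (rho m) f').
      move=> bf' f1'; have := smear_lip (eta0 m) (J m) bf' f1'.
      rewrite (_ : 4 * d%:R / eta m = (a m)^-1)//.
      by rewrite /eta; field; rewrite !gt_eqF.
    have S2 (f' : V -> R) (l : R) : 0 < l <= (a m)^-1 -> lip l f' -> (forall x, `|f' x| <= 1) ->
       lip (l - k0 * a m `^ al * l `^ (1 + al)) (transl (rho m) f').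
      move=> la lf f1'; apply: smear_lip_base; first exact: lip_bmf lf f1'.
      exact: (@jump_smoothing _ _ mu al al02 (a m) (D m) (a0 m) (hD m) g g01 hg l f' la lf f1').
    have := titer_lip (a0 m) k00 (ltW al1) S1 S2 n bf f1.
    apply: lipW.
    apply: (@le_trans _ _ (C3 * (n.+1%:R * h m) `^ (- al^-1))); last first.
      apply: ler_wpM2r; first exact: powR_ge0.
      by rewrite /C lerDr; apply: addr_ge0; [exact: ltW|apply: mulr_ge0 => //; exact: ltW].
    rewrite /C3 -powRM; last 2 first.
    - by rewrite mulr_ge0 ?divr_ge0 ?ltW.
    - by rewrite mulr_ge0 ?ler0n ?ltW.
    have n1 : (0 : R) < n.+1%:R by rewrite ltr0n.
    have pos1 : 0 < k1 * (c / al) * (n.+1%:R * h m) by apply: mulr_gt0; [apply: mulr_gt0 => //; exact: divr_gt0|apply: mulr_gt0].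
    have le1 : k1 * (c / al) * (n.+1%:R * h m) <= a m `^ al * (1 + k0 * n%:R).
      rewrite aal (_ : k1 * (c / al) * (n.+1%:R * h m) = h m * c / al * (k1 * n.+1%:R)); last by ring.
      rewrite ler_pM2l// -natr1 mulrDr mulr1 addrC lerD// ?ge_min ?lexx//.
      by rewrite ler_wpM2r ?ler0n// ge_min lexx orbT.
    rewrite !powRN lef_pV2 ?posrE ?powR_gt0//; last exact: lt_le_trans le1.
    apply: ge0_ler_powR; rewrite ?nnegrE ?invr_ge0 ?(ltW al0) ?(ltW pos1)//.
    by apply: ltW; exact: lt_le_trans le1.
move=> u k tau ktau.
pose x m := 1 - cosE (rho m) u.
have xE : (fun m => cosE (rho m) u ^+ k m) = (fun m => (1 - x m) ^+ k m).
  by apply/funext => m; rewrite /x subKr.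
have x0 m : 0 <= x m.
  by have := cosE_le1 (rho m) u; rewrite ler_norml subr_ge0 => /andP[].
have aoo2 : (fun m => K * a m `^ (2 - al) * enorm u ^+ 2) @ \oo --> 0.
  rewrite -(mul0r (enorm u ^+ 2)) -[X in X * _](mulr0 K).
  apply: cvgM; last exact: cvg_cst.
  apply: cvgM; first exact: cvg_cst.
  rewrite (_ : (fun m => a m `^ (2 - al)) = (fun m => (h m * c / al) `^ (al^-1 * (2 - al)))).
    by apply: powoo; rewrite mulr_gt0// invr_gt0.
  by apply/funext => m; rewrite /a powRrM.
have roo : (fun m => x m / h m - q m u) @ \oo --> 0.
  apply/cvgrPdist_le => e e0.
  move/cvgrPdist_le : aoo2 => /(_ _ e0); apply: filterS => m.
  rewrite !sub0r !normrN => /(le_trans (ler_norm _)); apply: le_trans.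
  rewrite -(ler_pM2l (h0 m)) -BE; apply: le_trans (rJ m u).
  rewrite -[X in X * `|_|](gtr0_norm (h0 m)) -normrM.
  rewrite mulrBr mulrC divfK ?gt_eqF// -cJ' /x -normrN.
  by rewrite le_eqVlt; apply/orP; left; apply/eqP; congr `|_|; ring.
have qoo : (fun m => x m / h m) @ \oo --> psi u.
  rewrite -(add0r (psi u)) (_ : (fun m => _) = (fun m => (x m / h m - q m u) + q m u)).
    exact: cvgD.
  by apply/funext => m; rewrite subrK.
rewrite xE; apply: onem_expn_cvg => //.
  rewrite (_ : x = (fun m => h m * (x m / h m))).
    by rewrite -(mul0r (psi u)); exact: cvgM.
  by apply/funext => m; rewrite mulrC divfK// gt_eqF.
rewrite (_ : (fun m => _ * _) = (fun m => ((k m)%:R * h m) * (x m / h m))).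
  exact: cvgM.
by apply/funext => m; rewrite -mulrA [h m * _]mulrC divfK// gt_eqF.
Qed.

End noise.

(** * Random walks and the Euler scheme *)

Section path_space.
Context {R : realType} {d : nat}.
Local Notation V := 'rV[R]_d.
Local Notation Rd := (@Rd R d).

Definition cylinders : set (set (nat -> V)) :=
  [set A | exists k (B : set Rd), measurable B /\ A = (fun w : nat -> V => w k) @^-1` B].

(** Infinite sequences let all schemes share one measurable space, whatever their number of steps.
    Coordinate 0 holds the initial value, coordinate k > 0 the k-th step of the noise, and the walk
    sets the coordinates beyond its horizon to 0. *)
Definition paths := g_sigma_algebraType cylinders.

Lemma meas_eval k : measurable_fun (setT : set paths) (fun w : paths => ((w : nat -> V) k) : Rd).
Proof.
move=> _ B mB; rewrite setTI; apply: sub_sigma_algebra.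
by exists k, B.
Qed.

Lemma meas_paths d' (T : measurableType d') (f : T -> paths) :
  (forall k, measurable_fun setT (fun z => ((f z : nat -> V) k) : Rd)) -> measurable_fun setT f.
Proof.
move=> mf; apply: (@measurability _ _ _ paths setT f cylinders) => //.
move=> _ [_ [k [B [mB ->]]] <-].
by have := mf k measurableT B mB.
Qed.

Definition upd (w : paths) (k : nat) (y : V) : paths := fun j => if j == k then y else (w : nat -> V) j.
Definition cut (k : nat) (w : paths) : paths := fun j => if (j <= k)%N then (w : nat -> V) j else 0.

Lemma meas_upd k : measurable_fun setT (fun z : (paths * Rd)%type => upd z.1 k z.2).
Proof.
apply: meas_paths => j; rewrite /upd; case: (j == k); first exact: measurable_snd.
exact: (measurableT_comp (meas_eval j) measurable_fst).
Qed.

Definition init (x : V) : paths := fun j => if j == 0%N then x else 0.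

Lemma meas_init : measurable_fun setT (fun x : Rd => init x).
Proof.
apply: meas_paths => j; rewrite /init; case: (j == 0%N); first exact: measurable_id.
exact: measurable_cst.
Qed.

Lemma cut_cut j k w : (j <= k)%N -> cut j (cut k w) = cut j w.
Proof.
move=> jk; apply/funext => i; rewrite /cut; case: ifP => // ij.
by rewrite (leq_trans ij jk).
Qed.

Lemma cut_upd k w y : cut k (upd w k.+1 y) = cut k w.
Proof.
apply/funext => i; rewrite /cut /upd; case: ifP => // ik.
by rewrite ltn_eqF.
Qed.

Section adapted_functions.
Context {Z : Type}.

Definition adaptk k (f : paths -> Z) := forall w, f (cut k w) = f w.

Lemma adaptk_mono j k f : (j <= k)%N -> adaptk j f -> adaptk k f.
Proof. by move=> jk af w; rewrite -af cut_cut// af. Qed.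

Lemma adaptk_upd k f w y : adaptk k f -> f (upd w k.+1 y) = f w.
Proof. by move=> af; rewrite -af cut_upd af. Qed.

End adapted_functions.

Section walk.
Variables (mu0 rho : probability Rd R).

Fixpoint walk k : probability paths R :=
  match k with
  | 0%N => law_of mu0 (pack_mfun meas_init)
  | k'.+1 => law_of (pprod (walk k') rho) (pack_mfun (meas_upd k'.+1))
  end.

Lemma Ex_walk0 (F : paths -> R) : bmf F -> Ex (walk 0) F = Ex mu0 (fun x : Rd => F (init x)).
Proof. by move=> bF; rewrite /= Ex_law. Qed.

Lemma Ex_walkS k (F : paths -> R) : bmf F ->
  Ex (walk k.+1) F = Ex (walk k) (fun w => Ex rho (fun y : Rd => F (upd w k.+1 y))).
Proof.
move=> bF; rewrite /= Ex_law//= (Ex_prod1 _ _ (f := fun z : (paths * Rd)%type => F (upd z.1 k.+1 z.2)))//.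
exact: (bmf_comp bF (meas_upd _)).
Qed.

Lemma Ex_walk_adapt k n (F : paths -> R) : (k <= n)%N -> bmf F -> adaptk k F ->
  Ex (walk n) F = Ex (walk k) F.
Proof.
move=> /subnK <- bF aF; elim: (n - k)%N => // m IH.
rewrite addSn Ex_walkS// -IH; apply: eq_Ex => w.
rewrite -[RHS](Ex_cst rho); apply: eq_Ex => y.
by apply: adaptk_upd; apply: adaptk_mono aF; exact: leq_addl.
Qed.

(** The step [k.+1] is independent of the past and has law [rho]. The weight [W] carries an event of
    the past, or the counter of a supermartingale. *)
Lemma walk_markov k n (W : paths -> R) (X : paths -> Rd) (f : V -> R) : (k < n)%N ->
  bmf W -> adaptk k W -> measurable_fun setT X -> adaptk k X -> @bmf R _ Rd f ->
  Ex (walk n) (fun w => W w * f ((X w : V) + (w : nat -> V) k.+1)) =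
  Ex (walk n) (fun w => W w * transl rho f (X w)).
Proof.
move=> kn bW aW mX aX bf.
have mXw : measurable_fun setT (fun w : paths => ((X w : V) + (w : nat -> V) k.+1) : Rd).
  by apply: mvD => //; exact: meas_eval.
have b1 : bmf (fun w => W w * f ((X w : V) + (w : nat -> V) k.+1)).
  by apply: bmfM => //; exact: (bmf_comp (T' := Rd) bf).
have b2 : bmf (fun w => W w * transl rho f (X w)).
  by apply: bmfM => //; apply: (bmf_comp (T' := Rd) _ mX); exact: bmf_transl.
rewrite (Ex_walk_adapt kn b1); last first.
  move=> w; rewrite -(adaptk_mono (leqnSn k) aW w) -(adaptk_mono (leqnSn k) aX w) /cut leqnn.
  by congr (W _ * f (X _ + _)).
rewrite (Ex_walk_adapt (ltnW kn) b2); last by move=> w; rewrite aW aX.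
rewrite Ex_walkS//; apply: eq_Ex => w.
rewrite -ExZ; last exact: bmf_shift.
apply: eq_Ex => y; rewrite !adaptk_upd//.
by rewrite /upd eqxx.
Qed.

End walk.
End path_space.

(** * The Euler scheme and the removal of its drift *)

Section scheme.
Context {R : realType} {d : nat}.
Local Notation V := 'rV[R]_d.
Local Notation Rd := (@Rd R d).
Local Notation paths := (@paths R d).
Variables (mu0 rho : probability Rd R) (N : nat) (h : R).
Variable (b : Rd -> pprobability Rd R -> Rd).
Hypothesis mb : measurable_fun setT (fun p : (Rd * pprobability Rd R)%type => b p.1 p.2).

Lemma meas_drift (m : pprobability Rd R) : measurable_fun (setT : set Rd) (fun x => b x m).
Proof. exact: (measurableT_comp mb (measurable_pair2 m)). Qed.

Local Notation P := (walk mu0 rho N).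

Lemma meas_step k (X : paths -> Rd) (m : pprobability Rd R) : measurable_fun setT X ->
  measurable_fun setT (fun w : paths =>
    ((X w : V) + h *: (b (X w) m : V) + (w : nat -> V) k) : Rd).
Proof.
move=> mX; apply: mvD; last exact: meas_eval.
apply: mvD => //; apply: mvZ.
exact: (measurableT_comp (meas_drift m) mX).
Qed.

(* The coefficients of step k involve the law of X_k, hence measurability is carried along. *)
Fixpoint Xsig k : {X : paths -> Rd | measurable_fun setT X} :=
  match k with
  | 0%N => exist _ _ (meas_eval 0)
  | k'.+1 => let X := Xsig k' in
     exist _ _ (meas_step k'.+1 (law_of P (pack_mfun (proj2_sig X))) (proj2_sig X))
  end.

Definition Xk k : paths -> V := proj1_sig (Xsig k).
Definition meas_Xk k : measurable_fun setT (Xk k : paths -> Rd) := proj2_sig (Xsig k).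
Definition lawk k : probability Rd R := law_of P (pack_mfun (meas_Xk k)).
Definition bk k (x : V) : V := b x (lawk k).

Lemma Xk0 w : Xk 0 w = (w : nat -> V) 0%N. Proof. by []. Qed.
Lemma XkS k w : Xk k.+1 w = Xk k w + h *: bk k (Xk k w) + (w : nat -> V) k.+1.
Proof. by []. Qed.

Lemma meas_bk k : measurable_fun (setT : set Rd) (bk k : Rd -> Rd).
Proof. exact: meas_drift. Qed.

Definition Lk k (w : paths) : V := \sum_(1 <= j < k.+1) (w : nat -> V) j.
Definition Yk k (w : paths) : V := \sum_(0 <= j < k) h *: bk j (Xk j w).

Lemma LkS k w : Lk k.+1 w = Lk k w + (w : nat -> V) k.+1.
Proof. by rewrite /Lk big_nat_recr. Qed.

Lemma YkS k w : Yk k.+1 w = Yk k w + h *: bk k (Xk k w).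
Proof. by rewrite /Yk big_nat_recr. Qed.

Lemma XkE k w : Xk k w = (w : nat -> V) 0%N + Yk k w + Lk k w.
Proof.
elim: k => [|k IH]; first by rewrite /Yk /Lk !big_geq// !addr0.
rewrite XkS YkS LkS {1}IH.
by rewrite -!addrA; congr (_ + (_ + _)); rewrite !addrA; congr (_ + _); rewrite addrC.
Qed.

Lemma meas_Lk k : measurable_fun setT (Lk k : paths -> Rd).
Proof. by apply: mv_sum => j; exact: meas_eval. Qed.

Lemma adaptk_Xk k : adaptk k (Xk k).
Proof.
elim: k => [w|k IH w]; first by rewrite !Xk0.
by rewrite !XkS (adaptk_mono (leqnSn k) IH) /cut leqnn.
Qed.

Lemma adaptk_Lk k : adaptk k (Lk k).
Proof.
move=> w; rewrite /Lk; apply: eq_big_nat => j /andP[_ jk].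
by rewrite /cut; rewrite ltnS in jk; rewrite jk.
Qed.

Lemma Ex_lawk k f : @bmf R _ Rd f -> Ex (lawk k) f = Ex P (fun w => f (Xk k w)).
Proof. by move=> bf; rewrite /lawk Ex_law. Qed.

Lemma Ex_walk_init f : @bmf R _ Rd f -> Ex P (fun w => f ((w : nat -> V) 0%N)) = Ex mu0 f.
Proof.
move=> bf.
have bF : bmf (fun w : paths => f ((w : nat -> V) 0%N)).
  exact: (bmf_comp (T' := Rd) bf (meas_eval 0)).
rewrite (Ex_walk_adapt _ _ (leq0n N) bF); last by move=> w; rewrite /cut leqnn.
by rewrite Ex_walk0.
Qed.

Lemma walk_incr j n (W : paths -> R) (X : paths -> Rd) (f : V -> R) : (j + n <= N)%N ->
  bmf W -> adaptk j W -> measurable_fun setT X -> adaptk j X -> @bmf R _ Rd f ->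
  Ex P (fun w => W w * f ((X w : V) + (Lk (j + n) w - Lk j w))) =
  Ex P (fun w => W w * titer rho n f (X w)).
Proof.
move=> jN bW aW mX aX bf.
elim: n f bf jN => [|n IH] f bf jN.
  by apply: eq_Ex => w; rewrite addn0 subrr addr0.
rewrite addnS in jN *.
have e w : (X w : V) + (Lk (j + n).+1 w - Lk j w) =
   ((X w : V) + (Lk (j + n) w - Lk j w)) + (w : nat -> V) (j + n).+1.
  by rewrite LkS addrAC addrA.
under eq_Ex do rewrite e.
have mX' : measurable_fun setT (fun w => ((X w : V) + (Lk (j + n) w - Lk j w)) : Rd).
  by apply: mvD => //; apply: mvB; exact: meas_Lk.
rewrite (walk_markov mu0 rho jN bW _ mX' _ bf); last 2 first.
- by apply: adaptk_mono aW; exact: leq_addr.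
- move=> w; rewrite (adaptk_mono (leq_addr n j) aX) (@adaptk_Lk (j + n)).
  by rewrite (adaptk_mono (leq_addr n j) (@adaptk_Lk j)).
rewrite (IH (transl rho f)); [|exact: bmf_transl|exact: ltnW].
by apply: eq_Ex => w; rewrite /titer -iterSr.
Qed.

Section drift_perturbation.
Variables (M C al : R).
Hypotheses (bM : forall x m, enorm (b x m) <= M) (h0 : 0 < h) (al1 : 1 < al) (C0 : 0 < C).
Hypothesis rhoN : noise al C h rho.

Let M0 : 0 <= M. Proof. by apply: le_trans (bM 0 mu0); exact: enorm_ge0. Qed.

Lemma Yk_lip j k w : (j <= k)%N -> enorm (Yk k w - Yk j w) <= M * h * (k - j)%:R.
Proof.
move=> jk; rewrite /Yk (@big_cat_nat _ _ _ j 0 k _ _ (leq0n j) jk)//= addrAC subrr add0r.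
apply: (le_trans (enorm_sum _ _)).
apply: (@le_trans _ _ (\sum_(j <= i < k) (M * h))).
  apply: ler_sum => i _; rewrite enormZ gtr0_norm// mulrC ler_pM2r//; exact: bM.
by rewrite sumr_const_nat mulr_natr.
Qed.

(** Comparison of the sum with an integral. Young's inequality yields (1 - 1/x)^q <= 1 - q/x, so
    that each term is at most the increment of x^q / q. *)
Lemma sum_powR_le n (p : R) : 0 < p < 1 ->
  \sum_(1 <= i < n.+1) i%:R `^ (- p) <= n%:R `^ (1 - p) / (1 - p).
Proof.
move=> /andP[p0 p1]; have q0 : 0 < 1 - p by rewrite subr_gt0.
set q := 1 - p in q0 *.
elim: n => [|n IH]; first by rewrite big_geq// powR0 ?mul0r// gt_eqF.
rewrite big_nat_recr//=; apply: (le_trans (lerD IH (lexx _))).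
set x : R := n.+1%:R.
have x0 : 0 < x by rewrite ltr0n.
have nx : n%:R = x * (1 - x^-1) by rewrite mulrBr mulr1 divff ?gt_eqF// /x -natr1 addrK.
have x1 : 0 <= 1 - x^-1.
  by rewrite subr_ge0 invf_le1// ler1n.
have amgm : (1 - x^-1) `^ q <= 1 - q * x^-1.
  have qi : 0 < q^-1 by rewrite invr_gt0.
  have pi' : 0 < p^-1 by rewrite invr_gt0.
  have e1 : q^-1^-1 + p^-1^-1 = 1 by rewrite !invrK /q subrK.
  have := @conjugate_powR R ((1 - x^-1) `^ q) 1 q^-1 p^-1 (powR_ge0 _ _) ler01 qi pi' e1.
  rewrite mulr1 powR1 -powRrM divff ?gt_eqF// powRr1// !invrK => /le_trans; apply.
  by rewrite le_eqVlt; apply/orP; left; apply/eqP; rewrite /q; ring.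
have qle : q <= 1 by rewrite /q; lra.
rewrite nx powRM//.
have -> : x `^ (- p) = x `^ q / x.
  rewrite -[X in _ / X](powRr1 (ltW x0)) -powRB; last by rewrite (gt_eqF x0) implybT.
  by congr (_ `^ _); rewrite /q; ring.
have xq : 0 <= x `^ q by exact: powR_ge0.
apply: (@le_trans _ _ (x `^ q * (1 - q * x^-1) / q + x `^ q / x)).
  by rewrite lerD2r ler_pM2r ?invr_gt0// ler_wpM2l.
rewrite le_eqVlt; apply/orP; left; apply/eqP; field.
by rewrite !gt_eqF.
Qed.

(** The drift is switched off one step at a time, from the last step backwards. Switching it off [i]
    steps before the end displaces the path by at most M h, while the function of the remaining pure
    noise has Lipschitz constant C (i h)^(-1/al). The sum of these costs is finite uniformly in [h]
    because al > 1. *)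
Lemma drift_perturb f k n : (n <= k)%N -> (k <= N)%N -> @bmf R _ Rd f -> (forall x, `|f x| <= 1) ->
  `|Ex P (fun w => f (Xk k w)) - Ex P (fun w => titer rho n f (Xk (k - n) w))| <=
    M * C / (1 - al^-1) * (n%:R * h) `^ (1 - al^-1).
Proof.
move=> nk kN bf f1.
have bT i j : bmf (fun w => titer rho i f (Xk j w)).
  by apply: (bmf_comp (T' := Rd) _ (meas_Xk j)); exact: bmf_titer.
have ai0 : 0 < al^-1 by rewrite invr_gt0; exact: lt_trans al1.
have ai1 : al^-1 < 1 by rewrite invf_lt1//; exact: lt_trans al1.
have S : `|Ex P (fun w => f (Xk k w)) - Ex P (fun w => titer rho n f (Xk (k - n) w))| <=
   \sum_(1 <= i < n.+1) M * C * h * (i%:R * h) `^ (- al^-1).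
  elim: n nk => [|n IH] nk; first by rewrite subn0 subrr normr0 big_geq.
  rewrite big_nat_recr//=.
  rewrite -[Ex P (fun w => f (Xk k w))](subrK (Ex P (fun w => titer rho n f (Xk (k - n) w)))) -addrA.
  apply: (le_trans (ler_normD _ _)); apply: lerD; first exact/IH/ltnW.
  have -> : (k - n = (k - n.+1).+1)%N by rewrite subnSK.
  set j := (k - n.+1)%N.
  have jN : (j < N)%N by apply: leq_trans kN; rewrite /j subnSK// leq_subr.
  have mstep : measurable_fun setT (fun w => (Xk j w + h *: bk j (Xk j w)) : Rd).
    apply: mvD; first exact: meas_Xk.
    by apply: mvZ; exact: (measurableT_comp (meas_bk j) (meas_Xk j)).
  have := walk_markov mu0 rho jN (bmf_cst 1) (fun w => erefl) mstep _ (bmf_titer rho n bf).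
  have aX : adaptk j (fun w => Xk j w + h *: bk j (Xk j w)).
    by move=> w; rewrite /= [Xk j (cut j w)](@adaptk_Xk j w).
  move=> /(_ aX) H.
  have -> : Ex P (fun w => titer rho n f (Xk j.+1 w)) =
      Ex P (fun w => titer rho n.+1 f (Xk j w + h *: bk j (Xk j w))).
    under eq_Ex do rewrite XkS -[titer _ _ _ _]mul1r.
    by rewrite H; apply: eq_Ex => w; rewrite mul1r.
  have b2 : bmf (fun w => titer rho n.+1 f (Xk j w + h *: bk j (Xk j w))).
    by apply: (bmf_comp (T' := Rd) _ mstep); exact: bmf_titer.
  rewrite -[X in _ - X]/(Ex P (fun w => titer rho n.+1 f (Xk j w))) -ExB//; apply: Ex_abs_le; first exact: bmfB.
  move=> w; case: rhoN => _ _ /(_ f n.+1 bf f1 isT) lT.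
  apply: (le_trans (lT _ _)); rewrite addrC addKr enormZ gtr0_norm//.
  have hb : enorm (bk j (Xk j w)) <= M by exact: bM.
  set D := (_ `^ _); have D0 : 0 <= C * D * h.
    by rewrite !mulr_ge0 ?powR_ge0// ltW.
  rewrite mulrA (_ : M * C * h * D = C * D * h * M); last by ring.
  by rewrite ler_wpM2l.
apply: (le_trans S).
have MC : 0 <= M * C * h by rewrite !mulr_ge0// ltW.
rewrite -mulr_sumr.
rewrite (eq_bigr (fun i => h `^ (- al^-1) * i%:R `^ (- al^-1))); last first.
  by move=> i _; rewrite powRM ?ler0n ?(ltW h0)// mulrC.
rewrite -mulr_sumr.
apply: (@le_trans _ _ (M * C * h * (h `^ (- al^-1) * (n%:R `^ (1 - al^-1) / (1 - al^-1))))).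
  rewrite ler_wpM2l// ler_wpM2l ?powR_ge0//; apply: sum_powR_le.
  by rewrite ai0.
rewrite powRM ?ler0n ?(ltW h0)//.
have -> : h `^ (1 - al^-1) = h * h `^ (- al^-1).
  by rewrite powRD ?(gt_eqF h0) ?implybT// powRr1// ltW.
by rewrite le_eqVlt; apply/orP; left; apply/eqP; ring.
Qed.

End drift_perturbation.
End scheme.

(** * Regularity, moments and oscillations of the walk *)

Section law_regularity.
Context {R : realType} {d : nat}.
Local Notation V := 'rV[R]_d.
Local Notation Rd := (@Rd R d).
Local Notation paths := (@paths R d).
Variables (mu0 rho : probability Rd R) (N : nat) (h : R).
Variable (b : Rd -> pprobability Rd R -> Rd).
Hypothesis mb : measurable_fun setT (fun p : (Rd * pprobability Rd R)%type => b p.1 p.2).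
Variables (M C al : R).
Hypotheses (bM : forall x m, enorm (b x m) <= M) (h0 : 0 < h) (al1 : 1 < al) (C0 : 0 < C).
Hypothesis rhoN : noise al C h rho.
Local Notation P := (walk mu0 rho N).
Local Notation X := (Xk mu0 rho N h mb).

(** The drift of the last [n] steps is removed for [f] and for its mollification alike. What remains
    is pure noise, for which the mollifier can be moved outside, where it acts on a Lipschitz
    function. *)
Lemma law_mollify (e : R) (e0 : 0 < e) f k n : (0 < n)%N -> (n <= k)%N -> (k <= N)%N ->
  @bmf R _ Rd f -> (forall x, `|f x| <= 1) ->
  `|Ex P (fun w => f (X k w)) - Ex P (fun w => transl (mollifier e0) f (X k w))| <=
    2 * (M * C / (1 - al^-1) * (n%:R * h) `^ (1 - al^-1)) +
    C * (n%:R * h) `^ (- al^-1) * (d%:R * e).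
Proof.
move=> n0 nk kN bf f1.
set B := M * C / _ * _.
have bg : @bmf R _ Rd (transl (mollifier e0) f) by exact: bmf_transl.
have g1 : forall x, `|transl (mollifier e0) f x| <= 1 by exact: transl_le1.
have bT g j : @bmf R _ Rd g -> bmf (fun w : paths => g (X j w)).
  by move=> bg'; apply: (bmf_comp (T' := Rd) bg' (meas_Xk _ _ _ _ _ _)).
have p1 := drift_perturb mu0 mb bM h0 al1 C0 rhoN nk kN bf f1.
have p2 := drift_perturb mu0 mb bM h0 al1 C0 rhoN nk kN bg g1.
rewrite -/B in p1 p2.
have p3 : `|Ex P (fun w => titer rho n f (X (k - n) w)) -
    Ex P (fun w => titer rho n (transl (mollifier e0) f) (X (k - n) w))| <=
    C * (n%:R * h) `^ (- al^-1) * (d%:R * e).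
  have bn : @bmf R _ Rd (titer rho n f) by exact: bmf_titer.
  have bn2 : @bmf R _ Rd (titer rho n (transl (mollifier e0) f)) by exact: bmf_titer.
  rewrite -ExB; [|exact: bT|exact: bT].
  apply: Ex_abs_le; first by apply: bmfB; exact: bT.
  move=> w; rewrite titerC// distrC.
  case: rhoN => _ _ /(_ f n bf f1 n0) lT.
  apply: transl_mollifier => //.
  by rewrite mulr_ge0 ?powR_ge0// ltW.
move: p1 p2 p3; move: (Ex P _) (Ex P _) (Ex P _) (Ex P _) => x1 x2 x3 x4 p1 p2 p3.
rewrite (_ : x4 - x2 = (x4 - x3) + (x3 - x1) - (x2 - x1)); last by ring.
apply: (le_trans (ler_normB _ _)).
have := ler_normD (x4 - x3) (x3 - x1); clearbody B; lra.
Qed.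

End law_regularity.

(** * Moments from characteristic functions *)

Section moments.
Context {R : realType} {d : nat}.
Local Notation V := 'rV[R]_d.
Local Notation Rd := (@Rd R d).

Lemma dyadic_scale (r z : R) (J : nat) : 0 < r -> r <= `|z| < r * 2 ^+ J ->
  exists2 j, (j < J)%N & r * 2 ^+ j <= `|z| < r * 2 ^+ j.+1.
Proof.
move=> r0; elim: J => [|J IH] /andP[z1 z2].
  by move: z2; rewrite expr0 mulr1 ltNge z1.
have [zJ|zJ] := ltP `|z| (r * 2 ^+ J).
  have [|j jJ hj] := IH; first by rewrite z1.
  by exists j => //; exact: ltnW.
by exists J => //; rewrite zJ.
Qed.

(** At the scale with r 2^j <= |z| < r 2^(j+1) the argument of the cosine has modulus in [1, 2],
    where 1 - cos is at least 1 - cos 1; the other terms are nonnegative. *)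
Lemma pow_le_dyadic (p r z : R) (J : nat) : 0 < p -> 0 < r -> `|z| < r * 2 ^+ J ->
  `|z| `^ p <= r `^ p + \sum_(j < J) (1 - cos 1)^-1 * (r * 2 ^+ j.+1) `^ p *
                                     (1 - cos ((r * 2 ^+ j)^-1 * z)).
Proof.
move=> p0 r0 zJ.
have c0 : 0 < (1 - cos 1)^-1 :> R by rewrite invr_gt0; exact: onem_cos1_gt0.
have t0 (j : 'I_J) : 0 <= (1 - cos 1)^-1 * (r * 2 ^+ j.+1) `^ p * (1 - cos ((r * 2 ^+ j)^-1 * z)).
  apply: mulr_ge0; last exact: onem_cos_ge0.
  by apply: mulr_ge0; [exact: ltW|exact: powR_ge0].
have [zr|rz] := leP `|z| r.
  apply: (@le_trans _ _ (r `^ p)).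
    by apply: ge0_ler_powR; rewrite ?nnegrE// ltW.
  by rewrite lerDl sumr_ge0.
have [|j jJ /andP[z1 z2]] := @dyadic_scale r z J r0; first by rewrite (ltW rz).
have rj : 0 < r * 2 ^+ j by apply: mulr_gt0 => //; exact: exprn_gt0.
rewrite (bigD1 (Ordinal jJ))//= addrCA.
apply: ler_wpDr; first by rewrite addr_ge0 ?powR_ge0// sumr_ge0.
apply: (@le_trans _ _ ((r * 2 ^+ j.+1) `^ p)).
  apply: ge0_ler_powR; rewrite ?nnegrE ?(ltW p0)//; last exact: ltW.
  by rewrite exprS mulrCA mulr_ge0// ltW.
rewrite mulrAC -[leLHS]mul1r ler_wpM2r ?powR_ge0//.
rewrite mulrC ler_pdivlMr ?onem_cos1_gt0// mul1r; apply: onem_cos_ge.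
rewrite normrM gtr0_norm ?invr_gt0// mulrC ler_pdivlMr// mul1r z1/= ler_pdivrMr//.
by rewrite mulrCA -exprS ltW.
Qed.

Lemma pow2_lt1 (q : R) : q < 0 -> 2 `^ q < 1 :> R.
Proof.
move=> q0; rewrite /powR gt_eqF// expR_lt1 nmulr_rlt0// ln_gt0//.
by rewrite ltr1n.
Qed.

Lemma dyadic_geometric (r p al : R) (J : nat) : 0 < r -> p < al ->
  \sum_(j < J) (r * 2 ^+ j.+1) `^ p * ((r * 2 ^+ j)^-1) `^ al <=
    2 `^ p * r `^ (p - al) / (1 - 2 `^ (p - al)).
Proof.
move=> r0 pal.
have two n : (2 : R) ^+ n = 2 `^ n%:R by rewrite powR_mulrn.
have e (j : 'I_J) : (r * 2 ^+ j.+1) `^ p * ((r * 2 ^+ j)^-1) `^ al =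
   2 `^ p * r `^ (p - al) * (2 `^ (p - al)) ^+ j.
  have x0 : 0 < r * 2 ^+ j by apply: mulr_gt0 => //; exact: exprn_gt0.
  rewrite exprS mulrCA powRM ?(ltW x0)// -!mulrA; congr (_ * _).
  rewrite -(powR_inv1 (ltW x0)) -powRrM mulN1r -powRD; last first.
    by rewrite (gt_eqF x0) implybT.
  rewrite powRM ?(ltW r0)// ?exprn_ge0//; congr (_ * _).
  by rewrite two -powRrM mulrC -powR_mulrn ?powR_ge0// -powRrM.
rewrite (eq_bigr _ (fun j _ => e j)) -mulr_sumr.
have q1 : 2 `^ (p - al) < 1 :> R.
  by apply: pow2_lt1; lra.
have q0 : 0 <= 2 `^ (p - al) :> R by exact: powR_ge0.
move: q1 q0; set q := 2 `^ (p - al) => q1 q0.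
apply: ler_wpM2l; first by rewrite mulr_ge0 ?powR_ge0.
have d0 : 0 < 1 - q by lra.
rewrite -[leRHS]mul1r ler_pdivlMr// mulrC.
have -> : (1 - q) * (\sum_(i < J) q ^+ i) = 1 - q ^+ J.
  have := subrXX 1 q J; rewrite expr1n => ->; congr (_ * _).
  by apply: eq_bigr => i _; rewrite expr1n mul1r.
by rewrite lerBlDr lerDl exprn_ge0.
Qed.

Let dscale (i : 'I_d) (t : R) : V := t^-1 *: delta_mx 0 i.

(* Moments are controlled by the characteristic function through
   |z|^p <= r^p + C sum_j (r 2^j)^p (1 - cos (z / (r 2^j))), the sum being over dyadic scales. *)
Lemma moment_le (p al C dl : R) : 1 <= p -> p < al -> al < 2 -> 0 <= C -> 0 < dl ->
  exists2 C' : R, 0 <= C' & forall (Q : probability Rd R) (tau : R), 0 <= tau ->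
    (forall u : V, 1 - cosE Q u <= C * tau * (enorm u `^ al + enorm u ^+ 2)) ->
    forall n : nat, Ex Q (fun x => Num.min (enorm (x : V) `^ p) n%:R) <= dl + C' * tau.
Proof.
move=> p1 pal al2 C0 dl0.
have p0 : 0 < p by lra.
pose D : R := d%:R `^ p * d%:R.
have D0 : 0 <= D by rewrite mulr_ge0 ?powR_ge0.
(* [D] is the price of passing from the norm to the coordinates; with this [r] the part of the
   coordinates below [r] contributes at most [dl]. *)
pose r : R := (dl / (D + 1)) `^ p^-1.
have D1 : 0 < D + 1 by rewrite ltr_wpDl.
have q0 : 0 < dl / (D + 1) by exact: divr_gt0.
have r0 : 0 < r by exact: powR_gt0.
have rp : D * r `^ p <= dl.
  rewrite /r -powRrM mulVf ?gt_eqF// powRr1 ?(ltW q0)// mulrCA ger_pMr//.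
  by rewrite ler_pdivrMr// mul1r lerDl.
pose g (q : R) := 2 `^ p * r `^ (p - q) / (1 - 2 `^ (p - q)).
pose c : R := (1 - cos 1)^-1.
have c0 : 0 < c by rewrite invr_gt0; exact: onem_cos1_gt0.
have pow1 (q : R) : p < q -> 2 `^ (p - q) < 1 :> R.
  by move=> pq; apply: pow2_lt1; lra.
have g0 (q : R) : p < q -> 0 <= g q.
  move=> /pow1 pq; rewrite /g mulr_ge0// ?mulr_ge0 ?powR_ge0//.
  by rewrite invr_ge0 subr_ge0 ltW.
have p2 : p < 2 by lra.
pose C' := D * (c * C * (g al + g 2)).
exists C' => [|Q tau tau0 HQ n].
  by rewrite /C' !mulr_ge0 ?addr_ge0 ?g0 ?(ltW c0).
pose S J (i : 'I_d) (x : V) := \sum_(j < J) c * (r * 2 ^+ j.+1) `^ p *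
    (1 - cos (dotv (dscale i (r * 2 ^+ j)) x)).
have bS J i : @bmf R _ Rd (S J i).
  apply: bmf_sum => j; apply: bmfZ; apply: bmfB; [exact: bmf_cst|exact: bmf_cos].
have ES J i : Ex Q (S J i) <= c * C * (g al + g 2) * tau.
  rewrite /S Ex_sum; last first.
    by move=> j; apply: bmfZ; apply: bmfB; [exact: bmf_cst|exact: bmf_cos].
  apply: (@le_trans _ _ (\sum_(j < J) c * C * tau * ((r * 2 ^+ j.+1) `^ p * ((r * 2 ^+ j)^-1) `^ al +
       (r * 2 ^+ j.+1) `^ p * ((r * 2 ^+ j)^-1) `^ 2))).
    apply: ler_sum => j _.
    have x0 : 0 < r * 2 ^+ j by apply: mulr_gt0 => //; exact: exprn_gt0.
    rewrite ExZ; last by apply: bmfB; [exact: bmf_cst|exact: bmf_cos].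
    rewrite ExB; [|exact: bmf_cst|exact: bmf_cos].
    rewrite Ex_cst -/(cosE Q _).
    have := HQ (dscale i (r * 2 ^+ j)).
    rewrite /dscale enormZ enorm_delta mulr1 gtr0_norm ?invr_gt0//.
    rewrite -(@powR_mulrn _ _ 2) ?invr_ge0 ?(ltW x0)// => h.
    rewrite -mulrDr -!mulrA (ler_pM2l c0).
    rewrite [leRHS]mulrA [leRHS]mulrCA ler_wpM2l ?powR_ge0//.
  rewrite -mulr_sumr big_split/= mulrAC ler_wpM2r//.
  rewrite ler_wpM2l ?mulr_ge0 ?(ltW c0)//.
  by apply: lerD; exact: dyadic_geometric.
(* Only finitely many scales are summed at a time, so the moment is first cut to |x| < r 2^J;
   dominated convergence removes the cut. *)
pose f J (x : V) := if enorm x < r * 2 ^+ J then Num.min (enorm x `^ p) n%:R else 0.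
have f0 J x : 0 <= f J x.
  by rewrite /f; case: ifP => // _; rewrite le_min powR_ge0/=.
have fn J x : f J x <= n%:R.
  by rewrite /f; case: ifP => // _; rewrite ge_min lexx orbT.
have mp : measurable_fun (setT : set Rd) (fun x => enorm (x : V) `^ p).
  exact: (measurableT_comp (@measurable_powR R p) meas_enorm).
have bmin : @bmf R _ Rd (fun x => Num.min (enorm (x : V) `^ p) n%:R).
  split; first by apply: measurable_minr => //; exact: measurable_cst.
  exists n%:R => x; rewrite ger0_norm ?le_min ?powR_ge0//=.
  by rewrite ge_min lexx orbT.
have mf J : measurable_fun (setT : set Rd) (f J).
  apply: measurable_fun_ifT; [|exact: bmin.1|exact: measurable_cst].
  by apply: measurable_fun_ltr; [exact: meas_enorm|exact: measurable_cst].
have bf J : @bmf R _ Rd (f J).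
  by split; [exact: mf|exists n%:R => x; rewrite ger0_norm].
have fS J x : f J x <= d%:R `^ p * \sum_(i < d) (r `^ p + S J i x).
  have S0 i : 0 <= S J i x.
    rewrite /S; apply: sumr_ge0 => j _; apply: mulr_ge0; last exact: onem_cos_ge0.
    by rewrite mulr_ge0 ?powR_ge0 ?(ltW c0).
  have T0 : 0 <= d%:R `^ p * \sum_(i < d) (r `^ p + S J i x).
    by rewrite mulr_ge0 ?powR_ge0// sumr_ge0// => i _; rewrite addr_ge0 ?powR_ge0.
  rewrite /f; case: ifP => // hx; rewrite ge_min; apply/orP; left.
  apply: (@le_trans _ _ (d%:R `^ p * \sum_(i < d) `|x 0 i| `^ p)); last first.
    rewrite ler_wpM2l ?powR_ge0//; apply: ler_sum => i _.
    have xi : `|x 0 i| < r * 2 ^+ J by apply: le_lt_trans hx; exact: coord_le.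
    apply: (le_trans (pow_le_dyadic p0 r0 xi)).
    rewrite lerD2l /S; apply: ler_sum => j _.
    by rewrite /dscale dotvZl dotv_delta.
  pose Sg := \sum_(i < d) `|x 0 i| `^ p.
  have Sg0 : 0 <= Sg by apply: sumr_ge0 => i _; exact: powR_ge0.
  have xs : enorm x <= d%:R * Sg `^ p^-1.
    apply: enorm_le_max => i.
    rewrite -[leLHS](powRr1 (normr_ge0 _)) -(mulfV (lt0r_neq0 p0)) powRrM.
    apply: ge0_ler_powR; rewrite ?nnegrE ?powR_ge0 ?invr_ge0 ?(ltW p0)//.
    by rewrite /Sg (bigD1 i)//= lerDl sumr_ge0// => j _; exact: powR_ge0.
  apply: (@le_trans _ _ ((d%:R * Sg `^ p^-1) `^ p)).
    apply: ge0_ler_powR; rewrite ?nnegrE ?enorm_ge0 ?(ltW p0)//.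
    by rewrite mulr_ge0 ?powR_ge0.
  by rewrite powRM ?powR_ge0// -powRrM mulVf ?gt_eqF// powRr1.
have Ef J : Ex Q (f J) <= dl + C' * tau.
  have bsum : @bmf R _ Rd (fun x => \sum_(i < d) (r `^ p + S J i x)).
    by apply: bmf_sum => i; apply: bmfD; [exact: bmf_cst|exact: bS].
  apply: (@le_trans _ _ (Ex Q (fun x => d%:R `^ p * \sum_(i < d) (r `^ p + S J i x)))).
    by apply: Ex_le => //; apply: bmfZ.
  rewrite ExZ// Ex_sum; last by move=> i; apply: bmfD; [exact: bmf_cst|exact: bS].
  apply: (@le_trans _ _ (d%:R `^ p * \sum_(i < d) (r `^ p + c * C * (g al + g 2) * tau))).
    rewrite ler_wpM2l ?powR_ge0//; apply: ler_sum => i _.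
    rewrite ExD; [|exact: bmf_cst|exact: bS].
    by rewrite Ex_cst lerD2l.
  rewrite (_ : _ * _ = D * r `^ p + C' * tau) ?lerD2r//.
  have key (x y z w v : R) : x * ((y + w * C * z * tau) * v) = x * v * y + x * v * (w * C * z) * tau.
    by ring.
  by rewrite sumr_const card_ord -[X in _ * X]mulr_natr; exact: key.
have fcv x : f^~ x @ \oo --> Num.min (enorm (x : V) `^ p) n%:R.
  apply: cvg_near_cst.
  have [k hk] : exists k : nat, enorm x / r < k%:R.
    by exists (Num.bound (enorm x / r)); apply: archi_boundP; rewrite divr_ge0 ?enorm_ge0 ?(ltW r0).
  exists k => // J /= kJ; rewrite /f ifT//.
  rewrite mulrC -ltr_pdivrMr//; apply: (lt_trans hk).
  by rewrite -natrX ltr_nat; apply: leq_ltn_trans kJ _; exact: ltn_expl.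
have [_ fc] := @Ex_dominated _ _ _ Q f _ n%:R mf (fun J x => ltac:(by rewrite ger0_norm)) fcv.
rewrite -(cvg_lim _ fc)//; apply: limr_le; first exact: (cvgP _ fc).
by apply: nearW => J; exact: Ef.
Qed.

End moments.

Section convolution_powers.
Context {R : realType} {d : nat}.
Local Notation V := 'rV[R]_d.
Local Notation Rd := (@Rd R d).
Variable rho : probability Rd R.

Fixpoint convn n : probability Rd R := if n is n'.+1 then conv rho (convn n') else \d_ (0 : Rd).

Lemma titer_convn n f : @bmf R _ Rd f -> titer rho n f = transl (convn n) f.
Proof.
move=> bf; elim: n => [|n IH] /=.
  apply/funext => x; rewrite /transl /Ex integral_dirac//; last first.
    by apply/measurable_EFinP; exact: bmf_meas (bmf_shift x bf).
  by rewrite diracT mul1e/= addr0.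
by apply/funext => x; rewrite transl_conv// IH.
Qed.

Lemma trig_convn u n : sinE rho u = 0 -> sinE (convn n) u = 0 /\ cosE (convn n) u = cosE rho u ^+ n.
Proof.
move=> s0; elim: n => [|n [IH1 IH2]] /=.
  have hd (f : V -> R) : @bmf R _ Rd f -> Ex \d_(0 : Rd) f = f 0.
    move=> bf; rewrite /Ex integral_dirac//; last by apply/measurable_EFinP; exact: bmf_meas bf.
    by rewrite diracT mul1e.
  rewrite /sinE /cosE hd; last exact: bmf_sin.
  rewrite hd; last exact: bmf_cos.
  by rewrite dotv0r sin0 cos0.
by have [-> ->] := trig_conv s0 IH1; rewrite exprS IH2.
Qed.

End convolution_powers.

Section convn_moment.
Context {R : realType} {d : nat}.
Local Notation V := 'rV[R]_d.
Local Notation Rd := (@Rd R d).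

(** For |f| <= 1 one has 1 - f^n <= n (1 - f), which makes the bound linear in the elapsed time. The
    constant is the same for all admissible noises and step sizes, so that it survives the limit. *)
Lemma convn_moment (p al C dl : R) : 1 <= p -> p < al -> al < 2 -> 0 < C -> 0 < dl ->
  exists2 C' : R, 0 <= C' & forall (rho : probability Rd R) (h : R) (n : nat), 0 < h ->
    noise al C h rho ->
    forall k : nat, Ex (convn rho n) (fun x => Num.min (enorm (x : V) `^ p) k%:R) <= dl + C' * (n%:R * h).
Proof.
move=> p1 pal al2 C0 dl0; have [C' C'0 H] := moment_le p1 pal al2 (ltW C0) dl0 (d := d).
exists C' => // rho h n h0 [s0 c0 _] k.
have nh : 0 <= n%:R * h by rewrite mulr_ge0// ltW.
apply: H => // u; have [_ ->] := trig_convn n (s0 u).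
have /andP[f0 f1] := c0 u.
have := cosE_le1 rho u; move: f0 f1; set f := cosE rho u => f0 f1; rewrite ler_norml => /andP[g0 g1].
apply: (@le_trans _ _ (n%:R * (1 - f))).
  have := subrXX 1 f n; rewrite expr1n => ->; rewrite mulrC ler_wpM2r//.
  rewrite -[n in n%:R]card_ord -sumr_const; apply: ler_sum => i _.
  rewrite expr1n mul1r; apply: (le_trans (ler_norm _)); rewrite normrX.
  by apply: exprn_ile1 => //; rewrite ler_norml g0.
apply: (@le_trans _ _ (n%:R * (C * h * (enorm u `^ al + enorm u ^+ 2)))).
  by rewrite ler_wpM2l.
by rewrite le_eqVlt; apply/orP; left; apply/eqP; ring.
Qed.

End convn_moment.

(** * The number of oscillations of a random walk *)

Section oscillations.
Context {R : realType} {d : nat}.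
Local Notation V := 'rV[R]_d.
Local Notation Rd := (@Rd R d).
Local Notation paths := (@paths R d).

Section greedy_count.
Variables (eps : R) (l : nat -> V).

(** A pair of counter and anchor: the recursive form of successive exit times from balls of radius
    [eps]. The counter bounds the length of every chain of increments larger than [2 * eps]. *)
Fixpoint osc k : nat * V :=
  if k is k'.+1 then
    let ca := osc k' in if eps < enorm (l k - ca.2) then (ca.1.+1, l k) else ca
  else (0%N, l 0%N).

Hypothesis eps0 : 0 <= eps.

Lemma osc_anchor k : enorm (l k - (osc k).2) <= eps.
Proof.
case: k => [|k] /=; first by rewrite subrr enorm0.
by case: ltP => //= _; rewrite subrr enorm0.
Qed.

Lemma osc_homo i j : (i <= j)%N ->
  ((osc i).1 <= (osc j).1)%N /\ ((osc i).1 = (osc j).1 -> osc i = osc j).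
Proof.
move=> /subnK <-; elim: (j - i)%N => // n [IH1 IH2].
rewrite addSn/=; case: ltP => //= _.
by split => [|e]; [exact: leq_trans (leqnSn _)|move: IH1; rewrite e ltnn].
Qed.

(** With an unchanged counter the anchor is unchanged too, and both values are within [eps] of
    it. *)
Lemma osc_jump i j : (i <= j)%N -> 2 * eps < enorm (l j - l i) -> ((osc i).1 < (osc j).1)%N.
Proof.
move=> ij lij; have [h1 h2] := osc_homo ij.
rewrite ltn_neqAle h1 andbT; apply/eqP => /h2 e.
have := enorm_tri (l j) (osc j).2 (l i).
have a1 := osc_anchor i; have a2 := osc_anchor j; rewrite e enormB in a1; lra.
Qed.

Lemma osc_chain i s :
  path (fun i j => (i <= j)%N && (2 * eps < enorm (l j - l i))) i s -> (size s <= (osc (last i s)).1)%N.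
Proof.
move=> h; suff : ((osc i).1 + size s <= (osc (last i s)).1)%N by apply: leq_trans; exact: leq_addl.
elim: s i h => [|j s IH] i /=; first by rewrite addn0.
move=> /andP[/andP[ij lij] /IH]; apply: leq_trans.
by rewrite addnS -addSn leq_add2r osc_jump.
Qed.

End greedy_count.

Variables (mu0 rho : probability Rd R) (N : nat) (k0 n : nat) (eps : R) (th : V -> R).
Hypotheses (kN : (k0 + n <= N)%N) (eps0 : 0 < eps) (bth : @bmf R _ Rd th).
Hypothesis th01 : forall x, 0 <= th x <= 1.
Hypothesis th1 : forall x, eps / 2 <= enorm x -> th x = 1.
Hypothesis thn : forall j, (j <= n)%N -> titer rho j th 0 <= 4^-1.
Local Notation P := (walk mu0 rho N).

Let l (w : paths) i := Lk (k0 + i) w.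
Let z i (w : paths) : R := 2 ^+ (osc eps (l w) i).1.
Let a i (w : paths) : V := (osc eps (l w) i).2.

Let z0 i w : 0 <= z i w. Proof. exact: exprn_ge0. Qed.

Let zS i w : z i.+1 w = if eps < enorm (l w i.+1 - a i w) then 2 * z i w else z i w.
Proof. by rewrite /z /a /=; case: ifP => //= _; rewrite exprS. Qed.

Let aS i w : a i.+1 w = if eps < enorm (l w i.+1 - a i w) then l w i.+1 else a i w.
Proof. by rewrite /a /=; case: ifP. Qed.

Let mza i : measurable_fun setT (z i) /\ measurable_fun setT (a i : paths -> Rd).
Proof.
elim: i => [|i [IH1 IH2]].
  by split; [exact: measurable_cst|exact: meas_Lk].
have mc : measurable_fun setT (fun w => eps < enorm (l w i.+1 - a i w)).
  apply: measurable_fun_ltr; first exact: measurable_cst.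
  apply: (measurableT_comp (@meas_enorm R d)); apply: mvB => //; exact: meas_Lk.
split.
  apply: (eq_measurable_fun (fun w => if eps < enorm (l w i.+1 - a i w) then 2 * z i w else z i w)).
    by move=> w _; rewrite zS.
  apply: measurable_fun_ifT => //; exact: measurable_funM.
apply: (eq_measurable_fun ((fun w => if eps < enorm (l w i.+1 - a i w) then l w i.+1 else a i w) : paths -> Rd)).
  by move=> w _; rewrite aS.
by apply: measurable_fun_ifT => //; exact: meas_Lk.
Qed.

Let az i : adaptk (k0 + i) (z i) /\ adaptk (k0 + i) (a i).
Proof.
elim: i => [|i [IH1 IH2]].
  by split => w //; rewrite /a /= /l addn0 adaptk_Lk.
have e w : l (cut (k0 + i.+1) w) i.+1 = l w i.+1 by rewrite /l adaptk_Lk.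
have le : (k0 + i <= k0 + i.+1)%N by rewrite leq_add2l.
have ae w : a i (cut (k0 + i.+1) w) = a i w by exact: (adaptk_mono le IH2).
have ze w : z i (cut (k0 + i.+1) w) = z i w by exact: (adaptk_mono le IH1).
by split => w; rewrite ?zS ?aS !e !ae ?ze.
Qed.

Lemma bmf_osc i : bmf (fun w : paths => 2 ^+ (osc eps (fun i => Lk (k0 + i) w) i).1 : R).
Proof.
rewrite -/(z i).
split; first exact: (mza i).1.
exists (2 ^+ i) => w; rewrite ger0_norm ?exprn_ge0// -/(z i w).
elim: i => [//|i IH]; rewrite zS exprS; case: ifP => _; first by rewrite ler_pM2l.
by apply: (le_trans IH); rewrite ler_peMl ?exprn_ge0// ler1n.
Qed.

Let bz i : bmf (z i). Proof. exact: bmf_osc. Qed.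

(** [th] stands in for the indicator of being at distance eps/2 from 0. If |x| > eps, then y or x +
    y is that far from 0, so th(x + y) + th(y) >= 1, and the second term has mean at most 1/4. *)
Let far j x : (j <= n)%N -> eps < enorm x -> 3 / 4 <= titer rho j th x.
Proof.
move=> jn xe; have := thn jn; rewrite !titer_convn// /transl => h.
have s0 : @bmf R _ Rd (fun y => th (0 + y)) by exact: bmf_shift.
have sx : @bmf R _ Rd (fun y => th (x + y)) by exact: bmf_shift.
suff : 1 <= Ex (convn rho j) (fun y => th (x + y)) + Ex (convn rho j) (fun y => th (0 + y)).
  lra.
rewrite -ExD// -(Ex_cst (convn rho j) 1); apply: Ex_le; [exact: bmf_cst|exact: bmfD|].
move=> y; rewrite add0r.
have [ye|ye] := leP (eps / 2) (enorm y); first by rewrite (th1 ye) lerDr; have /andP[] := th01 (x + y).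
rewrite th1 ?lerDl; first by have /andP[] := th01 y.
have := enormD (x + y) (- y); rewrite addrK enormN; lra.
Qed.

(* z_i (titer (n - i) th (l_i - a_i) + 1/4) is a supermartingale: a jump doubles z, but it resets
   the second factor from at least 1 to at most 1/2 *)
Lemma Ex_osc : Ex P (fun w => 2 ^+ (osc eps (fun i => Lk (k0 + i) w) n).1) <= 2.
Proof.
pose D i (w : paths) : V := l w i - a i w.
pose S i w := z i w * (titer rho (n - i) th (D i w) + 4^-1).
have mD i : measurable_fun setT (D i : paths -> Rd).
  by apply: mvB; [exact: meas_Lk|exact: (mza i).2].
have bT j (F : paths -> Rd) : measurable_fun setT F -> bmf (fun w => titer rho j th (F w)).
  by move=> mF; apply: (bmf_comp (T' := Rd) _ mF); exact: bmf_titer.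
have bS i : bmf (S i).
  by apply: bmfM => //; apply: bmfD; [exact: bT|exact: bmf_cst].
have step i : (i < n)%N -> Ex P (S i.+1) <= Ex P (S i).
  move=> ni.
  pose S' w := z i w * (titer rho (n - i.+1) th (D i w + (w : nat -> V) (k0 + i).+1) + 4^-1).
  have lS w : l w i.+1 = l w i + (w : nat -> V) (k0 + i).+1 by rewrite /l addnS LkS.
  have mD' : measurable_fun setT (fun w => (D i w + (w : nat -> V) (k0 + i).+1) : Rd).
    by apply: mvD => //; exact: meas_eval.
  have bS' : bmf S'.
    by apply: bmfM => //; apply: bmfD; [exact: bT|exact: bmf_cst].
  have le1 w : S i.+1 w <= S' w.
    rewrite /S /S' zS.
    have -> : D i w + (w : nat -> V) (k0 + i).+1 = l w i.+1 - a i w by rewrite lS /D addrAC.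
    rewrite /D aS; case: ifP => // jp; rewrite subrr.
    have h1 := far (leq_subr i.+1 n) jp.
    have h2 := thn (leq_subr i.+1 n).
    rewrite -mulrA mulrCA ler_wpM2l//; lra.
  apply: (@le_trans _ _ (Ex P S')); first exact: Ex_le.
  rewrite le_eqVlt; apply/orP; left; apply/eqP.
  have kiN : (k0 + i < N)%N by apply: leq_trans kN; rewrite ltn_add2l.
  have [az1 az2] := az i.
  have aD : adaptk (k0 + i) (D i).
    by move=> w; rewrite /D az2 /l adaptk_Lk.
  have := walk_markov mu0 rho kiN (bz i) az1 (mD i) aD (bmf_titer rho (n - i.+1) bth).
  rewrite /S' /S => H.
  under eq_Ex do rewrite mulrDr.
  under [RHS]eq_Ex do rewrite mulrDr.
  have b4 : bmf (fun w => z i w * 4^-1) by apply: bmfM => //; exact: bmf_cst.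
  rewrite ExD//; last by apply: bmfM => //; exact: bT.
  rewrite ExD//; last by apply: bmfM => //; exact: bT.
  by rewrite H -[(n - i)%N](subnSK ni).
have all_i i : (i <= n)%N -> Ex P (S i) <= Ex P (S 0%N).
  by elim: i => // i IH ni; apply: (le_trans (step _ ni)); exact/IH/ltnW.
have S0 : Ex P (S 0%N) <= 2^-1.
  apply: Ex_le_cst => // w; rewrite /S /z /D /a /= expr0 mul1r subrr subn0.
  have := thn (leqnn n); lra.
have : Ex P (fun w => z n w * 4^-1) <= 2^-1.
  apply: le_trans S0; apply: le_trans (all_i _ (leqnn n)); apply: Ex_le => //.
    by apply: bmfM => //; exact: bmf_cst.
  move=> w; rewrite /S subnn/= ler_wpM2l// lerDr.
  by have /andP[] := th01 (D n w).
under eq_Ex do rewrite mulrC.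
rewrite ExZ// -/(z n); lra.
Qed.

End oscillations.

(** * The Loeb space of an ultraproduct *)

Section ultrafilter.
Context {R : realType}.

Definition ult : set_system nat :=
  projT1 (cid (@ultraFilterLemma nat (\oo : set_system nat) _)).

Lemma ult_ultra : UltraFilter ult.
Proof. by rewrite /ult; case: cid => ? []. Qed.

#[global] Instance ult_proper : ProperFilter ult.
Proof. exact: (@ultra_proper _ _ ult_ultra). Qed.

Lemma ult_ge n : ult [set m | (n <= m)%N].
Proof.
rewrite /ult; case: cid => G [_ sub] /=; apply: sub.
by exists n.
Qed.

Lemma ult_oo (A : set nat) : (\oo : set_system nat) A -> ult A.
Proof. by rewrite /ult; case: cid => G [_ sub] /= /sub. Qed.

Lemma ultC (A : set nat) : ult (~` A) <-> ~ ult A.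
Proof.
split=> [h1 h2|h]; last by case: (in_ultra_setVsetC A ult_ultra).
by have [m []] := filter_ex (filterI h1 h2).
Qed.

Lemma ultU (A B : set nat) : ult (A `|` B) <-> ult A \/ ult B.
Proof.
split=> [h|[]]; last 2 first.
- by apply: filterS; exact: subsetUl.
- by apply: filterS; exact: subsetUr.
have [hA|/ultC hA] := pselect (ult A); first by left.
by right; apply: filterS (filterI h hA) => m [[//|//]] + /(_ _)[].
Qed.

Definition ulim (x : nat -> R) : R := lim (x @ ult).

Lemma cvg_ulim (x : nat -> R) (M : R) : ult [set m | `|x m| <= M] -> x @ ult --> ulim x.
Proof.
move=> xM; have UF : UltraFilter (x @ ult).
  split=> [|G GF sG]; first exact: fmap_proper_filter.
  apply/seteqP; split => A; last exact: sG.
  move=> GA; apply: contrapT => nA.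
  have /sG nGA : (x @ ult) (~` A) by apply/ultC.
  by have [y []] := filter_ex (filterI GA nGA).
have := @segment_compact R (- M) M; rewrite compact_ultra => /(_ _ UF).
have h : (x @ ult) [set` `[- M, M]].
  by apply: filterS xM => m /=; rewrite in_itv/= ler_norml.
by move=> /(_ h)[l [_ xl]]; exact: (cvgP l xl).
Qed.

Lemma ulimE (x : nat -> R) (l : R) : x @ ult --> l -> ulim x = l.
Proof. exact: cvg_lim. Qed.

Lemma ult_unique (x : nat -> R) (l l' : R) : x @ ult --> l -> x @ ult --> l' -> l = l'.
Proof. by move=> /ulimE <- /ulimE <-. Qed.

Lemma ult_le (x y : nat -> R) (l l' : R) : x @ ult --> l -> y @ ult --> l' ->
  ult [set m | x m <= y m] -> l <= l'.
Proof. by move=> xl yl xy; exact: (ler_cvg_to xl yl). Qed.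

Lemma ult_le_cst (x : nat -> R) (l c : R) : x @ ult --> l -> ult [set m | x m <= c] -> l <= c.
Proof. by move=> xl; apply: ult_le (xl) (@cvg_cst _ c _ _ _). Qed.

Lemma ult_ge_cst (x : nat -> R) (l c : R) : x @ ult --> l -> ult [set m | c <= x m] -> c <= l.
Proof. by move=> xl; apply: ult_le (@cvg_cst _ c _ _ _) (xl). Qed.

Lemma ult_near_eq (x y : nat -> R) (l : R) : x @ ult --> l -> ult [set m | x m = y m] -> y @ ult --> l.
Proof.
move=> xl xy; apply: cvg_trans xl; apply: near_eq_cvg.
by apply: filterS xy => m /= ->.
Qed.

Lemma ult_sum (I : Type) (s : seq I) (x : I -> nat -> R) (l : I -> R) :
  (forall i, x i @ ult --> l i) -> (fun m => \sum_(i <- s) x i m) @ ult --> \sum_(i <- s) l i.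
Proof.
move=> xl; elim: s => [|i s IH].
  by rewrite big_nil; under eq_fun do rewrite big_nil; exact: cvg_cst.
by rewrite big_cons; under eq_fun do rewrite big_cons; exact: cvgD.
Qed.

End ultrafilter.

Section null_sets.
Context {R : realType} {d : measure_display} {S : measurableType d}.
Variable P : nat -> probability S R.
Local Notation Om := (nat -> S).
Implicit Types (N : set Om) (B C : nat -> set S).

(* the internal set with components B m *)
Definition star B : set Om := [set w | ult [set m | B m (w m)]].
Definition pr m (A : set S) : R := fine (P m A).

Lemma pr_ge0 m (A : set S) : 0 <= pr m A. Proof. exact: fine_ge0. Qed.
Lemma pr_le1 m (A : set S) : measurable A -> pr m A <= 1.
Proof.
move=> mA; rewrite /pr -lee_fin fineK ?fin_num_measure//; exact: probability_le1.
Qed.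
Lemma pr_le m (A A' : set S) : measurable A -> measurable A' -> A `<=` A' -> pr m A <= pr m A'.
Proof.
by move=> mA mA' AA'; rewrite /pr fine_le ?fin_num_measure// le_measure ?inE.
Qed.
Lemma prU m (A A' : set S) : measurable A -> measurable A' ->
  pr m (A `|` A') + pr m (A `&` A') = pr m A + pr m A'.
Proof.
move=> mA mA'; have mI : measurable (A `&` A') by exact: measurableI.
have mU : measurable (A `|` A') by exact: measurableU.
apply/eqP; rewrite -eqe !EFinD !fineK ?fin_num_measure//.
have := @measureUfinl _ _ _ (P m) A A' mA mA'.
move=> /(_ _)->; last by rewrite -ge0_fin_numE ?fin_num_measure.
by rewrite subeK ?fin_num_measure.
Qed.
Lemma pr0 m : pr m set0 = 0. Proof. by rewrite /pr measure0. Qed.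
Lemma prT m : pr m setT = 1. Proof. by rewrite /pr probability_setT. Qed.

(** Counterexamples chosen in each bad component assemble to one point of the product. *)
Lemma star_sub B C : star B `<=` star C <-> ult [set m | B m `<=` C m].
Proof.
split=> [h|h w hB]; last by apply: filterS (filterI h hB) => m [/= s /s].
apply: contrapT => /ultC hn.
have hx m : exists x : S, ~ (B m `<=` C m) -> B m x /\ ~ C m x.
  have [hs|/existsNP[x /not_implyP hx]] := pselect (B m `<=` C m); first by exists point.
  by exists x.
have /choice[w hw] := hx.
have wB : star B w by apply: filterS hn => m /= /hw[].
have : star (fun m => ~` C m) w by apply: filterS hn => m /= /hw[].
by move=> /ultC; apply; exact: h.
Qed.

Lemma starC B : star (fun m => ~` B m) = ~` star B.
Proof. by apply/seteqP; split => w; [move/ultC|move=> h; apply/ultC]. Qed.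

Lemma starI B C : star (fun m => B m `&` C m) = star B `&` star C.
Proof.
apply/seteqP; split => [w h|w [h1 h2]]; last exact: filterI.
by split; apply: filterS h => m [].
Qed.

Lemma starU B C : star (fun m => B m `|` C m) = star B `|` star C.
Proof. by apply/seteqP; split => w; [move/ultU|move=> h; apply/ultU]. Qed.

Lemma star_set0 : star (fun=> set0) = set0.
Proof. by apply/seteqP; split => w // /filter_ex[]. Qed.

(** Outer Loeb measure 0, defined before the measure exists: the measurable sets will be the sets
    that differ from an internal one by such a set. *)
Definition lnull N := forall e : R, 0 < e -> exists B,
  [/\ (forall m, measurable (B m)), N `<=` star B & ult [set m | pr m (B m) <= e]].

Lemma lnullS N N' : N' `<=` N -> lnull N -> lnull N'.
Proof.
move=> NN h e /h [B [mB NB pB]]; exists B; split => //.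
exact: subset_trans NB.
Qed.

Lemma lnull0 : lnull set0.
Proof.
move=> e e0; exists (fun=> set0); split => //.
by apply: filterE => m /=; rewrite pr0 ltW.
Qed.

Lemma sum_half (e : R) m : \sum_(0 <= i < m) e / 2 ^+ i.+1 = e - e / 2 ^+ m.
Proof.
elim: m => [|m IH]; first by rewrite big_geq// expr0 divr1 subrr.
rewrite big_nat_recr//= IH exprS; field.
by rewrite expf_neq0.
Qed.

(** Component [m] of the cover is the union of only the first [m] covers, each replaced by the empty
    set where it is too large. Every fixed cover is present in almost all components, and the
    measures are summable to at most [e]. *)
Lemma lnull_bigcup (N : nat -> set Om) : (forall i, lnull (N i)) -> lnull (\bigcup_i N i).
Proof.
move=> h e e0.
have ei i : 0 < e / 2 ^+ i.+1 by rewrite divr_gt0// exprn_gt0.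
have /choice[B hB] : forall i, exists B, [/\ (forall m, measurable (B m)), N i `<=` star B &
   ult [set m | pr m (B m) <= e / 2 ^+ i.+1]] by move=> i; exact: h.
pose C i m := if pr m (B i m) <= e / 2 ^+ i.+1 then B i m else set0.
have mC i m : measurable (C i m) by rewrite /C; case: ifP => // _; have [] := hB i.
have pC i m : pr m (C i m) <= e / 2 ^+ i.+1.
  by rewrite /C; case: ifP => // _; rewrite pr0 ltW.
pose D m := \big[setU/set0]_(0 <= i < m) C i m.
have mD n m : measurable (\big[setU/set0]_(0 <= i < n) C i m).
  by apply: bigsetU_measurable => i _.
exists D; split.
- by move=> m; exact: mD.
- move=> w [i _ Nw]; have [_ /(_ _ Nw) Bw pB] := hB i.
  apply: filterS (filterI (filterI pB Bw) (ult_ge i.+1)) => m [[/= pm Bm] im].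
  rewrite /D big_mkord -(bigcup_mkord m (C^~ m)); exists i => //=.
  by rewrite /C pm.
- apply: filterE => m /=.
  apply: (@le_trans _ _ (e - e / 2 ^+ m)); last first.
    by rewrite lerBlDr lerDl divr_ge0 ?exprn_ge0// ltW.
  rewrite -sum_half /D.
  suff : forall n, pr m (\big[setU/set0]_(0 <= i < n) C i m) <= \sum_(0 <= i < n) e / 2 ^+ i.+1.
    exact.
  elim => [|n IH]; first by rewrite !big_geq// pr0.
  rewrite !big_nat_recr//=; apply: le_trans (lerD IH (pC n m)).
  by rewrite -prU// lerDl pr_ge0.
Qed.

Lemma lnullU N N' : lnull N -> lnull N' -> lnull (N `|` N').
Proof.
move=> h h'; apply: (@lnullS (\bigcup_i (if i == 0%N then N else N'))).
  by move=> w [Nw|Nw]; [exists 0%N|exists 1%N].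
by apply: lnull_bigcup => i; case: ifP.
Qed.

Lemma lnull_star B : (forall m, measurable (B m)) -> lnull (star B) <->
  (fun m => pr m (B m)) @ ult --> (0 : R).
Proof.
move=> mB; split=> h.
  apply/cvgrPdist_le => e /h [C [mC /star_sub BC pC]].
  apply: filterS (filterI BC pC) => m [/= bc pm].
  by rewrite sub0r normrN ger0_norm ?pr_ge0// (le_trans _ pm)// pr_le.
move=> e e0; exists B; split => //.
move/cvgrPdist_le : h => /(_ _ e0); apply: filterS => m /=.
by rewrite sub0r normrN ger0_norm// pr_ge0.
Qed.

Definition agree (A A' : set Om) := lnull [set w | ~ (A w <-> A' w)].

Lemma agree_refl (A : set Om) : agree A A.
Proof. by apply: lnullS lnull0 => w /= h; exfalso; exact: h. Qed.

Lemma agree_sym (A A' : set Om) : agree A A' -> agree A' A.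
Proof. by apply: lnullS => w /=; apply: contra_not; tauto. Qed.

Lemma agree_trans (A A' A'' : set Om) : agree A A' -> agree A' A'' -> agree A A''.
Proof.
move=> h h'; apply: lnullS (lnullU h h') => w /= hn.
by apply: contrapT => /not_orP[/contrapT h1 /contrapT h2]; apply: hn; tauto.
Qed.

Lemma agreeC (A A' : set Om) : agree A A' -> agree (~` A) (~` A').
Proof. by apply: lnullS => w /=; apply: contra_not => h; split; apply: contra_not; tauto. Qed.

Lemma agree_bigcup (A A' : nat -> set Om) : (forall i, agree (A i) (A' i)) ->
  agree (\bigcup_i A i) (\bigcup_i A' i).
Proof.
move=> h; apply: lnullS (lnull_bigcup h) => w /= hn.
apply: contrapT => hh; apply: hn; split => -[i _ Ai]; exists i => //;
  by apply: contrapT => ni; apply: hh; exists i => //=; tauto.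
Qed.

Definition ipr B : R := ulim (fun m => pr m (B m)).

Lemma ipr_cvg B : (forall m, measurable (B m)) -> (fun m => pr m (B m)) @ ult --> ipr B.
Proof.
move=> mB; apply: (@cvg_ulim _ _ 1); apply: filterE => m /=.
by rewrite ger0_norm ?pr_ge0// pr_le1.
Qed.

Lemma ipr_ge0 B : (forall m, measurable (B m)) -> 0 <= ipr B.
Proof. by move=> /ipr_cvg h; apply: (ult_ge_cst h); apply: filterE => m; exact: pr_ge0. Qed.

Lemma ipr_le B C : (forall m, measurable (B m)) -> (forall m, measurable (C m)) ->
  (forall m, B m `<=` C m) -> ipr B <= ipr C.
Proof.
move=> mB mC BC; apply: (ult_le (ipr_cvg mB) (ipr_cvg mC)).
by apply: filterE => m; apply: pr_le.
Qed.

Lemma ipr_agree B C : (forall m, measurable (B m)) -> (forall m, measurable (C m)) ->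
  agree (star B) (star C) -> ipr B = ipr C.
Proof.
move=> mB mC h; apply/eqP; rewrite eq_le.
suff key (B' C' : nat -> set S) : (forall m, measurable (B' m)) -> (forall m, measurable (C' m)) ->
    agree (star B') (star C') -> ipr B' <= ipr C'.
  by apply/andP; split; apply: key => //; exact: agree_sym.
move=> mB' mC' h'.
have mD m : measurable (B' m `&` ~` C' m) by apply: measurableI => //; exact: measurableC.
have : lnull (star (fun m => B' m `&` ~` C' m)).
  by apply: lnullS h'; rewrite starI starC => w [h1 h2] [h3 _]; exact: h2 (h3 h1).
move=> /(lnull_star mD) D0.
have := cvgD (ipr_cvg mC') D0; rewrite addr0 => CD.
apply: (ult_le (ipr_cvg mB') (CD _)); apply: filterE => m /=.
rewrite [leRHS](_ : _ = pr m (C' m) + pr m (B' m `&` ~` C' m))//.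
rewrite -prU// -[leLHS]addr0; apply: lerD; last exact: pr_ge0.
apply: pr_le => //; first exact: measurableU.
by move=> x Bx; have [Cx|Cx] := pselect (C' m x); [left|right].
Qed.

Lemma iprU B C : (forall m, measurable (B m)) -> (forall m, measurable (C m)) ->
  lnull (star B `&` star C) -> ipr (fun m => B m `|` C m) = ipr B + ipr C.
Proof.
move=> mB mC; rewrite -starI => h.
have mI m : measurable (B m `&` C m) by exact: measurableI.
have mU m : measurable (B m `|` C m) by exact: measurableU.
move: h => /(lnull_star mI) I0.
have := cvgD (ipr_cvg mU) I0; rewrite addr0 => h1.
apply: ult_unique (h1 _) _.
rewrite (_ : _ + _ = (fun m => pr m (B m) + pr m (C m))).
  by apply: cvgD; exact: ipr_cvg.
by apply/funext => m; rewrite /= -prU.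
Qed.

End null_sets.

(** * The Loeb measure *)

Section loeb.
Context {R : realType} {d : measure_display} {S : measurableType d}.
Variable P : nat -> probability S R.
Local Notation Om := (nat -> S).
Local Notation pr := (pr P).
Local Notation ipr := (ipr P).
Local Notation lnull := (lnull P).
Local Notation agree := (agree P).

(** The components may be all measurable sets, which gives the Loeb space itself, or the events of a
    discrete past, which gives its filtration. *)
Record internal_algebra (G : nat -> set (set S)) : Prop := InternalAlgebra {
  ialg_meas : forall m, G m `<=` measurable;
  ialg0 : forall m, G m set0;
  ialgC : forall m B, G m B -> G m (~` B);
  ialgU : forall m B C, G m B -> G m C -> G m (B `|` C) }.

(** Internal sets up to null sets. By [saturation] this is already a sigma-algebra, and it contains
    all subsets of null sets. *)
Definition lsets (G : nat -> set (set S)) : set (set Om) :=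
  [set A | exists B : nat -> set S, (forall m, G m (B m)) /\ agree A (star B)].

Lemma lsets_star G B : (forall m, G m (B m)) -> lsets G (star B).
Proof. by move=> GB; exists B; split => //; exact: agree_refl. Qed.

Lemma lsets_mono G G' : (forall m, G m `<=` G' m) -> lsets G `<=` lsets G'.
Proof. by move=> GG A [B [GB AB]]; exists B; split => // m; exact: GG. Qed.

Lemma lsets_null G N : internal_algebra G -> lnull N -> lsets G N.
Proof.
move=> iG hN; exists (fun=> set0); split; first by move=> m; exact: ialg0.
apply: lnullS hN => w; rewrite /= star_set0 => hn.
by apply: contrapT => hw; apply: hn.
Qed.

Lemma bigsetU_ialg G (B : nat -> nat -> set S) n m : internal_algebra G ->
  (forall i m, G m (B i m)) -> G m (\big[setU/set0]_(i < n) B i m).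
Proof.
move=> iG GB; elim: n => [|n IH]; first by rewrite big_ord0; exact: ialg0.
by rewrite big_ord_recr; exact: ialgU.
Qed.

(** A diagonal argument. Component [m] of [C] is the union of the first [nu m] sets, with [nu m] as
    large as possible while the measure stays within 1/(n+1) of the limit [l]. As [nu] tends to
    infinity along [ult], [C] contains every [star (B i)]; as its measure is only [l], the excess is
    null. *)
Lemma saturation G (B : nat -> nat -> set S) : internal_algebra G -> (forall i m, G m (B i m)) ->
  exists C : nat -> set S, [/\ (forall m, G m (C m)), agree (star C) (\bigcup_i star (B i)) &
    (fun n => ipr (fun m => \big[setU/set0]_(i < n) B i m)) @ \oo --> ipr C].
Proof.
move=> iG GB.
have mG m A : G m A -> measurable A by exact: ialg_meas.
pose Bn n m := \big[setU/set0]_(i < n) B i m.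
have GBn n m : G m (Bn n m) by exact: (@bigsetU_ialg G B n m iG GB).
have mBn n m : measurable (Bn n m) by exact: mG.
have Bn_le n n' m : (n <= n')%N -> Bn n m `<=` Bn n' m.
  move=> nn w; rewrite /Bn -!(bigcup_mkord _ (B^~ m)) => -[i /= ni Bi].
  by exists i => //=; exact: leq_trans nn.
pose p n := ipr (Bn n).
have p_nd : nondecreasing_seq p.
  by move=> n n' nn; apply: ipr_le => // m; exact: Bn_le.
have p_ub : has_ubound (range p).
  exists 1 => _ [n _ <-]; apply: (ult_le_cst (ipr_cvg (P := P) (mBn n))).
  by apply: filterE => m; exact: pr_le1.
have p_cvg := nondecreasing_cvgn p_nd p_ub.
set l := sup (range p) in p_cvg.
have p_le n : p n <= l by apply: ub_le_sup => //; exists n.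
pose E n m := (n <= m)%N && (pr m (Bn n m) <= l + n.+1%:R^-1).
have uE n : ult [set m | E n m].
  have lt : p n < l + n.+1%:R^-1 by apply: le_lt_trans (p_le n) _; rewrite ltrDl invr_gt0.
  apply: filterS (filterI (ult_ge n) (cvgr_lt _ (ipr_cvg (P := P) (mBn n)) _ lt)) => m [/= h1 h2].
  by rewrite /E h1 ltW.
(* The clause n <= m in [E] makes this a maximum over finitely many candidates. *)
pose nu m := \max_(n < m.+1 | E n m) (n : nat).
have nu_ge n m : E n m -> (n <= nu m)%N.
  move=> Enm; have nm : (n < m.+1)%N by move: Enm => /andP[].
  exact: (@leq_bigmax_cond _ (fun i : 'I_m.+1 => E i m) (fun i => i : nat) (Ordinal nm)).
have nuE m : E 0%N m -> E (nu m) m.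
  by move=> E0; rewrite /nu; elim/big_ind: _ => // x y Ex Ey; rewrite /maxn; case: ifP.
pose C m := Bn (nu m) m.
have GC m : G m (C m) by exact: GBn.
have mC m : measurable (C m) by exact: mG.
have uC n : ult [set m | Bn n m `<=` C m /\ pr m (C m) <= l + n.+1%:R^-1].
  apply: filterS (filterI (uE n) (uE 0%N)) => m [/= En E0].
  have nn := nu_ge _ _ En; split; first exact: Bn_le.
  have /andP[_ h] := nuE _ E0; apply: (le_trans h).
  by rewrite lerD2l lef_pV2 ?posrE// ler_nat.
have iC : ipr C = l.
  apply/eqP; rewrite eq_le; apply/andP; split.
    apply/ler_addgt0Pr => e e0; have [n ne] : exists n : nat, n.+1%:R^-1 <= e.
      by have [n /ltW] := @ltr_add_invr R 0 e e0; rewrite add0r; exists n.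
    apply: (le_trans _ (lerD (lexx l) ne)); apply: (ult_le_cst (ipr_cvg (P := P) mC)).
    by apply: filterS (uC n) => m [].
  apply: sup_le_ub; first by exists (p 0%N), 0%N.
  move=> _ [n _ <-]; apply: (ult_le (ipr_cvg (P := P) (mBn n)) (ipr_cvg (P := P) mC)).
  by apply: filterS (uC n) => m [/= h _]; exact: pr_le.
exists C; split => //; last by rewrite iC.
have sub : \bigcup_i star (B i) `<=` star C.
  move=> w [i _ Bw]; apply: filterS (filterI Bw (uC i.+1)) => m [/= Bm [h _]].
  by apply: h; rewrite /Bn -(bigcup_mkord _ (B^~ m)); exists i => /=.
move=> e e0.
have e2 : 0 < e / 2 by rewrite divr_gt0.
have [n [ne np]] : exists n : nat, n.+1%:R^-1 <= e / 2 /\ l - p n < e / 2.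
  have [k hk] := @ltr_add_invr R 0 _ e2; rewrite add0r in hk.
  move/cvgrPdist_lt : p_cvg => /(_ _ e2) [k' _ hk'].
  exists (maxn k k'); split.
    apply: le_trans (ltW hk); rewrite lef_pV2 ?posrE// ler_nat ltnS leq_maxl//.
  by have := hk' (maxn k k') (leq_maxr _ _); exact: le_lt_trans (ler_norm _).
have mD m : measurable (C m `&` ~` Bn n m) by apply: measurableI => //; exact: measurableC.
exists (fun m => C m `&` ~` Bn n m); split => //.
- move=> w /= hn.
  have Cw : star C w by apply: contrapT => h; apply: hn; split => // /sub.
  have nw : ~ (\bigcup_i star (B i)) w by move=> h; apply: hn; split.
  rewrite starI; split => //; rewrite starC => Bw; apply: nw.
  apply: contrapT => h.
  suff : forall k, star (fun m => ~` Bn k m) w by move=> /(_ n); rewrite starC; exact.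
  elim=> [|k IH]; first by apply: filterE => m; rewrite /Bn/= big_ord0.
  have nk : star (fun m => ~` B k m) w by rewrite starC => hk; apply: h; exists k.
  apply: filterS (filterI IH nk) => m [/= h1 h2].
  by rewrite /Bn/= big_ord_recr/= => -[].
- have lt : l - e / 2 < p n by rewrite ltrBlDl -ltrBlDr.
  have h : ult [set m | l - e / 2 < pr m (Bn n m)] by exact: (cvgr_gt _ (ipr_cvg (P := P) (mBn n)) _ lt).
  apply: filterS (filterI (uC n) h) => m [/= [BC pC] pB].
  have := prU P m (mBn n m) (mD m).
  rewrite setICA setICr setI0 pr0 addr0 => pU.
  have := pr_le P m (measurableU _ _ (mBn n m) (mD m)) (mC m).
  have sU : Bn n m `|` C m `&` ~` Bn n m `<=` C m by move=> x [/BC|[]].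
  move=> /(_ sU); rewrite pU; clearbody l; move: ne pC pB.
  by move: (n.+1%:R^-1) (pr m (C m)) (pr m (Bn n m)) (pr m _) => x1 x2 x3 x4; lra.
Qed.

Lemma lsets_sigma G : internal_algebra G -> sigma_algebra setT (lsets G).
Proof.
move=> iG; split.
- by apply: lsets_null => //; exact: lnull0.
- move=> A [B [GB AB]]; rewrite setTD; exists (fun m => ~` B m); split.
    by move=> m; apply: ialgC.
  by rewrite starC; exact: agreeC.
- move=> A /choice[B hB].
  have [C [GC CB _]] := saturation iG (fun i => (hB i).1).
  exists C; split => //; apply: agree_trans (agree_sym CB).
  by apply: agree_bigcup => i; have [] := hB i.
Qed.

Definition all_internal : nat -> set (set S) := fun=> measurable.

Lemma all_internal_algebra : internal_algebra all_internal.
Proof.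
split=> [m A|m|m B|m B C]; rewrite /all_internal//=.
- exact: measurableC.
- exact: measurableU.
Qed.

(** Generation adds no sets, by [lmeasE]; it merely provides the measurable type, in particular one
    for the past up to each time, on which adaptedness is ordinary measurability. *)
Definition ltype G := g_sigma_algebraType (lsets G).

Lemma lmeasE G (A : set (ltype G)) : internal_algebra G -> measurable A <-> lsets G A.
Proof. by move=> iG; rewrite /measurable/= sigma_algebra_id//; exact: lsets_sigma. Qed.

Definition loeb := ltype all_internal.

Lemma loeb_measE (A : set loeb) : measurable A <-> lsets all_internal A.
Proof. exact: lmeasE all_internal_algebra. Qed.

(** A chosen internal representative; the empty default makes the measure a total function. *)
Definition rep (A : set Om) : nat -> set S :=
  if pselect (lsets all_internal A) is left h then projT1 (cid h) else fun=> set0.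

Lemma repP (A : set Om) : lsets all_internal A -> (forall m, measurable (rep A m)) /\ agree A (star (rep A)).
Proof. by rewrite /rep; case: pselect => // h _; case: cid. Qed.

Definition loeb_fun (A : set loeb) : \bar R := (ipr (rep A))%:E.

Lemma loeb_funE A B : (forall m, measurable (B m)) -> agree A (star B) -> loeb_fun A = (ipr B)%:E.
Proof.
move=> mB AB; have [mR AR] : (forall m, measurable (rep A m)) /\ agree A (star (rep A)).
  by apply: repP; exists B.
congr (_%:E); apply: ipr_agree => //; apply: agree_trans AB; exact: agree_sym.
Qed.

Let ipr0 : ipr (fun=> set0) = 0.
Proof. by apply: ulimE; under eq_fun do rewrite pr0; exact: cvg_cst. Qed.

Let loeb0 : loeb_fun set0 = 0%E.
Proof.
by rewrite (@loeb_funE _ (fun=> set0)) ?ipr0 ?star_set0//; exact: agree_refl.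
Qed.

Let loeb_ge0 A : (0 <= loeb_fun A)%E.
Proof.
rewrite lee_fin; apply: ipr_ge0 => m; rewrite /rep; case: pselect => // h.
have [mR _] := projT2 (cid h); exact: mR.
Qed.

Let loeb_sigma_additive : semi_sigma_additive loeb_fun.
Proof.
move=> F mF tF _.
have hF i := repP ((loeb_measE (F i)).1 (mF i)).
pose B i := rep (F i).
have mB i m : measurable (B i m) by exact: (hF i).1.
have [C [mC CB pC]] := saturation all_internal_algebra mB.
rewrite (@loeb_funE _ C) => //; last first.
  apply: agree_trans (agree_sym CB); apply: agree_bigcup => i; by have [] := hF i.
have mU n m : measurable (\big[setU/set0]_(i < n) B i m).
  by apply: bigsetU_measurable => i _.
(* The sets themselves are disjoint, so their internal representatives can only overlap in a null
   set. *)
have disj n : lnull (star (fun m => \big[setU/set0]_(i < n) B i m) `&` star (B n)).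
  apply: lnullS (lnull_bigcup (fun i => (hF i).2)) => w [h1 h2].
  apply: contrapT => h.
  have eqF i : F i w <-> star (B i) w.
    by apply: contrapT => hi; apply: h; exists i.
  suff [i ni Biw] : exists2 i, (i < n)%N & star (B i) w.
    have := tF i n Logic.I Logic.I (ex_intro _ w (conj ((eqF i).2 Biw) ((eqF n).2 h2))).
    by move=> e; rewrite e ltnn in ni.
  elim: n h1 {h2} => [|n IH].
    by under eq_fun do rewrite big_ord0; rewrite star_set0.
  under eq_fun do rewrite big_ord_recr/=.
  rewrite starU => -[/IH[i ni Bi]|Bn]; last by exists n.
  by exists i => //; exact: ltnW.
rewrite (_ : (fun n => _) = EFin \o (fun n => ipr (fun m => \big[setU/set0]_(i < n) B i m))).
  by apply: cvg_EFin => //; exact: nearW.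
apply/funext => n /=; elim: n => [|n IH].
  rewrite big_geq//; congr (_%:E); apply/esym/ulimE.
  by under eq_fun do rewrite big_ord0 pr0; exact: cvg_cst.
rewrite big_nat_recr//= IH /loeb_fun -EFinD -iprU; [|exact: mU|exact: mB|exact: disj].
by congr ((ipr _)%:E); apply/funext => m; rewrite big_ord_recr.
Qed.

HB.instance Definition _ := isMeasure.Build _ loeb R loeb_fun loeb0 loeb_ge0 loeb_sigma_additive.

Let loebT : loeb_fun setT = 1%E.
Proof.
rewrite (@loeb_funE _ (fun=> setT))//; last first.
  by apply: lnullS (lnull0 P) => w /= h; apply: h; split => // _; exact: filterT.
by congr (_%:E); apply: ulimE; under eq_fun do rewrite prT; exact: cvg_cst.
Qed.

HB.instance Definition _ := @Measure_isProbability.Build _ _ R loeb_fun loebT.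

Definition loebP : probability loeb R := loeb_fun.

Lemma loeb_star B : (forall m, measurable (B m)) -> loebP (star B) = (ipr B)%:E.
Proof. by move=> mB; apply: loeb_funE => //; exact: agree_refl. Qed.

Lemma loeb_null (N : set loeb) : lnull N -> measurable N /\ loebP N = 0%E.
Proof.
move=> hN; split; first by apply/loeb_measE; apply: lsets_null => //; exact: all_internal_algebra.
rewrite [LHS](@loeb_funE _ (fun=> set0)) ?ipr0// star_set0.
by apply: lnullS hN => w /= hn; apply: contrapT => hw; apply: hn.
Qed.

Lemma null_loeb (N : set loeb) : measurable N -> loebP N = 0%E -> lnull N.
Proof.
move=> /loeb_measE [B [mB NB]]; rewrite [loebP _](loeb_funE mB NB) => -[iB].
have h : lnull (star B) by apply/(lnull_star P mB); rewrite -iB; exact: ipr_cvg.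
apply: lnullS (lnullU NB h) => w Nw.
by have [Bw|nB] := pselect (star B w); [right|left => -[/(_ Nw)]].
Qed.

End loeb.

(** * Standard parts and their expectations *)

Section standard_part.
Context {R : realType} {d : measure_display} {S : measurableType d}.
Variable P : nat -> probability S R.
Local Notation Om := (nat -> S).
Local Notation lnull := (lnull P).

Lemma Ex_le_ae d' (T : measurableType d') (Q : probability T R) (f g : T -> R) (N : set T) :
  bmf f -> bmf g -> measurable N -> Q N = 0%E -> (forall x, ~ N x -> f x <= g x) -> Ex Q f <= Ex Q g.
Proof.
move=> bf bg mN N0 fg.
have [M [M0 hM]] := bmf_bound bf; have [M' [M'0 hM']] := bmf_bound bg.
have bN : bmf (fun x => (M + M') * (\1_N x : R)) by apply: bmfZ; exact: bmf_indic.
apply: (@le_trans _ _ (Ex Q (fun x => g x + (M + M') * \1_N x))).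
  apply: Ex_le => //; first exact: bmfD.
  move=> x; have [Nx|Nx] := pselect (N x); last first.
    by rewrite indicE memNset// mulr0 addr0 fg.
  rewrite indicE mem_set// mulr1; have := hM x; have := hM' x.
  rewrite !ler_norml => /andP[h1 h2] /andP[h3 h4]; lra.
rewrite ExD// ExZ; last exact: bmf_indic.
by rewrite Ex_indic// N0/= mulr0 addr0.
Qed.

Lemma Ex_eq0 d' (T : measurableType d') (Q : probability T R) (f : T -> R) :
  bmf f -> (forall x, 0 <= f x) -> Ex Q f = 0 ->
  measurable [set x | 0 < f x] /\ Q [set x | 0 < f x] = 0%E.
Proof.
move=> bf f0 E0.
have mf (r : R) : measurable [set x | r < f x].
  rewrite (_ : [set x | r < f x] = f @^-1` `]r, +oo[); last first.
    by apply/seteqP; split => x /=; rewrite in_itv/= andbT.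
  by rewrite -[X in measurable X]setTI; exact: bf.1.
split => //.
rewrite (_ : [set x | 0 < f x] = \bigcup_n [set x | n.+1%:R^-1 < f x]); last first.
  apply/seteqP; split => [x /= fx|x [n _ /=]]; last by apply: lt_trans; rewrite invr_gt0.
  by have [n] := ltr_add_invr fx; rewrite add0r => h; exists n.
apply/eqP; rewrite -measure_le0; apply: le_trans (@measure_sigma_subadditive _ _ _ Q _ (fun n => [set x | n.+1%:R^-1 < f x]) _ _ _) _ => //.
  exact: bigcupT_measurable.
rewrite eseries0// => n _ _.
have := @Ex_le _ _ _ Q (fun x => n.+1%:R^-1 * \1_[set x | n.+1%:R^-1 < f x] x) f.
rewrite ExZ; last exact: bmf_indic.
rewrite Ex_indic// E0 => h.
have {}h : n.+1%:R^-1 * fine (Q [set x | n.+1%:R^-1 < f x]) <= 0.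
  apply: h => //; first by apply: bmfZ; exact: bmf_indic.
  move=> x; rewrite indicE; case: (boolP (_ \in _)) => [|_]; last by rewrite mulr0.
  by rewrite inE /= mulr1 => /ltW.
apply/eqP; rewrite -measure_le0 -[X in (X <= _)%E]fineK ?fin_num_measure// lee_fin.
by move: h; rewrite pmulr_rle0 // invr_gt0.
Qed.

Section internal_function.
Variables (G : nat -> set (set S)) (W : nat -> S -> R) (f : Om -> R).
Hypotheses (iG : internal_algebra G) (GW : forall m r, G m [set x | r < W m x]).
Hypothesis Wf : lnull [set w | ~ ((fun m => W m (w m)) @ ult --> f w)].

(** The event r < f agrees with the countable union of the internal events r + 1/(n+1) < W; the
    margin is needed because limits lose strict inequalities. *)
Lemma meas_st : measurable_fun setT (f : ltype P G -> R).
Proof.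
have h (r : R) : measurable ([set w | r < f w] : set (ltype P G)).
  apply/(lmeasE _ iG).
  have hB (n : nat) : lsets P G (star (fun m => [set x | r + n.+1%:R^-1 < W m x])).
    exact: lsets_star.
  have [_ _ sU] := @lsets_sigma _ _ _ P _ iG.
  have [B [GB AB]] := sU _ hB; exists B; split => //; apply: agree_trans AB.
  apply: lnullS Wf => w /=; apply: contra_not => fw; split.
    move=> rf; have [n hn] := ltr_add_invr rf; exists n => //.
    exact: (cvgr_gt _ fw _ hn).
  move=> [n _ hn]; apply: (@lt_le_trans _ _ (r + n.+1%:R^-1)).
    by rewrite ltrDl invr_gt0.
  by apply: (ult_ge_cst fw); apply: filterS hn => m /= /ltW.
apply: (@measurability _ _ (ltype P G) (measurableTypeR R) setT f (@RGenOInfty.G R)).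
  by rewrite RGenOInfty.measurableE.
move=> _ [_ [r ->] <-]; rewrite setTI.
by rewrite (_ : f @^-1` _ = [set w | r < f w])//; apply/seteqP; split => w /=; rewrite in_itv/= andbT.
Qed.

End internal_function.

Lemma meas_gt d' (T : measurableType d') (f : T -> R) (r : R) :
  measurable_fun setT f -> measurable [set x | r < f x].
Proof.
move=> mf; rewrite (_ : [set x | r < f x] = f @^-1` `]r, +oo[); last first.
  by apply/seteqP; split => x /=; rewrite in_itv/= andbT.
by rewrite -[X in measurable X]setTI; exact: mf.
Qed.

(** Both sides are compared with averages of n + 1 indicators of level sets of [W]. For these
    internal sets convergence is the definition of the Loeb measure, and the comparison costs
    1/(n+1) on each side. *)
Lemma Ex_st01 (W : nat -> S -> R) (f : Om -> R) :
  (forall m, measurable_fun setT (W m)) -> (forall m x, 0 <= W m x <= 1) ->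
  measurable_fun setT (f : loeb P -> R) -> (forall w, 0 <= f w <= 1) ->
  lnull [set w | ~ ((fun m => W m (w m)) @ ult --> f w)] ->
  (fun m => Ex (P m) (W m)) @ ult --> Ex (loebP P) f.
Proof.
move=> mW W01 mf f01 Wf.
have bW m : bmf (W m).
  by split => //; exists 1 => x; have /andP[h1 h2] := W01 m x; rewrite ger0_norm.
have bf : @bmf R _ (loeb P) f.
  by split => //; exists 1 => x; have /andP[h1 h2] := f01 x; rewrite ger0_norm.
have cE : (fun m => Ex (P m) (W m)) @ ult --> ulim (fun m => Ex (P m) (W m)).
  apply: (@cvg_ulim _ _ 1); apply: filterE => m /=; apply: Ex_abs_le => //.
  by move=> x; have /andP[h1 h2] := W01 m x; rewrite ger0_norm.
set l := ulim _ in cE.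
suff -> : Ex (loebP P) f = l by [].
apply/eqP; rewrite -subr_eq0 -normr_le0; apply/ler_addgt0Pr => e e0; rewrite add0r.
have [n hn] := ltr_add_invr e0; rewrite add0r in hn.
apply: le_trans (ltW hn).
pose B (k : nat) m := [set x | k.+1%:R <= n.+1%:R * W m x].
have mB k m : measurable (B k m) by exact: indic_avg_meas.
pose c : R := n.+1%:R^-1.
have c0 : 0 <= c by rewrite invr_ge0.
pose A m x := c * \sum_(k < n.+1) (\1_(B k m) x : R).
have bA m : bmf (A m) by apply: bmfZ; apply: bmf_sum => k; exact: bmf_indic.
pose a w := c * \sum_(k < n.+1) (\1_(star (B k)) w : R).
have msB k : measurable (star (B k) : set (loeb P)) by apply: (loeb_measE _).2; apply: lsets_star => m; exact: mB.
have ba : @bmf R _ (loeb P) a.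
  by apply: bmfZ; apply: bmf_sum => k; apply: bmf_indic.
have EA m : Ex (P m) (A m) = c * \sum_(k < n.+1) pr P m (B k m).
  rewrite /A ExZ; last by apply: bmf_sum => k; exact: bmf_indic.
  rewrite Ex_sum; last by move=> k; exact: bmf_indic.
  by congr (_ * _); apply: eq_bigr => k _; rewrite Ex_indic.
have Ea : Ex (loebP P) a = c * \sum_(k < n.+1) ipr P (B k).
  rewrite /a ExZ; last by apply: bmf_sum => k; exact: bmf_indic.
  rewrite Ex_sum; last by move=> k; exact: bmf_indic.
  by congr (_ * _); apply: eq_bigr => k _; rewrite Ex_indic// loeb_star.
have cA : (fun m => Ex (P m) (A m)) @ ult --> Ex (loebP P) a.
  rewrite Ea; under eq_fun do rewrite EA.
  apply: cvgM; first exact: cvg_cst.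
  by apply: ult_sum => k; exact: ipr_cvg.
have cAw w : (fun m => A m (w m)) @ ult --> a w.
  apply: cvgM; first exact: cvg_cst.
  apply: ult_sum => k.
  have [h|h] := pselect (star (B k) w).
    rewrite [X in _ --> X]indicE mem_set//.
    apply: (@ult_near_eq _ (fun=> true%:R)); first exact: cvg_cst.
    by apply: filterS h => m h /=; rewrite indicE mem_set.
  rewrite [X in _ --> X]indicE memNset//.
  apply: (@ult_near_eq _ (fun=> false%:R)); first exact: cvg_cst.
  by move/ultC : h; apply: filterS => m h /=; rewrite indicE memNset.
have [mN N0] := loeb_null Wf.
have W1 m x : A m x <= W m x <= A m x + c.
  by have := indic_avg n (W01 m x); rewrite -/c -/(A m x) => /andP[h1 h2]; apply/andP; split; lra.
have l1 : Ex (loebP P) a <= l.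
  apply: (ult_le cA cE); apply: filterE => m /=; apply: Ex_le => // x.
  by have /andP[] := W1 m x.
have l2 : l <= Ex (loebP P) a + c.
  have cA' : (fun m => Ex (P m) (A m) + c) @ ult --> Ex (loebP P) a + c.
    by apply: cvgD => //; exact: cvg_cst.
  apply: (ult_le cE cA'); apply: filterE => m /=.
  have bc : bmf (fun _ : S => c) by exact: bmf_cst.
  rewrite -[X in _ + X](Ex_cst (P m) c) -ExD//.
  apply: Ex_le => //; first exact: bmfD.
  by move=> x; have /andP[] := W1 m x.
have l3 : Ex (loebP P) a <= Ex (loebP P) f.
  apply: (Ex_le_ae ba bf mN N0) => w /contrapT fw.
  apply: (ult_le (cAw w) fw); apply: filterE => m /=; by have /andP[] := W1 m (w m).
have bac : @bmf R _ (loeb P) (fun w => a w + c) by apply: bmfD => //; exact: bmf_cst.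
have l4 : Ex (loebP P) f <= Ex (loebP P) a + c.
  have bc : @bmf R _ (loeb P) (fun _ => c) by exact: bmf_cst.
  rewrite -[X in _ + X](Ex_cst (loebP P) c) -ExD//.
  apply: (Ex_le_ae bf bac mN N0) => w /contrapT fw.
  have cw : (fun m => A m (w m) + c) @ ult --> a w + c.
    by apply: cvgD; [exact: cAw|exact: cvg_cst].
  apply: (ult_le fw cw); apply: filterE => m /=; by have /andP[] := W1 m (w m).
rewrite ler_norml -/c; apply/andP; split; lra.
Qed.

Lemma Ex_st (W : nat -> S -> R) (f : Om -> R) (K : R) :
  (forall m, measurable_fun setT (W m)) -> (forall m x, `|W m x| <= K) -> (forall w, `|f w| <= K) ->
  lnull [set w | ~ ((fun m => W m (w m)) @ ult --> f w)] ->
  @bmf R _ (loeb P) f /\ (fun m => Ex (P m) (W m)) @ ult --> Ex (loebP P) f.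
Proof.
move=> mW WK fK Wf.
have mf : measurable_fun setT (f : loeb P -> R).
  apply: (meas_st all_internal_algebra (W := W)) => // m r; exact: meas_gt.
have bf : @bmf R _ (loeb P) f by split => //; exists K.
have bW m : bmf (W m) by split => //; exists K.
split => //.
pose M := Num.max K 1.
have M0 : 0 < M by rewrite lt_max ltr01 orbT.
pose c : R := (2 * M)^-1.
have c0 : 0 < c by rewrite invr_gt0 mulr_gt0.
have rng (x : R) : `|x| <= K -> 0 <= c * (x + M) <= 1.
  move=> xK; have {}xK : `|x| <= M by rewrite (le_trans xK)// le_max lexx.
  move: xK; rewrite ler_norml => /andP[h1 h2].
  rewrite mulr_ge0 ?(ltW c0)//=; last by lra.
  by rewrite mulrC ler_pdivrMr ?mulr_gt0// mul1r; lra.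
have bWM m : bmf (fun x => W m x + M) by apply: bmfD => //; exact: bmf_cst.
have bfM : @bmf R _ (loeb P) (fun w => f w + M) by apply: bmfD => //; exact: bmf_cst.
have EW m : Ex (P m) (fun x => c * (W m x + M)) = c * (Ex (P m) (W m) + M).
  by rewrite ExZ// ExD ?Ex_cst//; exact: bmf_cst.
have Ef : Ex (loebP P) (fun x => c * (f x + M)) = c * (Ex (loebP P) f + M).
  by rewrite ExZ// ExD ?Ex_cst//; exact: bmf_cst.
have H : (fun m => c * (Ex (P m) (W m) + M)) @ ult --> c * (Ex (loebP P) f + M).
  rewrite -Ef (_ : (fun m => _) = (fun m => Ex (P m) (fun x => c * (W m x + M)))); last first.
    by apply/funext => m; rewrite EW.
  apply: Ex_st01 => [m|m x|||].
  - exact: (bmfZ c (bWM m)).1.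
  - exact: rng.
  - exact: (bmfZ c bfM).1.
  - by move=> w; exact: rng.
  - apply: lnullS Wf => w /=; apply: contra_not => h.
    apply: cvgM; first exact: cvg_cst.
    by apply: cvgD => //; exact: cvg_cst.
have K2 (x : R) : x = c^-1 * (c * (x + M)) - M by rewrite mulKf ?gt_eqF// addrK.
rewrite [X in _ --> X]K2 (_ : (fun m => Ex _ _) = (fun m => c^-1 * (c * (Ex (P m) (W m) + M)) - M)).
  apply: cvgB; last exact: cvg_cst.
  by apply: cvgM => //; exact: cvg_cst.
by apply/funext => m; exact: K2.
Qed.

(** Uniform tightness makes almost every sequence bounded along [ult], and bounded sequences have a
    limit there. *)
Lemma lnull_unbounded (W : nat -> S -> R) : (forall m, measurable_fun setT (W m)) ->
  (forall e : R, 0 < e -> exists K : R, ult [set m | pr P m [set x | K < W m x] <= e]) ->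
  lnull [set w | ~ exists K : R, ult [set m | W m (w m) <= K]].
Proof.
move=> mW h e /h [K hK]; exists (fun m => [set x | K < W m x]); split => //.
  by move=> m; exact: meas_gt.
move=> w /= hn; apply: contrapT => /ultC hw; apply: hn; exists K.
by apply: filterS hw => m /= /negP; rewrite -leNgt.
Qed.

End standard_part.

(** * Upper bounds for the Wasserstein distance *)

Section finite_coupling.
Context {R : realType} {F : finType}.
Variables al be : F -> R.
Hypotheses (al0 : forall a, 0 <= al a) (be0 : forall a, 0 <= be a).
Hypotheses (al1 : \sum_a al a = 1) (be1 : \sum_a be a = 1).

Let mn a := Num.min (al a) (be a).
Let t := 1 - \sum_a mn a.

(** The maximal coupling of two finite laws: the common mass stays on the diagonal, the remainders
    are coupled independently. If [t] is 0 the remainders vanish, in agreement with division by 0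
    being 0. *)
Definition fcoupling a b : R := (a == b)%:R * mn a + (al a - mn a) * (be b - mn b) / t.

Let al_mn a : 0 <= al a - mn a. Proof. by rewrite subr_ge0 ge_min lexx. Qed.
Let be_mn a : 0 <= be a - mn a. Proof. by rewrite subr_ge0 ge_min lexx orbT. Qed.
Let sal : \sum_a (al a - mn a) = t. Proof. by rewrite sumrB al1. Qed.
Let sbe : \sum_a (be a - mn a) = t. Proof. by rewrite sumrB be1. Qed.
Let t0 : 0 <= t. Proof. by rewrite -sal sumr_ge0. Qed.

Lemma fcoupling_ge0 a b : 0 <= fcoupling a b.
Proof.
by rewrite addr_ge0 ?mulr_ge0 ?invr_ge0// le_min al0 be0.
Qed.

Lemma fcoupling_suml a : \sum_b fcoupling a b = al a.
Proof.
rewrite big_split/= (bigD1 a)//= eqxx mul1r big1 ?addr0; last first.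
  by move=> b /negPf; rewrite eq_sym => ->; rewrite mul0r.
rewrite -mulr_suml -mulr_sumr sbe.
have [te|tn] := eqVneq t 0; last by rewrite mulfK// addrC subrK.
rewrite te mulr0 mul0r addr0; apply/eqP; rewrite eq_sym -subr_eq0.
have := sal; rewrite te => /eqP; rewrite psumr_eq0// => /allP/(_ a).
by rewrite mem_index_enum => /(_ isT).
Qed.

Lemma fcoupling_sumr b : \sum_a fcoupling a b = be b.
Proof.
rewrite big_split/= (bigD1 b)//= eqxx mul1r big1 ?addr0; last first.
  by move=> a /negPf ->; rewrite mul0r.
rewrite -!mulr_suml sal mulrAC.
have [te|tn] := eqVneq t 0; last by rewrite divff// mul1r addrC subrK.
rewrite te !mul0r addr0; apply/eqP; rewrite eq_sym -subr_eq0.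
have := sbe; rewrite te => /eqP; rewrite psumr_eq0// => /allP/(_ b).
by rewrite mem_index_enum => /(_ isT).
Qed.

Lemma fcoupling_offdiag : \sum_a \sum_b (a != b)%:R * fcoupling a b <= \sum_a `|al a - be a|.
Proof.
apply: (@le_trans _ _ t); last first.
  rewrite -sal; apply: ler_sum => a _; rewrite /mn.
  by have [h|h] := leP (al a) (be a); rewrite ?subrr ?normr_ge0// ler_norm.
apply: (@le_trans _ _ (\sum_a \sum_b (al a - mn a) * (be b - mn b) / t)).
  apply: ler_sum => a _; apply: ler_sum => b _; rewrite /fcoupling.
  have [->|ab] := eqVneq a b; first by rewrite mul0r !mulr_ge0 ?invr_ge0.
  by rewrite mul0r add0r mul1r.
rewrite (eq_bigr (fun a => (al a - mn a) * (t / t))); last first.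
  by move=> a _; rewrite -mulr_suml -mulr_sumr sbe mulrA.
rewrite -mulr_suml sal.
have [->|tn] := eqVneq t 0; first by rewrite mul0r.
by rewrite divff// mulr1.
Qed.

Lemma fcoupling_lel a b : fcoupling a b <= al a.
Proof.
rewrite -fcoupling_suml (bigD1 b)//= lerDl sumr_ge0// => i _; exact: fcoupling_ge0.
Qed.

Lemma fcoupling_ler a b : fcoupling a b <= be b.
Proof.
rewrite -fcoupling_sumr (bigD1 a)//= lerDl sumr_ge0// => i _; exact: fcoupling_ge0.
Qed.

End finite_coupling.

Section partition_coupling.
Context {R : realType} {d : measure_display} {T : measurableType d} {F : finType}.
Variables (m m' : probability T R) (g : F -> T -> R).
Hypotheses (bg : forall a, bmf (g a)) (g0 : forall a x, 0 <= g a x) (g1 : forall x, \sum_a g a x = 1).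
Local Notation TT := (T * T)%type.

Let al a := Ex m (g a).
Let be a := Ex m' (g a).
Let al0 a : 0 <= al a. Proof. exact: Ex_ge0. Qed.
Let be0 a : 0 <= be a. Proof. exact: Ex_ge0. Qed.
Let al1 : \sum_a al a = 1.
Proof. by rewrite -Ex_sum// -(Ex_cst m 1); apply: eq_Ex. Qed.
Let be1 : \sum_a be a = 1.
Proof. by rewrite -Ex_sum// -(Ex_cst m' 1); apply: eq_Ex. Qed.

Let pi := fcoupling al be.
(** The density of the coupling with respect to the product law on a pair of cells. A zero divisor
    is harmless, since then [pi a b] vanishes as well. *)
Let w a b := pi a b / (al a * be b).
Let pi0 a b : 0 <= pi a b. Proof. exact: fcoupling_ge0. Qed.

Let pi_al a b : al a = 0 -> pi a b = 0.
Proof.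
move=> a0; apply/eqP; rewrite eq_le pi0 andbT -a0; exact: (fcoupling_lel al0 be0 al1 be1).
Qed.
Let pi_be a b : be b = 0 -> pi a b = 0.
Proof.
move=> b0; apply/eqP; rewrite eq_le pi0 andbT -b0; exact: (fcoupling_ler al0 be0 al1 be1).
Qed.

Let wbe a b : w a b * be b = pi a b / al a.
Proof.
rewrite /w; have [b0|bn] := eqVneq (be b) 0; first by rewrite pi_be// !mul0r.
have [a0|an] := eqVneq (al a) 0; first by rewrite pi_al// !mul0r.
by field; rewrite an bn.
Qed.

Let wal a b : w a b * al a = pi a b / be b.
Proof.
rewrite /w; have [b0|bn] := eqVneq (be b) 0; first by rewrite pi_be// !mul0r.
have [a0|an] := eqVneq (al a) 0; first by rewrite pi_al// !mul0r.
by field; rewrite an bn.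
Qed.

Let wab a b : w a b * (al a * be b) = pi a b.
Proof.
rewrite /w; have [b0|bn] := eqVneq (be b) 0; first by rewrite pi_be// !mul0r.
have [a0|an] := eqVneq (al a) 0; first by rewrite pi_al// !mul0r.
by field; rewrite an bn.
Qed.

Let sum_pi_al a (c : R) : (al a = 0 -> c = 0) -> \sum_b c * (pi a b / al a) = c.
Proof.
move=> c0; rewrite -mulr_sumr -mulr_suml (fcoupling_suml al1 be1).
have [a0|an] := eqVneq (al a) 0; first by rewrite c0// mul0r.
by rewrite divff// mulr1.
Qed.

Let sum_pi_be b (c : R) : (be b = 0 -> c = 0) -> \sum_a c * (pi a b / be b) = c.
Proof.
move=> c0; rewrite -mulr_sumr -mulr_suml (fcoupling_sumr al1 be1).
have [b0|bn] := eqVneq (be b) 0; first by rewrite c0// mul0r.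
by rewrite divff// mulr1.
Qed.

Let p (z : TT) := \sum_a \sum_b w a b * (g a z.1 * g b z.2).
Let w0 a b : 0 <= w a b. Proof. by rewrite divr_ge0// mulr_ge0. Qed.
Let bgg a b : bmf (fun z : TT => g a z.1 * g b z.2).
Proof. by apply: bmfM; [exact: (bmf_comp (bg a))|exact: (bmf_comp (bg b))]. Qed.
Let bp : bmf p.
Proof. by apply: bmf_sum => a; apply: bmf_sum => b; exact: bmfZ. Qed.
Let p0 z : 0 <= p z.
Proof. apply: sumr_ge0 => a _; apply: sumr_ge0 => b _.
by apply: mulr_ge0; [exact: w0|exact: mulr_ge0].
Qed.

Let Ep (f : TT -> R) : bmf f -> Ex (pprod m m') (fun z => f z * p z) =
  \sum_a \sum_b w a b * Ex (pprod m m') (fun z => f z * (g a z.1 * g b z.2)).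
Proof.
move=> bf.
rewrite -[RHS](_ : Ex (pprod m m') (fun z => \sum_a \sum_b w a b * (f z * (g a z.1 * g b z.2))) = _).
  apply: eq_Ex => z; rewrite /p mulr_sumr; apply: eq_bigr => a _.
  by rewrite mulr_sumr; apply: eq_bigr => b _; rewrite mulrCA.
rewrite Ex_sum; last first.
  by move=> a; apply: bmf_sum => b; apply: bmfZ; exact: bmfM.
apply: eq_bigr => a _; rewrite Ex_sum; last by move=> b; apply: bmfZ; exact: bmfM.
by apply: eq_bigr => b _; rewrite ExZ//; exact: bmfM.
Qed.

Let Egg (u v : T -> R) : bmf u -> bmf v ->
  Ex (pprod m m') (fun z => u z.1 * v z.2) = Ex m u * Ex m' v.
Proof.
move=> bu bv; rewrite (Ex_prod1 m m' (f := fun z => u z.1 * v z.2)); last first.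
  by apply: bmfM; [exact: (bmf_comp bu)|exact: (bmf_comp bv)].
rewrite mulrC -ExZ//; apply: eq_Ex => x /=.
by rewrite ExZ// mulrC.
Qed.

Let p1 : (\int[pprod m m']_z (p z)%:E = 1)%E.
Proof.
rewrite -[LHS]fineK ?(integrable_fin_num _ (bmf_integrable _ bp))//.
rewrite -/(Ex (pprod m m') p); congr (_%:E).
have := Ep (bmf_cst 1); under eq_Ex do rewrite mul1r.
move=> ->; rewrite -[RHS]al1; apply: eq_bigr => a _.
rewrite -[RHS](fcoupling_suml al1 be1); apply: eq_bigr => b _.
by under eq_Ex do rewrite mul1r; rewrite Egg// wab.
Qed.

(** A pair of cells is drawn from the finite coupling, then the two points independently with
    densities proportional to [g a] and [g b]. *)
Definition pcoupling : probability TT R := density_prob bp.1 p0 p1.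

Let Ex_pcoupling (f : TT -> R) : bmf f -> Ex pcoupling f =
  \sum_a \sum_b w a b * Ex (pprod m m') (fun z => f z * (g a z.1 * g b z.2)).
Proof.
move=> bf; rewrite -Ep//.
have hD : has_density (pprod m m') pcoupling p by split; [exact: bp.1|exact: p0|].
by rewrite (Ex_density hD bf).
Qed.

Lemma pcoupling_l A : measurable A -> pcoupling (A `*` setT) = m A.
Proof.
move=> mA; have mAT : measurable (A `*` [set: T]) by exact: measurableX.
rewrite !Ex_indicE//; congr (_%:E); rewrite Ex_pcoupling; last exact: bmf_indic.
have bA : bmf (\1_A : T -> R) by exact: bmf_indic.
have e a : Ex m (fun x => \1_A x * g a x) = \sum_b w a b * Ex (pprod m m')
    (fun z => \1_(A `*` setT) z * (g a z.1 * g b z.2)).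
  rewrite -[LHS](sum_pi_al (a := a)); last first.
    move=> a0; apply/eqP; rewrite eq_le; apply/andP; split; last first.
      by apply: Ex_ge0 => x; rewrite mulr_ge0// indicE.
    rewrite -a0; apply: Ex_le => //; first exact: bmfM.
    by move=> x; rewrite ler_piMl// indicE lern1 leq_b1.
  apply: eq_bigr => b _; rewrite -wbe mulrCA; congr (_ * _).
  rewrite -(Egg (bmfM bA (bg a)) (bg b)).
  apply: eq_Ex => z; rewrite -mulrA; congr (_ * _).
  by rewrite !indicE in_setX in_setT andbT.
under eq_bigr do rewrite -e.
rewrite -Ex_sum; last by move=> a; exact: bmfM.
by apply: eq_Ex => x; rewrite -mulr_sumr g1 mulr1.
Qed.

Lemma pcoupling_r A : measurable A -> pcoupling (setT `*` A) = m' A.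
Proof.
move=> mA; have mAT : measurable ([set: T] `*` A) by exact: measurableX.
rewrite !Ex_indicE//; congr (_%:E); rewrite Ex_pcoupling; last exact: bmf_indic.
have bA : bmf (\1_A : T -> R) by exact: bmf_indic.
rewrite exchange_big/=.
have e b : Ex m' (fun x => \1_A x * g b x) = \sum_a w a b * Ex (pprod m m')
    (fun z => \1_(setT `*` A) z * (g a z.1 * g b z.2)).
  rewrite -[LHS](sum_pi_be (b := b)); last first.
    move=> b0; apply/eqP; rewrite eq_le; apply/andP; split; last first.
      by apply: Ex_ge0 => x; rewrite mulr_ge0// indicE.
    rewrite -b0; apply: Ex_le => //; first exact: bmfM.
    by move=> x; rewrite ler_piMl// indicE lern1 leq_b1.
  apply: eq_bigr => a _; rewrite -wal mulrCA; congr (_ * _).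
  rewrite mulrC -(Egg (bg a) (bmfM bA (bg b))).
  apply: eq_Ex => z; rewrite mulrCA; congr (_ * _).
  by rewrite !indicE in_setX in_setT.
under eq_bigr do rewrite -e.
rewrite -Ex_sum; last by move=> a; exact: bmfM.
by apply: eq_Ex => x; rewrite -mulr_sumr g1 mulr1.
Qed.

(** In the application [u a] bounds the cost of moving to the centre of cell [a], and [D] the cost
    of moving between two different centres, which is paid only off the diagonal. *)
Lemma pcoupling_le (f : TT -> R) (u : F -> T -> R) (D : R) : bmf f -> (forall a, bmf (u a)) ->
  (forall a x, 0 <= u a x) -> 0 <= D ->
  (forall a b z, f z <= u a z.1 + D * (a != b)%:R + u b z.2) ->
  Ex pcoupling f <= Ex m (fun x => \sum_a u a x * g a x) + Ex m' (fun x => \sum_a u a x * g a x)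
    + D * \sum_a `|Ex m (g a) - Ex m' (g a)|.
Proof.
move=> bf bu u0 D0 fu; rewrite Ex_pcoupling//.
have bug a : bmf (fun x => u a x * g a x) by exact: bmfM.
rewrite !Ex_sum//.
have le a b : w a b * Ex (pprod m m') (fun z => f z * (g a z.1 * g b z.2)) <=
   Ex m (fun x => u a x * g a x) * (pi a b / al a) +
   Ex m' (fun x => u b x * g b x) * (pi a b / be b) + D * ((a != b)%:R * pi a b).
  have b1 : bmf (fun z : TT => (u a z.1 * g a z.1) * g b z.2).
    by apply: bmfM; [exact: (bmf_comp (bug a))|exact: (bmf_comp (bg b))].
  have b2 : bmf (fun z : TT => g a z.1 * (u b z.2 * g b z.2)).
    by apply: bmfM; [exact: (bmf_comp (bg a))|exact: (bmf_comp (bug b))].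
  rewrite -wbe -wal -wab.
  apply: (@le_trans _ _ (w a b * Ex (pprod m m') (fun z => (u a z.1 * g a z.1) * g b z.2 +
      g a z.1 * (u b z.2 * g b z.2) + D * (a != b)%:R * (g a z.1 * g b z.2)))).
    rewrite ler_wpM2l//; apply: Ex_le.
    - exact: bmfM.
    - by apply: bmfD; [exact: bmfD|exact: bmfZ].
    - move=> z; apply: (@le_trans _ _ ((u a z.1 + D * (a != b)%:R + u b z.2) * (g a z.1 * g b z.2))).
        by rewrite ler_wpM2r// mulr_ge0.
      by rewrite le_eqVlt; apply/orP; left; apply/eqP; ring.
  rewrite ExD; [|exact: bmfD|exact: bmfZ]; rewrite ExD// ExZ//.
  rewrite (Egg (bug a) (bg b)) (Egg (bg a) (bug b)) (Egg (bg a) (bg b)) -/(al a) -/(be b).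
  by rewrite le_eqVlt; apply/orP; left; apply/eqP; ring.
apply: (@le_trans _ _ (\sum_a \sum_b (Ex m (fun x => u a x * g a x) * (pi a b / al a) +
   Ex m' (fun x => u b x * g b x) * (pi a b / be b) + D * ((a != b)%:R * pi a b)))).
  by apply: ler_sum => a _; apply: ler_sum.
rewrite (eq_bigr (fun a => \sum_b Ex m (fun x => u a x * g a x) * (pi a b / al a) +
   \sum_b Ex m' (fun x => u b x * g b x) * (pi a b / be b) + \sum_b D * ((a != b)%:R * pi a b))); last first.
  by move=> a _; rewrite !big_split.
rewrite !big_split/= [X in _ + X + _]exchange_big/=.
have zero (Q : probability T R) a : Ex Q (g a) = 0 -> Ex Q (fun x => u a x * g a x) = 0.
  move=> E0; have [M [M0 hM]] := bmf_bound (bu a).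
  apply/eqP; rewrite eq_le Ex_ge0// ?andbT//; last by move=> x; rewrite mulr_ge0.
  rewrite -(mulr0 M) -E0 -ExZ//; apply: Ex_le => //; first exact: bmfZ.
  by move=> x; rewrite ler_wpM2r// (le_trans _ (hM x))// ler_norm.
apply: lerD; first apply: lerD.
- by apply: ler_sum => a _; rewrite sum_pi_al//; exact: zero.
- by apply: ler_sum => a _; rewrite sum_pi_be//; exact: zero.
under eq_bigr do rewrite -mulr_sumr; rewrite -mulr_sumr ler_wpM2l//.
exact: fcoupling_offdiag.
Qed.

End partition_coupling.

Section quantizer.
Context {R : realType} {d : nat}.
Local Notation V := 'rV[R]_d.
Local Notation Rd := (@Rd R d).

(** A cubic grid. The cell index is an integer part clipped to 0..N, so that even points outside the
    cube have a centre of controlled norm. *)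
Lemma quantizer (r dl : R) : 0 < r -> 0 < dl ->
  exists (F : finType) (c : F -> V) (phi : V -> F),
    [/\ forall a, measurable ([set x | phi x = a] : set Rd),
        forall x, enorm x <= r -> enorm (x - c (phi x)) <= d%:R * dl &
        forall a, enorm (c a) <= d%:R * r].
Proof.
move=> r0 dl0.
have [n hn] : exists n : nat, 2 * r / dl < n.+1%:R.
  exists (Num.bound (2 * r / dl)); apply: (lt_trans (archi_boundP _)).
    by rewrite divr_ge0 ?mulr_ge0// ltW.
  by rewrite ltr_nat.
pose N := n.+1; pose D : R := 2 * r / N%:R.
have N0 : 0 < N%:R :> R by [].
have D0 : 0 < D by rewrite divr_gt0// mulr_gt0.
have Ddl : D <= dl by move: hn; rewrite ltr_pdivrMr// => hn; rewrite /D ler_pdivrMr// [leRHS]mulrC ltW.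
have DN : D * N%:R = 2 * r by rewrite divfK// gt_eqF.
pose sm (y : R) : nat := (\sum_(k < N) (k.+1%:R <= (y + r) / D)%R)%N.
have smN y : (sm y < N.+1)%N.
  rewrite ltnS -[N in X in (_ <= X)%N]card_ord -sum1_card; apply: leq_sum => k _; exact: leq_b1.
exists {ffun 'I_d -> 'I_N.+1}.
exists (fun a : {ffun 'I_d -> 'I_N.+1} => \row_i (D * (a i)%:R - r)).
exists (fun x : V => [ffun i => inord (sm (x 0 i))]); split.
- move=> a; rewrite (_ : [set x | _] = \bigcap_(i in [set` enum 'I_d]) [set x | sm ((x : V) 0 i) = a i]); last first.
    apply/seteqP; split => [x /= <- i _ /=|x /= h].
      by rewrite ffunE inordK.
    by apply/ffunP => i; rewrite ffunE; apply: val_inj; rewrite /= inordK// h//= mem_enum.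
  apply: fin_bigcap_measurable => // i _.
  have mS : measurable_fun (setT : set Rd) (fun x : V => \sum_(k < N) (\1_[set y : R | k.+1%:R <= (y + r) / D] (x 0 i) : R)).
    apply: measurable_sum => k.
    apply: (measurableT_comp (f := (\1_[set y : R | k.+1%:R <= (y + r) / D] : measurableTypeR R -> R))); last exact: meas_coord.
    apply: measurable_indic.
    rewrite (_ : [set y | _] = [set` `[k.+1%:R * D - r, +oo[]); first exact: measurable_itv.
    by apply/seteqP; split => y /=; rewrite in_itv/= andbT ler_pdivlMr// lerBlDr.
  rewrite (_ : [set x | _] = (fun x : V => \sum_(k < N) (\1_[set y : R | k.+1%:R <= (y + r) / D] (x 0 i) : R)) @^-1` [set (a i)%:R]).
    by rewrite -[X in measurable X]setTI; apply: mS => //; exact: measurable_set1.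
  have e (x : V) : \sum_(k < N) (\1_[set y : R | k.+1%:R <= (y + r) / D] (x 0 i) : R) = (sm (x 0 i))%:R.
    rewrite /sm natr_sum; apply: eq_bigr => k _; rewrite indicE; congr (_ %:R); congr nat_of_bool.
    by apply/idP/idP; rewrite inE.
  apply/seteqP; split => [x /= h|x /=]; first by rewrite e h.
  by rewrite e => /eqP; rewrite eqr_nat => /eqP.
- move=> x xr; apply: enorm_le_max => i; rewrite !mxE ffunE inordK//.
  have := le_trans (coord_le x i) xr; rewrite ler_norml => /andP[x1 x2].
  have h : 0 <= (x 0 i + r) / D <= N%:R.
    rewrite divr_ge0 ?(ltW D0)//=; last lra.
    by rewrite ler_pdivrMr// mulrC DN; lra.
  have := count_le h; rewrite -natr_sum -/(sm _) => /andP[h1 h2].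
  apply: le_trans Ddl.
  have -> : x 0 i - (D * (sm (x 0 i))%:R - r) = D * ((x 0 i + r) / D - (sm (x 0 i))%:R).
    by field; rewrite gt_eqF.
  by rewrite normrM gtr0_norm// ger0_norm// ler_piMr// ltW.
- move=> a; apply: enorm_le_max => i; rewrite mxE.
  have h0 : 0 <= (a i)%:R :> R by [].
  have h1 : D * (a i)%:R <= D * N%:R by rewrite ler_pM2l// ler_nat -ltnS ltn_ord.
  have h2 : 0 <= D * (a i)%:R by rewrite mulr_ge0// ltW.
  rewrite DN in h1; rewrite ler_norml; apply/andP; split; lra.
Qed.

End quantizer.

Section wasserstein_bounds.
Context {R : realType} {d : nat}.
Local Notation V := 'rV[R]_d.
Local Notation Rd := (@Rd R d).
Implicit Types (m : probability Rd R).

Lemma int_le_of_min d' (T : measurableType d') (Q : probability T R) (f : T -> R) (c : R) :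
  measurable_fun setT f -> (forall x, 0 <= f x) ->
  (forall n : nat, Ex Q (fun x => Num.min (f x) n%:R) <= c) -> (\int[Q]_x (f x)%:E <= c%:E)%E.
Proof.
move=> mf f0 H.
have bm n : bmf (fun x => Num.min (f x) n%:R).
  split; first by apply: measurable_minr.
  exists n%:R => x; rewrite ger0_norm; first by rewrite ge_min lexx orbT.
  by rewrite le_min f0/=.
have g0 n x : setT x -> (0 <= (Num.min (f x) n%:R)%:E)%E by rewrite lee_fin le_min f0/=.
have mg n : measurable_fun setT (fun x => (Num.min (f x) n%:R)%:E) by apply/measurable_EFinP; exact: (bm n).1.
have nd x : setT x -> nondecreasing_seq (fun n : nat => (Num.min (f x) n%:R)%:E).
  move=> _ i j ij; rewrite lee_fin le_min ge_min lexx/= ge_min.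
  by rewrite ler_nat ij orbT.
have := @cvg_monotone_convergence _ _ _ Q setT measurableT _ mg g0 nd.
have -> : (fun x => limn (fun n : nat => (Num.min (f x) n%:R)%:E)) = (fun x => (f x)%:E).
  apply/funext => x; apply/cvg_lim => //; apply: cvg_near_cst.
  exists (Num.bound (f x)) => // k /= hk; congr (_%:E); apply/min_idPl.
  by apply: ltW; apply: (lt_le_trans (archi_boundP (f0 x))); rewrite ler_nat.
move=> h; rewrite -(cvg_lim _ h)//; apply: lime_le; first exact: (cvgP _ h).
by apply: nearW => n; rewrite Ex_fin// lee_fin.
Qed.

Lemma meas_enorm_pow (p : R) : measurable_fun (setT : set Rd) (fun x : V => enorm x `^ p).
Proof. exact: (measurableT_comp (@measurable_powR R p) meas_enorm). Qed.

Lemma meas_cost (p : R) :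
  measurable_fun (setT : set (Rd * Rd)%type) (fun z : Rd * Rd => enorm ((z.1 : V) - z.2) `^ p).
Proof.
apply: (measurableT_comp (meas_enorm_pow p)); exact: mvB.
Qed.

Lemma wasserstein_le (p c : R) m m' (pi : probability (Rd * Rd)%type R) : 0 < p -> 0 <= c ->
  coupling m m' pi ->
  (forall n : nat, Ex pi (fun z => Num.min (enorm ((z.1 : V) - z.2) `^ p) n%:R) <= c) ->
  (wasserstein p m m' <= (c `^ p^-1)%:E)%E.
Proof.
move=> p0 c0 cpl H; rewrite /wasserstein -poweR_EFin.
set I := ereal_inf _.
have I0 : (0 <= I)%E.
  by apply: le_ereal_inf_tmp => _ [pi' _ <-]; apply: integral_ge0 => z _; rewrite lee_fin powR_ge0.
have Ic : (I <= c%:E)%E.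
  apply: (@le_trans _ _ (\int[pi]_z (enorm ((z.1 : V) - z.2) `^ p)%:E)%E).
    by apply: ereal_inf_lbound; exists pi.
  by apply: int_le_of_min => //; [exact: meas_cost|move=> z; exact: powR_ge0].
apply: gt0_ler_poweR => //; first by rewrite invr_ge0 ltW.
  by rewrite in_itv/= I0 leey.
by rewrite in_itv/= lee_fin c0 leey.
Qed.

Lemma coupling_law d' (T : measurableType d') (Q : probability T R) (X Y : {mfun T >-> Rd})
  (Z : {mfun T >-> (Rd * Rd)%type}) : (forall w, Z w = (X w, Y w)) ->
  coupling (law_of Q X) (law_of Q Y) (law_of Q Z).
Proof.
move=> ZE; split => A mA; rewrite !law_ofE; congr (Q _).
  by apply/seteqP; split => w /=; rewrite ZE //= => -[].
by apply/seteqP; split => w /=; rewrite ZE //= => -[].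
Qed.

(* Uniform integrability of |x|^p is smallness of the mean of this excess over the level r,
   uniformly in the truncation n. *)
Definition excess (p r : R) (n : nat) (x : V) : R :=
  Num.min (enorm x `^ p) n%:R - Num.min (enorm x `^ p) r.
(** The cut is in the norm of the point, whereas [excess] cuts the value. [excess] is continuous and
    passes to weak limits; [tail] vanishes near the origin and suits estimates. The next two lemmas
    exchange them. *)
Definition tail (p s : R) (n : nat) (x : V) : R :=
  if s <= enorm x then Num.min (enorm x `^ p) n%:R else 0.

Lemma tail_le_excess (p r s : R) n x : 0 < p -> 0 <= r -> 0 <= s -> 2 * r <= s `^ p -> 2 * r <= n%:R ->
  tail p s n x <= 2 * excess p r n x.
Proof.
move=> p0 r0 s0 rs rn; rewrite /tail /excess; case: ifP => sx; last first.
  have a0 := powR_ge0 (enorm x) p; move: a0; set a := enorm x `^ p => a0.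
  rewrite mulr_ge0// subr_ge0 le_min ge_min lexx/= ge_min.
  by apply/orP; right; lra.
have : s `^ p <= enorm x `^ p by apply: ge0_ler_powR; rewrite ?nnegrE ?enorm_ge0 ?(ltW p0).
move: (enorm x `^ p) (s `^ p) rs => a b rs ba.
have -> : Num.min a r = r by apply/min_idPr; lra.
by have [h|h] := leP a n%:R; lra.
Qed.

Lemma excess_le_tail (p r s : R) n x : 0 < p -> 0 <= r -> 0 <= s -> s `^ p <= r ->
  excess p r n x <= tail p s n x.
Proof.
move=> p0 r0 s0 sr; rewrite /tail /excess; case: ifP => sx.
  by rewrite lerBlDr lerDl le_min powR_ge0.
have : enorm x `^ p <= s `^ p.
  apply: ge0_ler_powR; rewrite ?nnegrE ?enorm_ge0 ?(ltW p0)//.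
  by move/negbT : sx; rewrite -ltNge => /ltW.
move: (enorm x `^ p) (s `^ p) sr => a b sr ba.
have -> : Num.min a r = a by apply/min_idPl; lra.
by rewrite subr_le0 ge_min lexx.
Qed.

Lemma bmf_minpow (p c : R) : 0 <= c -> @bmf R _ Rd (fun x : V => Num.min (enorm x `^ p) c).
Proof.
move=> c0; split; first by apply: measurable_minr => //; exact: meas_enorm_pow.
exists c => x; rewrite ger0_norm; first by rewrite ge_min lexx orbT.
by rewrite le_min powR_ge0.
Qed.

Lemma bmf_excess (p r : R) n : 0 <= r -> @bmf R _ Rd (excess p r n).
Proof. by move=> r0; apply: bmfB; exact: bmf_minpow. Qed.

Lemma bmf_tail (p s : R) n : @bmf R _ Rd (tail p s n).
Proof.
split; last first.
  exists n%:R => x; rewrite /tail; case: ifP => _; last by rewrite normr0.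
  rewrite ger0_norm; first by rewrite ge_min lexx orbT.
  by rewrite le_min powR_ge0/=.
apply: measurable_fun_ifT; [|by have [] := bmf_minpow p (ler0n R n)|exact: measurable_cst].
by apply: measurable_fun_ler; [exact: measurable_cst|exact: meas_enorm].
Qed.

Lemma finite_moment_excess (p e : R) m : finite_moment p m -> 0 < e ->
  exists2 r : R, 0 <= r & forall n, Ex m (excess p r n) <= e.
Proof.
move=> fm e0.
pose I := fine (\int[m]_x ((enorm x) `^ p)%:E)%E.
have II : (\int[m]_x ((enorm x) `^ p)%:E = I%:E)%E.
  rewrite /I fineK// ge0_fin_numE//; apply: integral_ge0 => x _; rewrite lee_fin powR_ge0//.
have leI n : Ex m (fun x : V => Num.min (enorm x `^ p) n%:R) <= I.
  rewrite -lee_fin -II -Ex_fin; last exact: bmf_minpow.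
  apply: ge0_le_integral => //.
  - by move=> x _; rewrite lee_fin le_min powR_ge0/=.
  - by apply/measurable_EFinP; exact: (bmf_minpow p (ler0n R n)).1.
  - by apply/measurable_EFinP; exact: meas_enorm_pow.
  - by move=> x _; rewrite lee_fin ge_min lexx.
have [k hk] : exists k : nat, I - e < Ex m (fun x : V => Num.min (enorm x `^ p) k%:R).
  apply: contrapT => /forallNP h.
  have : (\int[m]_x ((enorm x) `^ p)%:E <= (I - e)%:E)%E.
    apply: int_le_of_min; [exact: meas_enorm_pow|by move=> x; exact: powR_ge0|].
    by move=> n; have /negP := h n; rewrite -leNgt.
  by rewrite II lee_fin; lra.
exists k%:R => // n; rewrite /excess ExB; [|exact: bmf_minpow|exact: bmf_minpow].
have := leI n; lra.
Qed.

Lemma finite_moment_of_min (p c : R) m :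
  (forall n : nat, Ex m (fun x : V => Num.min (enorm x `^ p) n%:R) <= c) -> finite_moment p m.
Proof.
move=> H; apply: (@le_lt_trans _ _ c%:E); last exact: ltry.
by apply: int_le_of_min => //; [exact: meas_enorm_pow|move=> x; exact: powR_ge0].
Qed.

Lemma pow_sum3 (p a b c : R) (n : nat) : 1 <= p -> 0 <= a -> 0 <= b -> 0 <= c ->
  Num.min ((a + b + c) `^ p) n%:R <=
    3 `^ p * (Num.min (a `^ p) n%:R + b `^ p + Num.min (c `^ p) n%:R).
Proof.
move=> p1 a0 b0 c0.
have p0 : 0 <= p by lra.
have t1 : 1 <= 3 `^ p :> R.
  by rewrite -[leLHS](powRr0 3); apply: ler_powR => //; lra.
have n0 : 0 <= n%:R :> R by [].
have step x : 0 <= x -> (a + b + c) <= 3 * x ->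
    Num.min ((a + b + c) `^ p) n%:R <= 3 `^ p * Num.min (x `^ p) n%:R.
  move=> x0 sx.
  have h : (a + b + c) `^ p <= 3 `^ p * x `^ p.
    rewrite -powRM//; apply: ge0_ler_powR; rewrite ?nnegrE ?addr_ge0 ?mulr_ge0//.
  have h2 : n%:R <= 3 `^ p * n%:R by rewrite ler_peMl.
  by have [k|k] := leP (x `^ p) n%:R; rewrite ge_min ?h// h2 orbT.
have A0 : 0 <= Num.min (a `^ p) n%:R by rewrite le_min powR_ge0/=.
have C0 : 0 <= Num.min (c `^ p) n%:R by rewrite le_min powR_ge0/=.
have B0 := powR_ge0 b p.
have [ab|ba] := leP a b; have [bc|cb] := leP b c; have [ac|ca] := leP a c.
all: try (apply: (le_trans (step c c0 _)); [lra|rewrite ler_wpM2l ?powR_ge0//; lra]).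
all: try (apply: (le_trans (step a a0 _)); [lra|rewrite ler_wpM2l ?powR_ge0//; lra]).
all: apply: (le_trans (step b b0 _)); [lra|rewrite ler_wpM2l ?powR_ge0//].
all: have : Num.min (b `^ p) n%:R <= b `^ p by rewrite ge_min lexx.
all: lra.
Qed.

End wasserstein_bounds.

(** * Wasserstein convergence from weak convergence and uniform integrability *)

Section wasserstein_convergence.
Context {R : realType} {d : nat}.
Local Notation V := 'rV[R]_d.
Local Notation Rd := (@Rd R d).

(* A quantisation at random (the mollifier makes the quantised weights continuous functionals of
   the law) couples two laws up to the total variation distance of finitely many weights. *)
Lemma wasserstein_quantised (p r e : R) (m m' : probability Rd R) (e0 : 0 < e)
    (F : finType) (c : F -> V) (phi : V -> F) (eta : R) :
  1 <= p -> 0 < r -> d%:R * e <= r -> 0 <= eta ->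
  (forall a, measurable ([set x | phi x = a] : set Rd)) ->
  (forall x, enorm x <= 2 * r -> enorm (x - c (phi x)) <= eta) ->
  (forall a, enorm (c a) <= d%:R * (2 * r)) ->
  let g a := transl (mollifier e0) (\1_[set x | phi x = a] : V -> R) in
  let cost n := fun m0 : probability Rd R =>
    (d%:R * e + eta) `^ p + (1 + 2 * d%:R) `^ p * Ex m0 (tail p r n) in
  exists2 pi, coupling m m' pi & forall n,
    Ex pi (fun z => Num.min (enorm ((z.1 : V) - z.2) `^ p) n%:R) <=
      3 `^ p * (cost n m + cost n m' +
        (2 * (d%:R * (2 * r))) `^ p * \sum_a `|Ex m (g a) - Ex m' (g a)|).
Proof.
move=> p1 r0 der eta0 mphi hphi hc g cost.
have p0 : 0 < p by lra.
have bI a : @bmf R _ Rd (\1_[set x | phi x = a] : V -> R) by exact: bmf_indic.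
have bg a : @bmf R _ Rd (g a) by exact: bmf_transl.
have g0 a x : 0 <= g a x by apply: Ex_ge0 => y; rewrite indicE.
have pick (v : F -> R) z : \sum_a v a * (\1_[set x | phi x = a] z : R) = v (phi z).
  rewrite (bigD1 (phi z))//= indicE mem_set// mulr1 big1 ?addr0// => a ax.
  by rewrite indicE memNset ?mulr0//= => h; move: ax; rewrite h eqxx.
have sumI x : \sum_a (\1_[set x | phi x = a] x : R) = 1.
  by rewrite -(pick (fun=> 1) x); apply: eq_bigr => a _; rewrite mul1r.
have g1 x : \sum_a g a x = 1.
  rewrite /g /transl -Ex_sum; last by move=> a; exact: bmf_shift.
  by under eq_Ex do rewrite sumI; rewrite Ex_cst.
have cpl : coupling m m' (pcoupling m m' bg g0 g1).
  by split => A mA; [exact: pcoupling_l|exact: pcoupling_r].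
exists (pcoupling m m' bg g0 g1) => // n.
pose u a x : R := 3 `^ p * Num.min (enorm (x - c a) `^ p) n%:R.
have u0 a x : 0 <= u a x by rewrite mulr_ge0 ?powR_ge0// le_min powR_ge0/=.
have bu a : @bmf R _ Rd (u a).
  by apply: bmfZ; have := bmf_shift (- c a) (bmf_minpow p (ler0n R n)); under eq_fun do rewrite addrC.
pose D : R := 3 `^ p * (2 * (d%:R * (2 * r))) `^ p.
have D0 : 0 <= D by rewrite mulr_ge0 ?powR_ge0.
have bf : @bmf R _ (Rd * Rd)%type (fun z => Num.min (enorm ((z.1 : V) - z.2) `^ p) n%:R).
  split; first by apply: measurable_minr => //; exact: meas_cost.
  exists n%:R => z; rewrite ger0_norm; first by rewrite ge_min lexx orbT.
  by rewrite le_min powR_ge0/=.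
have fu a b (z : Rd * Rd) : Num.min (enorm ((z.1 : V) - z.2) `^ p) n%:R <=
    u a z.1 + D * (a != b)%:R + u b z.2.
  have tri : enorm ((z.1 : V) - z.2) <= enorm ((z.1 : V) - c a) + enorm (c a - c b) + enorm ((z.2 : V) - c b).
    apply: (le_trans (enorm_tri _ (c a) _)); rewrite -addrA lerD2l.
    by apply: (le_trans (enorm_tri _ (c b) _)); rewrite lerD2l enormB.
  apply: (@le_trans _ _ (Num.min ((enorm ((z.1 : V) - c a) + enorm (c a - c b) + enorm ((z.2 : V) - c b)) `^ p) n%:R)).
    rewrite le_min ge_min ge_min lexx orbT andbT; apply/orP; left.
    by apply: ge0_ler_powR; rewrite ?nnegrE ?addr_ge0 ?enorm_ge0 ?(ltW p0).
  apply: (le_trans (pow_sum3 _ p1 (enorm_ge0 _) (enorm_ge0 _) (enorm_ge0 _))).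
  rewrite !mulrDr /u; apply: lerD => //; rewrite lerD2l.
  have [->|ab] := eqVneq a b.
    by rewrite subrr enorm0 powR0 ?(gt_eqF p0)// !mulr0.
  rewrite mulr1 /D ler_wpM2l ?powR_ge0//.
  apply: ge0_ler_powR; rewrite ?nnegrE ?enorm_ge0 ?(ltW p0)// ?mulr_ge0 ?(ltW r0)//.
  by apply: (le_trans (enormD _ _)); rewrite enormN mulrDl mul1r lerD.
apply: (le_trans (@pcoupling_le _ _ _ _ m m' g bg g0 g1 _ _ _ bf bu u0 D0 fu)).
have cst (m0 : probability Rd R) : Ex m0 (fun x => \sum_a u a x * g a x) <= 3 `^ p * cost n m0.
  have bc : @bmf R _ Rd (fun x => (d%:R * e + eta) `^ p + (1 + 2 * d%:R) `^ p * tail p r n x).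
    by apply: bmfD; [exact: bmf_cst|apply: bmfZ; exact: bmf_tail].
  have -> : 3 `^ p * cost n m0 = Ex m0 (fun x => 3 `^ p * ((d%:R * e + eta) `^ p + (1 + 2 * d%:R) `^ p * tail p r n x)).
    rewrite ExZ// ExD ?Ex_cst; [|exact: bmf_cst|by apply: bmfZ; exact: bmf_tail].
    by rewrite ExZ//; exact: bmf_tail.
  apply: Ex_le; [by apply: bmf_sum => a; exact: bmfM|exact: bmfZ|] => x.
  have ug a : u a x * g a x = Ex (mollifier e0) (fun y : Rd => u a x * \1_[set x | phi x = a] (x + y)).
    by rewrite /g /transl ExZ//; exact: bmf_shift.
  have bs a : @bmf R _ Rd (fun y => u a x * (\1_[set x | phi x = a] (x + y) : R)).
    by apply: bmfZ; have := bmf_shift x (bI a).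
  under eq_bigr do rewrite ug.
  rewrite -Ex_sum//; apply: Ex_mollifier_le; first exact: bmf_sum.
  move=> y ye; rewrite (pick (u ^~ x)) /u ler_wpM2l ?powR_ge0//.
  have T0 : 0 <= (1 + 2 * d%:R) `^ p * tail p r n x.
    by rewrite mulr_ge0 ?powR_ge0// /tail; case: ifP => // _; rewrite le_min powR_ge0/=.
  (* Within 2r the error is that of the grid plus the smear. Beyond it |x| >= r, as the smear is at
     most [r], and every centre has norm at most 2 d r <= 2 d |x|. *)
  have [xr|xr] := leP (enorm (x + y)) (2 * r).
    rewrite ge_min; apply/orP; left; apply: ler_wpDr => //.
    apply: ge0_ler_powR; rewrite ?nnegrE ?enorm_ge0 ?(ltW p0)//.
      by rewrite addr_ge0// mulr_ge0// ltW.
    rewrite (_ : x - _ = (x + y - c (phi (x + y))) - y); last by rewrite [RHS]addrAC addrK.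
    apply: (le_trans (enormD _ _)); rewrite enormN addrC lerD//.
    exact: hphi.
  have xr' : r <= enorm x.
    by have := enormD x y; lra.
  apply: ler_wpDl; first exact: powR_ge0.
  rewrite /tail xr'.
  have e1 : enorm (x - c (phi (x + y))) <= (1 + 2 * d%:R) * enorm x.
    apply: (le_trans (enormD _ _)); rewrite enormN mulrDl mul1r lerD2l.
    apply: (le_trans (hc _)); rewrite mulrCA mulrA ler_wpM2l// mulr_ge0//.
  have e2 : enorm (x - c (phi (x + y))) `^ p <= (1 + 2 * d%:R) `^ p * enorm x `^ p.
    rewrite -powRM ?enorm_ge0// ?addr_ge0 ?mulr_ge0//.
    apply: ge0_ler_powR; rewrite ?nnegrE ?enorm_ge0 ?(ltW p0)//.
    by rewrite mulr_ge0 ?enorm_ge0// addr_ge0 ?mulr_ge0.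
  have e3 : n%:R <= (1 + 2 * d%:R) `^ p * n%:R :> R.
    rewrite ler_peMl//; apply: (@le_trans _ _ (1 `^ p)); first by rewrite powR1.
    apply: ge0_ler_powR; rewrite ?nnegrE ?(ltW p0)//.
    by rewrite lerDl mulr_ge0.
  have [k|k] := leP (enorm x `^ p) n%:R; rewrite ge_min ?e2// e3 orbT//.
have := cst m; have := cst m'.
rewrite /D -mulrA !mulrDr => h1 h2; rewrite lerD2r; exact: lerD.
Qed.

Lemma cvg_minc T (G : set_system T) (FG : Filter G) (f : T -> R) (a c : R) :
  f @ G --> a -> (fun x => Num.min (f x) c) @ G --> Num.min a c.
Proof.
move=> /cvgrPdist_le h; apply/cvgrPdist_le => e /h; apply: filterS => y; apply: le_trans.
move: (f y) => b.
have [ac|ac] := leP a c; have [bc|bc] := leP b c => //; last by rewrite subrr normr0.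
  by rewrite !ler0_norm; lra.
by rewrite !ger0_norm; lra.
Qed.

Lemma continuous_enorm_pow (p : R) : 1 <= p -> continuous (fun x : V => enorm x `^ p).
Proof.
move=> p1 x; have p0 : 0 < p by lra.
have cE : {for x, continuous (@enorm R d)} by exact: lip_continuous (@lip_enorm R d) x.
have [x0|xn] := eqVneq (enorm x) 0; last first.
  have xp : 0 < enorm x by rewrite lt_neqAle eq_sym xn enorm_ge0.
  apply: (@cvg_trans _ ((fun y => expR (p * ln (enorm y))) @ x)).
    apply: (@near_eq_cvg _ _ (nbhs x)).
    have h : \forall y \near x, 0 < enorm y by exact: (cvgr_gt (enorm x) cE).
    apply: filterS h => y yp.
    by rewrite /powR gt_eqF.
  rewrite /powR gt_eqF//; apply: (continuous_comp (f := fun y => p * ln (enorm y)) (g := expR)); last exact: continuous_expR.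
  have cl : (fun y : V => ln (enorm y)) @ x --> ln (enorm x).
    exact: (continuous_comp cE (continuous_ln xp)).
  exact: (@cvgM _ _ (nbhs x) _ _ _ _ _ (cvg_cst p) cl).
apply/(@cvgrPdist_le _ _ _ (nbhs x) _ (fun y : V => enorm y `^ p) (enorm x `^ p)) => e e0; rewrite x0 powR0 ?gt_eqF//.
have e1 : 0 < e `^ p^-1 by exact: powR_gt0.
move/(@cvgrPdist_le _ _ _ (nbhs x) _ (@enorm R d) (enorm x)) : cE => /(_ _ e1); apply: filterS => y.
rewrite x0 !sub0r !normrN !ger0_norm ?enorm_ge0 ?powR_ge0// => h.
have -> : e = (e `^ p^-1) `^ p by rewrite -powRrM mulVf ?gt_eqF// powRr1// ltW.
by apply: ge0_ler_powR; rewrite ?nnegrE ?enorm_ge0 ?(ltW p0) ?(ltW e1).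
Qed.

Lemma continuous_excess (p r : R) n : 1 <= p -> continuous (excess p r n : V -> R).
Proof.
move=> p1 x; have h := @continuous_enorm_pow p p1 x.
exact: (@cvgB _ _ _ (nbhs x) _ _ _ _ _ (cvg_minc _ h) (cvg_minc _ h)).
Qed.

(** [mu m] and [nu] need not live on one space: only finitely many mollified cell weights have to
    converge, and these are expectations of bounded continuous functions. *)
Lemma wasserstein_cvg (p e : R) (mu : nat -> probability Rd R) (nu : probability Rd R) :
  1 <= p -> 0 < e ->
  (forall f, @bmf R _ Rd f -> continuous f -> (fun m => Ex (mu m) f) @ ult --> Ex nu f) ->
  (forall e', 0 < e' -> exists2 r : R, 0 <= r &
     ult [set m | forall n, Ex (mu m) (excess p r n) <= e']) ->
  ult [set m | (wasserstein p (mu m) nu <= (e `^ p^-1)%:E)%E].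
Proof.
move=> p1 e0 cmu UI; have p0 : 0 < p by lra.
have P3 : 0 < 3 `^ p :> R by exact: powR_gt0.
have d1 : 0 < 1 + 2 * d%:R :> R by apply: ltr_wpDr => //; rewrite mulr_ge0.
have Pd : 0 < (1 + 2 * d%:R) `^ p :> R by exact: powR_gt0.
(* Each of the three terms in [wasserstein_quantised] will be at most 2 c1, and 3^p times their sum
   stays below [e]. *)
pose c1 : R := e / (8 * 3 `^ p).
have c10 : 0 < c1 by rewrite divr_gt0// mulr_gt0.
pose s0 : R := c1 `^ p^-1.
have s00 : 0 < s0 by exact: powR_gt0.
pose e1 : R := s0 / (2 * (d%:R + 1)).
have dd : 0 < 2 * (d%:R + 1) :> R by rewrite mulr_gt0// ltr_wpDl.
have e10 : 0 < e1 by exact: divr_gt0.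
have se : d%:R * e1 + d%:R * e1 <= s0.
  rewrite -mulrDl /e1 mulrA ler_pdivrMr// mulrC ler_wpM2l ?(ltW s00)//; lra.
pose e' : R := c1 / (2 * (1 + 2 * d%:R) `^ p).
have e'0 : 0 < e' by rewrite divr_gt0// mulr_gt0.
have [r' r'0 ur] := UI _ e'0.
pose r : R := Num.max 1 (Num.max (d%:R * e1) ((2 * r') `^ p^-1)).
have r0 : 0 < r by rewrite lt_max ltr01.
have der : d%:R * e1 <= r by rewrite !le_max lexx orbT.
have r'r : 2 * r' <= r `^ p.
  have -> : 2 * r' = ((2 * r') `^ p^-1) `^ p.
    by rewrite -powRrM mulVf ?gt_eqF// powRr1// mulr_ge0.
  apply: ge0_ler_powR; rewrite ?nnegrE ?powR_ge0 ?(ltW p0) ?(ltW r0)//.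
  by rewrite !le_max lexx !orbT.
have r20 : 0 < 2 * r by rewrite mulr_gt0.
have [F [c [phi [mphi hphi hc]]]] := @quantizer R d _ _ r20 e10.
have eta0 : 0 <= d%:R * e1 by rewrite mulr_ge0// ltW.
pose g a := transl (mollifier e10) (\1_[set x | phi x = a] : V -> R).
have bI a : @bmf R _ Rd (\1_[set x | phi x = a] : V -> R) by exact: bmf_indic.
have cg a : (fun m => Ex (mu m) (g a)) @ ult --> Ex nu (g a).
  apply: cmu; first exact: bmf_transl.
  apply: (@lip_continuous _ _ (4 * d%:R / e1)); apply: mollifier_lip => // x.
  by rewrite indicE; case: (_ \in _); rewrite ?normr1 ?normr0.
pose Dc : R := (2 * (d%:R * (2 * r))) `^ p.
have Dc0 : 0 <= Dc by exact: powR_ge0.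
pose c2 : R := 2 * c1 / (Dc + 1).
have c20 : 0 < c2 by rewrite divr_gt0 ?mulr_gt0// ltr_wpDl.
have Dc2 : Dc * c2 <= 2 * c1.
  rewrite /c2 mulrA ler_pdivrMr ?ltr_wpDl// mulrC ler_wpM2l ?lerDl//.
  by rewrite mulr_ge0// ltW.
have uS : ult [set m | \sum_a `|Ex (mu m) (g a) - Ex nu (g a)| <= c2].
  have h : (fun m => \sum_a `|Ex (mu m) (g a) - Ex nu (g a)|) @ ult --> \sum_(a : F) (0 : R).
    apply: ult_sum => a; rewrite -(normr0 R) -(subrr (Ex nu (g a))).
    by apply: cvg_norm; apply: cvgB => //; exact: cvg_cst.
  rewrite sumr_const mul0rn in h.
  have h' : ult [set m | \sum_a `|Ex (mu m) (g a) - Ex nu (g a)| < c2] by exact: (cvgr_lt 0 h _ c20).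
  by apply: filterS h' => m /= /ltW.
have exnu n : Ex nu (excess p r' n) <= e'.
  apply: (ult_le_cst (cmu _ (bmf_excess p n r'0) (@continuous_excess p r' n p1))).
  by apply: filterS ur => m h; exact: h.
have tail_le (m0 : probability Rd R) n : (forall n, Ex m0 (excess p r' n) <= e') -> 2 * r' <= n%:R ->
    (d%:R * e1 + d%:R * e1) `^ p + (1 + 2 * d%:R) `^ p * Ex m0 (tail p r n) <= 2 * c1.
  move=> hm rn.
  have h1 : (d%:R * e1 + d%:R * e1) `^ p <= c1.
    have -> : c1 = s0 `^ p by rewrite /s0 -powRrM mulVf ?gt_eqF// powRr1// ltW.
    by apply: ge0_ler_powR; rewrite ?nnegrE ?(ltW p0) ?(ltW s00)// addr_ge0.
  have h2 : Ex m0 (tail p r n) <= 2 * e'.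
    apply: (@le_trans _ _ (Ex m0 (fun x => 2 * excess p r' n x))).
      apply: Ex_le; [exact: bmf_tail|by apply: bmfZ; exact: bmf_excess|].
      by move=> x; apply: tail_le_excess => //; exact: ltW.
    by rewrite ExZ ?ler_pM2l//; exact: bmf_excess.
  have h3 : (1 + 2 * d%:R) `^ p * Ex m0 (tail p r n) <= c1.
    apply: (@le_trans _ _ ((1 + 2 * d%:R) `^ p * (2 * e'))); first by rewrite ler_pM2l.
    by rewrite /e' le_eqVlt; apply/orP; left; apply/eqP; field; rewrite gt_eqF.
  lra.
apply: filterS (filterI ur uS) => m [/= exm Sm].
have [pi cpl Epi] := @wasserstein_quantised p r e1 (mu m) nu e10 F c phi _ p1 r0 der eta0 mphi hphi hc.
apply: (@wasserstein_le _ _ _ _ _ _ pi) => //; first exact: ltW.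
move=> n.
(* The truncation level is raised until it exceeds 2 r', as [tail_le_excess] requires. *)
pose n' := (n + Num.bound (2 * r'))%N.
have nn : 2 * r' <= n'%:R.
  apply: ltW; apply: (lt_le_trans (archi_boundP _)); first by rewrite mulr_ge0.
  by rewrite ler_nat leq_addl.
have bc k : @bmf R _ (Rd * Rd)%type (fun z => Num.min (enorm ((z.1 : V) - z.2) `^ p) k%:R).
  split; first by apply: measurable_minr => //; exact: meas_cost.
  exists k%:R => z; rewrite ger0_norm; first by rewrite ge_min lexx orbT.
  by rewrite le_min powR_ge0/=.
apply: (@le_trans _ _ (Ex pi (fun z => Num.min (enorm ((z.1 : V) - z.2) `^ p) n'%:R))).
  apply: Ex_le => // z; rewrite le_min ge_min lexx/= ge_min.
  by rewrite ler_nat leq_addr orbT.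
apply: (le_trans (Epi n')).
have t1 := tail_le (mu m) n' exm nn; have t2 := tail_le nu n' exnu nn.
have t3 : Dc * \sum_a `|Ex (mu m) (g a) - Ex nu (g a)| <= 2 * c1.
  by apply: le_trans Dc2; rewrite ler_wpM2l.
have -> : e = 3 `^ p * (8 * c1) by rewrite /c1; field; rewrite gt_eqF.
rewrite ler_pM2l// -/Dc -/(g _); apply: (@le_trans _ _ (2 * c1 + 2 * c1 + 2 * c1)); last lra.
by apply: lerD => //; exact: lerD.
Qed.

End wasserstein_convergence.

(** * The limit of the noise along the ultrafilter *)

Section vector_limits.
Context {R : realType} {d : nat}.
Local Notation V := 'rV[R]_d.
Local Notation Rd := (@Rd R d).

Section filters.
Context {T : Type} (G : set_system T) {FG : Filter G}.

Lemma cvg_of_enorm (x : T -> V) (l : V) : (fun t => enorm (x t - l)) @ G --> 0 -> x @ G --> l.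
Proof.
move=> /cvgrPdist_le h; apply/cvgrPdist_le => e /h; apply: filterS => t.
rewrite sub0r normrN ger0_norm ?enorm_ge0// enormB; apply: le_trans.
exact: mx_norm_le_enorm.
Qed.

Lemma cvg_cont (x : T -> V) (l : V) (f : V -> R) : continuous f -> x @ G --> l ->
  (fun t => f (x t)) @ G --> f l.
Proof. by move=> cf xl; exact: (cvg_comp x f xl (cf l)). Qed.

End filters.

Definition vlim (x : nat -> V) : V := \row_i ulim (fun m => x m 0 i).

Lemma cvg_vlim (x : nat -> V) (K : R) : ult [set m | enorm (x m) <= K] -> x @ ult --> vlim x.
Proof.
move=> xK; apply: cvg_of_enorm.
have h : (fun m => \sum_(i < d) `|(x m - vlim x) 0 i|) @ ult --> \sum_(i < d) (0 : R).
  apply: ult_sum => i; rewrite -(normr0 R); apply: cvg_norm.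
  under eq_fun do rewrite !mxE; rewrite -(subrr (ulim (fun m => x m 0 i))).
  apply: cvgB; last exact: cvg_cst.
  apply: (@cvg_ulim _ _ K); apply: filterS xK => m /=; apply: le_trans; exact: coord_le.
rewrite sumr_const mul0rn in h.
apply/cvgrPdist_le => e e0; move/cvgrPdist_le : h => /(_ _ e0); apply: filterS => m.
rewrite !sub0r !normrN ger0_norm ?sumr_ge0// ger0_norm ?enorm_ge0//.
by apply: le_trans; exact: enorm_le_sum.
Qed.

Lemma vlimE (x : nat -> V) (l : V) : x @ ult --> l -> vlim x = l.
Proof.
move=> xl; apply/rowP => i; rewrite mxE; apply: ulimE.
exact: (cvg_cont (lip_continuous (@lip_coord R d i)) xl).
Qed.

Lemma cvg_enorm_le (x : nat -> V) (l : V) (c : R) : x @ ult --> l -> ult [set m | enorm (x m) <= c] ->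
  enorm l <= c.
Proof.
move=> xl; apply: ult_le_cst.
exact: (cvg_cont (lip_continuous (@lip_enorm R d)) xl).
Qed.

End vector_limits.

Section time_index.
Context {R : realType} (T : R).
Hypothesis T0 : 0 < T.

Definition mesh m : R := T / m.+1%:R.
Definition kk m (t : R) : nat := Num.truncn (Num.min t T / mesh m).

Lemma mesh_gt0 m : 0 < mesh m. Proof. by rewrite divr_gt0. Qed.

Lemma meshM m : m.+1%:R * mesh m = T.
Proof. by rewrite /mesh mulrC divfK. Qed.

Lemma mesh_cvg0 : mesh @ \oo --> 0.
Proof.
by rewrite /mesh -(mulr0 T); apply: cvgM; [exact: cvg_cst|exact: cvg_harmonic].
Qed.

Lemma kk_le m s t : s <= t -> (kk m s <= kk m t)%N.
Proof.
move=> st; apply: le_truncn; rewrite ler_pM2r ?invr_gt0 ?mesh_gt0//.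
by rewrite le_min ge_min st/= ge_min lexx orbT.
Qed.

Lemma kk_itv m t : 0 <= t <= T -> (kk m t)%:R * mesh m <= t < (kk m t)%:R * mesh m + mesh m.
Proof.
move=> /andP[t0 tT]; have m0 := mesh_gt0 m.
have -> : kk m t = Num.truncn (t / mesh m) by rewrite /kk; congr Num.truncn; congr (_ / _); apply/min_idPl.
have := @truncn_itv _ (t / mesh m); rewrite divr_ge0 ?(ltW m0)// => /(_ isT) /andP[h1 h2].
rewrite -ler_pdivlMr// h1/= -[X in _ + X]mul1r -mulrDl natr1 -ltr_pdivrMr//.
Qed.

Lemma kk0 m : kk m 0 = 0%N.
Proof.
have := @kk_itv m 0; rewrite lexx ltW// => /(_ isT) /andP[h _].
apply/eqP; rewrite -leqn0 -(@ler_nat R) -(pmulr_lle0 _ (mesh_gt0 m)) //.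
Qed.

Lemma kkT m t : (kk m t <= m.+1)%N.
Proof.
apply: (@leq_trans (kk m (Num.max t T))); first by apply: kk_le; rewrite le_max lexx.
rewrite -(@ler_nat R) -(ler_pM2r (mesh_gt0 m)) meshM.
have -> : kk m (Num.max t T) = kk m T.
  by rewrite /kk; congr Num.truncn; congr (_ / _); rewrite minxx; apply/min_idPr; rewrite le_max lexx orbT.
by have := @kk_itv m T; rewrite lexx ltW// => /(_ isT)/andP[].
Qed.

Lemma kk_diff m s t : 0 <= s -> s <= t -> t <= T ->
  `|((kk m t - kk m s)%N%:R * mesh m) - (t - s)| <= mesh m.
Proof.
move=> s0 st tT.
have /andP[s1 s2] := @kk_itv m s (introT andP (conj s0 (le_trans st tT))).
have /andP[t1 t2] := @kk_itv m t (introT andP (conj (le_trans s0 st) tT)).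
rewrite natrB ?kk_le// mulrBl ler_norml; apply/andP; split; lra.
Qed.

Lemma kk_cvg s t : 0 <= s -> s <= t -> t <= T ->
  (fun m => (kk m t - kk m s)%N%:R * mesh m) @ \oo --> t - s.
Proof.
move=> s0 st tT; apply/cvgrPdist_le => e e0.
move/cvgrPdist_le : mesh_cvg0 => /(_ _ e0); apply: filterS => m.
rewrite sub0r normrN gtr0_norm ?mesh_gt0// => h; rewrite distrC.
by apply: le_trans h; exact: kk_diff.
Qed.

Lemma kk_add m s t : s <= t -> kk m t = (kk m s + (kk m t - kk m s))%N.
Proof. by move=> st; rewrite subnKC// kk_le. Qed.

End time_index.

Section limit_noise.
Context {R : realType} {d : nat}.
Local Notation V := 'rV[R]_d.
Local Notation Rd := (@Rd R d).
Local Notation paths := (@paths R d).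
Variables (T : R) (mu0 : probability Rd R) (rho : nat -> probability Rd R) (al C : R).
Hypotheses (T0 : 0 < T) (al12 : 1 < al < 2) (C0 : 0 < C).
Hypothesis rhoN : forall m, noise al C (T / m.+1%:R) (rho m).

Definition base m : probability paths R := walk mu0 (rho m) m.+1.
Local Notation P := base.
Local Notation kk := (kk T).
Local Notation mesh := (mesh T).
Local Notation Om := (nat -> paths).
Local Notation Q := (loebP P).

Lemma Ex_incr m j n (W : paths -> R) (f : V -> R) : (j + n <= m.+1)%N -> bmf W -> adaptk j W ->
  @bmf R _ Rd f ->
  Ex (P m) (fun w => W w * f (Lk (j + n) w - Lk j w)) = Ex (P m) W * Ex (convn (rho m) n) f.
Proof.
move=> jn bW aW bf.
have m0 : measurable_fun setT ((fun _ => 0) : paths -> Rd) by exact: measurable_cst.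
have := @walk_incr _ _ mu0 (rho m) m.+1 j n W (fun _ => 0) f jn bW aW m0 (fun _ => erefl) bf.
under eq_Ex do rewrite add0r; move=> ->.
rewrite mulrC -ExZ//; apply: eq_Ex => w; rewrite mulrC; congr (_ * _).
by rewrite titer_convn// /transl; apply: eq_Ex => y; rewrite add0r.
Qed.

Lemma Ex_incr1 m j n (f : V -> R) : (j + n <= m.+1)%N -> @bmf R _ Rd f ->
  Ex (P m) (fun w => f (Lk (j + n) w - Lk j w)) = Ex (convn (rho m) n) f.
Proof.
move=> jn bf; have := @Ex_incr m j n (fun=> 1) f jn (bmf_cst 1) (fun=> erefl) bf.
by rewrite Ex_cst mul1r => <-; apply: eq_Ex => w; rewrite mul1r.
Qed.

Lemma Lk0 (w : paths) : Lk 0 w = 0.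
Proof. by rewrite /Lk big_geq. Qed.

Lemma incr_moment (p dl : R) : 1 <= p -> p < al -> 0 < dl ->
  exists2 C' : R, 0 <= C' & forall m j n, (j + n <= m.+1)%N -> forall k : nat,
    Ex (P m) (fun w => Num.min (enorm (Lk (j + n) w - Lk j w) `^ p) k%:R) <= dl + C' * (n%:R * mesh m).
Proof.
move=> p1 pal dl0; have /andP[_ al2] := al12.
have [C' C'0 H] := convn_moment (d := d) p1 pal al2 C0 dl0.
exists C' => // m j n jn k.
rewrite (@Ex_incr1 m j n (fun x => Num.min (enorm x `^ p) k%:R))//; last exact: bmf_minpow.
exact: (H (rho m) (mesh m) n (mesh_gt0 T0 m) (rhoN m) k).
Qed.

Lemma incr_tight : exists2 B : R, 0 < B & forall (K : R) m j n, (j + n <= m.+1)%N -> 1 <= K ->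
  pr P m [set w | K < enorm (Lk (j + n) w - Lk j w)] <= B / K.
Proof.
have /andP[al1 _] := al12.
have [C' C'0 H] := incr_moment (lexx 1) al1 ltr01.
exists (1 + C' * T) => [|K m j n jn K1]; first by rewrite ltr_wpDr// mulr_ge0// ltW.
have K0 : 0 < K by apply: lt_le_trans K1.
pose k := (Num.bound K); pose f (w : paths) := Num.min (enorm (Lk (j + n) w - Lk j w) `^ 1) k%:R.
have mI : measurable_fun setT ((fun w => Lk (j + n) w - Lk j w) : paths -> Rd).
  by apply: mvB; exact: meas_Lk.
have bf : bmf f.
  exact: (bmf_comp (T' := Rd) (bmf_minpow 1 (ler0n R k)) mI).
have f0 w : 0 <= f w by rewrite le_min powR_ge0/=.
have Kk : K <= k%:R by apply: ltW; apply: archi_boundP; exact: ltW.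
have mE : measurable_fun setT (fun w : paths => enorm (Lk (j + n) w - Lk j w)).
  exact: (measurableT_comp (@meas_enorm R d) mI).
have le1 : pr P m [set w | K < enorm (Lk (j + n) w - Lk j w)] <= fine (P m [set w | K <= f w]).
  apply: pr_le.
  - exact: meas_gt.
  - rewrite (_ : [set w | K <= f w] = f @^-1` [set` `[K, +oo[]); last first.
      by apply/seteqP; split => w /=; rewrite in_itv/= andbT.
    by rewrite -[X in measurable X]setTI; exact: bf.1.
  - by move=> w /= h; rewrite le_min powRr1 ?enorm_ge0// ltW.
apply: (le_trans le1); apply: (le_trans (Ex_markov (P m) bf f0 K0)).
rewrite ler_pM2r ?invr_gt0//; apply: (le_trans (H m j n jn k)).
rewrite lerD2l ler_wpM2l//.
apply: (@le_trans _ _ (m.+1%:R * mesh m)); last by rewrite meshM.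
by rewrite ler_pM2r ?mesh_gt0// ler_nat; apply: leq_trans jn; exact: leq_addl.
Qed.

Definition dL s t m (w : paths) : V := Lk (kk m t) w - Lk (kk m s) w.
(** The standard part at each time separately; its exceptional null set depends on [t], which is why
    its paths have to be regularised. *)
Definition Lo t (w : Om) : V := vlim (fun m => Lk (kk m t) (w m)).

Lemma Lo_cvg t : lnull P [set w | ~ ((fun m => Lk (kk m t) (w m)) @ ult --> Lo t w)].
Proof.
have [B B0 H] := incr_tight.
have : lnull P [set w : Om | ~ exists K : R, ult [set m | enorm (Lk (kk m t) (w m)) <= K]].
  apply: (@lnull_unbounded _ _ _ P (fun m w => enorm (Lk (kk m t) w))).
    by move=> m; exact: (measurableT_comp (@meas_enorm R d) (meas_Lk _)).
  move=> e e0; exists (Num.max 1 (B / e)); apply: filterE => m /=.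
  set K := Num.max _ _; have K1 : 1 <= K by rewrite le_max lexx.
  have K0 : 0 < K by exact: lt_le_trans K1.
  have := H K m 0%N (kk m t) (kkT T0 m t) K1.
  rewrite add0n; under eq_set do rewrite Lk0 subr0.
  move=> /le_trans; apply; rewrite ler_pdivrMr// mulrC -ler_pdivrMr//.
  by rewrite le_max lexx orbT.
apply: lnullS => w /=; apply: contra_not => -[K hK]; exact: (cvg_vlim hK).
Qed.

(** Events of the discrete past: those decided by the coordinates up to step [kk m t]. *)
Definition Gt (t : R) m : set (set paths) :=
  [set B | measurable B /\ forall w, B (cut (kk m t) w) <-> B w].

Lemma Gt_algebra t : internal_algebra (Gt t).
Proof.
split => [m B []//|m|m B [mB hB]|m B D [mB hB] [mD hD]].
- by split => //; exact: measurable0.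
- by split=> [|w]; [exact: measurableC|rewrite /= hB].
- by split=> [|w]; [exact: measurableU|rewrite /= hB hD].
Qed.

Lemma Gt_mono s t m : s <= t -> Gt s m `<=` Gt t m.
Proof.
move=> st B [mB hB]; split => // w.
by rewrite -hB cut_cut ?hB//; exact: kk_le.
Qed.

Lemma Gt_gt t m (W : paths -> R) r : measurable_fun setT W -> adaptk (kk m t) W ->
  Gt t m [set w | r < W w].
Proof. by move=> mW aW; split=> [|w /=]; [exact: meas_gt|rewrite aW]. Qed.

Definition Ft (t : R) : set (set (loeb P)) := lsets P (Gt t).

Lemma Ft_sigma t : sigma_algebra setT (Ft t).
Proof. exact: lsets_sigma (Gt_algebra t). Qed.

Lemma Ft_mono s t : s <= t -> Ft s `<=` Ft t.
Proof. by move=> st; apply: lsets_mono => m; exact: Gt_mono. Qed.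

Lemma Ft_meas t : Ft t `<=` measurable.
Proof. by move=> A [B [GB AB]]; apply/loeb_measE; exists B; split => // m; have [] := GB m. Qed.

Lemma Ex_st_bcont (Z : nat -> paths -> V) (z : Om -> V) (f : V -> R) (A : set (loeb P))
    (B : nat -> set paths) :
  (forall m, measurable_fun setT (Z m : paths -> Rd)) ->
  lnull P [set w | ~ ((fun m => Z m (w m)) @ ult --> z w)] ->
  (forall m, measurable (B m)) -> agree P A (star B) ->
  @bmf R _ Rd f -> continuous f ->
  @bmf R _ (loeb P) (fun w => \1_A w * f (z w)) /\
  (fun m => Ex (P m) (fun w => \1_(B m) w * f (Z m w))) @ ult --> Ex Q (fun w => \1_A w * f (z w)).
Proof.
move=> mZ Zz mB AB bf cf; have [K [K0 hK]] := bmf_bound bf.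
have i1 (U : Type) (D : set U) x y : `|y| <= K -> `|\1_D x * y| <= K.
  by move=> h; rewrite indicE normrM ger0_norm//; apply: le_trans h; rewrite ler_piMl// lern1 leq_b1.
apply: (@Ex_st _ _ _ P (fun m w => \1_(B m) w * f (Z m w)) (fun w => \1_A w * f (z w)) K).
- move=> m; apply: measurable_funM; first exact: measurable_indic.
  exact: (bmf_comp (T' := Rd) bf (mZ m)).1.
- by move=> m x; exact: i1.
- by move=> w; exact: i1.
apply: lnullS (lnullU Zz AB) => w /= hn; apply: contrapT => /not_orP[/contrapT h1 /contrapT h2].
apply: hn; apply: cvgM; last exact: (cvg_cont cf h1).
have [Aw|nA] := pselect (A w).
  rewrite [X in _ --> X]indicE mem_set//.
  apply: (@ult_near_eq _ (fun=> true%:R)); first exact: cvg_cst.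
  by apply: filterS (h2.1 Aw) => m hm /=; rewrite indicE mem_set.
rewrite [X in _ --> X]indicE memNset//.
apply: (@ult_near_eq _ (fun=> false%:R)); first exact: cvg_cst.
have : ~ star B w by move=> /h2.2.
by move/ultC; apply: filterS => m hm /=; rewrite indicE memNset.
Qed.

Lemma Ex_st_cont (Z : nat -> paths -> V) (z : Om -> V) (f : V -> R) :
  (forall m, measurable_fun setT (Z m : paths -> Rd)) ->
  lnull P [set w | ~ ((fun m => Z m (w m)) @ ult --> z w)] -> @bmf R _ Rd f -> continuous f ->
  @bmf R _ (loeb P) (fun w => f (z w)) /\
  (fun m => Ex (P m) (fun w => f (Z m w))) @ ult --> Ex Q (fun w => f (z w)).
Proof.
move=> mZ Zz bf cf; have [K [K0 hK]] := bmf_bound bf.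
apply: (@Ex_st _ _ _ P (fun m w => f (Z m w)) (fun w => f (z w)) K) => //.
  by move=> m; exact: (bmf_comp (T' := Rd) bf (mZ m)).1.
apply: lnullS Zz => w /=; apply: contra_not; exact: (cvg_cont cf).
Qed.

Lemma dL_cvg s t :
  lnull P [set w | ~ ((fun m => dL s t m (w m)) @ ult --> Lo t w - Lo s w)].
Proof.
apply: lnullS (lnullU (Lo_cvg t) (Lo_cvg s)) => w /= hn.
apply: contrapT => /not_orP[/contrapT h1 /contrapT h2]; apply: hn; exact: cvgB.
Qed.

Lemma meas_dL s t m : measurable_fun setT (dL s t m : paths -> Rd).
Proof. by apply: mvB; exact: meas_Lk. Qed.

Lemma Ex_dL s t (f : V -> R) : s <= t -> @bmf R _ Rd f -> continuous f ->
  @bmf R _ (loeb P) (fun w => f (Lo t w - Lo s w)) /\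
  (fun m => Ex (convn (rho m) (kk m t - kk m s)) f) @ ult --> Ex Q (fun w => f (Lo t w - Lo s w)).
Proof.
move=> st bf cf; have [b1 h] := Ex_st_cont (meas_dL s t) (dL_cvg s t) bf cf; split => //.
apply: (ult_near_eq h); apply: filterE => m /=; rewrite /dL (kk_add T0 m st).
by rewrite Ex_incr1// -kk_add// kkT.
Qed.

Lemma Lo_moment (p dl : R) : 1 <= p -> p < al -> 0 < dl -> exists2 C' : R, 0 <= C' &
  forall s t, 0 <= s -> s <= t -> t <= T -> forall k : nat,
    Ex Q (fun w => Num.min (enorm (Lo t w - Lo s w) `^ p) k%:R) <= dl + C' * (t - s).
Proof.
move=> p1 pal dl0; have /andP[_ al2] := al12.
have [C' C'0 H] := convn_moment (d := d) p1 pal al2 C0 dl0.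
exists C' => // s t s0 st tT k.
have cf : continuous (fun x : V => Num.min (enorm x `^ p) k%:R).
  by move=> x; exact: (cvg_minc _ (@continuous_enorm_pow R d p p1 x)).
have [_ h] := Ex_dL st (bmf_minpow p (ler0n R k)) cf.
have h2 : (fun m => dl + C' * ((kk m t - kk m s)%N%:R * mesh m)) @ ult --> dl + C' * (t - s).
  apply: cvgD; first exact: cvg_cst.
  apply: cvgM; first exact: cvg_cst.
  by apply: cvg_trans (kk_cvg T0 s0 st tT) => A; exact: ult_oo.
apply: (ult_le h h2); apply: filterE => m /=.
exact: (H (rho m) (mesh m) _ (mesh_gt0 T0 m) (rhoN m) k).
Qed.

(** Independence is exact in every scheme, since the internal representative of [A] depends on
    coordinates before the increment; continuous test functions carry it to the limit. *)
Lemma Lo_indep s t (A : set (loeb P)) (f : V -> R) : 0 <= s -> s <= t -> t <= T -> Ft s A ->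
  @bmf R _ Rd f -> continuous f ->
  Ex Q (fun w => \1_A w * f (Lo t w - Lo s w)) = Ex Q \1_A * Ex Q (fun w => f (Lo t w - Lo s w)).
Proof.
move=> s0 st tT [B [GB AB]] bf cf.
have mB m : measurable (B m) by have [] := GB m.
have mZ := meas_dL s t; have Zz := dL_cvg s t.
have [_ e1] := Ex_st_bcont mZ Zz mB AB bf cf.
have [_ e2] := Ex_st_bcont mZ Zz mB AB (bmf_cst 1) (@cst_continuous _ _ (1 : R)).
have AT : agree P setT (star (fun=> setT)).
  by apply: lnullS (lnull0 P) => w /= h; apply: h; split => // _; exact: filterT.
have [_ e3] := Ex_st_bcont mZ Zz (fun=> measurableT) AT bf cf.
have -> : Ex Q \1_A = Ex Q (fun w => \1_A w * 1) by apply: eq_Ex => w; rewrite mulr1.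
have -> : Ex Q (fun w => f (Lo t w - Lo s w)) = Ex Q (fun w => \1_setT w * f (Lo t w - Lo s w)).
  by apply: eq_Ex => w; rewrite indicT mul1r.
apply: (ult_unique e1); have e4 := cvgM e2 e3.
apply: (ult_near_eq (e4 _)); apply: filterE => m /=.
have kkn : (kk m s + (kk m t - kk m s) <= m.+1)%N by rewrite -kk_add// kkT.
have aB : adaptk (kk m s) (\1_(B m) : paths -> R).
  move=> w; rewrite !indicE; congr (_ %:R); congr nat_of_bool.
  by apply/idP/idP; rewrite !inE => /(GB m).2.
have bB : bmf (\1_(B m) : paths -> R) by exact: bmf_indic.
have E1 := Ex_incr kkn bB aB bf.
have E2 := Ex_incr1 kkn bf.
rewrite -kk_add// in E1 E2.
rewrite [X in X * _ = _](_ : _ = Ex (P m) \1_(B m)); last by apply: eq_Ex => w; rewrite mulr1.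
rewrite [X in _ * X = _](_ : _ = Ex (convn (rho m) (kk m t - kk m s)) f).
  by rewrite -E1.
by rewrite -E2; apply: eq_Ex => w; rewrite indicT mul1r.
Qed.

End limit_noise.

(** * Right-continuous version of the limit noise *)

Section regulated_functions.
Context {R : realType} {d : nat}.
Local Notation V := 'rV[R]_d.
Variables (T : R) (D : set R).
Hypotheses (T0 : 0 < T) (DT : forall q, D q -> 0 <= q <= T).

Definition jumps (x : R -> V) (e : R) : rel R := fun q q' => (q < q') && (e < enorm (x q' - x q)).

(** Locally bounded numbers of oscillations along the times in [D] replace the existence of
    one-sided limits: this is the form that the counter [osc] controls. *)
Definition regular (x : R -> V) := forall (e t : R), 0 < e -> 0 <= t <= T ->
  exists dl N, 0 < dl /\ forall q0 s, (forall q, q \in q0 :: s -> D q /\ `|q - t| < dl) ->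
    path (jumps x e) q0 s -> (size s <= N)%N.

(** One of two distant points is far from any given third point; a chain of jumps can thus be
    prolonged at the price of halving their size. *)
Lemma jump_choice (x : R -> V) (e p q q' : R) : e < enorm (x q' - x q) ->
  e / 2 < enorm (x p - x q) \/ e / 2 < enorm (x p - x q').
Proof.
move=> h; have [h1|h1] := ltP (e / 2) (enorm (x p - x q)); first by left.
by right; have := enorm_tri (x q') (x p) (x q); rewrite [enorm (x q' - x p)]enormB; lra.
Qed.

(** If oscillations persisted in every right neighbourhood of [t], chains of e/2-jumps could be
    prolonged at their left end by points ever closer to [t], against the bound on their length. *)
Lemma regular_right x : regular x -> forall t e : R, 0 <= t <= T -> 0 < e ->
  exists2 dl : R, 0 < dl & forall q q', D q -> D q' -> t < q < t + dl -> t < q' < t + dl ->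
    enorm (x q' - x q) <= e.
Proof.
move=> reg t e tT e0; apply: contrapT => hn.
have e2 : 0 < e / 2 by rewrite divr_gt0.
have pair dl : 0 < dl -> exists q q', [/\ D q /\ D q', t < q < t + dl, t < q' < t + dl, q < q' & e < enorm (x q' - x q)].
  move=> dl0; apply: contrapT => h; apply: hn; exists dl => // q q' Dq Dq' hq hq'.
  rewrite leNgt; apply/negP => he.
  have [qq|qq|qq] := ltgtP q q'.
  - by apply: h; exists q, q'.
  - by apply: h; exists q', q; split => //; rewrite enormB.
  - by move: he; rewrite qq subrr enorm0 ltNge ltW.
have [dl [N [dl0 hN]]] := reg _ _ e2 tT.
have build n : exists q0 s, [/\ forall q, q \in q0 :: s -> D q /\ t < q < t + dl,
    path (jumps x (e / 2)) q0 s & size s = n].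
  elim: n => [|n [q0 [s [hs ps <-]]]].
    have [q [q' [[Dq _] hq _ _ _]]] := pair _ dl0.
    by exists q, [::]; split => // p; rewrite inE => /eqP ->.
  have [Dq0 /andP[tq0 q0d]] := hs q0 (mem_head _ _).
  have d0 : 0 < q0 - t by rewrite subr_gt0.
  have [q [q' [[Dq Dq'] hq hq' qq' eq]]] := pair _ d0.
  have lt1 p : t < p < t + (q0 - t) -> t < p < t + dl /\ p < q0.
    by move=> /andP[p1 p2]; rewrite addrC subrK in p2; split => //; rewrite p1 (lt_trans p2).
  have [h|h] := jump_choice q0 eq.
    exists q, (q0 :: s); split => //=; last by rewrite ps andbT /jumps h (lt1 _ hq).2.
    by move=> p; rewrite inE => /orP[/eqP ->|/hs//]; split => //; exact: (lt1 _ hq).1.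
  exists q', (q0 :: s); split => //=; last by rewrite ps andbT /jumps h (lt1 _ hq').2.
  by move=> p; rewrite inE => /orP[/eqP ->|/hs//]; split => //; exact: (lt1 _ hq').1.
have [q0 [s [hs ps sN]]] := build N.+1.
have := hN q0 s; rewrite sN ltnn => h; apply/notF/h => // q /hs[Dq /andP[q1 q2]]; split => //.
by rewrite ltr_norml; apply/andP; split; lra.
Qed.

(** Mirror image of [regular_right]: the chains now grow at their right end. *)
Lemma regular_left x : regular x -> forall t e : R, 0 <= t <= T -> 0 < e ->
  exists2 dl : R, 0 < dl & forall q q', D q -> D q' -> t - dl < q < t -> t - dl < q' < t ->
    enorm (x q' - x q) <= e.
Proof.
move=> reg t e tT e0; apply: contrapT => hn.
have e2 : 0 < e / 2 by rewrite divr_gt0.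
have pair dl : 0 < dl -> exists q q', [/\ D q /\ D q', t - dl < q < t, t - dl < q' < t, q < q' & e < enorm (x q' - x q)].
  move=> dl0; apply: contrapT => h; apply: hn; exists dl => // q q' Dq Dq' hq hq'.
  rewrite leNgt; apply/negP => he.
  have [qq|qq|qq] := ltgtP q q'.
  - by apply: h; exists q, q'.
  - by apply: h; exists q', q; split => //; rewrite enormB.
  - by move: he; rewrite qq subrr enorm0 ltNge ltW.
have [dl [N [dl0 hN]]] := reg _ _ e2 tT.
have build n : exists q0 s, [/\ forall q, q \in q0 :: s -> D q /\ t - dl < q < t,
    path (jumps x (e / 2)) q0 s & size s = n].
  elim: n => [|n [q0 [s [hs ps <-]]]].
    have [q [q' [[Dq _] hq _ _ _]]] := pair _ dl0.
    by exists q, [::]; split => // p; rewrite inE => /eqP ->.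
  have [Dl /andP[dql lqt]] := hs (last q0 s) (mem_last _ _).
  set l := last q0 s in Dl dql lqt.
  have d0 : 0 < t - l by rewrite subr_gt0.
  have [q [q' [[Dq Dq'] hq hq' qq' eq]]] := pair _ d0.
  have lt1 p : t - (t - l) < p < t -> t - dl < p < t /\ l < p.
    by move=> /andP[p1 p2]; rewrite subKr in p1; split => //; rewrite p2 (lt_trans dql).
  have [h|h] := jump_choice l eq; rewrite enormB in h.
    exists q0, (rcons s q); split; last by rewrite size_rcons.
      move=> p; rewrite -rcons_cons mem_rcons inE => /orP[/eqP ->|/hs//].
      by split => //; exact: (lt1 _ hq).1.
    by rewrite rcons_path ps /jumps -/l h (lt1 _ hq).2.
  exists q0, (rcons s q'); split; last by rewrite size_rcons.
    move=> p; rewrite -rcons_cons mem_rcons inE => /orP[/eqP ->|/hs//].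
    by split => //; exact: (lt1 _ hq').1.
  by rewrite rcons_path ps /jumps -/l h (lt1 _ hq').2.
have [q0 [s [hs ps sN]]] := build N.+1.
have := hN q0 s; rewrite sN ltnn => h; apply/notF/h => // q /hs[Dq /andP[q1 q2]]; split => //.
by rewrite ltr_norml; apply/andP; split; lra.
Qed.

Variable r : nat -> R -> R.
Hypotheses (rD : forall n t, 0 <= t <= T -> D (r n t)).
Hypotheses (r_gt : forall n t, 0 <= t < T -> t < r n t) (r_T : forall n, r n T = T).
Hypothesis r_cvg : forall t, 0 <= t < T -> r ^~ t @ \oo --> t.

Definition rlim (x : R -> V) (t : R) : V := vlim (fun n => x (r n t)).

Lemma r_ult t (e : R) : 0 <= t < T -> 0 < e -> ult [set n | t < r n t < t + e].
Proof.
move=> tT e0; have te : t < t + e by rewrite ltrDl.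
have h0 : \forall n \near \oo, r n t < t + e by exact: (cvgr_lt t (r_cvg tT) _ te).
apply: ult_oo; apply: filterS h0 => n /= h.
by rewrite r_gt.
Qed.

Lemma rlim_T x : rlim x T = x T.
Proof. by apply: vlimE; under eq_fun do rewrite r_T; exact: cvg_cst. Qed.

Section regular_limit.
Variable x : R -> V.
Hypothesis reg : regular x.

Lemma rlim_seq t : 0 <= t < T -> (fun n => x (r n t)) @ ult --> rlim x t.
Proof.
move=> tT; have tT' : 0 <= t <= T by move: tT => /andP[-> /ltW].
have [dl dl0 h] := regular_right reg tT' ltr01.
have [n0 h0] := filter_ex (r_ult tT dl0).
apply: (@cvg_vlim _ _ _ (enorm (x (r n0 t)) + 1)); apply: filterS (r_ult tT dl0) => n /= hn.
have := h _ _ (rD n0 tT') (rD n tT') h0 hn.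
have := enormD (x (r n t) - x (r n0 t)) (x (r n0 t)); rewrite subrK; lra.
Qed.

Lemma rlim_near t (e : R) : 0 <= t < T -> 0 < e -> exists2 dl : R, 0 < dl & forall q, D q ->
  t < q < t + dl -> enorm (x q - rlim x t) <= e.
Proof.
move=> tT e0; have tT' : 0 <= t <= T by move: tT => /andP[-> /ltW].
have [dl dl0 h] := regular_right reg tT' e0.
exists dl => // q Dq hq.
have c : (fun n => x q - x (r n t)) @ ult --> x q - rlim x t.
  by apply: cvgB; [exact: cvg_cst|exact: rlim_seq].
apply: (cvg_enorm_le c); apply: filterS (r_ult tT dl0) => n /= hn.
exact: (h _ _ (rD n tT') Dq hn hq).
Qed.

Lemma rlim_seq_oo t : 0 <= t < T -> (fun n => x (r n t)) @ \oo --> rlim x t.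
Proof.
move=> tT; have tT' : 0 <= t <= T by move: tT => /andP[-> /ltW].
apply: cvg_of_enorm; apply/cvgrPdist_le => e e0.
have [dl dl0 h] := rlim_near tT e0.
have te : t < t + dl by rewrite ltrDl.
have h0 : \forall n \near \oo, r n t < t + dl by exact: (cvgr_lt t (r_cvg tT) _ te).
apply: filterS h0 => n /= hn.
rewrite sub0r normrN ger0_norm ?enorm_ge0//; apply: h; first exact: rD.
by rewrite r_gt.
Qed.

Lemma rlim_between s (a c e : R) (y : V) : 0 <= s <= T -> a < s < c ->
  (forall q, D q -> a < q < c -> enorm (y - x q) <= e) -> enorm (y - rlim x s) <= e.
Proof.
move=> /andP[s0 sT] /andP[as_ sc] h.
have [sT'|sT'] := ltP s T; last first.
  have sE : s = T by apply/eqP; rewrite eq_le sT sT'.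
  rewrite sE rlim_T; apply: h; last by rewrite -sE as_.
  by rewrite -(r_T 0); apply: rD; rewrite lexx ltW.
have sT2 : 0 <= s < T by rewrite s0.
have cv : (fun n => y - x (r n s)) @ ult --> y - rlim x s.
  by apply: cvgB; [exact: cvg_cst|exact: rlim_seq].
have cs : 0 < c - s by rewrite subr_gt0.
apply: (cvg_enorm_le cv); apply: filterS (r_ult sT2 cs) => n /= /andP[h1 h2].
apply: h; first by apply: rD; rewrite s0.
by rewrite (lt_trans as_)//=; rewrite addrC subrK in h2.
Qed.

Lemma rlim_right t : 0 <= t < T -> rlim x @ t^'+ --> rlim x t.
Proof.
move=> tT; apply: cvg_of_enorm; apply/cvgrPdist_le => e e0.
have [dl dl0 h] := rlim_near tT e0.
have /andP[t0 tT1] := tT.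
have m0 : 0 < Num.min dl (T - t) by rewrite lt_min dl0 subr_gt0.
near=> s; rewrite sub0r normrN ger0_norm ?enorm_ge0// enormB.
have ts : t < s by near: s; exact: nbhs_right_gt.
have sd : s < t + Num.min dl (T - t) by near: s; apply: nbhs_right_lt; rewrite ltrDl.
have s1 : s < t + dl by apply: lt_le_trans sd _; rewrite lerD2l ge_min lexx.
have s2 : s < T by apply: lt_le_trans sd _; rewrite -lerBrDl ge_min lexx orbT.
apply: (@rlim_between s t (t + dl)); rewrite ?ts ?(le_trans t0 (ltW ts)) ?(ltW s2)//.
by move=> q Dq hq; rewrite enormB; exact: h.
Unshelve. all: by end_near. Qed.

Lemma rlim_left t : 0 < t <= T -> cvg (rlim x @ t^'-).
Proof.
move=> /andP[t0 tT].
have cau (e : R) : 0 < e -> exists2 dl : R, 0 < dl & forall s s', 0 <= s -> 0 <= s' ->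
    t - dl < s < t -> t - dl < s' < t -> enorm (rlim x s' - rlim x s) <= e.
  move=> e0; have [dl dl0 h] := @regular_left x reg t e (introT andP (conj (ltW t0) tT)) e0.
  have inT s : 0 <= s -> t - dl < s < t -> 0 <= s <= T.
    by move=> -> /andP[_ /ltW st]; exact: le_trans tT.
  exists dl => // s s' s0 s0' hs hs'.
  apply: (rlim_between (inT _ s0 hs) hs) => q Dq hq; rewrite enormB.
  apply: (rlim_between (inT _ s0' hs') hs') => q' Dq' hq'.
  by rewrite enormB; exact: h.
pose u n : R := t - t / n.+2%:R.
have u0 n : 0 <= u n < t.
  rewrite /u subr_ge0 gtrBl divr_gt0// andbT ler_pdivrMr// ler_peMr ?(ltW t0)// ler1n//.
have uoo (dl : R) : 0 < dl -> ult [set n | t - dl < u n < t].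
  move=> dl0; apply: ult_oo.
  have : (fun n => t * n.+1%:R^-1) @ \oo --> t * 0 by apply: cvgM; [exact: cvg_cst|exact: cvg_harmonic].
  rewrite mulr0 => h.
  have h0 : \forall n \near \oo, t * n.+1%:R^-1 < dl by exact: (cvgr_lt 0 h _ dl0).
  apply: filterS h0 => n /= hn.
  have /andP[_ ->] := u0 n; rewrite andbT /u ltrD2l ltrN2; apply: le_lt_trans hn.
  by rewrite ler_pM2l// lef_pV2 ?posrE// ler_nat.
pose l := vlim (fun n => rlim x (u n)).
have cl : (fun n => rlim x (u n)) @ ult --> l.
  have [dl dl0 h] := cau _ ltr01; have [n0 h0] := filter_ex (uoo _ dl0).
  apply: (@cvg_vlim _ _ _ (enorm (rlim x (u n0)) + 1)); apply: filterS (uoo _ dl0) => n /= hn.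
  have /andP[p0 _] := u0 n; have /andP[p1 _] := u0 n0.
  have := h _ _ p1 p0 h0 hn.
  have := enormD (rlim x (u n) - rlim x (u n0)) (rlim x (u n0)); rewrite subrK; lra.
apply/cvg_ex; exists l; apply: cvg_of_enorm; apply/cvgrPdist_le => e e0.
have [dl dl0 h] := cau _ e0.
near=> s; rewrite sub0r normrN ger0_norm ?enorm_ge0//.
have st : s < t by near: s; exact: nbhs_left_lt.
have s0 : 0 <= s by apply: ltW; near: s; exact: nbhs_left_gt.
have sd : t - dl < s by near: s; apply: nbhs_left_gt; rewrite gtrBl.
have c : (fun n => rlim x s - rlim x (u n)) @ ult --> rlim x s - l.
  by apply: cvgB => //; exact: cvg_cst.
apply: (cvg_enorm_le c); apply: filterS (uoo _ dl0) => n /= hn.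
by have /andP[p0 _] := u0 n; apply: h => //; rewrite sd.
Unshelve. all: by end_near. Qed.

End regular_limit.

End regulated_functions.

Section sampling_times.
Context {R : realType} (T : R).
Hypothesis T0 : 0 < T.

(** Rational multiples of [T]; the cap makes [T] itself a sampling time, which stands for its
    missing right neighbours. *)
Definition qtime (i j : nat) : R := Num.min T (T * (i%:R / j.+1%:R)).
Definition qtimes : set R := [set q | exists i j, q = qtime i j].
(** The first point strictly after [t] on the grid of step T/(n+1), the successor making it strict,
    capped at [T]. *)
Definition rtime (n : nat) (t : R) : R := qtime (Num.truncn (t / T * n.+1%:R)).+1 n.

Lemma qtime_itv i j : 0 <= qtime i j <= T.
Proof.
by rewrite /qtime le_min ltW//= ge_min lexx andbT mulr_ge0 ?divr_ge0// ltW.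
Qed.

Lemma qtimes_itv q : qtimes q -> 0 <= q <= T.
Proof. by move=> [i [j ->]]; exact: qtime_itv. Qed.

Lemma rtime_q n t : qtimes (rtime n t).
Proof. by exists (Num.truncn (t / T * n.+1%:R)).+1, n. Qed.

Let rtime_raw n t : 0 <= t ->
  t < T * ((Num.truncn (t / T * n.+1%:R)).+1%:R / n.+1%:R) <= t + T / n.+1%:R.
Proof.
move=> t0; have n0 : 0 < n.+1%:R :> R by [].
have := @truncn_itv _ (t / T * n.+1%:R); rewrite mulr_ge0 ?divr_ge0 ?(ltW T0)// => /(_ isT).
set k := Num.truncn _ => /andP[k1 k2]; apply/andP; split.
  by rewrite mulrC -ltr_pdivrMr// ltr_pdivlMr.
have -> : t + T / n.+1%:R = T * ((t / T * n.+1%:R + 1) / n.+1%:R).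
  by field; rewrite !gt_eqF.
by rewrite ler_pM2l// ler_pM2r ?invr_gt0// -natr1 lerD2r.
Qed.

Lemma rtime_gt n t : 0 <= t < T -> t < rtime n t.
Proof.
move=> /andP[t0 tT]; rewrite /rtime /qtime lt_min tT/=.
by have /andP[] := rtime_raw n t0.
Qed.

Lemma rtime_T n : rtime n T = T.
Proof.
rewrite /rtime /qtime; apply/min_idPl.
by have /andP[/ltW] := rtime_raw n (ltW T0).
Qed.

Lemma rtime_cvg t : 0 <= t < T -> rtime ^~ t @ \oo --> t.
Proof.
move=> tT; apply/cvgrPdist_le => e e0.
have h : (fun n => T * n.+1%:R^-1) @ \oo --> T * 0 by apply: cvgM; [exact: cvg_cst|exact: cvg_harmonic].
rewrite mulr0 in h; have h0 : \forall n \near \oo, T * n.+1%:R^-1 < e by exact: (cvgr_lt 0 h _ e0).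
apply: filterS h0 => n /= hn; have h1 := rtime_gt n tT.
have /andP[t0 _] := tT; have /andP[_ h2] := rtime_raw n t0.
have h3 : rtime n t <= t + T / n.+1%:R by rewrite /rtime /qtime ge_min h2 orbT.
move: h3 hn; move: (T / n.+1%:R) => z h3 hn.
by rewrite distrC ger0_norm ?subr_ge0 ?(ltW h1)// lerBlDl (le_trans h3)// lerD2l ltW.
Qed.

End sampling_times.

Section regularised_noise.
Context {R : realType} {d : nat}.
Local Notation V := 'rV[R]_d.
Local Notation Rd := (@Rd R d).
Local Notation paths := (@paths R d).
Variables (T : R) (mu0 : probability Rd R) (rho : nat -> probability Rd R) (al C : R).
Hypotheses (T0 : 0 < T) (al12 : 1 < al < 2) (C0 : 0 < C).
Hypothesis rhoN : forall m, noise al C (T / m.+1%:R) (rho m).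
Local Notation P := (base mu0 rho).
Local Notation kk := (kk T).
Local Notation mesh := (mesh T).
Local Notation Om := (nat -> paths).
Local Notation Q := (loebP P).
Local Notation Lo := (Lo T).
Local Notation qtimes := (qtimes T).

Let theta (e : R) (x : V) : R := Num.min 1 (2 / e * enorm x).

(** The bound 2 lam on the elapsed time covers a window of length [lam] together with the rounding
    error of one mesh. *)
Let theta_small (e : R) : 0 < e -> exists2 lam : R, 0 < lam & forall m n, n%:R * mesh m <= 2 * lam ->
  forall j, (j <= n)%N -> titer (rho m) j (theta e) 0 <= 4^-1.
Proof.
move=> e0; have /andP[al1 al2] := al12.
(* The numbers 32 here and in [lam] lead to 2/e times (e/32 + e/16), which is 3/16 < 1/4. *)
have e32 : 0 < e / 32 by rewrite divr_gt0.
have [C' C'0 H] := convn_moment (d := d) (lexx 1) al1 al2 C0 e32.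
have C1 : 0 < C' + 1 by rewrite ltr_wpDl.
pose lam : R := e / (32 * (C' + 1)).
have lam0 : 0 < lam by rewrite divr_gt0// mulr_gt0.
exists lam => // m n nm j jn.
pose k := Num.bound e.
have ek : e <= k%:R by apply: ltW; apply: archi_boundP; exact: ltW.
have bth : @bmf R _ Rd (theta e).
  split.
    apply: measurable_minr; first exact: measurable_cst.
    by apply: measurable_funM; [exact: measurable_cst|exact: meas_enorm].
  exists 1 => x; rewrite ger0_norm; first by rewrite ge_min lexx.
  by rewrite le_min ler01/= mulr_ge0 ?enorm_ge0// divr_ge0// ltW.
rewrite titer_convn// /transl; under eq_Ex do rewrite add0r.
have e2 : 0 < 2 / e by exact: divr_gt0.
apply: (@le_trans _ _ (Ex (convn (rho m) j) (fun x => 2 / e * Num.min (enorm (x : V) `^ 1) k%:R))).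
  apply: Ex_le => //; first by apply: bmfZ; exact: bmf_minpow.
  move=> x; rewrite powRr1 ?enorm_ge0// /theta.
  have [h|h] := leP (enorm x) k%:R; first by rewrite ge_min lexx orbT.
  rewrite ge_min; apply/orP; left; apply: (@le_trans _ _ (2 / e * e)); last by rewrite ler_pM2l.
  by rewrite divfK ?gt_eqF// ler1n.
rewrite ExZ; last exact: bmf_minpow.
have hj := H (rho m) (mesh m) j (mesh_gt0 T0 m) (rhoN m) k.
have jl : j%:R * mesh m <= 2 * lam.
  by apply: le_trans nm; rewrite ler_pM2r ?mesh_gt0// ler_nat.
apply: (@le_trans _ _ (2 / e * (e / 32 + C' * (2 * lam)))).
  by rewrite ler_pM2l//; apply: (le_trans hj); rewrite lerD2l ler_wpM2l.
have l2 : C' * (2 * lam) <= e / 16.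
  apply: (@le_trans _ _ ((C' + 1) * (2 * lam))); first by rewrite ler_wpM2r ?lerDl// mulr_ge0// ltW.
  by rewrite /lam le_eqVlt; apply/orP; left; apply/eqP; field; rewrite gt_eqF.
apply: (@le_trans _ _ (2 / e * (e / 32 + e / 16))); first by rewrite ler_pM2l// lerD2l.
rewrite (_ : 2 / e * (e / 32 + e / 16) = 3 / 16); last by field; rewrite gt_eqF.
lra.
Qed.

Let wcount (e : R) (k0 n : nat) (w : paths) : R :=
  2 ^+ (osc e (fun i => Lk (k0 + i) w) n).1.

Let count_bounded (e lam : R) (a : R) : 0 < e -> 0 < lam ->
  (forall m n, n%:R * mesh m <= 2 * lam -> forall j, (j <= n)%N -> titer (rho m) j (theta e) 0 <= 4^-1) ->
  0 <= a <= T ->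
  lnull P [set w | ~ exists K : R, ult [set m |
    wcount e (kk m a) (kk m (Num.min T (a + lam)) - kk m a) (w m) <= K]].
Proof.
move=> e0 lam0 hth /andP[a0 aT]; set c := Num.min T (a + lam).
have ac : a <= c by rewrite le_min aT/= lerDl ltW.
have cT : c <= T by rewrite ge_min lexx.
have ca : c <= a + lam by rewrite ge_min lexx orbT.
apply: (lnull_unbounded (P := P) (W := fun m => wcount e (kk m a) (kk m c - kk m a))).
  by move=> m; exact: (bmf_osc _ _ _).1.
move=> eps eps0; exists (2 / eps).
(* A mesh below [lam] keeps the rounded window below 2 lam. *)
have hm : ult [set m | mesh m <= lam].
  apply: ult_oo; move/cvgrPdist_le : (mesh_cvg0 T) => /(_ _ lam0); apply: filterS => m.
  by rewrite sub0r normrN gtr0_norm ?mesh_gt0.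
apply: filterS hm => m /= hm.
set n := (kk m c - kk m a)%N.
have kn : (kk m a + n <= m.+1)%N by rewrite -kk_add// kkT.
have nm : n%:R * mesh m <= 2 * lam.
  have := @kk_diff _ T T0 m a c a0 ac cT; rewrite ler_norml => /andP[_]; rewrite -/n; lra.
have bth : @bmf R _ Rd (theta e).
  split.
    apply: measurable_minr; first exact: measurable_cst.
    by apply: measurable_funM; [exact: measurable_cst|exact: meas_enorm].
  exists 1 => x; rewrite ger0_norm; first by rewrite ge_min lexx.
  by rewrite le_min ler01/= mulr_ge0 ?enorm_ge0// divr_ge0// ltW.
have th01 x : 0 <= theta e x <= 1.
  rewrite /theta le_min ler01/= ge_min lexx/= andbT mulr_ge0 ?enorm_ge0//.
  by rewrite divr_ge0// ltW.
have th1 x : e / 2 <= enorm x -> theta e x = 1.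
  move=> h; apply/min_idPl; apply: (@le_trans _ _ (2 / e * (e / 2))).
    by rewrite (_ : 2 / e * (e / 2) = 1)//; field; rewrite gt_eqF.
  by rewrite ler_pM2l// divr_gt0.
have EW := Ex_osc mu0 kn bth th01 th1 (hth m n nm).
have bW : bmf (wcount e (kk m a) n) by exact: bmf_osc.
have W0 w : 0 <= wcount e (kk m a) n w by exact: exprn_ge0.
have K0 : 0 < 2 / eps by exact: divr_gt0.
apply: (@le_trans _ _ (fine (P m [set w | 2 / eps <= wcount e (kk m a) n w]))).
  apply: pr_le; first by apply: meas_gt; exact: bW.1.
    rewrite (_ : [set w | _] = (wcount e (kk m a) n) @^-1` [set` `[2 / eps, +oo[]); last first.
      by apply/seteqP; split => w /=; rewrite in_itv/= andbT.
    by rewrite -[X in measurable X]setTI; exact: bW.1.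
  by move=> w /= /ltW.
apply: (le_trans (Ex_markov _ bW W0 K0)).
rewrite ler_pdivrMr//; apply: (le_trans EW).
by rewrite mulrCA divff ?gt_eqF// mulr1.
Qed.

(** A chain has finitely many strict jumps, so almost all discrete paths perform them too; one path
    among these that also obeys the counter bound suffices. *)
Let chain_count (w : Om) (e a c : R) (K : R) : 0 < e ->
  (forall q, qtimes q -> (fun m => Lk (kk m q) (w m)) @ ult --> Lo q w) ->
  a <= c -> ult [set m | wcount e (kk m a) (kk m c - kk m a) (w m) <= K] ->
  exists N, forall q0 s, (forall q, q \in q0 :: s -> qtimes q /\ a <= q <= c) ->
    path (jumps (Lo ^~ w) (2 * e)) q0 s -> (size s <= N)%N.
Proof.
move=> e0 cv ac hK; exists (Num.bound K) => q0 s hs ps.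
pose l m i := Lk (kk m a + i) (w m); pose idx m q := (kk m q - kk m a)%N.
have key : ult [set m | path (fun i j => (i <= j)%N && (2 * e < enorm (l m j - l m i)))
    (idx m q0) (map (idx m) s)].
  elim: s q0 hs ps => [|q1 s IH] q0 hs /=; first by move=> _; apply: filterE.
  move=> /andP[/andP[q01 j01] ps].
  have hs1 : forall q, q \in q1 :: s -> qtimes q /\ a <= q <= c.
    by move=> q hq; apply: hs; rewrite inE hq orbT.
  have [D0 /andP[aq0 _]] := hs q0 (mem_head _ _).
  have [D1 /andP[aq1 _]] := hs1 q1 (mem_head _ _).
  have cJ : (fun m => enorm (Lk (kk m q1) (w m) - Lk (kk m q0) (w m))) @ ult -->
      enorm (Lo q1 w - Lo q0 w).
    apply: (cvg_cont (lip_continuous (@lip_enorm R d))).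
    by apply: cvgB; exact: cv.
  have uJ : ult [set m | 2 * e < enorm (Lk (kk m q1) (w m) - Lk (kk m q0) (w m))].
    exact: (cvgr_gt _ cJ _ j01).
  apply: filterS (filterI (IH _ hs1 ps) uJ) => m [/= -> h].
  rewrite andbT; apply/andP; split; first by apply: leq_sub2r; apply: kk_le => //; exact: ltW.
  by rewrite /l /idx -!kk_add.
have [m [hm hp]] := filter_ex (filterI hK key).
have sz := osc_chain (ltW e0) hp; rewrite size_map in sz.
have lastq : last (idx m q0) (map (idx m) s) = idx m (last q0 s) by rewrite last_map.
have [_ /andP[_ lc]] := hs _ (mem_last q0 s).
have le1 : (idx m (last q0 s) <= kk m c - kk m a)%N by apply: leq_sub2r; exact: kk_le.
have [le2 _] := osc_homo e (l m) le1.
have sN : (size s <= (osc e (l m) (kk m c - kk m a)).1)%N.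
  by apply: (leq_trans sz); rewrite lastq.
have K0 : 0 <= K by apply: le_trans hm; exact: exprn_ge0.
rewrite -(@ler_nat R); apply: le_trans (ltW (archi_boundP K0)).
apply: le_trans hm; rewrite /wcount -natrX ler_nat.
by apply: (leq_trans sN); apply: ltnW; exact: ltn_expl.
Qed.

Lemma Lo_regular : lnull P [set w | ~ regular T qtimes (Lo ^~ w)].
Proof.
(* Half of 1/(i+1), since the counter at level [eps] controls chains of jumps larger than
   [2 * eps]. *)
pose ei (i : nat) : R := i.+1%:R^-1 / 2.
have ei0 i : 0 < ei i by rewrite divr_gt0// invr_gt0.
pose lam i : R := projT1 (cid2 (theta_small (ei0 i))).
have lam0 i : 0 < lam i by rewrite /lam; case: cid2.
have hlam i : forall m n, n%:R * mesh m <= 2 * lam i ->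
   forall j, (j <= n)%N -> titer (rho m) j (theta (ei i)) 0 <= 4^-1.
  by rewrite /lam; case: cid2.
pose a i j : R := Num.min T (j%:R * (lam i / 4)).
have aT i j : 0 <= a i j <= T.
  by rewrite le_min ltW//= ge_min lexx andbT mulr_ge0// divr_ge0// ltW.
pose N1 i j := [set w : Om | ~ exists K : R, ult [set m |
    wcount (ei i) (kk m (a i j)) (kk m (Num.min T (a i j + lam i)) - kk m (a i j)) (w m) <= K]].
have hN1 i j : lnull P (N1 i j) := count_bounded (ei0 i) (lam0 i) (hlam i) (aT i j).
pose N2 i j := [set w : Om | ~ ((fun m => Lk (kk m (qtime T i j)) (w m)) @ ult --> Lo (qtime T i j) w)].
have hN2 i j : lnull P (N2 i j) by exact: (Lo_cvg mu0 T0 al12 C0 rhoN).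
have h := lnullU (lnull_bigcup (fun i => lnull_bigcup (hN1 i))) (lnull_bigcup (fun i => lnull_bigcup (hN2 i))).
apply: lnullS h => w /= hn; apply: contrapT => /not_orP[n1 n2]; apply: hn.
have cv q : qtimes q -> (fun m => Lk (kk m q) (w m)) @ ult --> Lo q w.
  move=> [i [j ->]]; apply: contrapT => hq; apply: n2.
  by exists i => //; exists j.
move=> e t e0 tT.
have [i hi] := @ltr_add_invr R 0 e e0; rewrite add0r in hi.
have ie : 2 * ei i <= e.
  by apply: le_trans (ltW hi); rewrite /ei mulrC divfK.
have l4 : 0 < lam i / 4 by rewrite divr_gt0.
have /andP[t0 tT'] := tT.
(* Windows of length [lam i] start at multiples of a quarter of it. Stepping back one multiple puts
   the whole neighbourhood of [t] of radius lam/4 into window [j], unless j = 0, where the window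
   starts at time 0. *)
pose j := (Num.truncn (t / (lam i / 4))).-1.
have [aj1 aj2] : j%:R * (lam i / 4) <= t /\ t < j%:R * (lam i / 4) + 2 * (lam i / 4) /\
    (j%:R * (lam i / 4) + lam i / 4 <= t \/ j = 0%N).
  have := @truncn_itv _ (t / (lam i / 4)); rewrite divr_ge0 ?(ltW l4)// => /(_ isT).
  rewrite /j; case: (Num.truncn _) => [|n] /= /andP[].
    move=> _; rewrite ltr_pdivrMr// mul1r mul0r add0r => h1; split => //; split; last by right.
    by lra.
  rewrite ler_pdivlMr// ltr_pdivrMr// => h1 h2; split; last split.
  - by apply: le_trans h1; rewrite ler_pM2r// ler_nat.
  - by move: h2; rewrite -natr1 -natr1 !mulrDl; lra.
  - by left; move: h1; rewrite -natr1 mulrDl mul1r.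
have aE : a i j = j%:R * (lam i / 4) by apply/min_idPr; exact: le_trans tT'.
have [K hK] : exists K : R, ult [set m |
    wcount (ei i) (kk m (a i j)) (kk m (Num.min T (a i j + lam i)) - kk m (a i j)) (w m) <= K].
  by apply: contrapT => hk; apply: n1; exists i => //; exists j.
have ac : a i j <= Num.min T (a i j + lam i).
  by have /andP[_ h1] := aT i j; rewrite le_min h1 lerDl ltW.
have [N hN] := chain_count (ei0 i) cv ac hK.
exists (lam i / 4), N; split => // q0 s hs ps; apply: (hN q0 s).
  move=> q /hs[Dq]; rewrite ltr_norml => /andP[q1 q2]; split => //.
  have /andP[q0' qT] := qtimes_itv T0 Dq.
  rewrite le_min qT aE/=; apply/andP; split; last by lra.
  by case: aj2 => _ [h1|->]; [lra|rewrite mul0r].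
apply: sub_path ps => q q'; rewrite /jumps => /andP[-> h1] /=.
exact: le_lt_trans h1.
Qed.

Local Notation rlim := (rlim (rtime T)).

(** [Lo] is continuous in probability by the moment bound, so a limit along the sampling times must
    be [Lo t]. The event [B i k], that the distance stays above 1/(i+1) from index [k] on, lies in
    single events of arbitrarily small probability. *)
Let rlim_ae t : 0 <= t <= T ->
  lnull P [set w | regular T qtimes (Lo ^~ w) /\ rlim (Lo ^~ w) t <> Lo t w].
Proof.
move=> /andP[t0 tT]; have [tT'|tT'] := ltP t T; last first.
  have -> : t = T by apply/eqP; rewrite eq_le tT tT'.
  by apply: lnullS (lnull0 P) => w /= [_]; apply; apply: rlim_T; exact: rtime_T.
have tT2 : 0 <= t < T by rewrite t0.
have /andP[al1 _] := al12.
pose f n (w : Om) : R := Num.min (enorm (Lo (rtime T n t) w - Lo t w) `^ 1) 1%:R.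
have rT n : rtime T n t <= T by have /andP[] := qtimes_itv T0 (rtime_q T n t).
have bf n : @bmf R _ (loeb P) (f n).
  have cf : continuous (fun x : V => Num.min (enorm x `^ 1) 1%:R).
    by move=> x; exact: (cvg_minc _ (@continuous_enorm_pow R d 1 (lexx 1) x)).
  by have [] := Ex_dL mu0 T0 al12 C0 rhoN (ltW (rtime_gt T0 n tT2)) (bmf_minpow 1 (ler0n R 1)) cf.
have f0 n w : 0 <= f n w by rewrite le_min powR_ge0/=.
pose B i k : set (loeb P) := \bigcap_(n in [set n | (k <= n)%N]) [set w | i.+1%:R^-1 <= f n w].
have mB1 i n : measurable ([set w | i.+1%:R^-1 <= f n w] : set (loeb P)).
  rewrite (_ : [set w | _] = (f n) @^-1` [set` `[i.+1%:R^-1, +oo[]); last first.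
    by apply/seteqP; split => w /=; rewrite in_itv/= andbT.
  by rewrite -[X in measurable X]setTI; apply: (bf n).1.
have mB i k : measurable (B i k) by apply: bigcap_measurable => [|n _]; [exists k => /=|exact: mB1].
have B0 i k : Q (B i k) = 0%E.
  have i0 : 0 < i.+1%:R^-1 :> R by rewrite invr_gt0.
  suff h : fine (Q (B i k)) <= 0.
    by apply/eqP; rewrite -measure_le0 -[X in (X <= _)%E]fineK ?fin_num_measure// lee_fin.
  apply/ler_addgt0Pr => e e0; rewrite add0r.
  have e2 : 0 < i.+1%:R^-1 * (e / 2) by rewrite mulr_gt0// divr_gt0.
  have [C' C'0 H] := Lo_moment mu0 T0 al12 C0 rhoN (lexx 1) al1 e2.
  have cv : (fun n => C' * (rtime T n t - t)) @ \oo --> C' * (t - t).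
    apply: cvgM; first exact: cvg_cst.
    by apply: cvgB; [exact: rtime_cvg|exact: cvg_cst].
  rewrite subrr mulr0 in cv.
  have h0 : \forall n \near \oo, C' * (rtime T n t - t) < i.+1%:R^-1 * (e / 2).
    exact: (cvgr_lt 0 cv _ e2).
  have [n [/= hn kn]] : exists n, C' * (rtime T n t - t) < i.+1%:R^-1 * (e / 2) /\ (k <= n)%N.
    have [n [h1 h2]] := filter_ex (filterI h0 (nbhs_infty_ge k)).
    by exists n.
  have sub : B i k `<=` [set w | i.+1%:R^-1 <= f n w] by move=> w; apply; exact: kn.
  have hle := @pr_le _ _ _ (fun=> Q) 0%N _ _ (mB i k) (mB1 i n) sub.
  apply: (le_trans hle).
  apply: (le_trans (Ex_markov Q (bf n) (f0 n) i0)); rewrite ler_pdivrMr//.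
  apply: (le_trans (H t _ t0 (ltW (rtime_gt T0 n tT2)) (rT n) 1%N)).
  apply: (le_trans (lerD (lexx _) (ltW hn))).
  by rewrite -mulrDr -splitr mulrC.
have hB i k : lnull P (B i k) by apply: null_loeb.
apply: lnullS (lnull_bigcup (fun i => lnull_bigcup (hB i))) => w /= [reg ne].
have pos : 0 < Num.min (enorm (rlim (Lo ^~ w) t - Lo t w) `^ 1) 1%:R.
  rewrite lt_min ltr01 andbT powRr1 ?enorm_ge0// lt_neqAle enorm_ge0 andbT eq_sym.
  apply/eqP => e; apply: ne; apply/eqP; rewrite -subr_eq0; apply/eqP/rowP => j.
  by rewrite [RHS]mxE; apply/eqP; rewrite -normr_le0 -e; exact: coord_le.
have cv : f ^~ w @ \oo --> Num.min (enorm (rlim (Lo ^~ w) t - Lo t w) `^ 1) 1%:R.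
  have cf : continuous (fun x : V => Num.min (enorm x `^ 1) 1%:R).
    by move=> x; exact: (cvg_minc _ (@continuous_enorm_pow R d 1 (lexx 1) x)).
  have ci : (fun n => Lo (rtime T n t) w - Lo t w) @ \oo --> rlim (Lo ^~ w) t - Lo t w.
    apply: cvgB; last exact: cvg_cst.
    apply: (rlim_seq_oo (T := T) (D := qtimes)) => //.
    - by move=> n u _; exact: rtime_q.
    - by move=> n u; exact: rtime_gt.
    - by move=> u; exact: rtime_cvg.
  exact: (cvg_cont cf ci).
have [i hi] := ltr_add_invr pos; rewrite add0r in hi.
have h0 : \forall n \near \oo, i.+1%:R^-1 < f n w by exact: (cvgr_gt _ cv _ hi).
have [k _ hk] := h0; exists i; first exact: Logic.I.
exists k; first exact: Logic.I.
by move=> n kn; exact: ltW (hk n kn).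
Qed.

(* Lt is 0 on the null set of bad points, so that every path is cadlag. *)
Definition good (w : Om) : Prop := regular T qtimes (Lo ^~ w) /\ rlim (Lo ^~ w) 0 = 0.

Definition Lt (t : R) (w : Om) : V := if pselect (good w) is left _ then rlim (Lo ^~ w) t else 0.

Let Lo0 (w : Om) : Lo 0 w = 0.
Proof.
apply: vlimE; under eq_fun do rewrite kk0// Lk0; exact: cvg_cst.
Qed.

Lemma good_ae : lnull P [set w | ~ good w].
Proof.
have h0 : (0 : R) <= 0 <= T by rewrite lexx ltW.
apply: lnullS (lnullU Lo_regular (rlim_ae h0)) => w /= hn.
apply: contrapT => /not_orP[/contrapT h1 h2]; apply: hn; split => //.
by apply: contrapT => h3; apply: h2; split => //; rewrite Lo0.
Qed.

Lemma Lt_ae t : 0 <= t <= T -> lnull P [set w | Lt t w <> Lo t w].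
Proof.
move=> tT; apply: lnullS (lnullU good_ae (rlim_ae tT)) => w /= hn.
apply: contrapT => /not_orP[/contrapT h1 h2]; apply: h2; split; first exact: h1.1.
by move: hn; rewrite /Lt; case: pselect.
Qed.

Lemma Lt0 w : Lt 0 w = 0. Proof. by rewrite /Lt; case: pselect => // -[]. Qed.

Lemma Lt_right w t : 0 <= t < T -> Lt ^~ w @ t^'+ --> Lt t w.
Proof.
move=> tT; rewrite /Lt; case: pselect => [[reg _]|_]; last exact: cvg_cst.
apply: (rlim_right (D := qtimes)) tT => //.
- by move=> n u _; exact: rtime_q.
- by move=> n u; exact: rtime_gt.
- by move=> n; exact: rtime_T.
- by move=> u; exact: rtime_cvg.
Qed.

Lemma Lt_left w t : 0 < t <= T -> cvg (Lt ^~ w @ t^'-).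
Proof.
move=> tT; rewrite /Lt; case: pselect => [[reg _]|_]; last exact: is_cvg_cst.
apply: (rlim_left (D := qtimes)) tT => //.
- by move=> n u _; exact: rtime_q.
- by move=> n u; exact: rtime_gt.
- by move=> n; exact: rtime_T.
- by move=> u; exact: rtime_cvg.
Qed.

Lemma Lt_cvg t : 0 <= t <= T -> lnull P [set w | ~ ((fun m => Lk (kk m t) (w m)) @ ult --> Lt t w)].
Proof.
move=> tT; apply: lnullS (lnullU (Lo_cvg mu0 T0 al12 C0 rhoN t) (Lt_ae tT)) => w /= hn.
by apply: contrapT => /not_orP[/contrapT h1 /contrapT h2]; apply: hn; rewrite h2.
Qed.

Lemma Lt_meas t : 0 <= t <= T ->
  measurable_fun setT ((fun w => Lt t w : Rd) : ltype P (Gt T t) -> Rd).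
Proof.
move=> tT; apply: measurable_rV => i.
apply: (meas_st (W := fun m w => Lk (kk m t) w 0 i) (Gt_algebra T t)).
  move=> m r; apply: Gt_gt; first exact: (measurable_coord i (meas_Lk _)).
  by move=> w; rewrite adaptk_Lk.
apply: lnullS (Lt_cvg tT) => w /=; apply: contra_not => h.
exact: (cvg_cont (lip_continuous (@lip_coord R d i)) h).
Qed.

Lemma Lt_adapted t (B : set Rd) : 0 <= t <= T -> measurable B ->
  @Ft _ _ T mu0 rho t (Lt t @^-1` B).
Proof.
move=> tT mB; apply/(lmeasE _ (Gt_algebra T t)).
by rewrite -[X in measurable X]setTI; exact: Lt_meas.
Qed.

Lemma Lt_measQ t : 0 <= t <= T -> measurable_fun (setT : set (loeb P)) (fun w => Lt t w : Rd).
Proof.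
move=> tT _ B mB; rewrite setTI; exact: (Ft_meas (Lt_adapted tT mB)).
Qed.

Lemma eq_Ex_ae (f g : Om -> R) (N : set Om) : @bmf R _ (loeb P) f -> @bmf R _ (loeb P) g ->
  lnull P N -> (forall w, ~ N w -> f w = g w) -> Ex Q f = Ex Q g.
Proof.
move=> bf bg hN fg; have [mN N0] := loeb_null hN.
by apply/eqP; rewrite eq_le; apply/andP; split; apply: (Ex_le_ae _ _ mN N0) => // w /fg ->.
Qed.

Section increments.
Variables (s t : R) (s0 : 0 <= s) (st : s <= t) (tT : t <= T).

Let sT : 0 <= s <= T. Proof. by rewrite s0 (le_trans st). Qed.
Let tT' : 0 <= t <= T. Proof. by rewrite tT (le_trans s0). Qed.

Let Z (w : loeb P) : Rd := Lt t w - Lt s w.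
Let mZ : measurable_fun setT Z. Proof. by apply: mvB; exact: Lt_measQ. Qed.

Let Z_ae : lnull P [set w | Z w <> Lo t w - Lo s w].
Proof.
apply: lnullS (lnullU (Lt_ae sT) (Lt_ae tT')) => w /= hn.
by apply: contrapT => /not_orP[/contrapT h1 /contrapT h2]; apply: hn; rewrite /Z h1 h2.
Qed.

Let Ex_Z (g : loeb P -> R) (f : V -> R) : bmf g -> @bmf R _ Rd f -> continuous f ->
  Ex Q (fun w => g w * f (Z w)) = Ex Q (fun w => g w * f (Lo t w - Lo s w)).
Proof.
move=> bg bf cf; apply: (eq_Ex_ae _ _ Z_ae).
- by apply: bmfM => //; exact: (bmf_comp (T' := Rd) bf mZ).
- by apply: bmfM => //; have [] := Ex_dL mu0 T0 al12 C0 rhoN st bf cf.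
- by move=> w /contrapT ->.
Qed.

(** Independence is known for continuous functions of the increment only. To reach Borel sets, the
    law of the increment given [A] is compared with its unconditional law through Lipschitz
    functions. *)
Lemma Lt_indep (A : set (loeb P)) (B : set Rd) : @Ft _ _ T mu0 rho s A -> measurable B ->
  Q (A `&` ((fun w => (Lt t w - Lt s w)%R) @^-1` B)) =
  (Q A * Q ((fun w => (Lt t w - Lt s w)%R) @^-1` B))%E.
Proof.
move=> FA mB; have mA := Ft_meas FA.
have mZB : measurable (Z @^-1` B) by rewrite -[X in measurable X]setTI; exact: mZ.
rewrite -/Z -[X in A `&` X]/(Z @^-1` B) -[X in (_ * Q X)%E]/(Z @^-1` B).
have [QA|QA] := eqVneq (Q A) 0%E.
  rewrite QA mul0e; apply/eqP; rewrite -measure_le0 -QA; apply: le_measure; rewrite ?inE//.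
  exact: measurableI.
have a0 : 0 < fine (Q A) by rewrite fine_gt0// lt0e QA measure_ge0 ltey_eq fin_num_measure.
(* The density of [Q] conditioned on [A]. *)
pose p (w : loeb P) : R := \1_A w / fine (Q A).
have bA : bmf (\1_A : loeb P -> R) by exact: bmf_indic.
have bp : bmf p by apply: bmfM.
have p0 w : 0 <= p w by rewrite divr_ge0 ?(ltW a0)// indicE.
have p1 : (\int[Q]_w (p w)%:E = 1)%E.
  rewrite Ex_fin//; congr (_%:E); rewrite /p; under eq_Ex do rewrite mulrC.
  by rewrite ExZ// Ex_indic// mulVf// gt_eqF.
pose D : probability (loeb P) R := density_prob bp.1 p0 p1.
have ED f : bmf f -> Ex D f = Ex Q (fun w => f w * p w).
  move=> bf; have hD : has_density Q D p by split; [exact: bp.1|exact: p0|].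
  by rewrite (Ex_density hD bf).
have key F : @bmf R _ Rd F -> Ex (law_of D (pack_mfun mZ)) F = Ex (law_of Q (pack_mfun mZ)) F.
  apply: prob_eq_of_blip => g l lg g1.
  have bg : @bmf R _ Rd g := lip_bmf lg g1.
  have cg := lip_continuous lg.
  rewrite !Ex_law//= ED; last exact: (bmf_comp bg mZ).
  rewrite (_ : Ex Q (fun w => _) = (fine (Q A))^-1 * Ex Q (fun w => \1_A w * g (Z w))); last first.
    rewrite -ExZ; last by apply: bmfM => //; exact: (bmf_comp bg mZ).
    by apply: eq_Ex => w; rewrite /p/=; ring.
  rewrite Ex_Z// (Lo_indep T0 al12 C0 rhoN s0 st tT FA bg cg) Ex_indic// mulKf ?gt_eqF//.
  have := Ex_Z (bmf_cst 1) bg cg; under eq_Ex do rewrite mul1r.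
  by move=> ->; apply: eq_Ex => w; rewrite mul1r.
have := key (\1_B) (bmf_indic mB); rewrite !Ex_law//=; [|exact: bmf_indic|exact: bmf_indic].
have e1 : (\1_B \o Z : loeb P -> R) = \1_(Z @^-1` B) by apply/funext => w; rewrite /= !indicE.
rewrite e1 ED; last exact: bmf_indic.
rewrite (_ : Ex Q (fun w => _) = (fine (Q A))^-1 * Ex Q \1_(A `&` Z @^-1` B)); last first.
  rewrite -ExZ; last by apply: bmf_indic; exact: measurableI.
  by apply: eq_Ex => w; rewrite /p setIC indicI /=; ring.
rewrite !Ex_indic//; last exact: measurableI.
have gen (x y z : \bar R) : x \is a fin_num -> y \is a fin_num -> z \is a fin_num ->
    0 < fine x -> (fine x)^-1 * fine z = fine y -> z = (x * y)%E.
  move=> xf yf zf x0 h; rewrite -[LHS]fineK// -(fineK xf) -(fineK yf) -EFinM -h.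
  by rewrite mulVKf// gt_eqF.
apply: gen => //; rewrite ?fin_num_measure//; exact: measurableI.
Qed.

Lemma Lt_cos (psi : V -> R) : (forall u (k : nat -> nat) (tau : R),
    (k m)%:R * (T / m.+1%:R) @[m --> \oo] --> tau ->
    cosE (rho m) u ^+ k m @[m --> \oo] --> expR (- (tau * psi u))) -> forall u,
  Ex Q (fun w => cos (dotv u (Lt t w - Lt s w))) = expR (- ((t - s) * psi u)) /\
  Ex Q (fun w => sin (dotv u (Lt t w - Lt s w))) = 0.
Proof.
move=> H u.
have cc : continuous (fun x : V => cos (dotv u x)).
  by move=> x; apply: (continuous_comp (lip_continuous (@lip_dotv R d u) (x := x))); exact: continuous_cos.
have cs : continuous (fun x : V => sin (dotv u x)).
  by move=> x; apply: (continuous_comp (lip_continuous (@lip_dotv R d u) (x := x))); exact: continuous_sin.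
have E1 (f : V -> R) : @bmf R _ Rd f -> continuous f ->
    (fun m => Ex (convn (rho m) (kk m t - kk m s)) f) @ ult --> Ex Q (fun w => f (Lt t w - Lt s w)).
  move=> bf cf; have [_ h] := Ex_dL mu0 T0 al12 C0 rhoN st bf cf.
  have := Ex_Z (bmf_cst 1) bf cf; under eq_Ex do rewrite mul1r.
  move=> e; suff -> : Ex Q (fun w => f (Lt t w - Lt s w)) = Ex Q (fun w => f (Lo t w - Lo s w)) by [].
  by rewrite [LHS]e; apply: eq_Ex => w; rewrite mul1r.
have s1 m : sinE (rho m) u = 0 by case: (rhoN m).
split.
  apply: (ult_unique (E1 _ (bmf_cos u) cc)).
  have := H u _ _ (kk_cvg T0 s0 st tT) => h.
  apply: cvg_trans (_ : (fun m => cosE (rho m) u ^+ (kk m t - kk m s)) @ ult --> _).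
    by apply: near_eq_cvg; apply: filterE => m; rewrite -/(cosE _ u) (trig_convn _ (s1 m)).2.
  by apply: cvg_trans h => A; exact: ult_oo.
apply: (ult_unique (E1 _ (bmf_sin u) cs)).
apply: (@ult_near_eq _ (fun=> 0)); first exact: cvg_cst.
by apply: filterE => m /=; rewrite -/(sinE _ u) (trig_convn _ (s1 m)).1.
Qed.

End increments.

End regularised_noise.

(** * Integrals over time windows *)

(** Bounds proportional to the length of the window add up, so they only have to be shown on short
    windows. *)
Lemma steps_ind (R : realType) (T lam : R) (p : R -> R -> Prop) : 0 < lam ->
  (forall a r c, 0 <= a -> a <= r -> r <= c -> c <= T -> p a r -> p r c -> p a c) ->
  (forall a c, 0 <= a -> a <= c -> c <= T -> c - a <= lam -> p a c) ->
  forall s t, 0 <= s -> s <= t -> t <= T -> p s t.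
Proof.
move=> lam0 tr sm s t s0 st tT.
have [n hn] : exists n : nat, t - s <= n%:R * lam.
  exists (Num.bound ((t - s) / lam)); rewrite -ler_pdivrMr//.
  by apply: ltW; apply: archi_boundP; rewrite divr_ge0 ?subr_ge0// ltW.
elim: n s s0 st hn => [|n IH] s s0 st hn.
  by apply: sm => //; apply: (le_trans hn); rewrite mul0r ltW.
have [h|h] := leP (t - s) lam; first exact: sm.
apply: (tr s (s + lam) t) => //; first by rewrite lerDl ltW.
- by rewrite -lerBrDl ltW.
- apply: sm => //; first by rewrite lerDl ltW.
    by apply: le_trans tT; rewrite -lerBrDl ltW.
  by rewrite addrC addKr.
apply: IH; first by rewrite addr_ge0// ltW.
  by rewrite -lerBrDl ltW.
by rewrite opprD addrA lerBlDr; move: hn; rewrite -natr1 mulrDl mul1r.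
Qed.

Lemma measurable_select d d' (T : measurableType d) (T' : measurableType d') (k : T -> nat)
    (g : nat -> T -> T') : (forall n, measurable (k @^-1` [set n])) ->
  (forall n, measurable_fun setT (g n)) -> measurable_fun setT (fun x => g (k x) x).
Proof.
move=> mk mg _ B mB; rewrite setTI.
have -> : (fun x => g (k x) x) @^-1` B = \bigcup_n (k @^-1` [set n] `&` g n @^-1` B).
  apply/seteqP; split=> [x /= h|x [n _ [/= <-]]//].
  by exists (k x).
apply: bigcup_measurable => n _; apply: measurableI; first exact: mk.
by rewrite -[X in measurable X]setTI; exact: mg.
Qed.

Section time_integral.
Context {R : realType}.
Variable T : R.
Hypothesis T0 : 0 < T.
Local Notation mR := (measurableTypeR R).
Local Notation U := (uniform_prob T0).

Local Notation win s t := ([set` `[s : R, t : R[] : set mR).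
Implicit Types (g h : R -> R) (s t r c : R).

(** An integral over [s, t[ written as an expectation under the uniform law on [0, T], so that
    Fubini for probabilities applies; half-open windows make it exactly additive. *)
Definition tint s t g : R := T * Ex U (fun u => \1_(win s t) u * g u).

Lemma mwin s t : measurable (win s t).
Proof. exact: measurable_itv. Qed.

Lemma bmf_win s t g : @bmf R _ mR g -> @bmf R _ mR (fun u => \1_(win s t) u * g u).
Proof. by move=> bg; apply: bmfM => //; apply: bmf_indic; exact: mwin. Qed.

Lemma winE s t u : \1_(win s t) u = ((s <= u < t)%R : bool)%:R :> R.
Proof. by rewrite indicE mem_setE in_itv. Qed.

Lemma tint_ext s t g h : (forall u, s <= u < t -> g u = h u) -> tint s t g = tint s t h.
Proof.
move=> gh; rewrite /tint; congr (_ * _); apply: eq_Ex => u; rewrite winE.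
by case: (boolP (s <= u < t)) => [/gh ->//|_]; rewrite !mul0r.
Qed.

Lemma tint_add s r t g : @bmf R _ mR g -> s <= r -> r <= t ->
  tint s t g = tint s r g + tint r t g.
Proof.
move=> bg sr rt; rewrite /tint -mulrDr -ExD; [|exact: bmf_win|exact: bmf_win].
congr (_ * _); apply: eq_Ex => u; rewrite -mulrDl !winE; congr (_ * _).
have [ur|ru] := ltP u r; last by rewrite andbF (le_trans sr ru) add0r.
by rewrite (lt_le_trans ur rt) andbT addr0.
Qed.

Lemma tintB s t g h : @bmf R _ mR g -> @bmf R _ mR h ->
  tint s t (fun u => g u - h u) = tint s t g - tint s t h.
Proof.
move=> bg bh; rewrite /tint -mulrBr -ExB; [|exact: bmf_win|exact: bmf_win].
by congr (_ * _); apply: eq_Ex => u; rewrite mulrBr.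
Qed.

Lemma tintZ s t c g : @bmf R _ mR g -> tint s t (fun u => c * g u) = c * tint s t g.
Proof.
move=> bg; rewrite /tint mulrCA -(ExZ U c (bmf_win s t bg)).
by congr (_ * _); apply: eq_Ex => u; rewrite mulrCA.
Qed.

Lemma tint_le s t g h : @bmf R _ mR g -> @bmf R _ mR h ->
  (forall u, s <= u < t -> g u <= h u) -> tint s t g <= tint s t h.
Proof.
move=> bg bh gh; rewrite ler_pM2l//; apply: Ex_le; [exact: bmf_win|exact: bmf_win|].
move=> u; rewrite winE; case: (boolP (s <= u < t)) => [/gh|_]; last by rewrite !mul0r.
by rewrite !mul1r.
Qed.

Lemma tint_abs s t g : @bmf R _ mR g -> `|tint s t g| <= tint s t (fun u => `|g u|).
Proof.
move=> bg; rewrite /tint normrM (gtr0_norm T0) ler_pM2l//.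
apply: (le_trans (Ex_abs _ (bmf_win s t bg))).
rewrite le_eqVlt; apply/orP; left; apply/eqP; apply: eq_Ex => u.
by rewrite normrM winE; congr (_ * _); rewrite ger0_norm.
Qed.

Lemma tint_integral s t g : @bmf R _ mR g -> 0 <= s -> t <= T ->
  tint s t g = \int[lebesgue_measure]_(u in [set` `[s, t[]) g u.
Proof.
move=> bg s0 tT; rewrite /tint (Ex_density (has_density_uniform T0) (bmf_win s t bg)).
rewrite -RintegralZl//; last first.
  exact: (density_integrable (has_density_uniform T0) (bmf_win s t bg)).
rewrite [RHS]Rintegral_mkcond; apply: eq_Rintegral => u _.
rewrite winE patchE mem_setE in_itv/=; case: ifP => [/andP[su ut]|_]; last by rewrite !mul0r mulr0.
rewrite mul1r /uniform_pdf (le_trans s0 su) (le_trans (ltW ut) tT)/= subr0.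
by rewrite mulrCA mulfV ?mulr1// gt_eqF.
Qed.

Lemma tint_cst s t c : 0 <= s -> s <= t -> t <= T -> tint s t (fun=> c) = c * (t - s).
Proof.
move=> s0 st tT; rewrite tint_integral//; last exact: (@bmf_cst R _ mR).
rewrite Rintegral_cst//.
have /= -> := @lebesgue_measure_itv R `[s, t[; rewrite lte_fin; case: ifP => h; first by rewrite -EFinB.
by congr (_ * _); move: st; rewrite le_eqVlt h orbF => /eqP ->; rewrite subrr.
Qed.

Lemma tint_le_cst s t g c : @bmf R _ mR g -> 0 <= s -> s <= t -> t <= T ->
  (forall u, s <= u < t -> `|g u| <= c) -> `|tint s t g| <= c * (t - s).
Proof.
move=> bg s0 st tT h; apply: (le_trans (tint_abs _ _ bg)); rewrite -tint_cst//.
by apply: tint_le h; [exact: bmf_abs|exact: (@bmf_cst R _ mR)].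
Qed.

Lemma tint_closed t g : @bmf R _ mR g -> t <= T ->
  tint 0 t g = Rintegral lebesgue_measure [set` `[0, t]] g.
Proof.
move=> bg tT; rewrite tint_integral// Rintegral_itv_bndo_bndc//.
have [mg [M hM]] := bg.
apply: measurable_bounded_integrable; first exact: mwin.
- by have /= -> := @lebesgue_measure_itv R `[0, t[; case: ifP => _; rewrite ltry.
- exact: measurable_funTS.
- exists M; split; first exact: num_real.
  by move=> x Mx y _; apply: (le_trans (hM y)); exact: ltW.
Qed.

Lemma Ex_tint dO (Om : measurableType dO) (Q : probability Om R) (f : R -> Om -> R) s t :
  @bmf R _ (mR * Om)%type (fun z => f z.1 z.2) ->
  [/\ bmf (fun w => tint s t (f ^~ w)), @bmf R _ mR (fun u => Ex Q (f u)) &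
   Ex Q (fun w => tint s t (f ^~ w)) = tint s t (fun u => Ex Q (f u))].
Proof.
move=> bf; have b1 : @bmf R _ (mR * Om)%type (fun z => \1_(win s t) z.1 * f z.1 z.2).
  apply: bmfM => //; apply: (@bmf_comp R _ _ (mR * Om)%type mR _ fst); last exact: measurable_fst.
  by apply: bmf_indic; exact: mwin.
have b2 : bmf (fun w => Ex U (fun u => \1_(win s t) u * f u w)).
  exact: (@bmf_Ex2 _ _ _ mR Om U _ b1).
split; first exact: bmfZ.
  exact: (@bmf_Ex1 _ _ _ mR Om Q _ bf).
rewrite /tint ExZ//; congr (_ * _).
rewrite -(@Ex_swap _ _ _ mR Om U Q (fun u w => \1_(win s t) u * f u w) b1).
apply: eq_Ex => u; rewrite ExZ//.
exact: (@bmf_sec1 _ _ _ mR Om _ u bf).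
Qed.

End time_integral.

(** * The limit of the Euler scheme *)

Section tails.
Context {R : realType} {d : nat}.
Local Notation V := 'rV[R]_d.
Local Notation Rd := (@Rd R d).

Lemma tail_ge0 (p s : R) n (x : V) : 0 <= tail p s n x.
Proof. by rewrite /tail; case: ifP => // _; rewrite le_min powR_ge0/=. Qed.

(** Beyond [s] the lower power is at most s^(ka-p) times the higher one; this makes the tails small
    once a moment of order p > ka is bounded. *)
Lemma tail_le_pow (ka p s : R) n : 0 < ka -> ka < p -> 0 < s ->
  exists n', forall x : V, tail ka s n x <= s `^ (ka - p) * Num.min (enorm x `^ p) n'%:R.
Proof.
move=> ka0 kap s0; pose y : R := n%:R * s `^ (p - ka).
have y0 : 0 <= y by rewrite mulr_ge0 ?powR_ge0.
exists (Num.bound y) => x.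
have yb : y <= (Num.bound y)%:R by apply: ltW; exact: archi_boundP.
have sp : 0 < s `^ (ka - p) by exact: powR_gt0.
have R0 : 0 <= s `^ (ka - p) * Num.min (enorm x `^ p) (Num.bound y)%:R.
  by rewrite mulr_ge0 ?(ltW sp)// le_min powR_ge0/=.
rewrite /tail; case: ifP => // sx.
have x0 : 0 < enorm x by exact: lt_le_trans sx.
have h1 : enorm x `^ ka <= s `^ (ka - p) * enorm x `^ p.
  have -> : enorm x `^ ka = enorm x `^ (ka - p) * enorm x `^ p.
    by rewrite -powRD ?subrK// (gt_eqF x0) implybT.
  rewrite ler_wpM2r ?powR_ge0// -[ka - p]opprB !powRN lef_pV2 ?posrE ?powR_gt0//.
  by apply: ge0_ler_powR; rewrite ?nnegrE ?enorm_ge0 ?(ltW s0)// subr_ge0 ltW.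
have h2 : n%:R <= s `^ (ka - p) * (Num.bound y)%:R.
  apply: (@le_trans _ _ (s `^ (ka - p) * y)); last by rewrite ler_pM2l.
  rewrite /y mulrCA -powRD; last by rewrite (gt_eqF s0) implybT.
  by rewrite (_ : ka - p + (p - ka) = 0) ?powRr0 ?mulr1//; ring.
by have [h|h] := leP (enorm x `^ p) (Num.bound y)%:R; rewrite ge_min ?h1// h2 orbT.
Qed.

Lemma tail_sum (ka s B : R) n (x y z : V) : 0 < ka -> 0 <= B -> 3 * B < s -> enorm y <= B ->
  tail ka s n (x + y + z) <= 3 `^ ka * (tail ka (s / 3) n x + tail ka (s / 3) n z).
Proof.
move=> ka0 B0 Bs yB; have T0 := @tail_ge0 ka (s / 3) n.
have P3 : 0 <= 3 `^ ka :> R by exact: powR_ge0.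
have R0 : 0 <= 3 `^ ka * (tail ka (s / 3) n x + tail ka (s / 3) n z).
  by rewrite mulr_ge0// addr_ge0.
rewrite {1}/tail; case: ifP => // sx.
have tri : enorm (x + y + z) <= enorm x + enorm y + enorm z.
  by apply: (le_trans (enormD _ _)); rewrite lerD2r enormD.
have t1 : 1 <= 3 `^ ka :> R.
  by rewrite -[leLHS](powRr0 3); apply: ler_powR; [lra|exact: ltW].
have step (v : V) : enorm (x + y + z) <= 3 * enorm v ->
    Num.min (enorm (x + y + z) `^ ka) n%:R <= 3 `^ ka * tail ka (s / 3) n v.
  move=> hv; rewrite /tail ifT; last by lra.
  have h : enorm (x + y + z) `^ ka <= 3 `^ ka * enorm v `^ ka.
    rewrite -powRM ?enorm_ge0//; apply: ge0_ler_powR; rewrite ?nnegrE ?enorm_ge0 ?(ltW ka0)//.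
    by rewrite mulr_ge0 ?enorm_ge0.
  have h2 : n%:R <= 3 `^ ka * n%:R by rewrite ler_peMl.
  by have [k|k] := leP (enorm v `^ ka) n%:R; rewrite ge_min ?h// h2 orbT.
have [xz|zx] := leP (enorm x) (enorm z).
  apply: (le_trans (step z _)); last by rewrite ler_wpM2l// lerDr.
  lra.
apply: (le_trans (step x _)); last by rewrite ler_wpM2l// lerDl.
lra.
Qed.

Lemma tail_mono (ka s : R) n n' (x : V) : (n <= n')%N -> tail ka s n x <= tail ka s n' x.
Proof.
move=> nn; rewrite /tail; case: ifP => // _.
by rewrite le_min ge_min lexx/= ge_min ler_nat nn orbT.
Qed.

End tails.

Section process.
Context {R : realType} {d : nat}.
Local Notation V := 'rV[R]_d.
Local Notation Rd := (@Rd R d).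
Local Notation paths := (@paths R d).
Variables (T : R) (mu0 : probability Rd R) (rho : nat -> probability Rd R) (al C : R).
Hypotheses (T0 : 0 < T) (al12 : 1 < al < 2) (C0 : 0 < C).
Hypothesis rhoN : forall m, noise al C (T / m.+1%:R) (rho m).
Variable b : Rd -> pprobability Rd R -> Rd.
Hypothesis mb : measurable_fun setT (fun p : (Rd * pprobability Rd R)%type => b p.1 p.2).
Variable M : R.
Hypothesis bM : forall x m, enorm (b x m) <= M.
Variables (ka K : R).
Hypotheses (ka1 : 1 <= ka) (kal : ka < al) (K0 : 0 < K).
Hypothesis bK : forall (x : Rd) (m m' : probability Rd R),
  finite_moment ka m -> finite_moment ka m' ->
  ((enorm ((b x m : V) - b x m'))%:E <= K%:E * wasserstein ka m m')%E.
Hypothesis mu0K : finite_moment ka mu0.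
Local Notation P := (base mu0 rho).
Local Notation kk := (kk T).
Local Notation mesh := (mesh T).
Local Notation Om := (nat -> paths).
Local Notation Q := (loebP P).
Local Notation Lt := (Lt T).

Let M0 : 0 <= M. Proof. by apply: le_trans (bM 0 mu0); exact: enorm_ge0. Qed.
Let ka0 : 0 < ka. Proof. exact: lt_le_trans ltr01 ka1. Qed.

Definition Xi m k : paths -> V := Xk mu0 (rho m) m.+1 (mesh m) mb k.
Definition Yi m k : paths -> V := Yk mu0 (rho m) m.+1 (mesh m) mb k.
Definition lawi m k : probability Rd R := lawk mu0 (rho m) m.+1 (mesh m) mb k.

Lemma XiE m k w : Xi m k w = (w : nat -> V) 0%N + Yi m k w + Lk k w.
Proof. exact: XkE. Qed.

Lemma meas_Xi m k : measurable_fun setT (Xi m k : paths -> Rd).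
Proof. exact: meas_Xk. Qed.

Lemma Ex_lawi m k f : @bmf R _ Rd f -> Ex (lawi m k) f = Ex (P m) (fun w => f (Xi m k w)).
Proof. by move=> bf; rewrite /lawi Ex_lawk. Qed.

Lemma Yi_lip m j k w : (j <= k)%N -> enorm (Yi m k w - Yi m j w) <= M * ((k - j)%:R * mesh m).
Proof.
move=> jk; rewrite mulrCA mulrC -mulrA [mesh m * _]mulrC mulrA mulrAC.
have := @Yk_lip R d mu0 (rho m) m.+1 (mesh m) b mb M bM (mesh_gt0 T0 m) j k w jk.
by rewrite mulrAC.
Qed.

Lemma Yi0 m w : Yi m 0 w = 0. Proof. by rewrite /Yi /Yk big_geq. Qed.

Lemma Yi_bound m k w : (k <= m.+1)%N -> enorm (Yi m k w) <= M * T.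
Proof.
move=> km; have := @Yi_lip m 0 k w (leq0n k); rewrite Yi0 subr0 subn0 => /le_trans; apply.
rewrite ler_wpM2l// -[leRHS](meshM T m) ler_pM2r ?mesh_gt0//.
by rewrite ler_nat.
Qed.

Definition Xs0 (w : Om) : V := vlim (fun m => (w m : nat -> V) 0%N).
(** The discrete drift terms are bounded by M T at every point, so this limit exists and is
    Lipschitz in [t] without exceptional set. *)
Definition Yt t (w : Om) : V := vlim (fun m => Yi m (kk m t) (w m)).
Definition Xt t (w : Om) : V := Xs0 w + Yt t w + Lt t w.

Lemma Yt_cvg t w : (fun m => Yi m (kk m t) (w m)) @ ult --> Yt t w.
Proof.
by apply: (@cvg_vlim _ _ _ (M * T)); apply: filterE => m /=; apply: Yi_bound; exact: kkT.
Qed.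

Lemma Yt_lip s t w : 0 <= s -> s <= t -> t <= T -> enorm (Yt t w - Yt s w) <= M * (t - s).
Proof.
move=> s0 st tT.
have h1 : (fun m => enorm (Yi m (kk m t) (w m) - Yi m (kk m s) (w m))) @ ult --> enorm (Yt t w - Yt s w).
  apply: (cvg_cont (lip_continuous (@lip_enorm R d))).
  by apply: cvgB; exact: Yt_cvg.
have h2 : (fun m => M * ((kk m t - kk m s)%N%:R * mesh m)) @ ult --> M * (t - s).
  apply: cvgM; first exact: cvg_cst.
  by apply: cvg_trans (kk_cvg T0 s0 st tT) => A; exact: ult_oo.
apply: (ult_le h1 h2); apply: filterE => m /=; apply: Yi_lip; exact: kk_le.
Qed.

Lemma Yt0 w : Yt 0 w = 0.
Proof. by apply: vlimE; under eq_fun do rewrite kk0// Yi0; exact: cvg_cst. Qed.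

Lemma Xt0 w : Xt 0 w = Xs0 w.
Proof. by rewrite /Xt Yt0 Lt0// !addr0. Qed.

Lemma Xs0_cvg : lnull P [set w | ~ ((fun m => (w m : nat -> V) 0%N) @ ult --> Xs0 w)].
Proof.
have h : lnull P [set w : Om | ~ exists K : R, ult [set m | enorm ((w m : nat -> V) 0%N) <= K]].
  apply: (@lnull_unbounded _ _ _ P (fun m (w : paths) => enorm ((w : nat -> V) 0%N))).
    by move=> m; exact: (measurableT_comp (@meas_enorm R d) (meas_eval 0)).
  move=> e e0.
  pose f n (x : V) : R := \1_[set x : V | n%:R < enorm x] x.
  have mA n : measurable ([set x : V | n%:R < enorm x] : set Rd) by apply: meas_gt; exact: meas_enorm.
  have mf n : measurable_fun (setT : set Rd) (f n) by exact: measurable_indic.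
  have f1 n x : `|f n x| <= 1 by rewrite /f indicE; case: (_ \in _); rewrite ?normr1 ?normr0.
  have fc x : f ^~ x @ \oo --> (0 : R).
    apply: cvg_near_cst; exists (Num.bound (enorm x)) => // n /= hn.
    rewrite /f indicE memNset//= => h.
    have := archi_boundP (enorm_ge0 x); rewrite ltNge => /negP; apply.
    by apply: le_trans (ltW h); rewrite ler_nat.
  have [_ cE] := @Ex_dominated _ _ _ mu0 f _ 1 mf f1 fc.
  rewrite Ex_cst in cE.
  have [n hn] : exists n, Ex mu0 (f n) < e.
    exact: (filter_ex (cvgr_lt 0 cE _ e0)).
  exists n%:R; apply: filterE => m /=.
  have bf : @bmf R _ Rd (f n) by split => //; exists 1.
  have := @Ex_walk_init _ _ mu0 (rho m) m.+1 (f n) bf => E1.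
  rewrite /pr -(Ex_indic (P m)); last first.
    by apply: meas_gt; exact: (measurableT_comp (@meas_enorm R d) (meas_eval 0)).
  apply: ltW; rewrite -E1 in hn; apply: le_lt_trans hn.
  by rewrite le_eqVlt; apply/orP; left; apply/eqP; apply: eq_Ex => w; rewrite /f !indicE.
apply: lnullS h => w /=; apply: contra_not => -[K' hK]; exact: (cvg_vlim hK).
Qed.

Lemma Xt_cvg t : 0 <= t <= T -> lnull P [set w | ~ ((fun m => Xi m (kk m t) (w m)) @ ult --> Xt t w)].
Proof.
move=> tT; apply: lnullS (lnullU Xs0_cvg (Lt_cvg mu0 T0 al12 C0 rhoN tT)) => w /= hn.
apply: contrapT => /not_orP[/contrapT h1 /contrapT h2]; apply: hn.
under eq_fun do rewrite XiE.
by apply: cvgD => //; apply: cvgD => //; exact: Yt_cvg.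
Qed.

Lemma Xt_meas t : 0 <= t <= T ->
  measurable_fun setT ((fun w => Xt t w : Rd) : ltype P (Gt T t) -> Rd).
Proof.
move=> tT; apply: measurable_rV => i.
apply: (meas_st (W := fun m w => Xi m (kk m t) w 0 i) (Gt_algebra T t)).
  move=> m r; apply: Gt_gt; first exact: (measurable_coord i (meas_Xi _ _)).
  by move=> w; rewrite /Xi (@adaptk_Xk _ _ _ _ _ _ _ mb).
apply: lnullS (Xt_cvg tT) => w /=; apply: contra_not => h.
exact: (cvg_cont (lip_continuous (@lip_coord R d i)) h).
Qed.

Lemma Xt_adapted t (B : set Rd) : 0 <= t <= T -> measurable B -> @Ft _ _ T mu0 rho t (Xt t @^-1` B).
Proof.
move=> tT mB; apply/(lmeasE _ (Gt_algebra T t)).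
by rewrite -[X in measurable X]setTI; exact: Xt_meas.
Qed.

Lemma Xt_measQ t : 0 <= t <= T -> measurable_fun (setT : set (loeb P)) (fun w => Xt t w : Rd).
Proof.
move=> tT _ B mB; rewrite setTI; exact: (Ft_meas (Xt_adapted tT mB)).
Qed.

Lemma Yt_cont_at w t : 0 <= t <= T -> forall e : R, 0 < e -> exists2 dl : R, 0 < dl &
  forall s, 0 <= s <= T -> `|s - t| < dl -> enorm (Yt s w - Yt t w) <= e.
Proof.
move=> /andP[t0 tT] e e0; have M1 : 0 < M + 1 by rewrite ltr_wpDl.
exists (e / (M + 1)) => [|s /andP[s0 sT]]; first exact: divr_gt0.
rewrite ltr_pdivlMr// => h.
have key : enorm (Yt s w - Yt t w) <= M * `|s - t|.
  have [st|ts] := leP s t.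
    by rewrite enormB distrC (ger0_norm (_ : 0 <= t - s)) ?subr_ge0//; exact: Yt_lip.
  by rewrite (ger0_norm (_ : 0 <= s - t)) ?subr_ge0 ?(ltW ts)//; apply: Yt_lip => //; exact: ltW.
apply: (le_trans key); apply: le_trans (ltW h).
by rewrite mulrC ler_wpM2l// lerDl.
Qed.

Lemma Xt_right w t : 0 <= t < T -> Xt ^~ w @ t^'+ --> Xt t w.
Proof.
move=> tT; have /andP[t0 tT1] := tT; apply: cvgD; last exact: Lt_right.
apply: cvgD; first exact: cvg_cst.
apply: cvg_of_enorm; apply/cvgrPdist_le => e e0.
have [dl dl0 h] := @Yt_cont_at w t (introT andP (conj t0 (ltW tT1))) e e0.
near=> s; rewrite sub0r normrN ger0_norm ?enorm_ge0//.
have ts : t < s by near: s; exact: nbhs_right_gt.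
have sd : s < t + dl by near: s; apply: nbhs_right_lt; rewrite ltrDl.
have sT : s < T by near: s; exact: nbhs_right_lt.
apply: h; first by rewrite (le_trans t0 (ltW ts)) ltW.
by rewrite ger0_norm ?subr_ge0 ?(ltW ts)// ltrBlDl.
Unshelve. all: by end_near. Qed.

Lemma Xt_left w t : 0 < t <= T -> cvg (Xt ^~ w @ t^'-).
Proof.
move=> tT; have /andP[t0 tT1] := tT.
apply: is_cvgD; last exact: Lt_left.
apply/cvg_ex; exists (Xs0 w + Yt t w); apply: cvgD; first exact: cvg_cst.
apply: cvg_of_enorm; apply/cvgrPdist_le => e e0.
have [dl dl0 h] := @Yt_cont_at w t (introT andP (conj (ltW t0) tT1)) e e0.
near=> s; rewrite sub0r normrN ger0_norm ?enorm_ge0//.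
have ts : s < t by near: s; exact: nbhs_left_lt.
have sd : t - dl < s by near: s; apply: nbhs_left_gt; rewrite gtrBl.
have s0 : 0 < s by near: s; exact: nbhs_left_gt.
apply: h; first by rewrite (ltW s0) (le_trans (ltW ts)).
by rewrite ltr0_norm ?subr_lt0// opprB ltrBlDl -ltrBlDr.
Unshelve. all: by end_near. Qed.

Lemma Ex_Xs0 f : @bmf R _ Rd f -> continuous f -> Ex Q (fun w => f (Xs0 w)) = Ex mu0 f.
Proof.
move=> bf cf.
have [_ h] := Ex_st_cont (Z := fun m (w : paths) => (w : nat -> V) 0%N) (fun m => meas_eval 0) Xs0_cvg bf cf.
apply: (ult_unique h); apply: (@ult_near_eq _ (fun=> Ex mu0 f)); first exact: cvg_cst.
by apply: filterE => m /=; rewrite Ex_walk_init.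
Qed.

(* Clamping makes law t a probability measure for every real t; only 0 <= t <= T matters. *)
Definition clamp (t : R) : R := Num.max 0 (Num.min t T).
Lemma clamp_itv t : 0 <= clamp t <= T.
Proof. by rewrite /clamp le_max lexx/= ge_max ltW//= ge_min lexx orbT. Qed.
Lemma clamp_id t : 0 <= t <= T -> clamp t = t.
Proof. by move=> /andP[t0 tT]; rewrite /clamp; rewrite (min_idPl tT); apply/max_idPr. Qed.

Definition law t : probability Rd R := law_of Q (pack_mfun (Xt_measQ (clamp_itv t))).

Lemma lawE t (B : set Rd) : 0 <= t <= T -> law t B = Q (Xt t @^-1` B).
Proof. by move=> tT; rewrite /law law_ofE /= clamp_id. Qed.

Lemma Ex_lawt t f : 0 <= t <= T -> @bmf R _ Rd f -> Ex (law t) f = Ex Q (fun w => f (Xt t w)).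
Proof. move=> tT bf; rewrite -{2}(clamp_id tT).
exact: (Ex_law Q (pack_mfun (Xt_measQ (clamp_itv t))) bf). Qed.

Lemma law0 (B : set Rd) : measurable B -> Q (Xt 0 @^-1` B) = mu0 B.
Proof.
move=> mB; have h0 : (0 : R) <= 0 <= T by rewrite lexx ltW.
rewrite -lawE//.
have key F : @bmf R _ Rd F -> Ex (law 0) F = Ex mu0 F.
  apply: prob_eq_of_blip => g l lg g1.
  have bg := lip_bmf lg g1; have cg := lip_continuous lg.
  by rewrite Ex_lawt// -Ex_Xs0//; apply: eq_Ex => w; rewrite Xt0.
by rewrite !Ex_indicE// key//; exact: bmf_indic.
Qed.

(** * Convergence, tails and time regularity of the laws *)

Lemma law_cvg t f : 0 <= t <= T -> @bmf R _ Rd f -> continuous f ->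
  (fun m => Ex (lawi m (kk m t)) f) @ ult --> Ex (law t) f.
Proof.
move=> tT bf cf; rewrite Ex_lawt//.
have [_ h] := Ex_st_cont (fun m => meas_Xi m (kk m t)) (Xt_cvg tT) bf cf.
by apply: (ult_near_eq h); apply: filterE => m /=; rewrite Ex_lawi.
Qed.

(** The three parts of [Xi] are treated separately: the initial value is uniformly integrable by
    assumption, the drift is bounded by M T, and the noise has bounded moments of an order [p]
    strictly between [ka] and [al]. *)
Lemma lawi_UI (e : R) : 0 < e -> exists2 r : R, 0 <= r &
  forall m k, (k <= m.+1)%N -> forall n, Ex (lawi m k) (excess ka r n) <= e.
Proof.
move=> e0.
pose p := (ka + al) / 2; have kap : ka < p by exact: (midf_lt kal).1.
have pal : p < al by exact: (midf_lt kal).2.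
have p1 : 1 <= p by exact: le_trans ka1 (ltW kap).
have [C' C'0 HL] := incr_moment mu0 T0 al12 C0 rhoN p1 pal ltr01.
pose B : R := 1 + C' * T.
have B0 : 0 < B by rewrite ltr_wpDr// mulr_ge0// ltW.
have P3 : 0 < 3 `^ ka :> R by exact: powR_gt0.
pose e' := e / (4 * 3 `^ ka).
have e'0 : 0 < e' by rewrite divr_gt0// mulr_gt0.
have [r1 r10 Hr1] := finite_moment_excess mu0K e'0.
pose s : R := Num.max (M * T + 1) (Num.max ((2 * r1) `^ ka^-1) ((B / e') `^ (p - ka)^-1)).
have s0 : 0 < s by rewrite lt_max ltr_wpDl// mulr_ge0// ltW.
have sM : 3 * (M * T) < 3 * s by rewrite ltr_pM2l// lt_max ltrDl ltr01.
have sr : 2 * r1 <= s `^ ka.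
  have -> : 2 * r1 = ((2 * r1) `^ ka^-1) `^ ka by rewrite -powRrM mulVf ?gt_eqF// powRr1// mulr_ge0.
  by apply: ge0_ler_powR; rewrite ?nnegrE ?powR_ge0 ?(ltW ka0) ?(ltW s0)// !le_max lexx orbT.
have sB : s `^ (ka - p) * B <= e'.
  have pk : 0 < p - ka by rewrite subr_gt0.
  have h : B / e' <= s `^ (p - ka).
    have -> : B / e' = ((B / e') `^ (p - ka)^-1) `^ (p - ka).
      by rewrite -powRrM mulVf ?gt_eqF// powRr1// divr_ge0// ltW.
    apply: ge0_ler_powR; rewrite ?nnegrE ?powR_ge0 ?(ltW pk) ?(ltW s0)//.
    by rewrite !le_max lexx !orbT.
  rewrite -[ka - p]opprB powRN mulrC ler_pdivrMr ?powR_gt0// mulrC -ler_pdivrMr//.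
exists ((3 * s) `^ ka) => [|m k km n]; first exact: powR_ge0.
have n'E : exists n' : nat, (n <= n')%N /\ 2 * r1 <= n'%:R.
  exists (n + Num.bound (2 * r1))%N; split; first exact: leq_addr.
  apply: ltW; apply: (lt_le_trans (archi_boundP _)); first by rewrite mulr_ge0.
  by rewrite ler_nat leq_addl.
have [n' [nn' rn']] := n'E.
have s3 : 0 < 3 * s by rewrite mulr_gt0.
have [n2 Hn2] := @tail_le_pow R d ka p s n' ka0 kap s0.
have bt := @bmf_tail R d ka s n'.
have bX : bmf (fun w : paths => tail ka s n' ((w : nat -> V) 0%N)).
  exact: (bmf_comp (T' := Rd) bt (meas_eval 0)).
have bL : bmf (fun w : paths => tail ka s n' (Lk k w)).
  exact: (bmf_comp (T' := Rd) bt (meas_Lk k)).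
rewrite Ex_lawi; last by apply: bmf_excess; exact: powR_ge0.
apply: (@le_trans _ _ (Ex (P m) (fun w => 3 `^ ka * (tail ka s n' ((w : nat -> V) 0%N) + tail ka s n' (Lk k w))))).
  apply: Ex_le.
  - by apply: (bmf_comp (T' := Rd) _ (meas_Xi m k)); apply: bmf_excess; exact: powR_ge0.
  - by apply: bmfZ; exact: bmfD.
  - move=> w; apply: (le_trans (@excess_le_tail R d ka _ (3 * s) n _ ka0 (powR_ge0 _ _) (ltW s3) (lexx _))).
    apply: (le_trans (tail_mono ka (3 * s) _ nn')).
    rewrite XiE; have := @tail_sum R d ka (3 * s) (M * T) n' ((w : nat -> V) 0%N) (Yi m k w) (Lk k w) ka0.
    rewrite [3 * s / 3]mulrAC divff// mul1r; apply => //; first by rewrite mulr_ge0// ltW.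
    exact: Yi_bound.
rewrite ExZ; last exact: bmfD.
rewrite ExD//.
have h1 : Ex (P m) (fun w => tail ka s n' ((w : nat -> V) 0%N)) <= 2 * e'.
  rewrite (@Ex_walk_init _ _ mu0 (rho m) m.+1 (tail ka s n'))//.
  apply: (@le_trans _ _ (Ex mu0 (fun x => 2 * excess ka r1 n' x))).
    apply: Ex_le => //; first by apply: bmfZ; exact: bmf_excess.
    by move=> x; apply: tail_le_excess => //; exact: ltW.
  by rewrite ExZ ?ler_pM2l//; exact: bmf_excess.
have h2 : Ex (P m) (fun w => tail ka s n' (Lk k w)) <= e'.
  have bl : bmf (fun w : paths => Num.min (enorm (Lk k w) `^ p) n2%:R).
    exact: (bmf_comp (T' := Rd) (bmf_minpow p (ler0n R n2)) (meas_Lk k)).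
  apply: (@le_trans _ _ (Ex (P m) (fun w => s `^ (ka - p) * Num.min (enorm (Lk k w) `^ p) n2%:R))).
    by apply: Ex_le => //; exact: bmfZ.
  rewrite ExZ//; apply: le_trans sB; rewrite ler_wpM2l ?powR_ge0//.
  have := HL m 0%N k km n2; rewrite add0n; under eq_Ex do rewrite Lk0 subr0.
  move=> /le_trans; apply; rewrite lerD2l ler_wpM2l// -[leRHS](meshM T m) ler_pM2r ?mesh_gt0//.
  by rewrite ler_nat.
apply: (@le_trans _ _ (3 `^ ka * (2 * e' + e'))); first by rewrite ler_pM2l// lerD.
have -> : e = 3 `^ ka * (4 * e') by rewrite /e'; field; rewrite gt_eqF.
rewrite ler_pM2l// (_ : 2 * e' + e' = 3 * e'); last by ring.
by rewrite ler_pM2r// ler_nat.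
Qed.

Lemma Xi_incr (e : R) : 0 < e -> exists2 lam : R, 0 < lam &
  forall m j n, (j + n <= m.+1)%N -> n%:R * mesh m <= lam -> forall k : nat,
    Ex (P m) (fun w => Num.min (enorm (Xi m (j + n) w - Xi m j w) `^ ka) k%:R) <= e.
Proof.
move=> e0; have P3 : 0 < 3 `^ ka :> R by exact: powR_gt0.
pose e' := e / (3 * 3 `^ ka).
have e'0 : 0 < e' by rewrite divr_gt0// mulr_gt0.
have [C' C'0 HL] := incr_moment mu0 T0 al12 C0 rhoN ka1 kal e'0.
have C1 : 0 < C' + 1 by rewrite ltr_wpDl.
have M1 : 0 < M + 1 by rewrite ltr_wpDl.
pose lam := Num.min (e' / (C' + 1)) (e' `^ ka^-1 / (M + 1)).
have lam0 : 0 < lam by rewrite lt_min !divr_gt0 ?powR_gt0.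
exists lam => // m j n jn nl k.
have nm0 : 0 <= n%:R * mesh m by rewrite mulr_ge0// ltW// mesh_gt0.
have bL : bmf (fun w : paths => Num.min (enorm (Lk (j + n) w - Lk j w) `^ ka) k%:R).
  apply: (bmf_comp (T' := Rd) (bmf_minpow ka (ler0n R k))); apply: mvB; exact: meas_Lk.
apply: (@le_trans _ _ (Ex (P m) (fun w => 3 `^ ka * (Num.min (enorm (Lk (j + n) w - Lk j w) `^ ka) k%:R + e')))).
  apply: Ex_le.
  - apply: (bmf_comp (T' := Rd) (bmf_minpow ka (ler0n R k))); apply: mvB; exact: meas_Xi.
  - by apply: bmfZ; apply: bmfD => //; exact: bmf_cst.
  - move=> w; have tri : enorm (Xi m (j + n) w - Xi m j w) <=
        enorm (Lk (j + n) w - Lk j w) + enorm (Yi m (j + n) w - Yi m j w) + 0.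
      rewrite addr0 !XiE; apply: le_trans (enormD _ _).
      rewrite (_ : _ - _ = Lk (j + n) w - Lk j w + (Yi m (j + n) w - Yi m j w))//.
      rewrite -!addrA !opprD !addrA; apply/rowP => i; rewrite !mxE; ring.
    apply: (@le_trans _ _ (Num.min ((enorm (Lk (j + n) w - Lk j w) + enorm (Yi m (j + n) w - Yi m j w) + 0) `^ ka) k%:R)).
      rewrite le_min ge_min ge_min lexx orbT andbT; apply/orP; left.
      by apply: ge0_ler_powR; rewrite ?nnegrE ?addr_ge0 ?enorm_ge0 ?(ltW ka0).
    apply: (le_trans (pow_sum3 _ ka1 (enorm_ge0 _) (enorm_ge0 _) (lexx 0))).
    have m0 : Num.min ((0 : R) `^ ka) k%:R = 0.
      by rewrite powR0 ?gt_eqF//; apply/min_idPl; exact: ler0n.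
    rewrite ler_pM2l// m0 addr0 lerD2l.
    have := @Yi_lip m j (j + n) w (leq_addr n j); rewrite addKn => h.
    have -> : e' = (e' `^ ka^-1) `^ ka by rewrite -powRrM mulVf ?gt_eqF// powRr1// ltW.
    apply: ge0_ler_powR; rewrite ?nnegrE ?enorm_ge0 ?powR_ge0 ?(ltW ka0)//.
    apply: (le_trans h); apply: (@le_trans _ _ ((M + 1) * lam)).
      by apply: ler_pM => //; rewrite lerDl.
    by rewrite mulrC -ler_pdivlMr// ge_min lexx orbT.
rewrite ExZ; last by apply: bmfD => //; exact: bmf_cst.
rewrite ExD// Ex_cst.
have := HL m j n jn k.
have h2 : C' * (n%:R * mesh m) <= e'.
  apply: (@le_trans _ _ ((C' + 1) * lam)).
    by apply: ler_pM => //; rewrite lerDl.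
  by rewrite mulrC -ler_pdivlMr// ge_min lexx.
move=> h1; have -> : e = 3 `^ ka * (3 * e') by rewrite /e'; field; rewrite gt_eqF.
rewrite ler_pM2l//; lra.
Qed.

Lemma Xt_incr (e : R) : 0 < e -> exists2 lam : R, 0 < lam &
  forall s t, 0 <= s -> s <= t -> t <= T -> t - s <= lam -> forall k : nat,
    Ex Q (fun w => Num.min (enorm (Xt t w - Xt s w) `^ ka) k%:R) <= e.
Proof.
move=> e0; have [lam lam0 H] := Xi_incr e0.
have l2 : 0 < lam / 2 by rewrite divr_gt0.
exists (lam / 2) => // s t s0 st tT tsl k.
have sT : 0 <= s <= T by rewrite s0 (le_trans st).
have tT' : 0 <= t <= T by rewrite tT (le_trans s0).
have Zz : lnull P [set w | ~ ((fun m => Xi m (kk m t) (w m) - Xi m (kk m s) (w m)) @ ult --> Xt t w - Xt s w)].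
  apply: lnullS (lnullU (Xt_cvg tT') (Xt_cvg sT)) => w /= hn.
  apply: contrapT => /not_orP[/contrapT h1 /contrapT h2]; apply: hn.
  exact: (@cvgB _ _ _ ult _ (fun m => Xi m (kk m t) (w m)) (fun m => Xi m (kk m s) (w m)) _ _ h1 h2).
have cf : continuous (fun x : V => Num.min (enorm x `^ ka) k%:R).
  by move=> x; exact: (cvg_minc _ (@continuous_enorm_pow R d ka ka1 x)).
have mZ m : measurable_fun setT ((fun w => Xi m (kk m t) w - Xi m (kk m s) w) : paths -> Rd).
  by apply: mvB; exact: meas_Xi.
have [_ h] := Ex_st_cont (Z := fun m w => Xi m (kk m t) w - Xi m (kk m s) w) mZ Zz (bmf_minpow ka (ler0n R k)) cf.
have hm : ult [set m | mesh m <= lam / 2].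
  apply: ult_oo; move/cvgrPdist_le : (mesh_cvg0 T) => /(_ _ l2); apply: filterS => m.
  by rewrite sub0r normrN gtr0_norm ?mesh_gt0.
apply: (ult_le_cst h); apply: filterS hm => m /= hm.
rewrite (kk_add T0 m st); apply: H; first by rewrite -kk_add// kkT.
have := @kk_diff _ T T0 m s t s0 st tT; rewrite ler_norml => /andP[_]; lra.
Qed.

Lemma lawi_moment m k : (k <= m.+1)%N -> finite_moment ka (lawi m k).
Proof.
move=> km; have [r r0 H] := lawi_UI ltr01.
apply: (@finite_moment_of_min _ _ ka (1 + r)) => n.
have := H m k km n; rewrite /excess ExB; [|exact: bmf_minpow|exact: bmf_minpow].
have : Ex (lawi m k) (fun x => Num.min (enorm (x : V) `^ ka) r) <= r.
  by apply: Ex_le_cst; [exact: bmf_minpow|move=> x; rewrite ge_min lexx orbT].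
lra.
Qed.

Lemma law_moment t : 0 <= t <= T -> finite_moment ka (law t).
Proof.
move=> tT; have [r r0 H] := lawi_UI ltr01.
apply: (@finite_moment_of_min _ _ ka (1 + r)) => n.
have := law_cvg tT (bmf_excess ka n r0) (@continuous_excess R d ka r n ka1) => h.
have : Ex (law t) (excess ka r n) <= 1.
  by apply: (ult_le_cst h); apply: filterE => m /=; apply: H; exact: kkT.
rewrite /excess ExB; [|exact: bmf_minpow|exact: bmf_minpow].
have : Ex (law t) (fun x => Num.min (enorm (x : V) `^ ka) r) <= r.
  by apply: Ex_le_cst; [exact: bmf_minpow|move=> x; rewrite ge_min lexx orbT].
lra.
Qed.

(** The bound c/K is written as a power of a root to match the form in which [wasserstein_le] and
    [wasserstein_cvg] are stated. *)
Lemma drift_le (c : R) (m m' : probability Rd R) (x : Rd) : 0 < c ->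
  finite_moment ka m -> finite_moment ka m' ->
  (wasserstein ka m m' <= (((c / K) `^ ka) `^ ka^-1)%:E)%E -> enorm ((b x m : V) - b x m') <= c.
Proof.
move=> c0 fm fm' hW; rewrite -lee_fin; apply: (le_trans (bK x fm fm')).
apply: (@le_trans _ _ (K%:E * (((c / K) `^ ka) `^ ka^-1)%:E)%E).
  by rewrite lee_pmul2l// fin_numE.
rewrite -EFinM lee_fin -powRrM mulfV ?gt_eqF// powRr1 ?divr_ge0 ?(ltW c0) ?(ltW K0)//.
by rewrite mulrC divfK// gt_eqF.
Qed.

(** The pair of values of the scheme at the two times is itself a coupling. *)
Lemma lawi_close (e : R) : 0 < e -> exists2 lam : R, 0 < lam &
  forall m j n, (j + n <= m.+1)%N -> n%:R * mesh m <= lam ->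
    forall x : Rd, enorm ((b x (lawi m (j + n)) : V) - b x (lawi m j)) <= e.
Proof.
move=> e0; have c0 : 0 < (e / K) `^ ka by rewrite powR_gt0// divr_gt0.
have [lam lam0 H] := Xi_incr c0; exists lam => // m j n jn nl x.
apply: drift_le => //; [exact: lawi_moment|by apply: lawi_moment; apply: leq_trans jn; exact: leq_addr|].
have mZ : measurable_fun setT ((fun w => (Xi m (j + n) w, Xi m j w)) : paths -> (Rd * Rd)%type).
  apply: (@measurable_fun_pair _ _ _ paths Rd Rd); exact: meas_Xi.
apply: (@wasserstein_le _ _ _ _ _ _ (law_of (P m) (pack_mfun mZ))).
- exact: ka0.
- exact: ltW.
- exact: coupling_law.
- move=> k; rewrite Ex_law//=; first exact: H.
  split; first by apply: measurable_minr => //; exact: meas_cost.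
  exists k%:R => z; rewrite ger0_norm; first by rewrite ge_min lexx orbT.
  by rewrite le_min powR_ge0/=.
Qed.

Lemma law_close (e : R) : 0 < e -> exists2 lam : R, 0 < lam &
  forall s t, 0 <= s -> s <= t -> t <= T -> t - s <= lam ->
    forall x : Rd, enorm ((b x (law t) : V) - b x (law s)) <= e.
Proof.
move=> e0; have c0 : 0 < (e / K) `^ ka by rewrite powR_gt0// divr_gt0.
have [lam lam0 H] := Xt_incr c0; exists lam => // s t s0 st tT tsl x.
have sT : 0 <= s <= T by rewrite s0 (le_trans st).
have tT' : 0 <= t <= T by rewrite tT (le_trans s0).
apply: drift_le => //; [exact: law_moment|exact: law_moment|].
have mZ : measurable_fun setT ((fun w => (Xt (clamp t) w, Xt (clamp s) w)) : loeb P -> (Rd * Rd)%type).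
  apply: (@measurable_fun_pair _ _ _ (loeb P) Rd Rd); apply: Xt_measQ; exact: clamp_itv.
apply: (@wasserstein_le _ _ _ _ _ _ (law_of Q (pack_mfun mZ))).
- exact: ka0.
- exact: ltW.
- exact: coupling_law.
- move=> k; have bm : @bmf R _ (Rd * Rd)%type (fun z => Num.min (enorm ((z.1 : V) - z.2) `^ ka) k%:R).
    split; first by apply: measurable_minr; [exact: meas_cost|exact: measurable_cst].
    exists k%:R => z; rewrite ger0_norm; first by rewrite ge_min lexx orbT.
    by rewrite le_min powR_ge0 ler0n.
  rewrite (Ex_law Q (pack_mfun mZ) bm).
  apply: le_trans (H s t s0 st tT tsl k).
  have -> : Xt t = Xt (clamp t) by rewrite clamp_id.
  have -> : Xt s = Xt (clamp s) by rewrite clamp_id.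
  exact: lexx.
Qed.

(** Here no coupling is at hand, as the two laws live on different spaces; weak convergence and
    uniform integrability replace it. *)
Lemma law_st_close t (e : R) : 0 <= t <= T -> 0 < e ->
  ult [set m | forall x : Rd, enorm ((b x (lawi m (kk m t)) : V) - b x (law t)) <= e].
Proof.
move=> tT e0; have c0 : 0 < (e / K) `^ ka by rewrite powR_gt0// divr_gt0.
have UI e' : 0 < e' -> exists2 r : R, 0 <= r &
    ult [set m | forall n, Ex (lawi m (kk m t)) (excess ka r n) <= e'].
  move=> e'0; have [r r0 H] := lawi_UI e'0; exists r => //.
  by apply: filterE => m n; apply: H; exact: kkT.
have h := wasserstein_cvg ka1 c0 (fun f => @law_cvg t f tT) UI.
apply: filterS h => m /= hm x.
by apply: drift_le; [exact: e0|apply: lawi_moment; exact: kkT|exact: law_moment|exact: hm].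
Qed.

(** * Riemann sums along the scheme against integrals along the limit *)

Local Notation mR := (measurableTypeR R).
Local Notation tint := (@tint R T T0).

(** The sampling time after [clamp u] is [qtime T (idx n u) n]; it depends on [u] through an
    integer, so functions of it are measurable by countable selection. *)
Let idx n (u : R) : nat := (Num.truncn (clamp u / T * n.+1%:R)).+1.

Let meas_idx n j : measurable (idx n @^-1` [set j] : set mR).
Proof.
have mf : measurable_fun (setT : set mR) (fun u => clamp u / T * n.+1%:R : R).
  apply: measurable_funM; last exact: measurable_cst.
  apply: measurable_funM; last exact: measurable_cst.
  apply: measurable_maxr; first exact: measurable_cst.
  by apply: measurable_minr; [exact: measurable_id|exact: measurable_cst].
have f0 u : 0 <= clamp u / T * n.+1%:R.
  by have /andP[h _] := clamp_itv u; rewrite mulr_ge0// divr_ge0// ltW.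
case: j => [|j].
  by rewrite (_ : _ @^-1` _ = set0)//; apply/seteqP; split.
have -> : idx n @^-1` [set j.+1] = (fun u => clamp u / T * n.+1%:R) @^-1` [set` `[j%:R : R, j.+1%:R[].
  apply/seteqP; split=> u /=; rewrite in_itv/= /idx.
    by move=> [<-]; exact: truncn_itv.
  by move=> /truncn_def ->.
by rewrite -[X in measurable X]setTI; apply: mf => //; exact: measurable_itv.
Qed.

Lemma Xt_rtime u w : (fun n => Xt (rtime T n (clamp u)) w) @ \oo --> Xt (clamp u) w.
Proof.
have /andP[u0 uT] := clamp_itv u.
have [h|h] := ltP (clamp u) T; last first.
  have -> : clamp u = T by apply/eqP; rewrite eq_le uT.
  by under eq_fun do rewrite rtime_T//; exact: cvg_cst.
have hT : 0 <= clamp u < T by rewrite u0.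
have hx : (fun n => rtime T n (clamp u)) @ \oo --> (clamp u)^'+.
  move=> A [eps /= eps0 hA].
  move/cvgrPdist_lt : (rtime_cvg T0 hT) => /(_ _ eps0); apply: filterS => n /= hn.
  by apply: hA => //; exact: rtime_gt.
exact: (cvg_comp _ _ hx (@Xt_right w _ hT)).
Qed.

(** Joint measurability in time and chance: right continuity makes the process the limit of its
    values at the countably many sampling times. *)
Lemma meas_Xj : measurable_fun (setT : set (mR * loeb P)%type)
  ((fun z => Xt (clamp z.1) z.2) : (mR * loeb P)%type -> Rd).
Proof.
apply: measurable_rV => i.
apply: (measurable_fun_cvg (h := fun n (z : mR * loeb P) => Xt (rtime T n (clamp z.1)) z.2 0 i)).
  move=> n.
  apply: (@measurable_coord R d _ (mR * loeb P)%type (fun z => Xt (rtime T n (clamp z.1)) z.2) i).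
  apply: (@measurable_select _ _ (mR * loeb P)%type Rd (fun z => idx n z.1)
    (fun j z => Xt (qtime T j n) z.2)) => j.
    rewrite -[X in measurable X]setTI.
    exact: (@measurable_fst _ _ mR (loeb P) measurableT _ (meas_idx n j)).
  apply: (@measurableT_comp _ _ _ _ _ _ (fun w : loeb P => Xt (qtime T j n) w : Rd)).
    by apply: Xt_measQ; exact: qtime_itv.
  exact: measurable_snd.
by move=> z _ /=; exact: (cvg_cont (lip_continuous (@lip_coord R d i)) (@Xt_rtime z.1 z.2)).
Qed.

Lemma bmf_Xj f : @bmf R _ Rd f -> @bmf R _ (mR * loeb P)%type (fun z => f (Xt (clamp z.1) z.2)).
Proof. by move=> bf; exact: (bmf_comp bf meas_Xj). Qed.

Lemma bmf_path f w : @bmf R _ Rd f -> @bmf R _ mR (fun u => f (Xt (clamp u) w)).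
Proof. by move=> bf; exact: (@bmf_sec2 _ _ _ mR (loeb P) _ w (bmf_Xj bf)). Qed.

(** [Ad], the limit of these Riemann sums, sees [f] along the schemes, while [It] sees [f] along the
    limit process. For measurable [f] their equality is the core of the identification of the drift;
    [gap] is their distance in L^1. *)
Definition Am f m s t (w : paths) : R := \sum_(kk m s <= j < kk m t) mesh m * f (Xi m j w).
Definition Ad f s t (w : Om) : R := ulim (fun m => Am f m s t (w m)).
Definition It f s t (w : Om) : R := tint s t (fun u => f (Xt (clamp u) w)).

Lemma mesh_sum m j k (F : nat -> R) (c : R) : (forall i, (j <= i < k)%N -> `|F i| <= c) ->
  `|\sum_(j <= i < k) mesh m * F i| <= c * ((k - j)%N%:R * mesh m).
Proof.
move=> Fc; apply: (le_trans (ler_norm_sum _ _ _)).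
apply: (@le_trans _ _ (\sum_(j <= i < k) mesh m * c)).
  rewrite !big_nat; apply: ler_sum => i ij.
  by rewrite normrM (gtr0_norm (mesh_gt0 T0 m)) ler_pM2l ?mesh_gt0// Fc.
rewrite sumr_const_nat -[X in X <= _]mulr_natl le_eqVlt; apply/orP; left; apply/eqP; ring.
Qed.

Lemma window_le m s t : (kk m t - kk m s)%N%:R * mesh m <= T.
Proof.
rewrite -[leRHS](meshM T m) ler_pM2r ?mesh_gt0// ler_nat.
by apply: (leq_trans (leq_subr _ _)); exact: kkT.
Qed.

Section bounded.
Variable f : V -> R.
Hypotheses (bf : @bmf R _ Rd f) (f1 : forall x, `|f x| <= 1).

Lemma Am_le m s t w : `|Am f m s t w| <= T.
Proof.
apply: le_trans (window_le m s t).
by rewrite -[leRHS]mul1r; apply: mesh_sum => i _.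
Qed.

Lemma Ad_cvg s t w : (fun m => Am f m s t (w m)) @ ult --> Ad f s t w.
Proof. by apply: (@cvg_ulim _ _ T); apply: filterE => m /=; exact: Am_le. Qed.

Lemma Ad_le s t w : `|Ad f s t w| <= T.
Proof.
have h : (fun m => `|Am f m s t (w m)|) @ ult --> `|Ad f s t w|.
  by apply: cvg_norm; exact: Ad_cvg.
by apply: (ult_le_cst h); apply: filterE => m /=; exact: Am_le.
Qed.

Lemma bmf_Am m s t : bmf (Am f m s t).
Proof. by apply: bmf_sum => j; apply: bmfZ; exact: (bmf_comp (T' := Rd) bf (meas_Xi m j)). Qed.

Lemma Ex_Ad s t : @bmf R _ (loeb P) (Ad f s t) /\
  (fun m => Ex (P m) (Am f m s t)) @ ult --> Ex Q (Ad f s t).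
Proof.
apply: (@Ex_st _ _ _ P _ _ T).
- by move=> m; exact: bmf_meas (bmf_Am m s t).
- by move=> m w; exact: Am_le.
- by move=> w; exact: Ad_le.
- by apply: lnullS (lnull0 P) => w /= []; exact: Ad_cvg.
Qed.

Lemma bmf_It s t : @bmf R _ (loeb P) (It f s t).
Proof. by have [h _ _] := Ex_tint T0 Q (f := fun u w => f (Xt (clamp u) w)) s t (bmf_Xj bf). Qed.

Lemma Ad_add s r t w : s <= r -> r <= t -> Ad f s t w = Ad f s r w + Ad f r t w.
Proof.
move=> sr rt; have h := @Ad_cvg s t w; apply: (ult_unique h).
have -> : (fun m => Am f m s t (w m)) = (fun m => Am f m s r (w m) + Am f m r t (w m)).
  by apply/funext => m; rewrite /Am -big_cat_nat//; exact: kk_le.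
by apply: cvgD; exact: Ad_cvg.
Qed.

Definition gap s t : R := Ex Q (fun w => `|Ad f s t w - It f s t w|).

Lemma bmf_gap s t : @bmf R _ (loeb P) (fun w => `|Ad f s t w - It f s t w|).
Proof. by apply: bmf_abs; apply: bmfB; [exact: (Ex_Ad s t).1|exact: bmf_It]. Qed.

Lemma gap_add s r t : s <= r -> r <= t -> gap s t <= gap s r + gap r t.
Proof.
move=> sr rt; rewrite /gap -ExD; [|exact: bmf_gap|exact: bmf_gap].
apply: Ex_le; [exact: bmf_gap|by apply: bmfD; exact: bmf_gap|move=> w].
rewrite (Ad_add w sr rt) /It (tint_add T0 (bmf_path w bf) sr rt) opprD addrACA.
exact: ler_normD.
Qed.

End bounded.

Let al1 : 1 < al. Proof. by have /andP[] := al12. Qed.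

(** The modulus of continuity is expressed through a truncated power, since this is what [Xi_incr]
    and [Xt_incr] control. *)
Lemma lip_minpow (f : V -> R) (l eta : R) : 0 <= l -> lip l f -> (forall x, `|f x| <= 1) -> 0 < eta ->
  exists2 c : R, 0 < c &
  forall x y, `|f x - f y| <= eta + c * Num.min (enorm (x - y) `^ ka) 1%:R.
Proof.
move=> l0 fl f1 eta0; pose a := eta / (l + 1).
have l1 : 0 < l + 1 by rewrite ltr_wpDl.
have a0 : 0 < a by rewrite divr_gt0.
pose c := Num.min (a `^ ka) 1; have c0 : 0 < c by rewrite lt_min powR_gt0 ?ltr01.
exists (2 / c) => [|x y]; first exact: divr_gt0.
have m0 : 0 <= Num.min (enorm (x - y) `^ ka) 1%:R by rewrite le_min powR_ge0/= ler0n.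
have [h|h] := leP (enorm (x - y)) a.
  apply: (@le_trans _ _ eta); last by rewrite lerDl mulr_ge0// ltW// divr_gt0.
  apply: (le_trans (fl x y)); apply: (@le_trans _ _ ((l + 1) * a)).
    by apply: ler_pM => //; rewrite ?enorm_ge0// lerDl.
  by rewrite mulrC divfK// gt_eqF.
apply: (@le_trans _ _ (2 / c * c)).
  rewrite divfK ?gt_eqF//; apply: (le_trans (ler_normB _ _)).
  by rewrite (_ : 2 = 1 + 1)// lerD.
apply: (@le_trans _ _ (2 / c * Num.min (enorm (x - y) `^ ka) 1%:R)); last by rewrite lerDr ltW.
rewrite ler_pM2l ?divr_gt0// le_min !ge_min lexx orbT andbT; apply/orP; left.
by apply: ge0_ler_powR; rewrite ?nnegrE ?enorm_ge0 ?(ltW ka0) ?(ltW a0) ?(ltW h).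
Qed.

(** On a short window both quantities are close to (t - s) f(X_s), with an error that is a small
    multiple of the length of the window. *)
Lemma gap_window (f : V -> R) (l e : R) : 0 <= l -> lip l f -> (forall x, `|f x| <= 1) -> 0 < e ->
  exists2 lam : R, 0 < lam &
  forall s t, 0 <= s -> s <= t -> t <= T -> t - s <= lam -> gap f s t <= e * (t - s).
Proof.
move=> l0 fl f1 e0; have bf := lip_bmf fl f1; have cf := lip_continuous fl.
have e4 : 0 < e / 4 by rewrite divr_gt0.
have [c c0 hc] := lip_minpow l0 fl f1 e4.
have ec : 0 < e / 4 / c by rewrite divr_gt0.
have [lam1 lam10 H1] := Xi_incr ec.
have [lam2 lam20 H2] := Xt_incr ec.
have ee : e / 4 + c * (e / 4 / c) = e / 2 by field; rewrite gt_eqF.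
have lam3 : 0 < lam1 / 2 by rewrite divr_gt0.
exists (Num.min (lam1 / 2) lam2) => [|s t s0 st tT]; first by rewrite lt_min lam3.
rewrite le_min => /andP[ts1 ts2].
have sT : 0 <= s <= T by rewrite s0 (le_trans st).
pose n m := (kk m t - kk m s)%N.
pose W m (w : paths) := `|Am f m s t w - (n m)%:R * mesh m * f (Xi m (kk m s) w)|.
pose g (w : Om) := `|Ad f s t w - (t - s) * f (Xt s w)|.
have cn : (fun m => (n m)%:R * mesh m) @ ult --> t - s.
  by apply: cvg_trans (kk_cvg T0 s0 st tT) => A; exact: ult_oo.
have T2 : T + T = 2 * T by ring.
have bW m : bmf (W m).
  apply: bmf_abs; apply: bmfB; first exact: bmf_Am.
  by apply: bmfZ; exact: (bmf_comp (T' := Rd) bf (meas_Xi m _)).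
have nT m : 0 <= (n m)%:R * mesh m <= T.
  by rewrite window_le andbT mulr_ge0// ltW// mesh_gt0.
have [bg hg] : @bmf R _ (loeb P) g /\ (fun m => Ex (P m) (W m)) @ ult --> Ex Q g.
  apply: (@Ex_st _ _ _ P W g (2 * T)).
  - by move=> m; exact: bmf_meas (bW m).
  - move=> m w; rewrite normr_id -T2; apply: (le_trans (ler_normB _ _)); apply: lerD; first exact: Am_le.
    have /andP[n0 n1] := nT m.
    by rewrite normrM (ger0_norm n0) -[leRHS]mulr1; exact: ler_pM.
  - move=> w; rewrite normr_id -T2; apply: (le_trans (ler_normB _ _)); apply: lerD; first exact: Ad_le.
    rewrite normrM ger0_norm ?subr_ge0// -[leRHS]mulr1; apply: ler_pM => //; first by rewrite subr_ge0.
    by apply: le_trans tT; rewrite gerBl.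
  - apply: lnullS (Xt_cvg sT) => w /=; apply: contra_not => h.
    apply: cvg_norm; apply: cvgB; first exact: Ad_cvg.
    by apply: cvgM => //; exact: (cvg_cont cf h).
have gs : Ex Q g <= e / 2 * (t - s).
  have cr : (fun m => e / 2 * ((n m)%:R * mesh m)) @ ult --> e / 2 * (t - s).
    by apply: cvgM => //; exact: cvg_cst.
  have hm : ult [set m | mesh m <= lam1 / 2].
    apply: ult_oo; move/cvgrPdist_le : (mesh_cvg0 T) => /(_ _ lam3); apply: filterS => m.
    by rewrite sub0r normrN gtr0_norm ?mesh_gt0.
  apply: (ult_le hg cr); apply: filterS hm => m /= hm.
  have nl : (n m)%:R * mesh m <= lam1.
    have := kk_diff T0 m s0 st tT; rewrite ler_norml => /andP[_].
    rewrite lerBlDr => /le_trans; apply.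
    have -> : lam1 = lam1 / 2 + lam1 / 2 by field.
    exact: lerD.
  have diff j : (kk m s <= j < kk m t)%N ->
      Ex (P m) (fun w => `|f (Xi m j w) - f (Xi m (kk m s) w)|) <= e / 2.
    move=> /andP[sj jt]; have jE : j = (kk m s + (j - kk m s))%N by rewrite subnKC.
    have jm : (kk m s + (j - kk m s) <= m.+1)%N.
      by rewrite -jE (leq_trans (ltnW jt))// kkT.
    have jl : (j - kk m s)%N%:R * mesh m <= lam1.
      by apply: le_trans nl; rewrite ler_pM2r ?mesh_gt0// ler_nat leq_sub2r// ltnW.
    have := H1 m (kk m s) (j - kk m s)%N jm jl 1%N; rewrite -jE => h.
    have bd : bmf (fun w : paths => Num.min (enorm (Xi m j w - Xi m (kk m s) w) `^ ka) 1%:R).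
      by apply: (bmf_comp (T' := Rd) (bmf_minpow ka (ler0n R 1))); apply: mvB; exact: meas_Xi.
    have bX i : bmf (fun w : paths => f (Xi m i w)).
      exact: (bmf_comp (T' := Rd) bf (meas_Xi m i)).
    apply: (@le_trans _ _ (Ex (P m) (fun w => e / 4 + c * Num.min (enorm (Xi m j w - Xi m (kk m s) w) `^ ka) 1%:R))).
      apply: Ex_le; [by apply: bmf_abs; exact: bmfB|by apply: bmfD; [exact: bmf_cst|exact: bmfZ]|].
      by move=> w; exact: hc.
    by rewrite ExD; [|exact: bmf_cst|exact: bmfZ]; rewrite Ex_cst ExZ// -ee lerD2l ler_pM2l.
  pose D j (w : paths) := `|f (Xi m j w) - f (Xi m (kk m s) w)|.
  have bD j : bmf (D j).
    by apply: bmf_abs; apply: bmfB; exact: (bmf_comp (T' := Rd) bf (meas_Xi m _)).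
  apply: (@le_trans _ _ (Ex (P m) (fun w => \sum_(kk m s <= j < kk m t) mesh m * D j w))).
    apply: Ex_le => //; first by apply: bmf_sum => j; exact: bmfZ.
    move=> w; rewrite /W.
    have -> : Am f m s t w - (n m)%:R * mesh m * f (Xi m (kk m s) w) =
        \sum_(kk m s <= j < kk m t) mesh m * (f (Xi m j w) - f (Xi m (kk m s) w)).
      rewrite /Am; under [RHS]eq_bigr do rewrite mulrBr.
      by rewrite sumrB sumr_const_nat -mulrA mulr_natl.
    apply: (le_trans (ler_norm_sum _ _ _)); apply: ler_sum => j _.
    by rewrite normrM (gtr0_norm (mesh_gt0 T0 m)).
  rewrite Ex_sum; last by move=> j; exact: bmfZ.
  apply: (le_trans (ler_norm _)).
  under eq_bigr do rewrite ExZ//.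
  apply: mesh_sum => j jst; rewrite ger0_norm; first exact: diff.
  by apply: Ex_ge0 => w; exact: normr_ge0.
pose G (u : R) (w : loeb P) := `|f (Xt (clamp u) w) - f (Xt s w)|.
have bXs : @bmf R _ (loeb P) (fun w => f (Xt s w)) by exact: (bmf_comp bf (Xt_measQ sT)).
have bG : @bmf R _ (mR * loeb P)%type (fun z => G z.1 z.2).
  apply: bmf_abs; apply: bmfB; first exact: bmf_Xj.
  by apply: (@bmf_comp R _ _ (mR * loeb P)%type (loeb P) _ snd bXs); exact: measurable_snd.
have [bGt bEG EG] := Ex_tint T0 Q s t bG.
have Gs : Ex Q (fun w => tint s t (G ^~ w)) <= e / 2 * (t - s).
  rewrite EG -(tint_cst T0 _ s0 st tT); apply: tint_le => //; first exact: (@bmf_cst R _ mR).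
  move=> u /andP[su ut]; have uT : u <= T by apply: le_trans tT; exact: ltW.
  have uc : clamp u = u by rewrite clamp_id// uT (le_trans s0).
  have us : u - s <= lam2 by apply: le_trans ts2; rewrite lerD2r ltW.
  have h := H2 s u s0 su uT us 1%N.
  have uT' : 0 <= u <= T by rewrite uT (le_trans s0).
  have bd : @bmf R _ (loeb P) (fun w => Num.min (enorm (Xt u w - Xt s w) `^ ka) 1%:R).
    apply: (bmf_comp (bmf_minpow ka (ler0n R 1)) (X := fun w : loeb P => Xt u w - Xt s w : Rd)).
    by apply: mvB; exact: Xt_measQ.
  have bd2 : @bmf R _ (loeb P) (fun w => e / 4 + c * Num.min (enorm (Xt u w - Xt s w) `^ ka) 1%:R).
    by apply: bmfD; [exact: bmf_cst|exact: bmfZ].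
  apply: (@le_trans _ _ (Ex Q (fun w => e / 4 + c * Num.min (enorm (Xt u w - Xt s w) `^ ka) 1%:R))).
    have bu : @bmf R _ (loeb P) (fun w => f (Xt u w)) by exact: (bmf_comp bf (Xt_measQ uT')).
    rewrite /G uc; apply: Ex_le; [exact: (bmf_abs (bmfB bu bXs))|exact: bd2|].
    by move=> w; exact: hc.
  rewrite ExD; [|exact: bmf_cst|exact: bmfZ].
  by rewrite Ex_cst (ExZ Q c bd) -ee lerD2l ler_pM2l.
have -> : e * (t - s) = e / 2 * (t - s) + e / 2 * (t - s) by field.
apply: le_trans (lerD gs Gs); rewrite -ExD//.
apply: Ex_le; [exact: bmf_gap|exact: bmfD|move=> w].
have -> : Ad f s t w - It f s t w =
    (Ad f s t w - (t - s) * f (Xt s w)) - (It f s t w - (t - s) * f (Xt s w)) by ring.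
apply: (le_trans (ler_normB _ _)); rewrite lerD2l.
have bp := bmf_path w bf; have bc := @bmf_cst R _ mR (f (Xt s w)).
rewrite /It [(t - s) * _]mulrC -(tint_cst T0 _ s0 st tT) -(tintB T0 s t bp bc).
exact: (tint_abs T0 s t (bmfB bp bc)).
Qed.

Lemma gap_lip (f : V -> R) (l : R) s t : 0 <= l -> lip l f -> (forall x, `|f x| <= 1) ->
  0 <= s -> s <= t -> t <= T -> gap f s t = 0.
Proof.
move=> l0 fl f1 s0 st tT; have bf := lip_bmf fl f1.
apply/eqP; rewrite eq_le Ex_ge0 ?andbT//; apply/ler_addgt0Pr => e e0; rewrite add0r.
have eT : 0 < e / T by rewrite divr_gt0.
have [lam lam0 H] := gap_window l0 fl f1 eT.
have h : gap f s t <= e / T * (t - s).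
  apply: (@steps_ind R T lam (fun s t => gap f s t <= e / T * (t - s))) => //.
  move=> a r c' a0 ar rc cT h1 h2.
  apply: (le_trans (gap_add bf f1 ar rc)).
  have -> : e / T * (c' - a) = e / T * (r - a) + e / T * (c' - r) by ring.
  exact: lerD.
apply: (le_trans h); apply: (@le_trans _ _ (e / T * T)); last by rewrite divfK// gt_eqF.
by rewrite ler_pM2l//; apply: le_trans tT; rewrite gerBl.
Qed.

Definition occupation : probability Rd R := law_of (pprod (uniform_prob T0) Q) (pack_mfun meas_Xj).

Lemma It_occupation f s t : @bmf R _ Rd f -> (forall x, 0 <= f x) ->
  Ex Q (It f s t) <= T * Ex occupation f.
Proof.
move=> bf f0.
have -> : Ex occupation f = Ex (uniform_prob T0) (fun u => Ex Q (fun w => f (Xt (clamp u) w))).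
  rewrite /occupation (Ex_law (pprod (uniform_prob T0) Q) (pack_mfun meas_Xj) bf).
  exact: (@Ex_prod1 _ _ _ mR (loeb P) (uniform_prob T0) Q _ (bmf_Xj bf)).
have [_ be ->] := Ex_tint T0 Q (f := fun u w => f (Xt (clamp u) w)) s t (bmf_Xj bf).
rewrite ler_pM2l//; apply: Ex_le => //; first exact: bmf_win.
move=> u; rewrite winE; case: (_ && _); first by rewrite mul1r.
by rewrite mul0r; apply: Ex_ge0.
Qed.

Lemma Ad_dist f g s t w : @bmf R _ Rd f -> @bmf R _ Rd g ->
  (forall x, `|f x| <= 1) -> (forall x, `|g x| <= 1) ->
  `|Ad f s t w - Ad g s t w| <= 2 * Ad (fun x => `|f x - g x| / 2) s t w.
Proof.
move=> bf bg f1 g1.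
have H1 x : `| `|f x - g x| / 2| <= 1.
  rewrite normrM normr_id ger0_norm ?invr_ge0// ler_pdivrMr// mul1r.
  by apply: (le_trans (ler_normB _ _)); rewrite (_ : 2 = 1 + 1)// lerD.
have h1 : (fun m => `|Am f m s t (w m) - Am g m s t (w m)|) @ ult --> `|Ad f s t w - Ad g s t w|.
  by apply: cvg_norm; apply: cvgB; exact: Ad_cvg.
have h2 : (fun m => 2 * Am (fun x => `|f x - g x| / 2) m s t (w m)) @ ult -->
    2 * Ad (fun x => `|f x - g x| / 2) s t w.
  by apply: cvgM; [exact: cvg_cst|exact: Ad_cvg].
apply: (ult_le h1 h2); apply: filterE => m /=.
rewrite /Am -sumrB mulr_sumr; apply: (le_trans (ler_norm_sum _ _ _)); apply: ler_sum => j _.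
rewrite -mulrBr normrM (gtr0_norm (mesh_gt0 T0 m)) mulrCA ler_pM2l ?mesh_gt0//.
by rewrite mulrC divfK.
Qed.

Lemma It_dist f g s t w : @bmf R _ Rd f -> @bmf R _ Rd g ->
  `|It f s t w - It g s t w| <= 2 * It (fun x => `|f x - g x| / 2) s t w.
Proof.
move=> bf bg; have bH : @bmf R _ Rd (fun x => `|f x - g x| / 2).
  by apply: bmfM => //; apply: bmf_abs; exact: bmfB.
rewrite /It -(tintB T0 s t (bmf_path w bf) (bmf_path w bg)) -(tintZ T0 s t 2 (bmf_path w bH)).
apply: (le_trans (tint_abs T0 s t (bmfB (bmf_path w bf) (bmf_path w bg)))).
rewrite le_eqVlt; apply/orP; left; apply/eqP; apply: tint_ext => u _.
by rewrite mulrC divfK.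
Qed.

(* [law_mollify] is applied at each step j with a lag of length close to a small dl <= s. *)
Lemma Ad_mollify s t (eta : R) : 0 < s -> s <= t -> t <= T -> 0 < eta ->
  exists (e : R) (e0 : 0 < e),
    forall H, @bmf R _ Rd H -> (forall x, `|H x| <= 1) ->
      Ex Q (Ad H s t) <= Ex Q (It (transl (mollifier e0) H) s t) + eta * T.
Proof.
move=> s0 st tT eta0; pose q : R := 1 - al^-1.
have q0 : 0 < q by rewrite subr_gt0 invf_lt1// (lt_trans ltr01).
pose c1 : R := 2 * (M * C / q).
have c10 : 0 <= c1 by rewrite mulr_ge0// divr_ge0 ?mulr_ge0// ltW.
have c11 : 0 < c1 + 1 by rewrite ltr_wpDl.
have eta2 : 0 < eta / 2 by rewrite divr_gt0.
(* The lag [dl] makes the drift removal cost at most eta/2; the minimum with [s] ensures that every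
   step of the window has a past of that length. The width of the mollifier is chosen afterwards,
   against the smoothing over the lag dl/2. *)
pose dl : R := Num.min s ((eta / 2 / (c1 + 1)) `^ q^-1).
have dl0 : 0 < dl by rewrite lt_min s0/= powR_gt0// divr_gt0.
have dls : dl <= s by rewrite ge_min lexx.
have dlq : c1 * dl `^ q <= eta / 2.
  have h : dl `^ q <= eta / 2 / (c1 + 1).
    have e1 : 0 <= eta / 2 / (c1 + 1) by rewrite ltW// divr_gt0.
    have -> : eta / 2 / (c1 + 1) = ((eta / 2 / (c1 + 1)) `^ q^-1) `^ q.
      by rewrite -powRrM mulVf ?gt_eqF// powRr1.
    apply: ge0_ler_powR; rewrite ?nnegrE ?powR_ge0 ?(ltW q0) ?(ltW dl0)//.
    by rewrite ge_min lexx orbT.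
  apply: (@le_trans _ _ ((c1 + 1) * (eta / 2 / (c1 + 1)))); last by rewrite mulrC divfK// gt_eqF.
  by apply: ler_pM => //; [exact: powR_ge0|rewrite lerDl].
have dl2 : 0 < dl / 2 by rewrite divr_gt0.
pose c2 : R := C * (dl / 2) `^ (- al^-1) * d%:R.
have c20 : 0 <= c2 by rewrite !mulr_ge0 ?powR_ge0// ltW.
have c21 : 0 < c2 + 1 by rewrite ltr_wpDl.
have e0 : 0 < eta / 2 / (c2 + 1) by rewrite divr_gt0.
exists (eta / 2 / (c2 + 1)), e0 => H bH H1.
pose H' := transl (mollifier e0) H.
have bH' : @bmf R _ Rd H' by exact: bmf_transl.
have H1' x : `|H' x| <= 1 by exact: transl_le1.
have lH' : lip (4 * d%:R / (eta / 2 / (c2 + 1))) H' by exact: mollifier_lip.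
have l0 : 0 <= 4 * d%:R / (eta / 2 / (c2 + 1)) by apply: divr_ge0; [exact: mulr_ge0|exact: ltW].
have [bA cA] := Ex_Ad bH H1 s t; have [bA' cA'] := Ex_Ad bH' H1' s t.
have gp := gap_lip l0 lH' H1' (ltW s0) st tT.
have <- : Ex Q (Ad H' s t) = Ex Q (It H' s t).
  have bI := bmf_It bH' s t.
  apply/eqP; rewrite -subr_eq0 -normr_le0 -gp -(ExB Q bA' bI).
  by apply: Ex_abs; exact: bmfB.
have cR : (fun m => Ex (P m) (Am H' m s t) + eta * T) @ ult --> Ex Q (Ad H' s t) + eta * T.
  by apply: cvgD => //; exact: cvg_cst.
have hm : ult [set m | mesh m <= dl / 2].
  apply: ult_oo; move/cvgrPdist_le : (mesh_cvg0 T) => /(_ _ dl2); apply: filterS => m.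
  by rewrite sub0r normrN gtr0_norm ?mesh_gt0.
apply: (ult_le cA cR); apply: filterS hm => m /= hm.
have dlT : 0 <= dl <= T by rewrite (ltW dl0) (le_trans dls)// (le_trans st).
have /andP[n1 n2] := kk_itv T0 m dlT.
set n := kk m dl in n1 n2.
have n3 : dl / 2 <= n%:R * mesh m.
  rewrite -(lerD2r (dl / 2)); have -> : dl / 2 + dl / 2 = dl by field.
  by apply: (le_trans (ltW n2)); rewrite lerD2l.
have n0 : (0 < n)%N.
  by rewrite lt0n; apply/eqP => nE; move: n3; rewrite nE mul0r leNgt dl2.
have bX f j : @bmf R _ Rd f -> bmf (fun w : paths => f (Xi m j w)).
  by move=> bf; exact: (bmf_comp (T' := Rd) bf (meas_Xi m j)).
have ExA f : @bmf R _ Rd f ->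
    Ex (P m) (Am f m s t) = \sum_(kk m s <= j < kk m t) mesh m * Ex (P m) (fun w => f (Xi m j w)).
  move=> bf; rewrite /Am Ex_sum; last by move=> j; apply: bmfZ; exact: bX.
  by apply: eq_bigr => j _; rewrite ExZ//; exact: bX.
rewrite -lerBlDl !ExA// -sumrB; under eq_bigr do rewrite -mulrBr.
apply: (@le_trans _ _ (eta * ((kk m t - kk m s)%N%:R * mesh m))); last first.
  by rewrite ler_pM2l// window_le.
apply: (le_trans (ler_norm _)); apply: mesh_sum => j /andP[sj jt].
have nj : (n <= j)%N by apply: leq_trans sj; exact: kk_le.
have jm : (j <= m.+1)%N by apply: (leq_trans (ltnW jt)); exact: kkT.
have h := law_mollify mu0 mb bM (mesh_gt0 T0 m) al1 C0 (rhoN m) e0 n0 nj jm bH H1.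
apply: (le_trans h).
have x0 : 0 < n%:R * mesh m by exact: lt_le_trans n3.
rewrite [leRHS]splitr.
apply: lerD.
  rewrite mulrA; apply: le_trans dlq; rewrite -/q -/c1 ler_wpM2l//.
  by apply: ge0_ler_powR; rewrite ?nnegrE ?(ltW x0) ?(ltW dl0) ?(ltW q0).
apply: (@le_trans _ _ (c2 * (eta / 2 / (c2 + 1)))).
  rewrite mulrA ler_pM2r// /c2 ler_wpM2r// ler_pM2l//.
  rewrite !powRN lef_pV2 ?posrE ?powR_gt0//.
  by apply: ge0_ler_powR; rewrite ?nnegrE ?(ltW x0) ?(ltW dl2)// invr_ge0 ltW// (lt_trans ltr01).
apply: (@le_trans _ _ ((c2 + 1) * (eta / 2 / (c2 + 1)))); last by rewrite mulrC divfK// gt_eqF.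
by rewrite ler_pM2r// lerDl.
Qed.

(** With H = |f - g|/2 for a Lipschitz [g], the error in [It] is an L^1 distance under the
    occupation measure, and by [Ad_mollify] the error in [Ad] is one under its mollification. The
    mollifier is fixed before [g], which is possible because [Ad_mollify] is uniform in [H].
    Smoothing needs some elapsed time, whence 0 < s. *)
Lemma gap_bmf f s t : 0 < s -> s <= t -> t <= T ->
  @bmf R _ Rd f -> (forall x, `|f x| <= 1) -> gap f s t = 0.
Proof.
move=> s0 st tT bf f1.
apply/eqP; rewrite eq_le Ex_ge0 ?andbT//; apply/ler_addgt0Pr => ep ep0; rewrite add0r.
pose eta : R := ep / (4 * T); have eta0 : 0 < eta by rewrite divr_gt0// mulr_gt0.
have [e [e0 HM]] := Ad_mollify s0 st tT eta0.
have [g [l [l0 gl g1 E1 E2]]] := blip_dense2 occupation (conv occupation (mollifier e0)) bf f1 eta0.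
have bg := lip_bmf gl g1.
pose H x := `|f x - g x| / 2.
have bH : @bmf R _ Rd H by apply: bmfM => //; apply: bmf_abs; exact: bmfB.
have H0 x : 0 <= H x by rewrite divr_ge0.
have H1 x : `|H x| <= 1.
  rewrite ger0_norm// ler_pdivrMr// mul1r.
  by apply: (le_trans (ler_normB _ _)); rewrite (_ : 2 = 1 + 1)// lerD.
have HE (O : probability Rd R) : Ex O (fun x => `|f x - g x|) <= eta -> Ex O H <= eta / 2.
  move=> h; have -> : Ex O H = 2^-1 * Ex O (fun x => `|f x - g x|).
    by rewrite -ExZ; [apply: eq_Ex => x; rewrite mulrC|apply: bmf_abs; exact: bmfB].
  by rewrite mulrC ler_pM2r.
have bT := bmf_transl (mollifier e0) bH.
have T0' x : 0 <= transl (mollifier e0) H x by exact: Ex_ge0.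
have [bAH _] := Ex_Ad bH H1 s t; have bIH := bmf_It bH s t.
have [bAf _] := Ex_Ad bf f1 s t; have bIf := bmf_It bf s t.
have [bAg _] := Ex_Ad bg g1 s t; have bIg := bmf_It bg s t.
have step1 : gap f s t <= 2 * Ex Q (Ad H s t) + gap g s t + 2 * Ex Q (It H s t).
  have bgg := bmf_gap bg g1 s t.
  rewrite /gap -(ExZ Q 2 bAH) -(ExZ Q 2 bIH) -ExD; [|exact: bmfZ|exact: bgg].
  rewrite -ExD; [|by apply: bmfD; [exact: bmfZ|exact: bgg]|exact: bmfZ].
  apply: Ex_le; [exact: bmf_gap|by apply: bmfD; [apply: bmfD; [exact: bmfZ|exact: bgg]|exact: bmfZ]|].
  move=> w; have hA := Ad_dist s t w bf bg f1 g1; have hI := It_dist s t w bg bf.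
  have HC : (fun x => `|g x - f x| / 2) = H by apply/funext => x; rewrite distrC.
  rewrite HC in hI.
  have -> : Ad f s t w - It f s t w =
    (Ad f s t w - Ad g s t w) + (Ad g s t w - It g s t w) + (It g s t w - It f s t w) by ring.
  apply: (le_trans (ler_normD _ _)); apply: lerD => //.
  by apply: (le_trans (ler_normD _ _)); apply: lerD.
have step2 : Ex Q (It H s t) <= T * (eta / 2).
  by apply: (le_trans (It_occupation s t bH H0)); rewrite ler_pM2l//; exact: HE.
have step3 : Ex Q (Ad H s t) <= T * (eta / 2) + eta * T.
  apply: (le_trans (HM H bH H1)); rewrite lerD2r.
  apply: (le_trans (It_occupation s t bT T0')); rewrite ler_pM2l//.
  by rewrite -(Ex_conv occupation (mollifier e0) bH); exact: HE.
rewrite (gap_lip l0 gl g1 (ltW s0) st tT) addr0 in step1.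
apply: (le_trans step1).
have -> : ep = 2 * (T * (eta / 2) + eta * T) + 2 * (T * (eta / 2)).
  by rewrite /eta; field; rewrite gt_eqF.
by apply: lerD; rewrite ler_pM2l.
Qed.

(** * Identification of the drift *)

Definition drift_path (i : 'I_d) (w : Om) (u : R) : R := (b (Xt (clamp u) w) (law (clamp u)) : V) 0 i.

Lemma meas_drift_coord nu i : measurable_fun (setT : set Rd) (fun x => (b x nu : V) 0 i).
Proof. by apply: measurable_coord; exact: meas_drift. Qed.

Lemma drift_path_le i w u : `|drift_path i w u| <= M.
Proof. exact: (le_trans (coord_le _ _) (bM _ _)). Qed.

Lemma meas_path w : measurable_fun (setT : set mR) (fun u => Xt (clamp u) w : Rd).
Proof.
have hp : measurable_fun (setT : set mR) ((fun u => (u, w)) : mR -> (mR * loeb P)%type).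
  by apply: (@measurable_fun_pair _ _ _ mR mR (loeb P)) => //; exact: measurable_cst.
exact: (measurableT_comp meas_Xj hp).
Qed.

(** Measurability of the curve of laws is avoided: the law is taken at the next sampling time, which
    has countably many values, and [law_close] makes the error vanish uniformly in space. *)
Lemma bmf_drift_path i w : @bmf R _ mR (drift_path i w).
Proof.
split; last by exists M => u; exact: drift_path_le.
apply: (measurable_fun_cvg
  (h := fun n u => (b (Xt (clamp u) w) (law (rtime T n (clamp u))) : V) 0 i)).
  move=> n.
  apply: (@measurable_select _ _ mR R (idx n)
    (fun j u => (b (Xt (clamp u) w) (law (qtime T j n)) : V) 0 i)) => // j.
  exact: (measurableT_comp (meas_drift_coord (law (qtime T j n)) i) (meas_path w)).
move=> u _; have /andP[u0 uT] := clamp_itv u.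
have [h|h] := ltP (clamp u) T; last first.
  rewrite /drift_path; have -> : clamp u = T by apply/eqP; rewrite eq_le uT.
  by under eq_fun do rewrite rtime_T//; exact: cvg_cst.
have hT : 0 <= clamp u < T by rewrite u0.
apply/cvgrPdist_le => e e0; have [lam lam0 H] := law_close e0.
move/cvgrPdist_le : (rtime_cvg T0 hT) => /(_ _ lam0); apply: filterS => n /= hn.
have ru := rtime_gt T0 n hT.
rewrite distrC; have := coord_le ((b (Xt (clamp u) w) (law (rtime T n (clamp u))) : V) - b (Xt (clamp u) w) (law (clamp u))) i.
rewrite !mxE => /le_trans; apply.
apply: (H (clamp u) (rtime T n (clamp u)) u0 (ltW ru)).
  by have /andP[] := qtimes_itv T0 (rtime_q T n (clamp u)).
by apply: le_trans hn; rewrite distrC ler_norm.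
Qed.

Lemma Yt_coord s t w i : 0 <= s -> s <= t -> t <= T ->
  `|Yt t w 0 i - Yt s w 0 i| <= M * (t - s).
Proof.
move=> s0 st tT; have := coord_le (Yt t w - Yt s w) i.
by rewrite !mxE => /le_trans; apply; exact: Yt_lip.
Qed.

(** The measure argument is frozen at [law s]. The three errors e/3 come from freezing the discrete
    laws at the start of the window, from replacing that discrete law by [law s], and from freezing
    the limit laws. *)
Lemma drift_window i (e : R) : 0 < e -> exists2 lam : R, 0 < lam &
  forall s t, 0 < s -> s <= t -> t <= T -> t - s <= lam ->
  lnull P [set w | ~ (`|Yt t w 0 i - Yt s w 0 i - tint s t (drift_path i w)| <= e * (t - s))].
Proof.
move=> e0; have e3 : 0 < e / 3 by rewrite divr_gt0.
have [lam1 lam10 H1] := lawi_close e3.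
have [lam2 lam20 H2] := law_close e3.
have lam3 : 0 < lam1 / 2 by rewrite divr_gt0.
exists (Num.min (lam1 / 2) lam2) => [|s t s0 st tT]; first by rewrite lt_min lam3.
rewrite le_min => /andP[ts1 ts2].
have sT : 0 <= s <= T by rewrite (ltW s0) (le_trans st).
have M1 : 0 < M + 1 by rewrite ltr_wpDl.
(* Normalised to modulus at most 1 for [gap_bmf]; M + 1 is positive even if [M] is 0. *)
pose f (x : V) := (M + 1)^-1 * (b x (law s) : V) 0 i.
have f1 x : `|f x| <= 1.
  rewrite normrM gtr0_norm ?invr_gt0// mulrC ler_pdivrMr// mul1r.
  by apply: (le_trans (coord_le _ _)); apply: (le_trans (bM _ _)); rewrite lerDl.
have bf : @bmf R _ Rd f.
  split; last by exists 1.
  by apply: measurable_funM; [exact: measurable_cst|exact: meas_drift_coord].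
have fM x : (M + 1) * f x = (b x (law s) : V) 0 i by rewrite mulVKf// gt_eqF.
have [mN QN] := Ex_eq0 (bmf_gap bf f1 s t) (fun w => normr_ge0 _) (gap_bmf s0 st tT bf f1).
apply: lnullS (null_loeb mN QN) => w /= hw.
rewrite lt_neqAle normr_ge0 andbT eq_sym normr_eq0 subr_eq0; apply/eqP => E; apply: hw.
pose n m := (kk m t - kk m s)%N.
have cn : (fun m => (n m)%:R * mesh m) @ ult --> t - s.
  by apply: cvg_trans (kk_cvg T0 (ltW s0) st tT) => A; exact: ult_oo.
have cY r : (fun m => Yi m (kk m r) (w m) 0 i) @ ult --> Yt r w 0 i.
  exact: (cvg_cont (lip_continuous (@lip_coord R d i)) (@Yt_cvg r w)).
have cl : (fun m => `|Yi m (kk m t) (w m) 0 i - Yi m (kk m s) (w m) 0 i - (M + 1) * Am f m s t (w m)|)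
    @ ult --> `|Yt t w 0 i - Yt s w 0 i - (M + 1) * Ad f s t w|.
  apply: cvg_norm; apply: cvgB; first exact: cvgB.
  by apply: cvgM; [exact: cvg_cst|exact: Ad_cvg].
have cr : (fun m => (e / 3 + e / 3) * ((n m)%:R * mesh m)) @ ult --> (e / 3 + e / 3) * (t - s).
  by apply: cvgM => //; exact: cvg_cst.
have hm : ult [set m | mesh m <= lam1 / 2].
  apply: ult_oo; move/cvgrPdist_le : (mesh_cvg0 T) => /(_ _ lam3); apply: filterS => m.
  by rewrite sub0r normrN gtr0_norm ?mesh_gt0.
have hA : `|Yt t w 0 i - Yt s w 0 i - (M + 1) * Ad f s t w| <= (e / 3 + e / 3) * (t - s).
  apply: (ult_le cl cr); apply: filterS2 hm (law_st_close sT e3) => m /= hm hc.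
  have nl : (n m)%:R * mesh m <= lam1.
    have := kk_diff T0 m (ltW s0) st tT; rewrite ler_norml => /andP[_].
    rewrite lerBlDr => /le_trans; apply; rewrite [leRHS]splitr; exact: lerD.
  have -> : Yi m (kk m t) (w m) 0 i - Yi m (kk m s) (w m) 0 i =
      \sum_(kk m s <= j < kk m t) mesh m * (b (Xi m j (w m)) (lawi m j) : V) 0 i.
    rewrite /Yi /Yk (big_cat_nat (n := kk m s))//=; last by exact: kk_le.
    by rewrite mxE addrAC subrr add0r summxE; apply: eq_bigr => j _; rewrite mxE.
  rewrite /Am mulr_sumr -sumrB.
  under eq_bigr do rewrite mulrCA fM -mulrBr.
  apply: mesh_sum => j /andP[sj jt]; have jE : j = (kk m s + (j - kk m s))%N by rewrite subnKC.
  have jm : (kk m s + (j - kk m s) <= m.+1)%N.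
    by rewrite -jE (leq_trans (ltnW jt))// kkT.
  have jl : (j - kk m s)%N%:R * mesh m <= lam1.
    by apply: le_trans nl; rewrite ler_pM2r ?mesh_gt0// ler_nat leq_sub2r// ltnW.
  have := H1 m (kk m s) (j - kk m s)%N jm jl (Xi m j (w m)); rewrite -jE => h1.
  have h2 := hc (Xi m j (w m)).
  have := coord_le ((b (Xi m j (w m)) (lawi m j) : V) - b (Xi m j (w m)) (law s)) i.
  rewrite !mxE => /le_trans; apply.
  by apply: (le_trans (enorm_tri _ (b (Xi m j (w m)) (lawi m (kk m s))) _)); exact: lerD.
have bp := bmf_path w bf; have bd := bmf_drift_path i w.
have bMp : @bmf R _ mR (fun u => (M + 1) * f (Xt (clamp u) w)) by exact: bmfZ.
have hI : `|(M + 1) * It f s t w - tint s t (drift_path i w)| <= e / 3 * (t - s).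
  rewrite /It -(tintZ T0 s t (M + 1) bp) -(tintB T0 s t bMp bd).
  apply: tint_le_cst => //; [exact: bmfB|exact: ltW|move=> u /andP[su ut]].
  have uT : u <= T by apply: le_trans tT; exact: ltW.
  have uc : clamp u = u by rewrite clamp_id// uT (le_trans (ltW s0)).
  rewrite fM /drift_path uc distrC.
  have := coord_le ((b (Xt u w) (law u) : V) - b (Xt u w) (law s)) i.
  rewrite !mxE => /le_trans; apply; apply: H2 => //; first exact: ltW.
  by apply: le_trans ts2; rewrite lerD2r ltW.
rewrite E in hA.
have -> : e * (t - s) = (e / 3 + e / 3) * (t - s) + e / 3 * (t - s) by field.
have -> : Yt t w 0 i - Yt s w 0 i - tint s t (drift_path i w) =
  (Yt t w 0 i - Yt s w 0 i - (M + 1) * It f s t w) + ((M + 1) * It f s t w - tint s t (drift_path i w)) by ring.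
by apply: (le_trans (ler_normD _ _)); exact: lerD.
Qed.

Lemma drift_increment i s t : 0 < s -> s <= t -> t <= T ->
  lnull P [set w | Yt t w 0 i - Yt s w 0 i <> tint s t (drift_path i w)].
Proof.
move=> s0 st tT.
pose p (e : R) s t := 0 < s ->
  lnull P [set w | ~ (`|Yt t w 0 i - Yt s w 0 i - tint s t (drift_path i w)| <= e * (t - s))].
have h (e : R) : 0 < e -> p e s t.
  move=> e0; have [lam lam0 H] := drift_window i e0.
  apply: (@steps_ind R T lam (p e)) => //; last 2 first.
  - by move=> a c a0 ac cT cl a1; exact: H.
  - exact: ltW.
  move=> a r c a0 ar rc cT h1 h2 a1; have r1 := lt_le_trans a1 ar.
  apply: lnullS (lnullU (h1 a1) (h2 r1)) => w /= hn.
  apply: contrapT => /not_orP[/contrapT k1 /contrapT k2]; apply: hn.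
  rewrite (tint_add T0 (bmf_drift_path i w) ar rc).
  have -> : e * (c - a) = e * (r - a) + e * (c - r) by ring.
  have -> : Yt c w 0 i - Yt a w 0 i - (tint a r (drift_path i w) + tint r c (drift_path i w)) =
    (Yt r w 0 i - Yt a w 0 i - tint a r (drift_path i w)) +
    (Yt c w 0 i - Yt r w 0 i - tint r c (drift_path i w)) by ring.
  by apply: (le_trans (ler_normD _ _)); exact: lerD.
apply: lnullS (lnull_bigcup (fun n : nat => h n.+1%:R^-1 (ltac:(by rewrite invr_gt0)) s0)) => w /= hn.
apply: contrapT => hN; apply: hn; apply/eqP; rewrite -subr_eq0 -normr_le0.
have hc n : `|Yt t w 0 i - Yt s w 0 i - tint s t (drift_path i w)| <= n.+1%:R^-1 * (t - s).
  by apply: contrapT => k; apply: hN; exists n.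
have c0 : (fun n => n.+1%:R^-1 * (t - s) : R) @ ult --> 0 * (t - s).
  apply: cvgM; last exact: cvg_cst.
  by apply: cvg_trans (cvg_harmonic : harmonic @ \oo --> (0 : R)) => A; exact: ult_oo.
by rewrite mul0r in c0; apply: (ult_ge_cst c0); apply: filterE => n /=; exact: hc.
Qed.

Definition drift_defect i t w : R := Yt t w 0 i - tint 0 t (drift_path i w).

Lemma drift_defect_lip i s t w : 0 <= s -> s <= t -> t <= T ->
  `|drift_defect i t w - drift_defect i s w| <= 2 * (M * (t - s)).
Proof.
move=> s0 st tT; rewrite /drift_defect (tint_add T0 (bmf_drift_path i w) s0 st).
have -> : Yt t w 0 i - (tint 0 s (drift_path i w) + tint s t (drift_path i w)) -
    (Yt s w 0 i - tint 0 s (drift_path i w)) = (Yt t w 0 i - Yt s w 0 i) - tint s t (drift_path i w) by ring.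
apply: (le_trans (ler_normB _ _)); rewrite (_ : 2 = 1 + 1)// mulrDl mul1r.
apply: lerD; first exact: Yt_coord.
apply: tint_le_cst => //; first exact: bmf_drift_path.
by move=> u _; exact: drift_path_le.
Qed.

(** The defect is Lipschitz in time and, off one null set, takes equal values at positive sampling
    times. Sampling times tending to [t] and to 0 then show that it equals its value 0 at time 0
    everywhere. *)
Lemma drift_identified : lnull P [set w | ~ forall t, 0 <= t <= T ->
  Yt t w = vintegral t (fun s => b (Xt s w) (law s))].
Proof.
pose bad n j (i : 'I_d) := [set w | 0 < qtime T 1 n /\ qtime T 1 n <= qtime T j n /\
  drift_defect i (qtime T j n) w <> drift_defect i (qtime T 1 n) w].
have nb n j i : lnull P (bad n j i).
  have [h1|h1] := boolP (0 < qtime T 1 n); last first.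
    by apply: lnullS (lnull0 P) => w /= [h _]; rewrite h in h1.
  have [h2|h2] := boolP (qtime T 1 n <= qtime T j n); last first.
    by apply: lnullS (lnull0 P) => w /= [_ [h _]]; rewrite h in h2.
  have /andP[_ h3] := qtime_itv T0 j n.
  apply: lnullS (drift_increment i h1 h2 h3) => w /= [_ [_ h4]] E; apply: h4.
  have := tint_add T0 (bmf_drift_path i w) (ltW h1) h2 => E2.
  apply/eqP; rewrite -subr_eq0 /drift_defect E2 -E; apply/eqP; ring.
(* The finite union over coordinates is indexed by natural numbers to fit [lnull_bigcup]. *)
have nb2 k : lnull P [set w | exists i : 'I_d, (i : nat) = k /\ exists n j, bad n j i w].
  have [kd|kd] := ltnP k d; last first.
    by apply: lnullS (lnull0 P) => w /= [i [ik _]]; have := ltn_ord i; rewrite ik ltnNge kd.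
  apply: lnullS (lnull_bigcup (fun n => lnull_bigcup (fun j => nb n j (Ordinal kd)))).
  move=> w /= [i [ik [n [j h]]]]; exists n => //; exists j => //.
  by have <- : i = Ordinal kd by apply: val_inj.
apply: lnullS (lnull_bigcup nb2) => w /= hn.
apply: contrapT => hN; apply: hn => t tT; have /andP[t0 tT1] := tT.
apply/rowP => i; rewrite /vintegral [RHS]mxE.
have eqD n j : 0 < qtime T 1 n -> qtime T 1 n <= qtime T j n ->
    drift_defect i (qtime T j n) w = drift_defect i (qtime T 1 n) w.
  move=> h1 h2; apply: contrapT => h3; apply: hN; exists i => //; exists i; split => //.
  by exists n, j.
have r0 n : rtime T n 0 = qtime T 1 n by rewrite /rtime !mul0r truncn0.
have T00 : (0 : R) <= 0 < T by rewrite lexx.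
have q1 n : 0 < qtime T 1 n by rewrite -r0; exact: rtime_gt.
have rt n : t <= rtime T n t.
  have [h|h] := ltP t T; first by apply: ltW; apply: rtime_gt => //; rewrite t0.
  by have -> : t = T; [apply/eqP; rewrite eq_le tT1|rewrite rtime_T].
have rT n : rtime T n t <= T by have /andP[] := qtimes_itv T0 (rtime_q T n t).
have D0 : drift_defect i 0 w = 0.
  have bd := bmf_drift_path i w.
  rewrite /drift_defect Yt0 mxE (@tint_ext R T T0 0 0 _ (fun=> 0)).
    by rewrite tint_cst ?lexx ?(ltW T0)// mul0r subr0.
  by move=> u /andP[u0]; rewrite ltNge u0.
have rc : rtime T ^~ t @ \oo --> t.
  have [h|h] := ltP t T; first by apply: rtime_cvg; rewrite ?t0.
  have -> : t = T by apply/eqP; rewrite eq_le tT1.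
  by under eq_fun do rewrite rtime_T//; exact: cvg_cst.
have hD n : `|drift_defect i t w| <= 2 * (M * (rtime T n t - t)) + 2 * (M * (rtime T n 0 - 0)).
  have E : drift_defect i (rtime T n t) w = drift_defect i (rtime T n 0) w.
    rewrite r0; apply: eqD => //; rewrite /rtime /qtime le_min !ge_min lexx/=.
    apply/orP; right; rewrite ler_pM2l// ler_pM2r ?invr_gt0// ler_nat//.
  have h1 := drift_defect_lip i w t0 (rt n) (rT n).
  have h2 : `|drift_defect i (rtime T n 0) w - drift_defect i 0 w| <= 2 * (M * (rtime T n 0 - 0)).
    have /andP[k1 k2] := qtime_itv T0 1 n; rewrite r0.
    exact: (drift_defect_lip i w (lexx 0) k1 k2).
  rewrite D0 subr0 -E in h2; rewrite distrC in h1.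
  have {1}-> : drift_defect i t w =
    (drift_defect i t w - drift_defect i (rtime T n t) w) + drift_defect i (rtime T n t) w by ring.
  by apply: (le_trans (ler_normD _ _)); exact: lerD.
have c0 : (fun n => 2 * (M * (rtime T n t - t)) + 2 * (M * (rtime T n 0 - 0))) @ \oo -->
    2 * (M * (t - t)) + 2 * (M * ((0 : R) - 0)).
  apply: cvgD; (apply: cvgM; first exact: cvg_cst); (apply: cvgM; first exact: cvg_cst);
    (apply: cvgB; last exact: cvg_cst); first exact: rc.
  exact: rtime_cvg.
rewrite !subrr !mulr0 addr0 in c0.
have c1 : (fun n => 2 * (M * (rtime T n t - t)) + 2 * (M * (rtime T n 0 - 0))) @ ult --> (0 : R).
  by apply: cvg_trans c0 => A; exact: ult_oo.
have : `|drift_defect i t w| <= 0 by apply: (ult_ge_cst c1); apply: filterE => n /=; exact: hD.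
rewrite normr_le0 subr_eq0 => /eqP ->.
rewrite (tint_closed T0 (bmf_drift_path i w) tT1); apply: eq_Rintegral => u.
rewrite inE/= in_itv/= => /andP[u0 ut].
by rewrite /drift_path clamp_id// u0 (le_trans ut).
Qed.

End process.

Theorem theorem3p1 (R : realType) (d : nat) (T kappa alpha : R)
    (mu : {finite_measure set (@Rd R d) -> \bar R})
    (b : @Rd R d -> pprobability (@Rd R d) R -> @Rd R d)
    (mu0 : probability (@Rd R d) R) :
  0 < T ->
  1 <= kappa -> kappa < alpha ->
  spherical_symmetric mu ->
  H1 alpha mu ->
  measurable_fun setT (fun p : (@Rd R d * pprobability (@Rd R d) R)%type => b p.1 p.2) ->
  (exists M : R, forall x m, enorm (b x m) <= M) ->
  (exists K : R, 0 < K /\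
     forall (x : @Rd R d) (m m' : probability (@Rd R d) R),
       finite_moment kappa m -> finite_moment kappa m' ->
       ((enorm ((b x m : 'rV[R]_d) - b x m'))%:E <= K%:E * wasserstein kappa m m')%E) ->
  finite_moment kappa mu0 ->
  exists (dO : measure_display) (Om : measurableType dO) (P : probability Om R)
         (F : R -> set (set Om)) (X L : R -> Om -> 'rV[R]_d)
         (law : R -> probability (@Rd R d) R),
    filtration F /\ complete_fps P F /\
        levy_process T P F L (stable_symbol alpha mu) /\
        adapted T F X /\ cadlag T X /\
        (forall t, 0 <= t <= T -> forall B : set (@Rd R d), measurable B ->
            law t B = P (X t @^-1` B)) /\
        (forall B : set (@Rd R d), measurable B -> P (X 0 @^-1` B) = mu0 B) /\
        exists N : set Om, [/\ measurable N, P N = 0%E &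
          forall w, ~ N w -> forall t, 0 <= t <= T ->
            X t w = X 0 w + vintegral t (fun s => (b (X s w) (law s) : 'rV[R]_d)) + L t w].
Proof.
move=> T0 ka1 kal symm h1 mb [M bM] [K [K0 bK]] mu0K.
have al12 := h1.1.
have [psi [C [rho [C0 psiE _ rhoN charE]]]] := noise_exists T0 symm h1.
pose P := base mu0 rho.
pose law := law mu0 T0 al12 C0 rhoN mb bM.
have dn : lnull P [set w | ~ forall t, 0 <= t <= T ->
    Yt T mu0 rho mb t w = vintegral t (fun s => b (Xt T mu0 rho mb s w) (law s))].
  exact: drift_identified bK mu0K.
exists _, (loeb P), (loebP P), (fun t => @Ft R d T mu0 rho t), (Xt T mu0 rho mb), (Lt T), law.
split; [|split; [|split; [|split; [|split; [|split; [|split]]]]]].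
- split; first by move=> t; exact: Ft_sigma.
  split; first by move=> t; exact: Ft_meas.
  by move=> s t; exact: Ft_mono.
(* A subset of a null set is again [lnull], hence agrees with the empty internal set, which is
   available already at time 0. *)
- move=> N mN PN A AN.
  have nA : lnull P A by apply: lnullS AN (null_loeb mN PN).
  by split; [exact: (loeb_null nA).1|exact: lsets_null (Gt_algebra T 0) nA].
- split; first by move=> w; exact: Lt0.
  split; first by move=> w; split => t ht; [exact: Lt_right|exact: Lt_left].
  split; first by move=> t tT B mB; exact: (Lt_adapted mu0 T0 al12 C0 rhoN tT mB).
  move=> s t s0 st tT; split.
    by move=> A B FA mB; exact: (Lt_indep T0 al12 C0 rhoN s0 st tT FA mB).
  move=> u; have [hc hs] := Lt_cos mu0 T0 al12 C0 rhoN s0 st tT charE u.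
  have sT : 0 <= s <= T by rewrite s0 (le_trans st).
  have tT' : 0 <= t <= T by rewrite tT (le_trans s0).
  have mt := Lt_measQ (mu0 := mu0) T0 al12 C0 rhoN tT'.
  have ms := Lt_measQ (mu0 := mu0) T0 al12 C0 rhoN sT.
  have bc := bmf_comp (bmf_cos u) (mvB mt ms).
  have bs := bmf_comp (bmf_sin u) (mvB mt ms).
  split; first by rewrite (Ex_fin (loebP P) bc) hc psiE -EFinM -EFinN.
  by rewrite (Ex_fin (loebP P) bs) hs.
- by move=> t tT B mB; exact: (Xt_adapted mu0 T0 al12 C0 rhoN mb bM tT mB).
- by move=> w; split => t ht; [exact: (Xt_right T0 bM ht)|exact: (Xt_left T0 bM ht)].
- by move=> t tT B mB; exact: lawE.
- by move=> B mB; exact: (law0 mu0 T0 al12 C0 rhoN mb bM mB).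
- have [mN PN] := loeb_null dn; eexists; split; [exact: mN|exact: PN|].
  move=> w /= /contrapT hw t tT; rewrite -hw// Xt0//.
Qed.
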